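(* Let $i\in\mathbb I$ (with $c_{i,\tau i}\in\{2,0,-1\}$). (i) For any $x\in{}^\sigma\mathbf f[i,\tau i]$ we have $\widetilde{\mathbf T}_i^{-1}(x)=\widetilde T_{r_i}^{-1}(x)$ in $\widetilde{\mathbf B}^\imath_\tau$, i.e. $\widetilde{\mathbf T}_i^{-1}(\iota(x))=\iota(\widetilde T_{r_i}^{-1}(x))$. (ii) For any homogeneous $x\in{}^\sigma\mathbf f[i,\tau i]$ and $u\in\mathbf f_{i,\tau i}$ we have $$\widetilde{\mathbf T}_i^{-1}(\iota(xu))=v^{-\frac12(\tau\mathrm{wt}(u)+\mathrm{wt}(u),\,\mathrm{wt}(x))}\;\mathbb K_{\tau\tau_i\mathrm{wt}(u)}^{-1}\diamond \iota\big(\tau\tau_i(u)\,\widetilde T_{r_i}^{-1}(x)\big).$$ (iii) For any homogeneous $x\in\mathbf f[i,\tau i]$ and $u\in\mathbf f_{i,\tau i}$ we have $$\widetilde{\mathbf T}_i(\iota(ux))=v^{-\frac12(\tau\mathrm{wt}(u)+\mathrm{wt}(u),\,\mathrm{wt}(x))}\;\mathbb K_{\tau_i\mathrm{wt}(u)}^{-1}\diamond \iota\big(\widetilde T_{r_i}(x)\,\tau\tau_i(u)\big).$$ All products $xu$, $ux$, $\tau\tau_i(u)\widetilde T_{r_i}^{-1}(x)$, $\widetilde T_{r_i}(x)\tau\tau_i(u)$ are taken in the algebra $\mathbf f$.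
   Context: Root data. $C=(c_{ij})_{i,j\in\mathbb I}$ is a symmetrizable generalized Cartan matrix ($\mathbb I$ finite), $D=\mathrm{diag}(d_i)$, $d_i\in\mathbb Z_{>0}$, $DC$ symmetric; $\mathbb Z^{\mathbb I}=\bigoplus_i\mathbb Z\alpha_i$, $(\alpha_i,\alpha_j)=d_ic_{ij}$; simple reflections $s_i(\alpha_j)=\alpha_j-c_{ij}\alpha_i$ generate the Weyl group $W$. $v$ is an indeterminate, $v_i=v^{d_i}$. $\tau$ is a permutation of $\mathbb I$ with $\tau^2=\mathrm{id}$, $c_{\tau i,\tau j}=c_{ij}$, $d_{\tau i}=d_i$, extended linearly to $\mathbb Z^{\mathbb I}$. Quantum group. $\widetilde{\mathbf U}$ is the $\mathbb Q(v^{1/2})$-algebra generated by $E_i,F_i$ and invertible commuting $K_i,K_i'$ ($i\in\mathbb I$), with $[E_i,F_j]=\delta_{ij}(v_i^{-1}-v_i)(K_i-K_i')$, $K_iE_j=v_i^{c_{ij}}E_jK_i$, $K_iF_j=v_i^{-c_{ij}}F_jK_i$, $K_i'E_j=v_i^{-c_{ij}}E_jK_i'$, $K_i'F_j=v_i^{c_{ij}}F_jK_i'$, and the quantum Serre relations among the $E_i$ and among the $F_i$. $\mathbf U^{+}$ is the subalgebra generated by the $E_i$. For $\mu=\sum m_i\alpha_i$, $K_\mu=\prod K_i^{m_i}$, $K'_\mu=\prod (K_i')^{m_i}$. $\sigma$ is the anti-involution of $\widetilde{\mathbf U}$ with $E_i\mapsto E_i$, $F_i\mapsto F_i$, $K_i\leftrightarrow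 K_i'$. The rescaled Lusztig symmetry $\widetilde T_i$ is the automorphism of $\widetilde{\mathbf U}$ with $\widetilde T_i(K_\mu)=K_{s_i\mu}$, $\widetilde T_i(K'_\mu)=K'_{s_i\mu}$, $\widetilde T_i(E_i)=v_i(K_i')^{-1}F_i$, $\widetilde T_i(F_i)=v_i^{-1}E_iK_i^{-1}$, and for $j\ne i$, $\widetilde T_i(X_j)=\sum_{r+s=-c_{ij}}(-1)^rv_i^{-(r+\frac12c_{ij})}(v_i-v_i^{-1})^{c_{ij}}X_i^{(s)}X_jX_i^{(r)}$ for $X=E$ and $X=F$, where $X_i^{(r)}=X_i^r/[r]_{v_i}^!$. One has $\widetilde T_i^{-1}=\sigma\widetilde T_i\sigma$; the $\widetilde T_i$ satisfy braid relations and $\widetilde T_w=\widetilde T_{i_1}\cdots\widetilde T_{i_r}$ for a reduced expression $w=s_{i_1}\cdots s_{i_r}$. The algebra $\mathbf f$ and the iHopf algebra. $\mathbf f$ is the $\mathbb Q(v^{1/2})$-algebra generated by $\vartheta_i$ ($i\in\mathbb I$) subject to the quantum Serre relations $\sum_{r=0}^{1-c_{ij}}(-1)^r{1-c_{ij}\brack r}_{v_i}\vartheta_i^r\vartheta_j\vartheta_i^{1-c_{ij}-r}=0$ ($i\ne j$), $\mathbb N^{\mathbb I}$-graded by $\mathrm{wt}(\vartheta_i)=\alpha_i$; we identify $\mathbf f\cong\mathbf U^+$ by $x\mapsto x^+$, $\vartheta_i^+=E_i$. $\widetilde{\mathbf B}$ is the algebra generated by $\mathbf f$ and commuting invertible $h_i$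 with $h_i\vartheta_j=v_i^{c_{ij}}\vartheta_jh_i$; $h_\alpha=\prod h_i^{a_i}$ for $\alpha=\sum a_i\alpha_i$. It is a Hopf algebra with $\Delta(\vartheta_i)=\vartheta_i\otimes1+h_i\otimes\vartheta_i$, $\Delta(h_i)=h_i\otimes h_i$, and carries the symmetric Hopf pairing $\varphi$ ($\varphi(ab,c)=\sum\varphi(a,c_{(1)})\varphi(b,c_{(2)})$, $\varphi(a,bc)=\sum\varphi(a_{(1)},b)\varphi(a_{(2)},c)$) with $\varphi(\vartheta_i,\vartheta_j)=\delta_{ij}(v_i-v_i^{-1})$, $\varphi(h_i,h_j)=v_i^{c_{ij}}$, $\varphi(\vartheta_i,h_j)=0$. $\tau$ acts on $\widetilde{\mathbf B}$ by $\vartheta_i\mapsto\vartheta_{\tau i}$, $h_i\mapsto h_{\tau i}$. The iHopf algebra $\widetilde{\mathbf B}^\imath_\tau$ is the vector space $\widetilde{\mathbf B}$ with the associative product $a*b=\sum\varphi(\tau b_{(2)},a_{(1)})\,a_{(2)}b_{(1)}$. $\iota:\mathbf f\to\widetilde{\mathbf B}^\imath_\tau$ is the inclusion of vector spaces. Put $\mathbb K_\alpha=v^{\frac12(\alpha,\tau\alpha)}h_{\tau\alpha}$ for $\alpha\in\mathbb Z^{\mathbb I}$ (so $\mathbb K_\alpha*\mathbb K_\beta=\mathbb K_{\alpha+\beta}$, $\mathbb K_\alpha^{-1}=\mathbb K_{-\alpha}$). The $\diamond$-action is $h_\alpha\diamond x=v^{\frac12(\tau\alpha-\alpha,\mathrm{wt}(x))}h_\alpha*x$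 for homogeneous $x$, extended linearly in $h_\alpha$ (so $\mathbb K_\alpha\diamond x=v^{\frac12(\alpha-\tau\alpha,\mathrm{wt}(x))}\mathbb K_\alpha*x$). iQuantum group. $\widetilde{\mathbf U}^\imath\subset\widetilde{\mathbf U}$ is the subalgebra generated by $B_i=F_i+E_{\tau i}K_i'$ and $\tilde k_i^{\pm1}$, $\tilde k_i=K_iK'_{\tau i}$. There is an algebra isomorphism $\widetilde{\mathbf B}^\imath_\tau\cong\widetilde{\mathbf U}^\imath$, $\vartheta_i\mapsto B_i$, $h_i\mapsto\tilde k_{\tau i}$, by which the two algebras are identified. Relative braid symmetries. Let $r_i=s_i$, $s_is_{\tau i}$, $s_is_{\tau i}s_i$ according to $c_{i,\tau i}=2,0,-1$. $\tau_i$ is the involution of $\{i,\tau i\}$ with $r_i(\alpha_i)=-\alpha_{\tau_i(i)}$, $r_i(\alpha_{\tau i})=-\alpha_{\tau_i(\tau i)}$, extended linearly to $\mathbb Z\alpha_i+\mathbb Z\alpha_{\tau i}$. Let $\widetilde\Upsilon_i=\sum_{\mu}\widetilde\Upsilon_i^\mu$, with $\widetilde\Upsilon_i^0=1$ and $\widetilde\Upsilon_i^\mu$ of weight $\mu\in\mathbb N\alpha_i+\mathbb N\alpha_{\tau i}$ in the subalgebra generated by $E_i,E_{\tau i}$, be the unique element (rank one quasi $K$-matrix, in the completion of $\widetilde{\mathbf U}$ allowing infinite sums in the $\mathbf U^+$-direction) with $B_j\widetilde\Upsilon_i=\widetilde\Upsilon_i(F_j+K_jE_{\tau j})$ and $\tilde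 k_j\widetilde\Upsilon_i=\widetilde\Upsilon_i\tilde k_j$ for $j\in\{i,\tau i\}$. After extending scalars to the algebraic closure of $\mathbb Q(v^{1/2})$, let $\widetilde\Psi$ be the automorphism of $\widetilde{\mathbf U}$ with $K_j\mapsto a_j^{1/2}K_j$, $K_j'\mapsto a_j^{1/2}K_j'$, $E_j\mapsto a_j^{1/2}E_j$, $F_j\mapsto F_j$, where $a_j=v^{-\frac12(\alpha_j,\alpha_{\tau j})}$; set $\widetilde{\mathscr T}_{w}=\widetilde\Psi^{-1}\widetilde T_w\widetilde\Psi$. It is known that there is a unique automorphism $\widetilde{\mathbf T}_i$ of $\widetilde{\mathbf U}^\imath$ whose inverse satisfies $\widetilde{\mathbf T}_i^{-1}(y)\,\widetilde\Upsilon_i=\widetilde\Upsilon_i\,\widetilde{\mathscr T}_{r_i}^{-1}(y)$ for all $y\in\widetilde{\mathbf U}^\imath$. It is transported to $\widetilde{\mathbf B}^\imath_\tau$. Subalgebras. $\mathbf f_{i,\tau i}\subset\mathbf f$ is the subalgebra generated by $\vartheta_i,\vartheta_{\tau i}$; $\tau\tau_i$ acts on it as the algebra automorphism permuting these generators. $\mathbf f[i,\tau i]=\{x\in\mathbf f: \widetilde T_{r_i}(x^+)\in\mathbf U^+\}$, ${}^\sigma\mathbf f[i,\tau i]=\{x\in\mathbf f:\widetilde T_{r_i}^{-1}(x^+)\in\mathbf U^+\}$; for $x$ in the former (resp. latter), $\widetilde T_{r_i}(x)$ (resp. $\widetilde T_{r_i}^{-1}(x)$) denotes the corresponding element of $\mathbf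 f\cong\mathbf U^+$. *)

(* Defs.v *)
From HB Require Import structures.
From mathcomp Require Import all_boot all_order all_algebra all_field.
From mathcomp Require Import boolp classical_sets.
From mathcomp Require Import finmap.
From mathcomp.multinomials Require Import monalg.
From mathcomp Require Import ring.

Set Implicit Arguments.
Unset Strict Implicit.
Unset Printing Implicit Defensive.

Import Order.TTheory GRing.Theory Num.Theory.
Local Open Scope quotient_scope.
Local Open Scope classical_set_scope.
Local Open Scope ring_scope.

(* Every algebra given by generators and relations is the quotient of the free
   algebra by the two-sided ideal generated by the relators. It depends on a
   field [F] and on an element [q] of [F] standing for $v^{1/2}$; hence
   [U_alg D q] over $\mathbb Q(v^{1/2})$ becomes [U_alg D (phi q)] after an
   extension of scalars [phi]. *)

Lemma malg_scalerAr (F : fieldType) (M : monomType) c (x y : {malg F[M]}) :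
  c *: (x * y) = x * (c *: y).
Proof.
apply/malgP => m; rewrite mcoeffZ (mcoeffMl x y).
rewrite (mcoeffMlw _ (fsubset_refl (msupp x)) (msuppZ_le c y)).
rewrite big_distrr; apply: eq_bigr => k1 _ /=.
rewrite big_distrr; apply: eq_bigr => k2 _ /=.
by rewrite mcoeffZ mulrnAr mulrCA.
Qed.

Section FreeAlgebra.
Variables (F : fieldType) (G : choiceType).

Definition free_alg := {malg F[{fmonom G}]}.

HB.instance Definition _ := GRing.Lalgebra.on free_alg.

Lemma free_scalerAr c (x y : free_alg) : c *: (x * y) = x * (c *: y).
Proof. exact: malg_scalerAr. Qed.
HB.instance Definition _ :=
  GRing.Lalgebra_isAlgebra.Build F free_alg free_scalerAr.

Definition free_gen (g : G) : free_alg := << fmu g >>.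
End FreeAlgebra.

Section FreeEval.
Variables (F F' : fieldType) (phi : {rmorphism F -> F'}).
Variables (G : choiceType) (A : algType F') (g : G -> A).

Definition word_eval (w : {fmonom G}) : A := \prod_(a <- w) g a.

Lemma word_eval_mmorphism : mmorphism word_eval.
Proof.
split=> [u w|]; first by rewrite /word_eval fmM big_cat.
by rewrite /word_eval fm1 big_nil.
Qed.
HB.instance Definition _ :=
  isMultiplicative.Build {fmonom G} A word_eval word_eval_mmorphism.

Definition free_eval (x : free_alg F G) : A :=
  mmap (in_alg A \o phi) word_eval x.

Lemma free_eval_zmod : zmod_morphism free_eval.
Proof. by move=> x y; rewrite /free_eval mmapB. Qed.
HB.instance Definition _ :=
  GRing.isZmodMorphism.Build (free_alg F G) A free_eval free_eval_zmod.

Lemma free_eval_monoid : monoid_morphism free_eval.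
Proof.
suff [mM m1] : multiplicative free_eval by split.
apply: commr_mmap_is_multiplicative => x m m'.
by rewrite /GRing.comm /= -scalerAl mul1r -scalerAr mulr1.
Qed.
HB.instance Definition _ :=
  GRing.isMonoidMorphism.Build (free_alg F G) A free_eval free_eval_monoid.

Lemma free_evalZ c x : free_eval (c *: x) = phi c *: free_eval x.
Proof. by rewrite /free_eval mmapZ /= -scalerAl mul1r. Qed.
HB.instance Definition _ := GRing.isScalable.Build F (free_alg F G) A
  (phi \; *:%R) free_eval free_evalZ.

Lemma free_eval_gen a : free_eval (free_gen F a) = g a.
Proof.
rewrite /free_eval /free_gen mmapU /= rmorph1 scale1r mul1r.
by rewrite /word_eval fmU big_seq1.
Qed.

Let evB x y : free_eval (x - y) = free_eval x - free_eval y.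
Proof. exact: rmorphB. Qed.
Let evM x y : free_eval (x * y) = free_eval x * free_eval y.
Proof. exact: rmorphM. Qed.
Let ev1 : free_eval 1 = 1.
Proof. exact: rmorph1. Qed.

Local Notation "''x_' a" := (free_gen F a) (at level 8, a at level 2).

Lemma free_eval_inv a b : free_eval ('x_a * 'x_b - 1) = g a * g b - 1.
Proof. by rewrite evB evM ev1 !free_eval_gen. Qed.

Lemma free_eval_comm a b z c d :
  free_eval ('x_a * 'x_b - z *: ('x_c * 'x_d))
    = g a * g b - phi z *: (g c * g d).
Proof.
by rewrite evB [X in X - _]evM [X in _ - X]free_evalZ [X in _ *: X]evM
  !free_eval_gen.
Qed.

Lemma free_eval_comm1 a b c d :
  free_eval ('x_a * 'x_b - 'x_c * 'x_d) = g a * g b - g c * g d.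
Proof. by rewrite evB [X in X - _]evM [X in _ - X]evM !free_eval_gen. Qed.

Lemma free_eval_bracket a b c d z m n :
  free_eval ('x_a * 'x_b - 'x_c * 'x_d - z *: ('x_m - 'x_n))
    = g a * g b - g c * g d - phi z *: (g m - g n).
Proof. by rewrite evB free_eval_comm1 free_evalZ evB !free_eval_gen. Qed.
End FreeEval.

Section Quotient.
Variables (F : fieldType) (A : algType F).

Inductive ideal_gen (R : A -> Prop) : A -> Prop :=
| ideal_rel x : R x -> ideal_gen R x
| ideal_0 : ideal_gen R 0
| ideal_D x y : ideal_gen R x -> ideal_gen R y -> ideal_gen R (x + y)
| ideal_Ml a x : ideal_gen R x -> ideal_gen R (a * x)
| ideal_Mr x a : ideal_gen R x -> ideal_gen R (x * a).

(* [algType] requires $1\ne0$, so the relators must not generate the unit. *)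
Record relators := Relators {
  relator :> A -> Prop;
  relators_proper : ~ ideal_gen relator 1
}.

Variable R : relators.

Lemma ideal_N x : ideal_gen R x -> ideal_gen R (- x).
Proof. by rewrite -mulN1r; apply: ideal_Ml. Qed.

Lemma ideal_Z c x : ideal_gen R x -> ideal_gen R (c *: x).
Proof. by rewrite -[x in c *: x]mul1r scalerAl; apply: ideal_Ml. Qed.

Definition ideal_eqv (x y : A) : bool := `[< ideal_gen R (x - y) >].

Lemma ideal_eqv_equiv : equiv_class_of ideal_eqv.
Proof.
split=> [x|x y|y x z].
- by apply/asboolP; rewrite subrr; apply: ideal_0.
- by apply/asboolP/asboolP => /ideal_N; rewrite opprB.
- move=> /asboolP xy /asboolP yz; apply/asboolP.
  by rewrite -[x - z](subrKA y); apply: ideal_D.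
Qed.
Canonical ideal_eqv_rel := EquivRelPack ideal_eqv_equiv.
Canonical ideal_eqv_enc := defaultEncModRel ideal_eqv.

Definition quot_alg := {eq_quot ideal_eqv}.
HB.instance Definition _ : EqQuotient A ideal_eqv quot_alg :=
  EqQuotient.on quot_alg.
HB.instance Definition _ := Choice.on quot_alg.

Definition quot_pi (x : A) : quot_alg := \pi x.

Lemma quot_piP x y : reflect (ideal_gen R (x - y)) (quot_pi x == quot_pi y).
Proof. by rewrite /quot_pi piE; apply: asboolP. Qed.

Lemma quot_pi_eq x y : ideal_gen R (x - y) -> quot_pi x = quot_pi y.
Proof. by move=> /quot_piP /eqP. Qed.

Lemma quot_repr x : ideal_gen R (repr (quot_pi x) - x).
Proof. by apply/quot_piP; rewrite /quot_pi reprK. Qed.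

Lemma quot_reprK (x : quot_alg) : quot_pi (repr x) = x.
Proof. exact: reprK. Qed.

(* The operations are locked so that unification does not unfold them. *)
Fact quot_key : unit. Proof. by []. Qed.
Let qadd := locked_with quot_key
  (fun x y : quot_alg => quot_pi (repr x + repr y)).
Let qopp := locked_with quot_key (fun x : quot_alg => quot_pi (- repr x)).
Let qmul := locked_with quot_key
  (fun x y : quot_alg => quot_pi (repr x * repr y)).
Let qscale := locked_with quot_key
  (fun c (x : quot_alg) => quot_pi (c *: repr x)).

Let piD x y : qadd (quot_pi x) (quot_pi y) = quot_pi (x + y).
Proof.
rewrite /qadd unlock; apply: quot_pi_eq; rewrite opprD addrACA.
by apply: ideal_D; apply: quot_repr.
Qed.
Let piN x : qopp (quot_pi x) = quot_pi (- x).
Proof.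
rewrite /qopp unlock; apply: quot_pi_eq; rewrite -opprD.
exact/ideal_N/quot_repr.
Qed.
Let piM x y : qmul (quot_pi x) (quot_pi y) = quot_pi (x * y).
Proof.
rewrite /qmul unlock; apply: quot_pi_eq.
rewrite -(subrKA (x * repr (quot_pi y))) -mulrBl -mulrBr.
by apply: ideal_D; [apply: ideal_Mr|apply: ideal_Ml]; apply: quot_repr.
Qed.
Let piZ c x : qscale c (quot_pi x) = quot_pi (c *: x).
Proof.
rewrite /qscale unlock; apply: quot_pi_eq; rewrite -scalerBr.
exact/ideal_Z/quot_repr.
Qed.

Let qE := (piD, piN, piM, piZ).
Let qW (P : quot_alg -> Prop) : (forall x, P (quot_pi x)) -> forall x, P x.
Proof. by move=> PP x; rewrite -(quot_reprK x). Qed.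

Let qaddA : associative qadd.
Proof. by elim/qW => x; elim/qW => y; elim/qW => z; rewrite !qE addrA. Qed.
Let qaddC : commutative qadd.
Proof. by elim/qW => x; elim/qW => y; rewrite !qE addrC. Qed.
Let qadd0 : left_id (quot_pi 0) qadd.
Proof. by elim/qW => ?; rewrite !qE add0r. Qed.
Let qaddN : left_inverse (quot_pi 0) qopp qadd.
Proof. by elim/qW => ?; rewrite !qE addNr. Qed.
HB.instance Definition _ :=
  GRing.isZmodule.Build quot_alg qaddA qaddC qadd0 qaddN.
Let pi_add x y : quot_pi x + quot_pi y = quot_pi (x + y).
Proof. exact: piD. Qed.

Let qmulA : associative qmul.
Proof. by elim/qW => x; elim/qW => y; elim/qW => z; rewrite !qE mulrA. Qed.
Let qmul1r : left_id (quot_pi 1) qmul.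
Proof. by elim/qW => ?; rewrite !qE mul1r. Qed.
Let qmulr1 : right_id (quot_pi 1) qmul.
Proof. by elim/qW => ?; rewrite !qE mulr1. Qed.
Let qmulDl : left_distributive qmul +%R.
Proof. by elim/qW => x; elim/qW => y; elim/qW => z; rewrite !(qE, pi_add) mulrDl. Qed.
Let qmulDr : right_distributive qmul +%R.
Proof. by elim/qW => x; elim/qW => y; elim/qW => z; rewrite !(qE, pi_add) mulrDr. Qed.
Let qone_neq0 : quot_pi 1 != 0.
Proof. by apply/quot_piP; rewrite subr0; apply: relators_proper. Qed.
HB.instance Definition _ := GRing.Zmodule_isNzRing.Build quot_alg
  qmulA qmul1r qmulr1 qmulDl qmulDr qone_neq0.

Let qscaleA a b v : qscale a (qscale b v) = qscale (a * b) v.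
Proof. by elim/qW: v => ?; rewrite !qE scalerA. Qed.
Let qscale1 : left_id 1 qscale.
Proof. by elim/qW => ?; rewrite !qE scale1r. Qed.
Let qscaleDr : right_distributive qscale +%R.
Proof. by move=> a; elim/qW => x; elim/qW => y; rewrite !(qE, pi_add) scalerDr. Qed.
Let qscaleDl v : {morph qscale^~ v : a b / a + b}.
Proof. by move=> a b; elim/qW: v => ?; rewrite !(qE, pi_add) scalerDl. Qed.
HB.instance Definition _ := GRing.Zmodule_isLmodule.Build F quot_alg
  qscaleA qscale1 qscaleDr qscaleDl.
Let pi_mul x y : quot_pi x * quot_pi y = quot_pi (x * y).
Proof. exact: piM. Qed.
Let pi_scale c x : c *: quot_pi x = quot_pi (c *: x).
Proof. exact: piZ. Qed.

Let qscaleAl a (u v : quot_alg) : a *: (u * v) = (a *: u) * v.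
Proof. by elim/qW: u => u; elim/qW: v => v; rewrite !(pi_mul, pi_scale) scalerAl. Qed.
HB.instance Definition _ := GRing.Lmodule_isLalgebra.Build F quot_alg qscaleAl.
Let qscaleAr a (u v : quot_alg) : a *: (u * v) = u * (a *: v).
Proof. by elim/qW: u => u; elim/qW: v => v; rewrite !(pi_mul, pi_scale) scalerAr. Qed.
HB.instance Definition _ := GRing.Lalgebra_isAlgebra.Build F quot_alg qscaleAr.

Lemma quot_pi_zmod : zmod_morphism quot_pi.
Proof. by move=> x y; rewrite -piD -piN. Qed.
HB.instance Definition _ :=
  GRing.isZmodMorphism.Build A quot_alg quot_pi quot_pi_zmod.
Lemma quot_pi_monoid : monoid_morphism quot_pi.
Proof. by split=> // x y; rewrite -piM. Qed.
HB.instance Definition _ :=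
  GRing.isMonoidMorphism.Build A quot_alg quot_pi quot_pi_monoid.
Lemma quot_piZ c x : quot_pi (c *: x) = c *: quot_pi x.
Proof. by rewrite -piZ. Qed.
HB.instance Definition _ :=
  GRing.isScalable.Build F A quot_alg *:%R quot_pi quot_piZ.

Lemma quot_rel x : R x -> quot_pi x = 0.
Proof.
by move=> Rx; rewrite -(rmorph0 quot_pi); apply: quot_pi_eq;
  rewrite subr0; apply: ideal_rel.
Qed.
End Quotient.

Section Presentation.
Variables (F : fieldType) (G : choiceType) (R : relators (free_alg F G)).

Definition pres_gen (a : G) : quot_alg R := quot_pi R (free_gen F a).

Local Notation "''x_' a" := (free_gen F a) (at level 8, a at level 2).
Local Notation "''y_' a" := (pres_gen a) (at level 8, a at level 2).

Let rel0 x : R x -> quot_pi R x = 0 := @quot_rel F _ R x.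
Let piB x y : quot_pi R (x - y) = quot_pi R x - quot_pi R y.
Proof. exact: rmorphB. Qed.
Let piM a b : quot_pi R ('x_a * 'x_b) = 'y_a * 'y_b.
Proof. exact: rmorphM. Qed.

Lemma pres_inv a b : R ('x_a * 'x_b - 1) -> 'y_a * 'y_b = 1.
Proof. by move/rel0; rewrite piB piM => /subr0_eq ->; apply: rmorph1. Qed.

Lemma pres_comm1 a b c d :
  R ('x_a * 'x_b - 'x_c * 'x_d) -> 'y_a * 'y_b = 'y_c * 'y_d.
Proof.
by move/rel0; rewrite piB [X in X - _]piM [X in _ - X]piM => /subr0_eq.
Qed.

Lemma pres_comm a b z c d :
  R ('x_a * 'x_b - z *: ('x_c * 'x_d)) -> 'y_a * 'y_b = z *: ('y_c * 'y_d).
Proof.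
move/rel0; rewrite piB [X in X - _]piM [X in _ - X]quot_piZ [X in _ *: X]piM.
by move/subr0_eq.
Qed.

Lemma pres_bracket a b c d z m n :
  R ('x_a * 'x_b - 'x_c * 'x_d - z *: ('x_m - 'x_n)) ->
  'y_a * 'y_b - 'y_c * 'y_d = z *: ('y_m - 'y_n).
Proof.
move/rel0; rewrite piB [X in _ - X]quot_piZ [X in _ *: X]piB.
by rewrite [X in X - _]piB [X in X - _ - _]piM [X in _ - X - _]piM => /subr0_eq.
Qed.

Section Lift.
Variables (F' : fieldType) (phi : {rmorphism F -> F'}) (A : algType F').
Variable g : G -> A.

Definition kills := forall x, R x -> free_eval phi g x = 0.

Hypothesis gK : kills.

Lemma kills_ideal x : ideal_gen R x -> free_eval phi g x = 0.
Proof.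
elim=> {x} [x /gK //||x y _ x0 _ y0|a x _ x0|x a _ x0].
- exact: rmorph0.
- by rewrite rmorphD /= x0 y0 addr0.
- by rewrite rmorphM /= x0 mulr0.
- by rewrite rmorphM /= x0 mul0r.
Qed.

(* The algebra morphism, semilinear along [phi], sending generator [a] to [g a]. *)
Definition lift of kills := fun x : quot_alg R => free_eval phi g (repr x).

Lemma lift_pi x : lift gK (quot_pi R x) = free_eval phi g x.
Proof.
apply/eqP; rewrite -subr_eq0; have /eqP := kills_ideal (quot_repr R x).
by rewrite rmorphB.
Qed.

Lemma lift_gen a : lift gK (pres_gen a) = g a.
Proof. by rewrite lift_pi free_eval_gen. Qed.

Lemma lift_zmod : zmod_morphism (lift gK).
Proof.
by move=> x y; rewrite -(quot_reprK x) -(quot_reprK y) -rmorphB !lift_pi rmorphB.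
Qed.
HB.instance Definition _ :=
  GRing.isZmodMorphism.Build (quot_alg R) A (lift gK) lift_zmod.
Lemma lift_monoid : monoid_morphism (lift gK).
Proof.
split=> [|x y]; first by rewrite -(rmorph1 (quot_pi R)) lift_pi rmorph1.
by rewrite -(quot_reprK x) -(quot_reprK y) -rmorphM !lift_pi rmorphM.
Qed.
HB.instance Definition _ :=
  GRing.isMonoidMorphism.Build (quot_alg R) A (lift gK) lift_monoid.
Lemma liftZ c x : lift gK (c *: x) = phi c *: lift gK x.
Proof. by rewrite -(quot_reprK x) -linearZ !lift_pi free_evalZ. Qed.
HB.instance Definition _ :=
  GRing.isScalable.Build F (quot_alg R) A (phi \; *:%R) (lift gK) liftZ.
End Lift.
End Presentation.

Section Augmentation.
Variables (F : fieldType) (G : choiceType) (R : free_alg F G -> Prop).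
Variable e : G -> F^o.

Lemma augmented_proper :
  (forall x, R x -> free_eval idfun e x = 0) -> ~ ideal_gen R 1.
Proof.
move=> eK; suff H x : ideal_gen R x -> free_eval idfun e x = 0.
  by move=> /H; rewrite rmorph1; apply/eqP; apply: oner_neq0.
elim=> {x} [x /eK //||x y _ x0 _ y0|a x _ x0|x a _ x0].
- exact: rmorph0.
- by rewrite rmorphD /= x0 y0 addr0.
- by rewrite rmorphM /= x0 mulr0.
- by rewrite rmorphM /= x0 mul0r.
Qed.
End Augmentation.

Section Subalgebra.
Variables (F : fieldType) (A : algType F) (S : A -> Prop).

Inductive in_subalg : A -> Prop :=
| in_subalg_gen x : S x -> in_subalg x
| in_subalg_1 : in_subalg 1
| in_subalg_ZD c x y : in_subalg x -> in_subalg y -> in_subalg (c *: x + y)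
| in_subalg_M x y : in_subalg x -> in_subalg y -> in_subalg (x * y).

Definition subalg : {pred A} := fun x => `[< in_subalg x >].

Lemma subalg_closed : subalg_closed subalg.
Proof.
split=> [|c x y|x y]; first by apply/asboolP; apply: in_subalg_1.
- by move=> /asboolP ? /asboolP ?; apply/asboolP; apply: in_subalg_ZD.
- by move=> /asboolP ? /asboolP ?; apply/asboolP; apply: in_subalg_M.
Qed.
HB.instance Definition _ := GRing.isSubalgClosed.Build F A subalg
  (GRing.subalg_closed_semi subalg_closed).

Record subalg_of := SubalgOf { subalg_val : A; _ : subalg_val \in subalg }.
HB.instance Definition _ := [isSub of subalg_of for subalg_val].
HB.instance Definition _ := [Choice of subalg_of by <:].
HB.instance Definition _ := [SubChoice_isSubAlgebra of subalg_of by <:].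
End Subalgebra.

(* A symmetrizable generalized Cartan matrix $C=(c_{ij})$ with symmetrizer
   $D=\mathrm{diag}(d_i)$ ([symz]) and an involution of the diagram. *)
Record satake (I : finType) := Satake {
  cartan : I -> I -> int;
  symz : I -> nat;
  tau : I -> I;
  cartan_diag : forall i, cartan i i = 2;
  cartan_off_le0 : forall i j, i != j -> cartan i j <= 0;
  cartan_eq0 : forall i j, cartan i j = 0 -> cartan j i = 0;
  symz_gt0 : forall i, (0 < symz i)%N;
  symz_cartan : forall i j,
    (symz i)%:Z * cartan i j = (symz j)%:Z * cartan j i;
  tauK : involutive tau;
  cartan_tau : forall i j, cartan (tau i) (tau j) = cartan i j;
  symz_tau : forall i, symz (tau i) = symz i
}.

Section RootLattice.
Variables (I : finType) (D : satake I).
Local Notation c := (cartan D).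
Local Notation d := (symz D).

Definition lattice := {ffun I -> int}.
HB.instance Definition _ := GRing.Zmodule.on lattice.

Definition alpha (i : I) : lattice := [ffun j => (i == j)%:Z].

Definition root_form (mu nu : lattice) : int :=
  \sum_i \sum_j mu i * nu j * ((d i)%:Z * c i j).

Definition refl (i : I) (mu : lattice) : lattice :=
  mu - alpha i *~ (\sum_j c i j * mu j).

Definition refl_word (w : seq I) (mu : lattice) : lattice := foldr refl mu w.

Definition lat_map (s : I -> I) (mu : lattice) : lattice :=
  \sum_i alpha (s i) *~ mu i.

(* A reduced expression of $r_i$; the last case is $c_{i,\tau i}=-1$. *)
Definition r_word (i : I) : seq I :=
  if c i (tau D i) == 2 then [:: i]
  else if c i (tau D i) == 0 then [:: i; tau D i]
  else [:: i; tau D i; i].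

(* $\tau_i(j)$ is the $k$ with $r_i(\alpha_j)=-\alpha_k$. Only $j\in\{i,\tau i\}$
   matters. *)
Definition tau_loc (i j : I) : I :=
  odflt j [pick k | refl_word (r_word i) (alpha j) == - alpha k].
End RootLattice.

Section QNumbers.
Variable F : fieldType.
Implicit Type v : F.
Definition qint v (n : nat) : F := (v ^+ n - v ^- n) / (v - v^-1).
Definition qfact v (n : nat) : F := \prod_(1 <= m < n.+1) qint v m.
Definition qbin v (n r : nat) : F := qfact v n / (qfact v r * qfact v (n - r)).
End QNumbers.

Lemma qbin_morph (F F' : fieldType) (phi : {rmorphism F -> F'}) v n r :
  phi (qbin v n r) = qbin (phi v) n r.
Proof.
have qi m : phi (qint v m) = qint (phi v) m.
  by rewrite /qint fmorph_div !rmorphB /= !fmorphV !rmorphXn.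
have qf m : phi (qfact v m) = qfact (phi v) m.
  by rewrite /qfact rmorph_prod; apply: eq_bigr => k _.
by rewrite /qbin fmorph_div rmorphM /= !qf.
Qed.

Section Serre.
Variables (I : finType) (D : satake I) (F : fieldType) (q : F).

Definition vi (i : I) : F := q ^+ (2 * symz D i).

Definition serre (A : algType F) (X : I -> A) (i j : I) : A :=
  let n := `|1 - cartan D i j|%N in
  \sum_(r < n.+1) ((-1) ^+ r * qbin (vi i) n r) *:
    (X i ^+ r * X j * X i ^+ (n - r)).

Lemma serre_tau (A : algType F) (X : I -> A) i j :
  serre (X \o tau D) i j = serre X (tau D i) (tau D j).
Proof. by rewrite /serre cartan_tau /vi symz_tau. Qed.

Lemma serre_scale (A : algType F) (X : I -> A) (s : I -> F) i j :
  exists c, serre (fun k => s k *: X k) i j = c *: serre X i j.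
Proof.
set n := `|1 - cartan D i j|%N; exists (s i ^+ n * s j).
rewrite /serre scaler_sumr; apply: eq_bigr => r _; rewrite !exprZn.
rewrite -!(scalerAl, scalerAr) !scalerA; congr (_ *: _).
have -> : s i ^+ n = s i ^+ r * s i ^+ (n - r).
  by rewrite -exprD subnKC // -ltnS ltn_ord.
by rewrite -/n; set a := s i ^+ r; set b := s i ^+ (n - r); ring.
Qed.

Lemma serre_eq (A : algType F) (X Y : I -> A) i j :
  X =1 Y -> serre X i j = serre Y i j.
Proof. by move=> XY; apply: eq_bigr => r _; rewrite !XY. Qed.

Lemma serre0 (A : algType F) i j : i != j -> serre (fun=> 0 : A) i j = 0.
Proof.
by move=> ij; rewrite /serre big1 // => r _; rewrite mulr0 mul0r scaler0.
Qed.
End Serre.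

Lemma serre_morph (I : finType) (D : satake I) (F F' : fieldType)
    (phi : {rmorphism F -> F'}) (q : F) (A : algType F) (A' : algType F')
    (f : {rmorphism A -> A'}) (X : I -> A) i j :
    (forall c x, f (c *: x) = phi c *: f x) ->
  f (serre D q X i j) = serre D (phi q) (f \o X) i j.
Proof.
move=> fZ; rewrite /serre rmorph_sum; apply: eq_bigr => r _.
rewrite fZ [phi _]rmorphM (qbin_morph phi) rmorphXn rmorphN1.
by rewrite !rmorphM !rmorphXn.
Qed.

Section AlgebraF.
Variables (I : finType) (D : satake I) (F : fieldType) (q : F).

Variant f_rel : free_alg F I -> Prop :=
| f_serre i j : i != j -> f_rel (serre D q (@free_gen F I) i j).

Lemma f_proper : ~ ideal_gen f_rel 1.
Proof.
apply: (@augmented_proper _ _ _ (fun=> 0)) => _ [i j ij].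
rewrite (serre_morph D _ _ _ _ (free_evalZ idfun _)) -[RHS](serre0 D q _ ij).
by apply: serre_eq => k; rewrite /= free_eval_gen.
Qed.

Definition f_alg := quot_alg (Relators f_proper).
Definition theta (i : I) : f_alg := pres_gen (Relators f_proper) i.

Lemma theta_serre i j : i != j -> serre D q theta i j = 0.
Proof.
move=> ij; rewrite -(quot_rel (R := Relators f_proper) (f_serre ij)).
by rewrite (serre_morph D (phi := idfun) _ _ _ _ (quot_piZ (Relators f_proper))).
Qed.

Variant B_gen := gTheta of I | gH of I | gHV of I.
Definition B_gen_code (g : B_gen) : I + I + I :=
  match g with gTheta i => inl (inl i) | gH i => inl (inr i) | gHV i => inr i end.
Definition B_gen_decode (s : I + I + I) : B_gen :=
  match s with inl (inl i) => gTheta i | inl (inr i) => gH i | inr i => gHV i end.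
Lemma B_gen_codeK : cancel B_gen_code B_gen_decode. Proof. by case. Qed.
HB.instance Definition _ := Equality.copy B_gen (can_type B_gen_codeK).
HB.instance Definition _ := Choice.copy B_gen (can_type B_gen_codeK).

Section Rel.
Local Notation x i := (free_gen F (gTheta i)).
Local Notation h i := (free_gen F (gH i)).
Local Notation hV i := (free_gen F (gHV i)).
Variant B_rel : free_alg F B_gen -> Prop :=
| B_serre i j : i != j -> B_rel (serre D q (fun k => x k) i j)
| B_hhV i : B_rel (h i * hV i - 1)
| B_hVh i : B_rel (hV i * h i - 1)
| B_hh i j : B_rel (h i * h j - h j * h i)
| B_hx i j : B_rel (h i * x j - (vi D q i) ^ (cartan D i j) *: (x j * h i)).
End Rel.

Lemma B_proper : ~ ideal_gen B_rel 1.
Proof.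
pose e g : F^o := if g is gTheta _ then 0 else 1.
apply: (@augmented_proper _ _ _ e) => _ [i j ij|i|i|i j|i j].
- rewrite (serre_morph D _ _ _ _ (free_evalZ idfun _)) -[RHS](serre0 D q _ ij).
  by apply: serre_eq => k; rewrite /= free_eval_gen.
- by rewrite free_eval_inv mul1r subrr.
- by rewrite free_eval_inv mul1r subrr.
- by rewrite free_eval_comm1 mul1r subrr.
- by rewrite free_eval_comm mulr0 mul0r scaler0 subrr.
Qed.

Definition B_alg := quot_alg (Relators B_proper).
Definition Btheta (i : I) : B_alg := pres_gen (Relators B_proper) (gTheta i).
Definition Bh (i : I) : B_alg := pres_gen (Relators B_proper) (gH i).
Definition BhV (i : I) : B_alg := pres_gen (Relators B_proper) (gHV i).
End AlgebraF.

Section AlgebraU.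
Variables (I : finType) (D : satake I) (F : fieldType) (q : F).
Local Notation v_ := (vi D q).
Local Notation c := (cartan D).

(* [V] marks an inverse: [gKV i] is $K_i^{-1}$, [gK'V i] is $(K_i')^{-1}$. *)
Variant U_gen := gE of I | gF of I | gK of I | gKV of I | gK' of I | gK'V of I.
Definition U_gen_code (g : U_gen) : I * 'I_6 :=
  match g with
  | gE i => (i, inord 0) | gF i => (i, inord 1) | gK i => (i, inord 2)
  | gKV i => (i, inord 3) | gK' i => (i, inord 4) | gK'V i => (i, inord 5)
  end.
Definition U_gen_decode (s : I * 'I_6) : U_gen :=
  match nat_of_ord s.2 with
  | 0 => gE s.1 | 1 => gF s.1 | 2 => gK s.1
  | 3 => gKV s.1 | 4 => gK' s.1 | _ => gK'V s.1
  end.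
Lemma U_gen_codeK : cancel U_gen_code U_gen_decode.
Proof. by case=> i; rewrite /U_gen_decode /= inordK. Qed.
HB.instance Definition _ := Equality.copy U_gen (can_type U_gen_codeK).
HB.instance Definition _ := Choice.copy U_gen (can_type U_gen_codeK).

Section Rel.
Local Notation e i := (free_gen F (gE i)).
Local Notation f i := (free_gen F (gF i)).
Local Notation k i := (free_gen F (gK i)).
Local Notation kV i := (free_gen F (gKV i)).
Local Notation k' i := (free_gen F (gK' i)).
Local Notation k'V i := (free_gen F (gK'V i)).
Variant U_rel : free_alg F U_gen -> Prop :=
| U_kkV i : U_rel (k i * kV i - 1)
| U_kVk i : U_rel (kV i * k i - 1)
| U_k'k'V i : U_rel (k' i * k'V i - 1)
| U_k'Vk' i : U_rel (k'V i * k' i - 1)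
| U_kk i j : U_rel (k i * k j - k j * k i)
| U_kk' i j : U_rel (k i * k' j - k' j * k i)
| U_k'k' i j : U_rel (k' i * k' j - k' j * k' i)
| U_ef i j : U_rel (e i * f j - f j * e i
                    - ((i == j)%:R * ((v_ i)^-1 - v_ i)) *: (k i - k' i))
| U_ke i j : U_rel (k i * e j - v_ i ^ c i j *: (e j * k i))
| U_kf i j : U_rel (k i * f j - v_ i ^ (- c i j) *: (f j * k i))
| U_k'e i j : U_rel (k' i * e j - v_ i ^ (- c i j) *: (e j * k' i))
| U_k'f i j : U_rel (k' i * f j - v_ i ^ c i j *: (f j * k' i))
| U_serre_e i j : i != j -> U_rel (serre D q (fun l => e l) i j)
| U_serre_f i j : i != j -> U_rel (serre D q (fun l => f l) i j).
End Rel.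

Lemma U_proper : ~ ideal_gen U_rel 1.
Proof.
pose e g : F^o := match g with gE _ | gF _ => 0 | _ => 1 end.
apply: (@augmented_proper _ _ _ e) => _ [].
13,14: move=> i j ij; rewrite (serre_morph D _ _ _ _ (free_evalZ idfun _));
  by rewrite -[RHS](serre0 D q _ ij); apply: serre_eq => k; rewrite /= free_eval_gen.
1-4: by move=> i; rewrite free_eval_inv mul1r subrr.
1-3: by move=> i j; rewrite free_eval_comm1 mul1r subrr.
- by move=> i j; rewrite free_eval_bracket !mul0r !subrr scaler0 subrr.
all: by move=> i j; rewrite free_eval_comm mulr0 mul0r scaler0 subrr.
Qed.

Definition U_alg := quot_alg (Relators U_proper).
Definition UE (i : I) : U_alg := pres_gen (Relators U_proper) (gE i).
Definition UF (i : I) : U_alg := pres_gen (Relators U_proper) (gF i).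
Definition UK (i : I) : U_alg := pres_gen (Relators U_proper) (gK i).
Definition UKV (i : I) : U_alg := pres_gen (Relators U_proper) (gKV i).
Definition UK' (i : I) : U_alg := pres_gen (Relators U_proper) (gK' i).
Definition UK'V (i : I) : U_alg := pres_gen (Relators U_proper) (gK'V i).

Section Relations.
Let Rp := Relators U_proper.
Lemma UK_V i : UK i * UKV i = 1.
Proof. exact: (pres_inv (R := Rp) (U_kkV i)). Qed.
Lemma UKV_K i : UKV i * UK i = 1.
Proof. exact: (pres_inv (R := Rp) (U_kVk i)). Qed.
Lemma UK'_V i : UK' i * UK'V i = 1.
Proof. exact: (pres_inv (R := Rp) (U_k'k'V i)). Qed.
Lemma UK'V_K' i : UK'V i * UK' i = 1.
Proof. exact: (pres_inv (R := Rp) (U_k'Vk' i)). Qed.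
Lemma UK_K i j : UK i * UK j = UK j * UK i.
Proof. exact: (pres_comm1 (R := Rp) (U_kk i j)). Qed.
Lemma UK_K' i j : UK i * UK' j = UK' j * UK i.
Proof. exact: (pres_comm1 (R := Rp) (U_kk' i j)). Qed.
Lemma UK'_K' i j : UK' i * UK' j = UK' j * UK' i.
Proof. exact: (pres_comm1 (R := Rp) (U_k'k' i j)). Qed.
Lemma UE_F i j : UE i * UF j - UF j * UE i =
  ((i == j)%:R * ((v_ i)^-1 - v_ i)) *: (UK i - UK' i).
Proof. exact: (pres_bracket (R := Rp) (U_ef i j)). Qed.
Lemma UK_E i j : UK i * UE j = v_ i ^ c i j *: (UE j * UK i).
Proof. exact: (pres_comm (R := Rp) (U_ke i j)). Qed.
Lemma UK_F i j : UK i * UF j = v_ i ^ (- c i j) *: (UF j * UK i).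
Proof. exact: (pres_comm (R := Rp) (U_kf i j)). Qed.
Lemma UK'_E i j : UK' i * UE j = v_ i ^ (- c i j) *: (UE j * UK' i).
Proof. exact: (pres_comm (R := Rp) (U_k'e i j)). Qed.
Lemma UK'_F i j : UK' i * UF j = v_ i ^ c i j *: (UF j * UK' i).
Proof. exact: (pres_comm (R := Rp) (U_k'f i j)). Qed.
Lemma UE_serre i j : i != j -> serre D q UE i j = 0.
Proof.
move=> ij; rewrite -(quot_rel (R := Rp) (U_serre_e ij)).
by rewrite (serre_morph D (phi := idfun) _ _ _ _ (quot_piZ Rp)).
Qed.
Lemma UF_serre i j : i != j -> serre D q UF i j = 0.
Proof.
move=> ij; rewrite -(quot_rel (R := Rp) (U_serre_f ij)).
by rewrite (serre_morph D (phi := idfun) _ _ _ _ (quot_piZ Rp)).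
Qed.
End Relations.
End AlgebraU.

Section Maps.
Variables (I : finType) (D : satake I) (F : fieldType) (q : F).

Lemma f_plus_kills : kills (Relators (@f_proper I D F q)) idfun (UE D q).
Proof.
move=> _ [i j ij]; rewrite (serre_morph D _ _ _ _ (free_evalZ idfun _)).
by rewrite -[RHS](UE_serre D q ij); apply: serre_eq => k; rewrite /= free_eval_gen.
Qed.
(* $x\mapsto x^+$ *)
Definition f_plus : f_alg D q -> U_alg D q := lift f_plus_kills.

Lemma f_iota_kills : kills (Relators (@f_proper I D F q)) idfun (Btheta D q).
Proof.
move=> _ [i j ij]; rewrite (serre_morph D _ _ _ _ (free_evalZ idfun _)).
rewrite -(quot_rel (R := Relators (@B_proper I D F q)) (B_serre D q ij)).
rewrite (serre_morph D (phi := idfun) _ _ _ _ (quot_piZ _)).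
by apply: serre_eq => k; rewrite /= free_eval_gen.
Qed.
Definition f_iota : f_alg D q -> B_alg D q := lift f_iota_kills.

Lemma tauB_kills : kills (Relators (@B_proper I D F q)) idfun
  (fun g => match g with
            | gTheta i => Btheta D q (tau D i)
            | gH i => Bh D q (tau D i)
            | gHV i => BhV D q (tau D i)
            end).
Proof.
set g := fun g => _; set R := Relators _.
have tauI i j : (tau D i != tau D j) = (i != j).
  by rewrite (inj_eq (can_inj (tauK D))).
move=> _ [i j ij|i|i|i j|i j].
- rewrite (serre_morph D _ _ _ _ (free_evalZ idfun _)).
  rewrite -(rmorph0 (quot_pi R)).
  have /(B_serre D q) /(quot_rel (R := R)) : tau D i != tau D j by rewrite tauI.
  rewrite (serre_morph D (phi := idfun) _ _ _ _ (quot_piZ _)) rmorph0 => <-.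
  rewrite -serre_tau; apply: serre_eq => k.
  by rewrite /= free_eval_gen.
- by rewrite free_eval_inv (pres_inv (R := R) (B_hhV D q _)) subrr.
- by rewrite free_eval_inv (pres_inv (R := R) (B_hVh D q _)) subrr.
- by rewrite free_eval_comm1 (pres_comm1 (R := R) (B_hh D q _ (tau D j))) subrr.
- rewrite free_eval_comm (pres_comm (R := R) (B_hx D q _ (tau D j))).
  by rewrite cartan_tau /vi symz_tau subrr.
Qed.
Definition tauB : B_alg D q -> B_alg D q := lift tauB_kills.

Lemma counit_kills : kills (Relators (@B_proper I D F q)) idfun
  (fun g => if g is gTheta _ then 0 else 1 : F^o).
Proof.
move=> _ [i j ij|i|i|i j|i j].
- rewrite (serre_morph D _ _ _ _ (free_evalZ idfun _)) -[RHS](serre0 D q _ ij).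
  by apply: serre_eq => k; rewrite /= free_eval_gen.
- by rewrite free_eval_inv mul1r subrr.
- by rewrite free_eval_inv mul1r subrr.
- by rewrite free_eval_comm1 mul1r subrr.
- by rewrite free_eval_comm mulr0 mul0r scaler0 subrr.
Qed.
Definition counit : B_alg D q -> F := lift counit_kills.

Lemma bc_kills (F' : fieldType) (phi : {rmorphism F -> F'}) :
  kills (Relators (@U_proper I D F q)) phi
    (@pres_gen _ _ (Relators (@U_proper I D F' (phi q)))).
Proof.
have pv i : phi (vi D q i) = vi D (phi q) i by rewrite /vi rmorphXn.
move=> _ [].
13: move=> i j ij; rewrite (serre_morph D _ _ _ _ (free_evalZ phi _));
  rewrite -[RHS](UE_serre D (phi q) ij);
  by apply: serre_eq => k; rewrite /= free_eval_gen.
13: move=> i j ij; rewrite (serre_morph D _ _ _ _ (free_evalZ phi _));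
  rewrite -[RHS](UF_serre D (phi q) ij);
  by apply: serre_eq => k; rewrite /= free_eval_gen.
- by move=> i; rewrite free_eval_inv UK_V subrr.
- by move=> i; rewrite free_eval_inv UKV_K subrr.
- by move=> i; rewrite free_eval_inv UK'_V subrr.
- by move=> i; rewrite free_eval_inv UK'V_K' subrr.
- by move=> i j; rewrite free_eval_comm1 UK_K subrr.
- by move=> i j; rewrite free_eval_comm1 UK_K' subrr.
- by move=> i j; rewrite free_eval_comm1 UK'_K' subrr.
- move=> i j; rewrite free_eval_bracket UE_F (rmorphM phi) rmorph_nat.
  by rewrite (rmorphB phi) fmorphV pv subrr.
- by move=> i j; rewrite free_eval_comm UK_E fmorphXz pv subrr.
- by move=> i j; rewrite free_eval_comm UK_F fmorphXz pv subrr.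
- by move=> i j; rewrite free_eval_comm UK'_E fmorphXz pv subrr.
- by move=> i j; rewrite free_eval_comm UK'_F fmorphXz pv subrr.
Qed.
Definition base_change (F' : fieldType) (phi : {rmorphism F -> F'}) :
  U_alg D q -> U_alg D (phi q) := lift (bc_kills phi).

Section Rescale.
Variables (s : I -> F) (s_neq0 : forall i, s i != 0).
Lemma rescale_kills : kills (Relators (@U_proper I D F q)) idfun
  (fun g => match g with
            | gE i => s i *: UE D q i
            | gF i => UF D q i
            | gK i => s i *: UK D q i
            | gKV i => (s i)^-1 *: UKV D q i
            | gK' i => s i *: UK' D q i
            | gK'V i => (s i)^-1 *: UK'V D q i
            end).
Proof.
have sM (a b : F) (x y : U_alg D q) : (a *: x) * (b *: y) = (a * b) *: (x * y).
  by rewrite -scalerAl -scalerAr scalerA.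
move=> _ [].
13: move=> i j ij; rewrite (serre_morph D _ _ _ _ (free_evalZ idfun _)).
13: have [a sE] := serre_scale D q (UE D q) s i j.
13: rewrite UE_serre // scaler0 in sE; rewrite -[RHS]sE.
13: by apply: serre_eq => k; rewrite /= free_eval_gen.
13: move=> i j ij; rewrite (serre_morph D _ _ _ _ (free_evalZ idfun _));
  rewrite -[RHS](UF_serre D q ij);
  by apply: serre_eq => k; rewrite /= free_eval_gen.
- by move=> i; rewrite free_eval_inv sM mulfV // scale1r UK_V subrr.
- by move=> i; rewrite free_eval_inv sM mulVf // scale1r UKV_K subrr.
- by move=> i; rewrite free_eval_inv sM mulfV // scale1r UK'_V subrr.
- by move=> i; rewrite free_eval_inv sM mulVf // scale1r UK'V_K' subrr.
- by move=> i j; rewrite free_eval_comm1 !sM UK_K [s j * _]mulrC subrr.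
- by move=> i j; rewrite free_eval_comm1 !sM UK_K' [s j * _]mulrC subrr.
- by move=> i j; rewrite free_eval_comm1 !sM UK'_K' [s j * _]mulrC subrr.
- move=> i j; rewrite free_eval_bracket -scalerAl -scalerAr -!scalerBr UE_F.
  rewrite !scalerA; case: eqP => [->|_]; last by rewrite !(mul0r, mulr0) !scale0r subrr.
  by rewrite [s j * _]mulrC subrr.
- move=> i j; rewrite free_eval_comm !sM UK_E !scalerA -scalerBl.
  by rewrite [X in X *: _](_ : _ = 0) ?scale0r //=; ring.
- move=> i j; rewrite free_eval_comm -scalerAl -scalerAr UK_F !scalerA -scalerBl.
  by rewrite [X in X *: _](_ : _ = 0) ?scale0r //=; ring.
- move=> i j; rewrite free_eval_comm !sM UK'_E !scalerA -scalerBl.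
  by rewrite [X in X *: _](_ : _ = 0) ?scale0r //=; ring.
- move=> i j; rewrite free_eval_comm -scalerAl -scalerAr UK'_F !scalerA -scalerBl.
  by rewrite [X in X *: _](_ : _ = 0) ?scale0r //=; ring.
Qed.
Definition rescale : U_alg D q -> U_alg D q := lift rescale_kills.
End Rescale.
End Maps.

(* The preimage of [y] under [f], meaningful when [f] is injective and [y] is
   in its image. *)
Definition fun_inv (A : zmodType) (B : Type) (f : A -> B) (y : B) : A :=
  xget 0 [set x | f x = y].

Section Weights.
Variables (I : finType) (D : satake I) (F : fieldType) (q : F).

Definition has_weight (A : algType F) (X : I -> A) (mu : lattice I) (x : A) :=
  exists s : seq (F * seq I),
    all (fun p => \sum_(j <- p.2) alpha j == mu) s /\
    x = \sum_(p <- s) p.1 *: \prod_(j <- p.2) X j.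

Definition homogeneous (x : f_alg D q) :=
  exists mu, has_weight (theta D q) mu x.

(* Well defined on nonzero homogeneous elements, as $\mathbf f$ is graded. *)
Definition wt (x : f_alg D q) : lattice I :=
  xget 0 [set mu | has_weight (theta D q) mu x].
End Weights.

Section QuantumGroup.
Variables (I : finType) (D : satake I) (F : fieldType) (q : F).
Local Notation c := (cartan D).
Local Notation d := (symz D).
Local Notation v_ := (vi D q).
Local Notation U := (U_alg D q).
Local Notation E := (UE D q).
Local Notation Fg := (UF D q).
Local Notation K := (UK D q).
Local Notation KV := (UKV D q).
Local Notation K' := (UK' D q).
Local Notation K'V := (UK'V D q).
Local Notation f := (f_alg D q).
Local Notation tau := (tau D).

Definition zpow (A : algType F) (x xV : A) (n : int) : A :=
  match n with Posz m => x ^+ m | Negz m => xV ^+ m.+1 end.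

Definition UK_mon (mu : lattice I) : U := \prod_i zpow (K i) (KV i) (mu i).
Definition UK'_mon (mu : lattice I) : U := \prod_i zpow (K' i) (K'V i) (mu i).

Definition divpow (X : I -> U) (i : I) (n : nat) : U :=
  (qfact (v_ i) n)^-1 *: X i ^+ n.

(* The factor $v_i^{-(r+\frac12 c_{ij})}$ is $q^{-d_i(2r+c_{ij})}$. *)
Definition lusztig_sum (X : I -> U) (i j : I) : U :=
  let n := `|c i j|%N in
  \sum_(r < n.+1)
    ((-1) ^+ r * q ^ (- ((d i)%:Z * ((2 * r)%N%:Z + c i j)))
               * (v_ i - (v_ i)^-1) ^ c i j) *:
      (divpow X i (n - r) * X j * divpow X i r).

(* The generator values determine the automorphisms $\widetilde T_i$. *)
Record is_lusztig (T : I -> {lrmorphism U -> U}) : Prop := {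
  lusztig_bij : forall i, bijective (T i);
  lusztig_K : forall i mu, T i (UK_mon mu) = UK_mon (refl D i mu);
  lusztig_K' : forall i mu, T i (UK'_mon mu) = UK'_mon (refl D i mu);
  lusztig_Ei : forall i, T i (E i) = v_ i *: (K'V i * Fg i);
  lusztig_Fi : forall i, T i (Fg i) = (v_ i)^-1 *: (E i * KV i);
  lusztig_Ej : forall i j, j != i -> T i (E j) = lusztig_sum E i j;
  lusztig_Fj : forall i j, j != i -> T i (Fg j) = lusztig_sum Fg i j
}.

Definition T_word (T : I -> {lrmorphism U -> U}) (w : seq I) (x : U) : U :=
  foldr (fun i => T i) x w.

Definition U_plus : {pred U} := subalg [set x | exists i, x = E i].

Section FSubspaces.
Variables (T : I -> {lrmorphism U -> U}) (i : I).

Definition T_r : U -> U := T_word T (r_word D i).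

(* $\mathbf f[i,\tau i]$ and ${}^\sigma\mathbf f[i,\tau i]$ *)
Definition f_bracket (x : f) := T_r (f_plus x) \in U_plus.
Definition f_sigma_bracket (x : f) := fun_inv T_r (f_plus x) \in U_plus.

(* $\widetilde T_{r_i}^{\pm1}(x)$ as elements of $\mathbf f\cong\mathbf U^+$ *)
Definition T_r_f (x : f) : f := fun_inv (@f_plus I D F q) (T_r (f_plus x)).
Definition T_r_inv_f (x : f) : f :=
  fun_inv (@f_plus I D F q) (fun_inv T_r (f_plus x)).
End FSubspaces.

Definition f_pair (i : I) :=
  subalg_of [set x | x = theta D q i \/ x = theta D q (tau i)].
Definition f_pair_val (i : I) (u : f_pair i) : f := val u.

(* $\tau\tau_i$ acting on $\mathbf f_{i,\tau i}$ *)
Definition is_tau_tau_loc (i : I) (s : {lrmorphism f_pair i -> f_pair i}) :=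
  forall j u, j = i \/ j = tau i ->
    f_pair_val u = theta D q j ->
    f_pair_val (s u) = theta D q (tau (tau_loc D i j)).

Definition UB (i : I) : U := Fg i + E (tau i) * K' i.
Definition Uk (i : I) : U := K i * K' (tau i).
Definition UkV (i : I) : U := K'V (tau i) * KV i.

Definition iU_alg :=
  subalg_of [set x | exists i, [\/ x = UB i, x = Uk i | x = UkV i]].
Definition iU_val (y : iU_alg) : U := val y.

(* The completion of $\widetilde{\mathbf U}$ is taken with respect to the left
   ideals generated by the products of $N$ of the $E_j$. *)
Definition deep_ideal (N : nat) (x : U) :=
  exists s : seq (U * N.-tuple I),
    x = \sum_(p <- s) p.1 * \prod_(j <- p.2) E j.

Definition partial_sum (Ups : lattice I -> U) (M : nat) : U :=
  \sum_(mu : {ffun I -> 'I_M} | (\sum_j mu j < M)%N)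
    Ups [ffun j => (mu j : nat)%:Z].

(* $a\Upsilon=\Upsilon b$ in the completion, where $\Upsilon=\sum_\mu\Upsilon^\mu$. *)
Definition intertwines (Ups : lattice I -> U) (a b : U) :=
  forall N, exists M0, forall M, (M0 <= M)%N ->
    deep_ideal N (a * partial_sum Ups M - partial_sum Ups M * b).

Record is_quasi_K (i : I) (Ups : lattice I -> U) : Prop := {
  quasi_K_0 : Ups 0 = 1;
  quasi_K_supp : forall mu, Ups mu != 0 ->
    exists m n : nat, mu = alpha i *+ m + alpha (tau i) *+ n;
  quasi_K_wt : forall mu, has_weight E mu (Ups mu);
  quasi_K_sub : forall mu,
    Ups mu \in subalg [set x | x = E i \/ x = E (tau i)];
  quasi_K_B : forall j, j = i \/ j = tau i ->
    intertwines Ups (UB j) (Fg j + K j * E (tau j));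
  quasi_K_k : forall j, j = i \/ j = tau i -> intertwines Ups (Uk j) (Uk j)
}.
End QuantumGroup.

Section Hopf.
Variables (I : finType) (D : satake I) (F : fieldType) (q : F).
Local Notation B := (B_alg D q).
Local Notation theta := (Btheta D q).
Local Notation h := (Bh D q).
Local Notation root_form := (root_form D).
Local Notation tau := (tau D).

Definition is_bilinear (V : lmodType F) (beta : B -> B -> V) :=
  (forall c a b x, beta (c *: a + b) x = c *: beta a x + beta b x) /\
  (forall c a b x, beta x (c *: a + b) = c *: beta x a + beta x b).

(* A list of pairs stands for $\sum a\otimes b\in\widetilde{\mathbf B}\otimes
   \widetilde{\mathbf B}$; equality of tensors is tested by bilinear maps. *)
Definition tensor_eq (s t : seq (B * B)) :=
  forall (V : lmodType F) (beta : B -> B -> V), is_bilinear beta ->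
    \sum_(p <- s) beta p.1 p.2 = \sum_(p <- t) beta p.1 p.2.

(* Coassociativity and the counit axiom follow from the values on generators. *)
Record is_coproduct (Delta : B -> seq (B * B)) : Prop := {
  coproduct_lin : forall c a b, tensor_eq (Delta (c *: a + b))
    ([seq (c *: p.1, p.2) | p <- Delta a] ++ Delta b);
  coproduct_1 : tensor_eq (Delta 1) [:: (1, 1)];
  coproduct_M : forall a b, tensor_eq (Delta (a * b))
    [seq (p.1 * r.1, p.2 * r.2) | p <- Delta a, r <- Delta b];
  coproduct_theta : forall i,
    tensor_eq (Delta (theta i)) [:: (theta i, 1); (h i, theta i)];
  coproduct_h : forall i, tensor_eq (Delta (h i)) [:: (h i, h i)]
}.

Record is_hopf_pairing (Delta : B -> seq (B * B)) (phi : B -> B -> F) : Prop := {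
  pairing_bilin : is_bilinear (V := F^o) phi;
  pairing_sym : forall a b, phi a b = phi b a;
  pairing_1l : forall a, phi 1 a = counit a;
  pairing_Ml : forall a b x,
    phi (a * b) x = \sum_(p <- Delta x) phi a p.1 * phi b p.2;
  pairing_Mr : forall x a b,
    phi x (a * b) = \sum_(p <- Delta x) phi p.1 a * phi p.2 b;
  pairing_theta : forall i j,
    phi (theta i) (theta j) = (i == j)%:R * (vi D q i - (vi D q i)^-1);
  pairing_h : forall i j, phi (h i) (h j) = vi D q i ^ cartan D i j;
  pairing_theta_h : forall i j, phi (theta i) (h j) = 0
}.

Section iHopf.
Variables (Delta : B -> seq (B * B)) (phi : B -> B -> F).

Definition istar (a b : B) : B :=
  \sum_(p <- Delta a) \sum_(r <- Delta b)
    phi (tauB r.2) p.1 *: (p.2 * r.1).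

Record is_iHopf_iso (Xi : {linear B -> iU_alg D q}) : Prop := {
  iHopf_iso_bij : bijective Xi;
  iHopf_iso_1 : Xi 1 = 1;
  iHopf_iso_M : forall a b, Xi (istar a b) = Xi a * Xi b;
  iHopf_iso_theta : forall i, iU_val (Xi (theta i)) = UB D q i;
  iHopf_iso_h : forall i, iU_val (Xi (h i)) = Uk D q (tau i)
}.

Definition Bh_mon (mu : lattice I) : B :=
  \prod_i zpow (h i) (BhV D q i) (mu i).

(* $h_\alpha\diamond\iota(x)$ and $\mathbb K_\alpha\diamond\iota(x)$ for homogeneous
   $x\in\mathbf f$, where $\mathbb K_\alpha=v^{\frac12(\alpha,\tau\alpha)}h_{\tau\alpha}$;
   note that $\mathbb K_\alpha^{-1}=\mathbb K_{-\alpha}$ for the product [istar]. *)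
Definition h_diamond (a : lattice I) (x : f_alg D q) : B :=
  q ^ root_form (lat_map tau a - a) (wt x) *: istar (Bh_mon a) (f_iota x).

Definition K_diamond (a : lattice I) (x : f_alg D q) : B :=
  q ^ root_form a (lat_map tau a) *: h_diamond (lat_map tau a) x.
End iHopf.

(* The map [g] of $\widetilde{\mathbf U}^\imath$ seen on
   $\widetilde{\mathbf B}^\imath_\tau$ *)
Definition transport (Xi : B -> iU_alg D q) (g : iU_alg D q -> iU_alg D q)
  (b : B) : B := fun_inv Xi (g (Xi b)).
End Hopf.

(* $\mathbb Q(v^{1/2})$ and its generator $v^{1/2}$ *)
Definition Qv : fieldType := {fraction {poly rat}}.
Definition vhalf : Qv := tofrac 'X.

Section RelativeBraid.
Variables (I : finType) (D : satake I).
Variables (L : closedFieldType) (emb : {rmorphism Qv -> L}).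
Variables (sqrt : L -> L) (sqrtP : forall z, sqrt z ^+ 2 = z).

(* $a_j^{1/2}$ with $a_j=v^{-\frac12(\alpha_j,\alpha_{\tau j})}$. Since [sqrt] is a
   function, $a_{\tau j}^{1/2}=a_j^{1/2}$. *)
Definition a_root (j : I) : L :=
  sqrt (emb vhalf ^ (- root_form D (alpha j) (alpha (tau D j)))).

Lemma a_root_neq0 j : a_root j != 0.
Proof.
have : a_root j ^+ 2 != 0.
  by rewrite sqrtP expfz_neq0 // fmorph_eq0 /vhalf tofrac_eq0 polyX_eq0.
by rewrite expf_eq0.
Qed.

Local Notation UL := (U_alg D (emb vhalf)).

Definition Psi : UL -> UL := rescale a_root_neq0.

(* $\widetilde{\mathscr T}_w=\widetilde\Psi^{-1}\widetilde T_w\widetilde\Psi$ *)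
Definition scrT (T : I -> {lrmorphism UL -> UL}) (w : seq I) (x : UL) : UL :=
  fun_inv Psi (T_word T w (Psi x)).

Record is_relative_braid (T : I -> {lrmorphism UL -> UL}) (i : I)
  (Ups : lattice I -> U_alg D vhalf)
  (bT : {lrmorphism iU_alg D vhalf -> iU_alg D vhalf}) : Prop := {
  relative_braid_bij : bijective bT;
  relative_braidP : forall y : iU_alg D vhalf,
    intertwines (base_change emb \o Ups)
      (base_change emb (iU_val (fun_inv bT y)))
      (fun_inv (scrT T (r_word D i)) (base_change emb (iU_val y)))
}.
End RelativeBraid.

(* Main.v *)
(* Put J = {i, tau i}. The algebra U acts on B: U^+ through skew derivations, F_k by left
   multiplication. The quasi K-matrix then acts by a locally finite sum, and an element b
   of B is recovered from the action of its image Xi b on 1. Hence bT^-1 is determined by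
   its intertwining relation on B, after descending from L to Q(v^(1/2))
   along a linear retraction. On generators this gives bT^-1 (h_mu) = h_(r mu) and, for
   k in J, bT^-1 (theta_k) = v_k^-1 theta_(tau tau_i k) h_(- tau_i k). For l outside J,
   theta_l is sent to the iterated q-commutator g_l = T_r^-1 (E_l), since
   Xi g_l = X + c (tau g_l)^+ K' with X Upsilon = Upsilon g_l^-.

   Every element of f is a sum of products a u with u in f_(i, tau i) and a obtained from
   the theta_l (l outside J) by products and q-commutators with the theta_k (k in J); such
   an a comes with a' = T_r^-1 (a) in f. The elements a span the sigma-bracket subalgebra,
   because T_r^-1 (u) lies in the left ideal of the F_k as soon as u has positive degree.
   The formula for bT^-1 (a u) follows by induction on the degree, comparing products of f
   with products of the iHopf algebra: the corrections are skew derivatives, and those on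
   both sides match by phi (tau g_l, g_(tau l)) = v_l - v_l^-1 and the coproduct of g_l.
   Part (iii) is part (ii) applied to T_r (x) and tau tau_i (u). *)
From HB Require Import structures.
Require Import Defs.
From mathcomp Require Import all_boot all_order all_algebra all_field.
From mathcomp Require Import boolp classical_sets.
From mathcomp Require Import finmap.
From mathcomp.multinomials Require Import monalg.
From mathcomp Require Import ring zify lra.
Set Implicit Arguments.
Unset Strict Implicit.
Unset Printing Implicit Defensive.
Import GRing.Theory.
Local Open Scope ring_scope.

(** The transported automorphism is multiplicative for [istar], whereas the formulas concern
    products in f. The difference of the two products is a skew derivative, and a skew derivative of
    an element a of the bracket subalgebra leaves that subalgebra: it is a sum of terms a1 u1 times
    a Cartan factor. So the formula for a alone depends on the formula for products a1 u1 of smaller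
    degree, and conversely; both are proved in one induction on the total degree ([transported]). On
    the image side the same difference appears as a sum over the coproduct of g_l. To compare the
    two without a common formula, [cor] carries each derivative together with its expected image,
    written as an expression in an arbitrary bilinear map, and both sides are shown to obey the same
    recursion. Its only inhomogeneous term is the pairing of tau g_l with g_(tau l); this number is
    read off from the quasi K-matrix by comparing two elements that it intertwines. The relation
    [adapted] keeps a and its preimage together for the same reason: the two rules by which such
    pairs grow are all that the induction sees. *)

Section Linear.
Variable F : fieldType.

(** * Linear maps as plain functions *)

Definition lin (V W : lmodType F) (f : V -> W) :=
  forall c x y, f (c *: x + y) = c *: f x + f y.

Section Basics.
Variables (V W : lmodType F) (f : V -> W).
Hypothesis fL : lin f.
Lemma linD x y : f (x + y) = f x + f y.
Proof. by rewrite -{1}[x]scale1r fL scale1r. Qed.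
Lemma lin0 : f 0 = 0.
Proof. by apply: (addrI (f 0)); rewrite -linD !addr0. Qed.
Lemma linZ c x : f (c *: x) = c *: f x.
Proof. by rewrite -[c *: x]addr0 fL lin0 addr0. Qed.
Lemma linN x : f (- x) = - f x.
Proof. by rewrite -scaleN1r linZ scaleN1r. Qed.
Lemma linB x y : f (x - y) = f x - f y.
Proof. by rewrite linD linN. Qed.
Lemma lin_sum (I : Type) (s : seq I) (g : I -> V) :
  f (\sum_(i <- s) g i) = \sum_(i <- s) f (g i).
Proof. by apply: (big_morph f linD lin0). Qed.
End Basics.


Lemma lin_id (V : lmodType F) : lin (fun x : V => x). Proof. by []. Qed.
Lemma lin_cst0 (V W : lmodType F) : lin (fun _ : V => 0 : W).
Proof. by move=> c x y; rewrite scaler0 addr0. Qed.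
Lemma lin_comp (V W Z : lmodType F) (g : W -> Z) (f : V -> W) :
  lin g -> lin f -> lin (fun x => g (f x)).
Proof. by move=> gL fL c x y; rewrite fL gL. Qed.
Lemma lin_add (V W : lmodType F) (f g : V -> W) :
  lin f -> lin g -> lin (fun x => f x + g x).
Proof. by move=> fL gL c x y; rewrite fL gL scalerDr addrACA. Qed.
Lemma lin_opp (V W : lmodType F) (f : V -> W) : lin f -> lin (fun x => - f x).
Proof. by move=> fL c x y; rewrite fL opprD scalerN. Qed.
Lemma lin_scale (V W : lmodType F) a (f : V -> W) :
  lin f -> lin (fun x => a *: f x).
Proof. by move=> fL c x y; rewrite fL scalerDr !scalerA mulrC. Qed.
Lemma lin_scalel (V W : lmodType F) (f : V -> F^o) (w : W) :
  lin f -> lin (fun x => (f x : F) *: w).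
Proof. by move=> fL c x y; rewrite fL scalerDl scalerA. Qed.
Lemma lin_mull (V : lmodType F) (A : algType F) (f : V -> A) a :
  lin f -> lin (fun x => a * f x).
Proof. by move=> fL c x y; rewrite fL mulrDr scalerAr. Qed.
Lemma lin_mulr (V : lmodType F) (A : algType F) (f : V -> A) a :
  lin f -> lin (fun x => f x * a).
Proof. by move=> fL c x y; rewrite fL mulrDl scalerAl. Qed.
Lemma lin_bigsum (V W : lmodType F) (I : Type) (s : seq I) (f : I -> V -> W) :
  (forall i, lin (f i)) -> lin (fun x => \sum_(i <- s) f i x).
Proof.
move=> fL c x y; rewrite scaler_sumr -big_split.
by apply: eq_bigr => i _; rewrite fL.
Qed.
End Linear.

(** * Endomorphism algebras as targets of representations *)

Section Endomorphisms.
Variables (F : fieldType) (V : lmodType F).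

Definition nontrivial := exists v : V, v != 0.

(** The witness [nt] that the module is nonzero is a parameter of the type, because an [algType]
    must satisfy 1 != 0 and the instance has to find the proof in the type itself. *)
Record endo (nt : nontrivial) := Endo { efun :> V -> V; endoP : lin efun }.
Variable nt : nontrivial.
Local Notation E := (endo nt).

Lemma endo_eq (f g : E) : f =1 g -> f = g.
Proof.
case: f g => f fL [g gL] /= fg; have {fg} fg : f = g by apply: funext.
by case: _ / fg gL => gL; congr Endo; apply: Prop_irrelevance.
Qed.

HB.instance Definition _ := gen_eqMixin E.
HB.instance Definition _ := gen_choiceMixin E.

Definition endo0 : E := Endo nt (@lin_cst0 F V V).
Definition endo1 : E := Endo nt (@lin_id F V).
Definition endoD (f g : E) : E := Endo nt (lin_add (endoP f) (endoP g)).
Definition endoN (f : E) : E := Endo nt (lin_opp (endoP f)).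
Definition endoM (f g : E) : E := Endo nt (lin_comp (endoP f) (endoP g)).
Definition endoZ c (f : E) : E := Endo nt (lin_scale c (endoP f)).

Fact endoDA : associative endoD.
Proof. by move=> f g h; apply: endo_eq => x /=; rewrite addrA. Qed.
Fact endoDC : commutative endoD.
Proof. by move=> f g; apply: endo_eq => x /=; rewrite addrC. Qed.
Fact endo0D : left_id endo0 endoD.
Proof. by move=> f; apply: endo_eq => x /=; rewrite add0r. Qed.
Fact endoND : left_inverse endo0 endoN endoD.
Proof. by move=> f; apply: endo_eq => x /=; rewrite addNr. Qed.
HB.instance Definition _ := GRing.isZmodule.Build E endoDA endoDC endo0D endoND.

Fact endoMA : associative endoM.
Proof. by move=> f g h; apply: endo_eq. Qed.
Fact endo1M : left_id endo1 endoM. Proof. by move=> f; apply: endo_eq. Qed.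
Fact endoM1 : right_id endo1 endoM. Proof. by move=> f; apply: endo_eq. Qed.
Fact endoMDl : left_distributive endoM +%R.
Proof. by move=> f g h; apply: endo_eq. Qed.
Fact endoMDr : right_distributive endoM +%R.
Proof. by move=> f g h; apply: endo_eq => x /=; rewrite (linD (endoP f)). Qed.
Fact endo1_neq0 : endo1 != 0.
Proof. by case: nt => v /eqP v0; apply/eqP => /(congr1 (@efun _ ^~ v)). Qed.
HB.instance Definition _ := GRing.Zmodule_isNzRing.Build E
  endoMA endo1M endoM1 endoMDl endoMDr endo1_neq0.

Fact endoZA a b (f : E) : endoZ a (endoZ b f) = endoZ (a * b) f.
Proof. by apply: endo_eq => x /=; rewrite scalerA. Qed.
Fact endo1Z : left_id 1 endoZ.
Proof. by move=> f; apply: endo_eq => x /=; rewrite scale1r. Qed.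
Fact endoZDr : right_distributive endoZ +%R.
Proof. by move=> a f g; apply: endo_eq => x /=; rewrite scalerDr. Qed.
Fact endoZDl (f : E) : {morph endoZ^~ f : a b / a + b}.
Proof. by move=> a b; apply: endo_eq => x /=; rewrite scalerDl. Qed.
HB.instance Definition _ :=
  GRing.Zmodule_isLmodule.Build F E endoZA endo1Z endoZDr endoZDl.
Fact endoZAl a (f g : E) : a *: (f * g) = (a *: f) * g.
Proof. by apply: endo_eq. Qed.
HB.instance Definition _ := GRing.Lmodule_isLalgebra.Build F E endoZAl.
Fact endoZAr a (f g : E) : a *: (f * g) = f * (a *: g).
Proof. by apply: endo_eq => x /=; rewrite (linZ (endoP f)). Qed.
HB.instance Definition _ := GRing.Lalgebra_isAlgebra.Build F E endoZAr.

Lemma endoME (f g : E) x : (f * g) x = f (g x). Proof. by []. Qed.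
Lemma endo1E x : (1 : E) x = x. Proof. by []. Qed.
Lemma endo0E x : (0 : E) x = 0. Proof. by []. Qed.
Lemma endoDE (f g : E) x : (f + g) x = f x + g x. Proof. by []. Qed.
Lemma endoNE (f : E) x : (- f) x = - f x. Proof. by []. Qed.
Lemma endoZE c (f : E) x : (c *: f) x = c *: f x. Proof. by []. Qed.
Definition endoE := (endoME, endo1E, endo0E, endoDE, endoNE, endoZE).
End Endomorphisms.

Lemma algType_nontrivial (F : fieldType) (A : algType F) : nontrivial A.
Proof. by exists 1; apply: oner_neq0. Qed.

(** * Words and induction in presented algebras *)

Section FreeInduction.
Variables (F : fieldType) (G : choiceType).

Lemma free_mulUU (k1 k2 : {fmonom G}) :
  (<< k1 >> : free_alg F G) * << k2 >> = << mmul k1 k2 >>.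
Proof.
change (fgmul (<< k1 >> : {malg F[{fmonom G}]}) << k2 >> = << mmul k1 k2 >>).
by rewrite fgmulUU mulr1.
Qed.

Lemma free_word (s : seq G) :
  (<< FMonom s >> : free_alg F G) = \prod_(a <- s) free_gen F a.
Proof.
elim: s => [|a s IHs].
  rewrite big_nil; have -> : FMonom [::] = (mone : {fmonom G}).
    by apply: val_inj; rewrite /= fm1.
  by apply/malgP => m; rewrite mcoeffU1 eq_sym.
rewrite big_cons -IHs free_mulUU; congr << _ >>.
by apply/eqP; rewrite fmP fmM fmU.
Qed.

Lemma free_span (x : free_alg F G) :
  exists s : seq (F * seq G),
    x = \sum_(p <- s) p.1 *: \prod_(a <- p.2) free_gen F a.
Proof.
exists [seq (x@_k, fmonom_val k) | k <- msupp x].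
rewrite big_map {1}[x]monalgE; apply: eq_bigr => k _ /=.
rewrite -free_word fmK; apply/malgP => m.
rewrite mcoeffZ; rewrite -> !mcoeffU; by rewrite mulr_natr.
Qed.

Lemma free_ind (P : free_alg F G -> Prop) :
  P 1 -> (forall c x y, P x -> P y -> P (c *: x + y)) ->
  (forall a x, P x -> P (free_gen F a * x)) -> forall x, P x.
Proof.
move=> P1 PL PM x; have [s ->] := free_span x; elim: s => [|[c w] s IHs].
  rewrite big_nil -(addNr 1) -scaleN1r; exact: PL.
rewrite big_cons; apply: PL => //=; elim: w => [|a w IHw].
  by rewrite big_nil.
by rewrite big_cons; apply: PM.
Qed.
End FreeInduction.

Section AlgHom.
Variable F : fieldType.
(* Plain functions are used for algebra morphisms, since most of those below
   are composites and inverses of locked lifts. *)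
Record ahom (A B : algType F) (f : A -> B) : Prop := {
  ahomL : lin f; ahom1 : f 1 = 1; ahomM : forall x y, f (x * y) = f x * f y }.

Variables (A B C : algType F).
Lemma ahomD (f : A -> B) : ahom f -> forall x y, f (x + y) = f x + f y.
Proof. by move=> [fL _ _]; apply: linD. Qed.
Lemma ahomB (f : A -> B) : ahom f -> forall x y, f (x - y) = f x - f y.
Proof. by move=> [fL _ _]; apply: linB. Qed.
Lemma ahomZ (f : A -> B) : ahom f -> forall c x, f (c *: x) = c *: f x.
Proof. by move=> [fL _ _]; apply: linZ. Qed.
Lemma ahom0 (f : A -> B) : ahom f -> f 0 = 0.
Proof. by move=> [fL _ _]; apply: lin0. Qed.
Lemma ahom_sum (f : A -> B) : ahom f -> forall (T : Type) (s : seq T) (g : T -> A),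
  f (\sum_(i <- s) g i) = \sum_(i <- s) f (g i).
Proof. by move=> [fL _ _] T s g; apply: lin_sum. Qed.
Lemma ahomX (f : A -> B) : ahom f -> forall x n, f (x ^+ n) = f x ^+ n.
Proof.
move=> fH x; elim=> [|n IHn]; first by rewrite !expr0 (ahom1 fH).
by rewrite !exprS (ahomM fH) IHn.
Qed.
Lemma ahom_prod (f : A -> B) : ahom f -> forall (T : Type) (s : seq T) (g : T -> A),
  f (\prod_(i <- s) g i) = \prod_(i <- s) f (g i).
Proof. by move=> fH T s g; apply: (big_morph f (ahomM fH) (ahom1 fH)). Qed.
Lemma ahom_comp (f : A -> B) (g : B -> C) : ahom f -> ahom g -> ahom (g \o f).
Proof.
move=> fH gH; split=> [||x y] /=.
- by apply: lin_comp; [apply: ahomL gH|apply: ahomL fH].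
- by rewrite (ahom1 fH) (ahom1 gH).
- by rewrite (ahomM fH) (ahomM gH).
Qed.
Lemma ahom_id : ahom (@id A). Proof. by split. Qed.
Lemma ahom_lr (f : {lrmorphism A -> B}) : ahom f.
Proof. by split=> [c x y||x y]; rewrite ?linearP ?rmorph1 ?rmorphM. Qed.
End AlgHom.

Section PresentationTheory.
Variables (F : fieldType) (G : choiceType) (R : relators (free_alg F G)).

Lemma quot_pi_ahom : ahom (quot_pi R).
Proof.
split=> [c x y||x y]; last exact: rmorphM; last exact: rmorph1.
by rewrite -quot_piZ; apply: raddfD.
Qed.

Lemma pres_span (x : quot_alg R) :
  exists s : seq (F * seq G),
    x = \sum_(p <- s) p.1 *: \prod_(a <- p.2) pres_gen R a.
Proof.
rewrite -(quot_reprK x); have [s ->] := free_span (repr x); exists s.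
rewrite (ahom_sum quot_pi_ahom); apply: eq_bigr => p _.
by rewrite (ahomZ quot_pi_ahom) (ahom_prod quot_pi_ahom).
Qed.

Lemma pres_ind (P : quot_alg R -> Prop) :
  P 1 -> (forall c x y, P x -> P y -> P (c *: x + y)) ->
  (forall a x, P x -> P (pres_gen R a * x)) -> forall x, P x.
Proof.
move=> P1 PL PM x; have [s ->] := pres_span x; elim: s => [|[c w] s IHs].
  rewrite big_nil -(addNr 1) -scaleN1r; exact: PL.
rewrite big_cons; apply: PL => //=; elim: w => [|a w IHw].
  by rewrite big_nil.
by rewrite big_cons; apply: PM.
Qed.

Lemma pres_indr (P : quot_alg R -> Prop) :
  P 1 -> (forall c x y, P x -> P y -> P (c *: x + y)) ->
  (forall a x, P x -> P (x * pres_gen R a)) -> forall x, P x.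
Proof.
move=> P1 PL PM x; have [s ->] := pres_span x; elim: s => [|[c w] s IHs].
  rewrite big_nil -(addNr 1) -scaleN1r; exact: PL.
rewrite big_cons; apply: PL => //=; elim/last_ind: w => [|w a IHw].
  by rewrite big_nil.
by rewrite -cats1 big_cat big_seq1; apply: PM.
Qed.

Variables (F' : fieldType) (phi : {rmorphism F -> F'}) (A : algType F').

Record semi_hom (f : quot_alg R -> A) : Prop := {
  semi_lin : forall c x y, f (c *: x + y) = phi c *: f x + f y;
  semi_1 : f 1 = 1;
  semi_M : forall x y, f (x * y) = f x * f y
}.

Lemma semi_hom_eq f g : semi_hom f -> semi_hom g ->
  (forall a, f (pres_gen R a) = g (pres_gen R a)) -> f =1 g.
Proof.
move=> fH gH fg; elim/pres_ind => [|c x y fx fy|a x fx].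
- by rewrite (semi_1 fH) (semi_1 gH).
- by rewrite (semi_lin fH) (semi_lin gH) fx fy.
- by rewrite (semi_M fH) (semi_M gH) fx fg.
Qed.

Lemma lift_semi_hom (g : G -> A) (gK : kills R phi g) : semi_hom (Defs.lift gK).
Proof.
split=> [c x y||x y]; rewrite ?rmorph1 ?rmorphM //.
by rewrite rmorphD /= liftZ.
Qed.
End PresentationTheory.

Section PresAlgHom.
Variables (F : fieldType) (G : choiceType) (R : relators (free_alg F G)).
Variable A : algType F.
Lemma ahom_semi (f : quot_alg R -> A) : ahom f <-> semi_hom idfun f.
Proof. by split=> -[]. Qed.
Lemma lift_ahom (g : G -> A) (gK : kills R idfun g) : ahom (Defs.lift gK).
Proof. exact/ahom_semi/lift_semi_hom. Qed.
Lemma ahom_eq (f g : quot_alg R -> A) : ahom f -> ahom g ->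
  (forall a, f (pres_gen R a) = g (pres_gen R a)) -> f =1 g.
Proof. by move=> /ahom_semi fH /ahom_semi gH; apply: semi_hom_eq fH gH. Qed.
End PresAlgHom.

(** * q-commutation and Serre relations under twists *)

Section QCommutation.
Variables (F : fieldType) (A : algType F).

Lemma scalar_mul (a b : F) (x y : A) : (a *: x) * (b *: y) = (a * b) *: (x * y).
Proof. by rewrite -scalerAl -scalerAr scalerA. Qed.

Lemma qcommXl c (x y : A) n : x * y = c *: (y * x) ->
  x ^+ n * y = c ^+ n *: (y * x ^+ n).
Proof.
move=> xy; elim: n => [|n IHn]; first by rewrite !expr0 mul1r mulr1 scale1r.
by rewrite {1}exprS -mulrA IHn -scalerAr [x * _]mulrA xy -scalerAl scalerA -mulrA -exprS -exprSr.
Qed.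

Lemma qcommXr c (x y : A) n : x * y = c *: (y * x) ->
  x * y ^+ n = c ^+ n *: (y ^+ n * x).
Proof.
move=> xy; elim: n => [|n IHn]; first by rewrite !expr0 mul1r mulr1 scale1r.
by rewrite {1}exprS mulrA xy -scalerAl -mulrA IHn -scalerAr scalerA mulrA -!exprS.
Qed.

Lemma qcommXX c (x y : A) m n : x * y = c *: (y * x) ->
  x ^+ m * y ^+ n = c ^+ (m * n) *: (y ^+ n * x ^+ m).
Proof. by move=> /(qcommXl m) /(qcommXr n) ->; rewrite exprM. Qed.

Lemma qcomm_inv c (x xV y : A) : c != 0 -> x * xV = 1 -> xV * x = 1 ->
  x * y = c *: (y * x) -> xV * y = c^-1 *: (y * xV).
Proof.
move=> c0 xxV xVx xy.
rewrite -[y in LHS]mulr1 -xxV !mulrA -(mulrA xV) -[in LHS](scalerK c0 (y * x)) -xy.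
by rewrite -scalerAr -scalerAl !mulrA xVx mul1r.
Qed.
End QCommutation.

Section TwistedSerre.
Variables (I : finType) (D : satake I) (F : fieldType) (q : F) (A : algType F).
Variables (X S : I -> A) (c : I -> I -> F).
Hypotheses (SX : forall i j, S i * X j = c i j *: (X j * S i))
           (SS : forall i j, S i * S j = S j * S i)
           (csym : forall i j, c i j = c j i).

Lemma twist_pow i r :
  (X i * S i) ^+ r = c i i ^+ 'C(r, 2) *: (X i ^+ r * S i ^+ r).
Proof.
elim: r => [|r IHr]; first by rewrite !expr0 mulr1 scale1r.
rewrite exprS IHr -scalerAr !mulrA -(mulrA (X i)) (qcommXr r (SX i i)).
rewrite -scalerAr -scalerAl scalerA -exprD binS bin1 mulrA -(exprS (X i)).
by rewrite -(mulrA (X i ^+ r.+1)) -(exprS (S i)).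
Qed.

Lemma bin2D m n : 'C(m + n, 2) = ('C(m, 2) + 'C(n, 2) + m * n)%N.
Proof.
elim: m => [|m IHm]; first by rewrite add0n bin0n mul0n addn0 add0n.
by rewrite addSn !binS !bin1 IHm; lia.
Qed.

Lemma serre_twist i j : let n := `|1 - cartan D i j|%N in
  serre D q (fun k => X k * S k) i j =
    (c i i ^+ 'C(n, 2) * c i j ^+ n) *: (serre D q X i j * (S i ^+ n * S j)).
Proof.
move=> n; rewrite /serre -/n big_distrl /= scaler_sumr; apply: eq_bigr => r _.
case: r => r /=; rewrite ltnS => rn; have nE := subnKC rn.
move: (n - r)%N nE => m <-; rewrite !twist_pow -!(scalerAl, scalerAr) !scalerA.
have -> : X i ^+ r * S i ^+ r * (X j * S j) * (X i ^+ m * S i ^+ m) =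
    (c i i ^+ (r * m) * c i j ^+ (r + m)) *:
       (X i ^+ r * X j * X i ^+ m * (S i ^+ (r + m) * S j)).
  have -> : S i ^+ (r + m) * S j = S i ^+ r * S j * S i ^+ m.
    rewrite exprD -!mulrA; congr (_ * _); rewrite -[RHS]scale1r.
    by rewrite (qcommXl m (c := 1)) ?expr1n // scale1r SS.
  rewrite !mulrA -(mulrA _ (S i ^+ r) (X j)) (qcommXl r (SX i j)).
  rewrite -!(scalerAr, scalerAl) -!mulrA (mulrA (S j)) (qcommXr m (SX j i)).
  rewrite -!(scalerAr, scalerAl) -!mulrA [S i ^+ r * (X i ^+ m * _)]mulrA.
  rewrite (qcommXX r m (SX i i)) -!(scalerAr, scalerAl) !scalerA.
  by congr (_ *: _); rewrite ?mulrA // (csym j i) exprD; ring.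
rewrite scalerA bin2D !exprD; congr (_ *: _); set z := qbin _ _ _.
ring.
Qed.
End TwistedSerre.

Section AlgHomSerre.
Variables (I : finType) (D : satake I) (F : fieldType) (q : F).
Lemma serre_ahom (A B : algType F) (f : A -> B) (X : I -> A) i j : ahom f ->
  f (serre D q X i j) = serre D q (f \o X) i j.
Proof.
move=> fH; rewrite /serre (ahom_sum fH); apply: eq_bigr => r _.
by rewrite (ahomZ fH) !(ahomM fH) !(ahomX fH).
Qed.

Lemma qbin_sub v n r : (r <= n)%N -> @qbin F v n (n - r) = qbin v n r.
Proof. by move=> rn; rewrite /qbin subKn // [X in _ / X]mulrC. Qed.

(** Reversing words exchanges r and n - r; the q-binomial is symmetric and the signs differ by
    (-1)^n. *)
Lemma serre_anti (A B : algType F) (f : A -> B) (X : I -> A) i j :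
  lin f -> f 1 = 1 -> (forall x y, f (x * y) = f y * f x) ->
  f (serre D q X i j) = (-1) ^+ `|1 - cartan D i j|%N *: serre D q (f \o X) i j.
Proof.
move=> fL f1 fM; have fX x m : f (x ^+ m) = f x ^+ m.
  by elim: m => [|m IHm]; rewrite ?expr0 // exprS exprSr fM IHm.
rewrite /serre; set n := `|_|%N; rewrite (lin_sum fL) scaler_sumr.
rewrite (reindex_inj rev_ord_inj) /=; apply: eq_bigr => r _.
have rn : (r <= n)%N by rewrite -ltnS.
rewrite (linZ fL) !fM !fX subSS subKn // qbin_sub // scalerA mulrA; congr (_ *: _).
rewrite mulrA; congr (_ * _); rewrite -[X in _ ^+ X * _](subnK rn) exprD -mulrA -exprD addnn.
by rewrite -(signr_odd _ r.*2) odd_double mulr1.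
Qed.

Section Brels.
Variable A : algType F.
(** The relations are collected in a record so that any family of operators satisfying them yields,
    through [B_lift], a representation of B. *)
Record B_rels (X H HV : I -> A) : Prop := {
  Br_serre : forall i j, i != j -> serre D q X i j = 0;
  Br_hhV : forall i, H i * HV i = 1;
  Br_hVh : forall i, HV i * H i = 1;
  Br_hh : forall i j, H i * H j = H j * H i;
  Br_hx : forall i j, H i * X j = vi D q i ^ cartan D i j *: (X j * H i)
}.
Variables (X H HV : I -> A).
Hypothesis br : B_rels X H HV.

Lemma B_rels_kills : kills (Relators (@B_proper I D F q)) idfun
  (fun g => match g with gTheta i => X i | gH i => H i | gHV i => HV i end).
Proof.
move=> _ [i j ij|i|i|i j|i j].
- rewrite (serre_morph D _ _ _ _ (free_evalZ idfun _)) -[RHS](Br_serre br ij).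
  by apply: serre_eq => k; rewrite /= free_eval_gen.
- by rewrite free_eval_inv (Br_hhV br) subrr.
- by rewrite free_eval_inv (Br_hVh br) subrr.
- by rewrite free_eval_comm1 (Br_hh br) subrr.
- by rewrite free_eval_comm (Br_hx br) subrr.
Qed.
Definition B_lift : B_alg D q -> A := Defs.lift B_rels_kills.
Lemma B_liftH : ahom B_lift. Proof. exact: lift_ahom. Qed.
Lemma B_lift_theta i : B_lift (Btheta D q i) = X i. Proof. exact: lift_gen. Qed.
Lemma B_lift_h i : B_lift (Bh D q i) = H i. Proof. exact: lift_gen. Qed.
Lemma B_lift_hV i : B_lift (BhV D q i) = HV i. Proof. exact: lift_gen. Qed.
End Brels.

Section Bbasics.
Local Notation B := (B_alg D q).
Local Notation th := (Btheta D q).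
Local Notation h := (Bh D q).
Local Notation hV := (BhV D q).
Lemma B_ind (P : B -> Prop) :
  P 1 -> (forall c x y, P x -> P y -> P (c *: x + y)) ->
  (forall i x, P x -> P (th i * x)) -> (forall i x, P x -> P (h i * x)) ->
  (forall i x, P x -> P (hV i * x)) -> forall x, P x.
Proof. by move=> P1 PL Pt Ph PhV; elim/pres_ind => // -[]. Qed.
Lemma Bh_V i : h i * hV i = 1. Proof. exact: (pres_inv (R := Relators (@B_proper I D F q)) (B_hhV D q i)). Qed.
Lemma BhV_h i : hV i * h i = 1. Proof. exact: (pres_inv (R := Relators (@B_proper I D F q)) (B_hVh D q i)). Qed.
Lemma Bh_h i j : h i * h j = h j * h i.
Proof. exact: (pres_comm1 (R := Relators (@B_proper I D F q)) (B_hh D q i j)). Qed.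
Lemma Bh_theta i j : h i * th j = vi D q i ^ cartan D i j *: (th j * h i).
Proof. exact: (pres_comm (R := Relators (@B_proper I D F q)) (B_hx D q i j)). Qed.
Lemma Btheta_serre i j : i != j -> serre D q th i j = 0.
Proof.
move=> ij; rewrite -(quot_rel (R := Relators (@B_proper I D F q)) (B_serre D q ij)).
by rewrite (serre_morph D (phi := idfun) _ _ _ _ (quot_piZ _)).
Qed.
Lemma B_ahom_eq (A : algType F) (f g : B -> A) : ahom f -> ahom g ->
  (forall i, f (th i) = g (th i)) -> (forall i, f (h i) = g (h i)) ->
  (forall i, f (hV i) = g (hV i)) -> f =1 g.
Proof. by move=> fH gH fgt fgh fgV; apply: ahom_eq => // -[]. Qed.
Lemma f_ind (P : f_alg D q -> Prop) :
  P 1 -> (forall c x y, P x -> P y -> P (c *: x + y)) ->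
  (forall i x, P x -> P (theta D q i * x)) -> forall x, P x.
Proof. exact: pres_ind. Qed.
Lemma f_iotaH : ahom (@f_iota I D F q). Proof. exact: lift_ahom. Qed.
Lemma f_iota_theta i : f_iota (theta D q i) = th i.
Proof. exact: (lift_gen (@f_iota_kills I D F q) i). Qed.
Lemma f_plusH : ahom (@f_plus I D F q). Proof. exact: lift_ahom. Qed.
Lemma f_plus_theta i : f_plus (theta D q i) = UE D q i.
Proof. exact: (lift_gen (@f_plus_kills I D F q) i). Qed.
Lemma tauBH : ahom (@tauB I D F q). Proof. exact: lift_ahom. Qed.
Lemma tauB_theta i : tauB (th i) = th (tau D i).
Proof. exact: (lift_gen (@tauB_kills I D F q) (gTheta i)). Qed.
Lemma tauB_h i : tauB (h i) = h (tau D i).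
Proof. exact: (lift_gen (@tauB_kills I D F q) (gH i)). Qed.
Lemma tauB_hV i : tauB (hV i) = hV (tau D i).
Proof. exact: (lift_gen (@tauB_kills I D F q) (gHV i)). Qed.
Lemma counitH : ahom (@counit I D F q : B -> F^o). Proof. exact: lift_ahom. Qed.
Lemma counit_theta i : counit (th i) = 0.
Proof. exact: (lift_gen (@counit_kills I D F q) (gTheta i)). Qed.
Lemma counit_h i : counit (h i) = 1.
Proof. exact: (lift_gen (@counit_kills I D F q) (gH i)). Qed.
Lemma counit_hV i : counit (hV i) = 1.
Proof. exact: (lift_gen (@counit_kills I D F q) (gHV i)). Qed.
End Bbasics.

Section Urels.
Variable A : algType F.
Local Notation v_ := (vi D q).
Local Notation c := (cartan D).
Record U_rels (E X K KV K' K'V : I -> A) : Prop := {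
  Ur_KKV : forall i, K i * KV i = 1;
  Ur_KVK : forall i, KV i * K i = 1;
  Ur_K'K'V : forall i, K' i * K'V i = 1;
  Ur_K'VK' : forall i, K'V i * K' i = 1;
  Ur_KK : forall i j, K i * K j = K j * K i;
  Ur_KK' : forall i j, K i * K' j = K' j * K i;
  Ur_K'K' : forall i j, K' i * K' j = K' j * K' i;
  Ur_EF : forall i j, E i * X j - X j * E i =
    ((i == j)%:R * ((v_ i)^-1 - v_ i)) *: (K i - K' i);
  Ur_KE : forall i j, K i * E j = v_ i ^ c i j *: (E j * K i);
  Ur_KF : forall i j, K i * X j = v_ i ^ (- c i j) *: (X j * K i);
  Ur_K'E : forall i j, K' i * E j = v_ i ^ (- c i j) *: (E j * K' i);
  Ur_K'F : forall i j, K' i * X j = v_ i ^ c i j *: (X j * K' i);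
  Ur_serreE : forall i j, i != j -> serre D q E i j = 0;
  Ur_serreF : forall i j, i != j -> serre D q X i j = 0
}.
Variables (E X K KV K' K'V : I -> A).
Hypothesis ur : U_rels E X K KV K' K'V.

Lemma U_rels_kills : kills (Relators (@U_proper I D F q)) idfun
  (fun g => match g with gE i => E i | gF i => X i | gK i => K i
            | gKV i => KV i | gK' i => K' i | gK'V i => K'V i end).
Proof.
move=> _ [].
- by move=> i; rewrite free_eval_inv (Ur_KKV ur) subrr.
- by move=> i; rewrite free_eval_inv (Ur_KVK ur) subrr.
- by move=> i; rewrite free_eval_inv (Ur_K'K'V ur) subrr.
- by move=> i; rewrite free_eval_inv (Ur_K'VK' ur) subrr.
- by move=> i j; rewrite free_eval_comm1 (Ur_KK ur) subrr.
- by move=> i j; rewrite free_eval_comm1 (Ur_KK' ur) subrr.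
- by move=> i j; rewrite free_eval_comm1 (Ur_K'K' ur) subrr.
- by move=> i j; rewrite free_eval_bracket (Ur_EF ur) subrr.
- by move=> i j; rewrite free_eval_comm (Ur_KE ur) subrr.
- by move=> i j; rewrite free_eval_comm (Ur_KF ur) subrr.
- by move=> i j; rewrite free_eval_comm (Ur_K'E ur) subrr.
- by move=> i j; rewrite free_eval_comm (Ur_K'F ur) subrr.
- move=> i j ij; rewrite (serre_morph D _ _ _ _ (free_evalZ idfun _)).
  rewrite -[RHS](Ur_serreE ur ij).
  by apply: serre_eq => k; rewrite /= free_eval_gen.
- move=> i j ij; rewrite (serre_morph D _ _ _ _ (free_evalZ idfun _)).
  rewrite -[RHS](Ur_serreF ur ij).
  by apply: serre_eq => k; rewrite /= free_eval_gen.
Qed.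
Definition U_lift : U_alg D q -> A := Defs.lift U_rels_kills.
Lemma U_liftH : ahom U_lift. Proof. exact: lift_ahom. Qed.
Lemma U_liftE i : U_lift (UE D q i) = E i. Proof. exact: lift_gen. Qed.
Lemma U_liftF i : U_lift (UF D q i) = X i. Proof. exact: lift_gen. Qed.
Lemma U_liftK i : U_lift (UK D q i) = K i. Proof. exact: lift_gen. Qed.
Lemma U_liftKV i : U_lift (UKV D q i) = KV i. Proof. exact: lift_gen. Qed.
Lemma U_liftK' i : U_lift (UK' D q i) = K' i. Proof. exact: lift_gen. Qed.
Lemma U_liftK'V i : U_lift (UK'V D q i) = K'V i. Proof. exact: lift_gen. Qed.
End Urels.



Lemma U_ahom_eq (A : algType F) (f g : U_alg D q -> A) : ahom f -> ahom g ->
  (forall i, f (UE D q i) = g (UE D q i)) ->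
  (forall i, f (UF D q i) = g (UF D q i)) ->
  (forall i, f (UK D q i) = g (UK D q i)) ->
  (forall i, f (UKV D q i) = g (UKV D q i)) ->
  (forall i, f (UK' D q i) = g (UK' D q i)) ->
  (forall i, f (UK'V D q i) = g (UK'V D q i)) -> f =1 g.
Proof.
move=> fH gH eE eF eK eKV eK' eK'V; apply: (ahom_eq fH gH); case=> i.
- exact: eE.
- exact: eF.
- exact: eK.
- exact: eKV.
- exact: eK'.
- exact: eK'V.
Qed.
End AlgHomSerre.

(** * Laurent monomials and the root lattice *)

Section Monomials.
Variables (F : fieldType) (A : algType F).

Section OneVariable.
Variables x xV : A.
Hypotheses (xxV : x * xV = 1) (xVx : xV * x = 1).
Lemma zpow_succ n : zpow x xV (n + 1) = x * zpow x xV n.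
Proof.
case: n => [n|[|n]].
- by rewrite -[_ + 1]/(Posz (n + 1)) addn1 /= exprS.
- by rewrite /= expr0 expr1 xxV.
- rewrite (_ : Negz n.+1 + 1 = Negz n) /=; last by lia.
  by rewrite [xV ^+ n.+2]exprS mulrA xxV mul1r.
Qed.
Lemma zpow_pred n : zpow x xV (n - 1) = xV * zpow x xV n.
Proof. by rewrite -{2}(subrK 1 n) zpow_succ mulrA xVx mul1r. Qed.
Lemma zpowD m n : zpow x xV (m + n) = zpow x xV m * zpow x xV n.
Proof.
elim/int_rect: m => [|m IHm|m IHm]; first by rewrite add0r mul1r.
  by rewrite -addn1 PoszD addrAC !zpow_succ IHm mulrA.
by rewrite -addn1 PoszD opprD addrAC !zpow_pred IHm mulrA.
Qed.
Lemma zpow_comm y : x * y = y * x -> forall n, zpow x xV n * y = y * zpow x xV n.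
Proof.
move=> xy; have xVy : xV * y = y * xV.
  by rewrite -[y in LHS]mulr1 -xxV !mulrA -(mulrA xV) -xy mulrA xVx mul1r.
elim/int_rect => [|m IHm|m IHm]; first by rewrite mul1r mulr1.
  by rewrite -addn1 PoszD zpow_succ -mulrA IHm !mulrA xy.
by rewrite -addn1 PoszD opprD zpow_pred -mulrA IHm !mulrA xVy.
Qed.
End OneVariable.

Variables (I : finType) (X XV : I -> A).
Hypotheses (XXV : forall i, X i * XV i = 1) (XVX : forall i, XV i * X i = 1)
  (XX : forall i j, X i * X j = X j * X i).

Definition mon (mu : lattice I) : A := \prod_i zpow (X i) (XV i) (mu i).

Lemma mon0 : mon 0 = 1.
Proof. by rewrite /mon big1 // => i _; rewrite ffunE. Qed.

Lemma monD mu nu : mon (mu + nu) = mon mu * mon nu.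
Proof.
rewrite /mon; elim: (index_enum I) => [|i s IHs]; first by rewrite !big_nil mulr1.
rewrite !big_cons IHs ffunE zpowD // -!mulrA; congr (_ * _).
rewrite !mulrA; congr (_ * _); elim: s {IHs} => [|j s IHs].
  by rewrite !big_nil mulr1 mul1r.
rewrite !big_cons !mulrA zpow_comm // -?mulrA ?IHs ?mulrA //.
by symmetry; apply: zpow_comm => //; apply: XX.
Qed.

Lemma mon_alpha i : mon (alpha i) = X i.
Proof.
rewrite /mon (big_only1 i) // => [|j ji _]; first by rewrite ffunE eqxx.
by rewrite ffunE eq_sym (negbTE ji).
Qed.

Lemma monNr mu : mon mu * mon (- mu) = 1.
Proof. by rewrite -monD subrr mon0. Qed.
Lemma mon_alphaN i : mon (- alpha i) = XV i.
Proof. by rewrite -[LHS]mul1r -(XVX i) -mulrA -{1}mon_alpha monNr mulr1. Qed.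
End Monomials.

Section Lattice.
Variables (I : finType) (D : satake I).
Local Notation rf := (root_form D).
Local Notation c := (cartan D).
Local Notation d := (symz D).
Local Notation tau := (tau D).
Implicit Types mu nu : lattice I.

Lemma rfDl mu mu' nu : rf (mu + mu') nu = rf mu nu + rf mu' nu.
Proof.
rewrite /root_form -big_split; apply: eq_bigr => k _; rewrite -big_split.
by apply: eq_bigr => l _; rewrite ffunE /=; ring.
Qed.
Lemma rfNl mu nu : rf (- mu) nu = - rf mu nu.
Proof.
rewrite /root_form -sumrN; apply: eq_bigr => k _; rewrite -sumrN.
by apply: eq_bigr => l _; rewrite ffunE /=; ring.
Qed.
Lemma rfC mu nu : rf mu nu = rf nu mu.
Proof.
rewrite /root_form exchange_big; apply: eq_bigr => k _; apply: eq_bigr => l _.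
by rewrite (symz_cartan D k l); ring.
Qed.
Lemma rfDr mu nu nu' : rf mu (nu + nu') = rf mu nu + rf mu nu'.
Proof. by rewrite !(rfC mu) rfDl. Qed.
Lemma rfNr mu nu : rf mu (- nu) = - rf mu nu.
Proof. by rewrite !(rfC mu) rfNl. Qed.
Lemma rfZl mu nu (z : int) : rf (mu *~ z) nu = z * rf mu nu.
Proof.
elim/int_rect: z => [|n IHn|n IHn]; rewrite ?mul0r ?mulr0z.
- by apply: (addrI (rf 0 nu)); rewrite -rfDl !addr0.
- by rewrite -addn1 PoszD mulrzDr rfDl IHn mulr1z mulrDl mul1r.
- by rewrite -addn1 PoszD opprD mulrzDr rfDl IHn mulrN1z rfNl mulrDl mulN1r.
Qed.
Lemma rfZr mu nu (z : int) : rf mu (nu *~ z) = z * rf mu nu.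
Proof. by rewrite !(rfC mu) rfZl. Qed.
Lemma rf0l mu : rf 0 mu = 0.
Proof. by rewrite -(mulr0z 0) rfZl mul0r. Qed.
Lemma rf0r mu : rf mu 0 = 0. Proof. by rewrite rfC rf0l. Qed.
Definition rfE := (rfDl, rfDr, rfNl, rfNr, rfZl, rfZr, rf0l, rf0r).

Definition pair i mu : int := \sum_j c i j * mu j.
Lemma rf_alphal i mu : rf (alpha i) mu = (d i)%:Z * pair i mu.
Proof.
rewrite /root_form (big_only1 i) // => [|k ki _].
  by rewrite mulr_sumr; apply: eq_bigr => l _; rewrite ffunE eqxx mul1r mulrC mulrA.
by rewrite big1 // => l _; rewrite ffunE eq_sym (negbTE ki) !mul0r.
Qed.
Lemma pair_alpha i j : pair i (alpha j) = c i j.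
Proof.
rewrite /pair (big_only1 j) // => [|k kj _]; rewrite ffunE ?eqxx ?mulr1 //.
by rewrite eq_sym (negbTE kj) mulr0.
Qed.
Lemma rf_alpha i j : rf (alpha i) (alpha j) = (d i)%:Z * c i j.
Proof. by rewrite rf_alphal pair_alpha. Qed.

Lemma reflE i mu : refl D i mu = mu - alpha i *~ pair i mu. Proof. by []. Qed.
Lemma pairD i mu nu : pair i (mu + nu) = pair i mu + pair i nu.
Proof. by rewrite /pair -big_split; apply: eq_bigr => k _; rewrite ffunE mulrDr. Qed.
Lemma pairN i mu : pair i (- mu) = - pair i mu.
Proof. by rewrite /pair -sumrN; apply: eq_bigr => k _; rewrite ffunE mulrN. Qed.
Lemma pair0 i : pair i 0 = 0.
Proof. by rewrite /pair big1 // => k _; rewrite ffunE mulr0. Qed.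
Lemma pairZ i mu (z : int) : pair i (mu *~ z) = z * pair i mu.
Proof.
elim/int_rect: z => [|n IHn|n IHn]; rewrite ?mul0r ?mulr0z ?pair0 //.
- by rewrite -addn1 PoszD mulrzDr pairD IHn mulr1z mulrDl mul1r.
- by rewrite -addn1 PoszD opprD mulrzDr pairD IHn mulrN1z pairN mulrDl mulN1r.
Qed.
Lemma rf_refl i mu nu : rf (refl D i mu) (refl D i nu) = rf mu nu.
Proof.
rewrite !reflE !rfE (rfC mu (alpha i)) rf_alpha !rf_alphal cartan_diag; ring.
Qed.
Lemma reflD i mu nu : refl D i (mu + nu) = refl D i mu + refl D i nu.
Proof. by rewrite !reflE pairD mulrzDr opprD addrACA. Qed.
Lemma refl_wordD w mu nu :
  refl_word D w (mu + nu) = refl_word D w mu + refl_word D w nu.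
Proof. by elim: w => //= i w ->; rewrite reflD. Qed.
Lemma rf_refl_word w mu nu : rf (refl_word D w mu) (refl_word D w nu) = rf mu nu.
Proof. by elim: w => //= i w; rewrite rf_refl. Qed.

(** Steps by a single simple root in both directions reduce multiplicative statements about the
    torus to the generators and their inverses. *)
Lemma lattice_ind (P : lattice I -> Prop) :
  P 0 -> (forall mu i, P mu -> P (mu + alpha i)) ->
  (forall mu i, P mu -> P (mu - alpha i)) -> forall mu, P mu.
Proof.
move=> P0 PD PB mu.
have PZ i z nu : P nu -> P (nu + alpha i *~ z).
  move=> Pnu; elim/int_rect: z => [|n IHn|n IHn]; first by rewrite mulr0z addr0.
    by rewrite -addn1 PoszD mulrzDr addrA mulr1z; apply: PD.
  by rewrite -addn1 PoszD opprD mulrzDr addrA mulrN1z; apply: PB.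
have -> : mu = \sum_i alpha i *~ mu i.
  apply/ffunP => j; rewrite sum_ffunE (big_only1 j) // => [|k kj _].
    by rewrite ffunMzE ffunE eqxx; lia.
  by rewrite ffunMzE ffunE (negbTE kj) mul0rz.
by elim/big_rec: _ => // k nu _; rewrite addrC; apply: PZ.
Qed.

Lemma lat_mapE mu j : lat_map tau mu j = mu (tau j).
Proof.
rewrite /lat_map sum_ffunE (big_only1 (tau j)) // => [|k kj _].
  by rewrite ffunMzE ffunE tauK eqxx; lia.
rewrite ffunMzE ffunE (_ : (tau k == j) = false) ?mul0rz //.
by apply: contraNF kj => /eqP <-; rewrite tauK.
Qed.
Lemma lat_mapD mu nu : lat_map tau (mu + nu) = lat_map tau mu + lat_map tau nu.
Proof. by apply/ffunP => j; rewrite !(lat_mapE, ffunE). Qed.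
Lemma lat_mapN mu : lat_map tau (- mu) = - lat_map tau mu.
Proof. by apply/ffunP => j; rewrite !(lat_mapE, ffunE). Qed.
Lemma lat_mapZ mu (z : int) : lat_map tau (mu *~ z) = lat_map tau mu *~ z.
Proof. by apply/ffunP => j; rewrite !(lat_mapE, ffunMzE). Qed.
Lemma lat_mapK : involutive (lat_map tau).
Proof. by move=> mu; apply/ffunP => j; rewrite !lat_mapE tauK. Qed.
Lemma lat_map0 : lat_map tau 0 = 0.
Proof. by apply/ffunP => j; rewrite !(lat_mapE, ffunE). Qed.
Lemma lat_map_alpha i : lat_map tau (alpha i) = alpha (tau i).
Proof.
apply/ffunP => j; rewrite lat_mapE !ffunE; congr (Posz (nat_of_bool _)).
by rewrite -(inj_eq (can_inj (tauK D))) tauK.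
Qed.
Lemma pair_tau i mu : pair i (lat_map tau mu) = pair (tau i) mu.
Proof.
rewrite /pair (reindex_inj (can_inj (tauK D))); apply: eq_bigr => k _.
by rewrite lat_mapE tauK -(cartan_tau D i) tauK.
Qed.
Lemma rf_tau mu nu : rf (lat_map tau mu) (lat_map tau nu) = rf mu nu.
Proof.
elim/lattice_ind: mu => [|mu i IH|mu i IH].
- by rewrite lat_map0 !rf0l.
- by rewrite lat_mapD !rfDl IH lat_map_alpha !rf_alphal symz_tau pair_tau tauK.
- rewrite lat_mapD lat_mapN !rfDl !rfNl IH lat_map_alpha !rf_alphal symz_tau.
  by rewrite pair_tau tauK.
Qed.
Lemma rf_tauC mu nu : rf (lat_map tau mu) nu = rf mu (lat_map tau nu).
Proof. by rewrite -{1}(lat_mapK nu) rf_tau. Qed.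
Lemma alpha_inj : injective (@alpha I).
Proof.
move=> i j /ffunP /(_ i); rewrite !ffunE eqxx; by case: eqP.
Qed.

Section Pair.
Variable i : I.
Local Notation ti := (tau i).
Local Notation r := (refl_word D (r_word D i)).
Local Notation tl := (tau_loc D i).
Hypothesis ci : c i ti \in [:: 2; 0; -1].
Definition inJ : pred I := fun k => (k == i) || (k == ti).

Lemma inJi : inJ i. Proof. by rewrite /inJ eqxx. Qed.
Lemma inJt : inJ ti. Proof. by rewrite /inJ eqxx orbT. Qed.
Lemma inJ_tau k : inJ (tau k) = inJ k.
Proof.
by rewrite /inJ !(can2_eq (tauK D) (tauK D)) tauK orbC.
Qed.

Lemma cti : c ti i = c i ti. Proof. by rewrite -{2}(tauK D i) cartan_tau. Qed.

Variant pair_spec : seq I -> Prop :=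
| Pair2 of ti = i & c i ti = 2 : pair_spec [:: i]
| Pair0 of ti != i & c i ti = 0 : pair_spec [:: i; ti]
| Pair1 of ti != i & c i ti = -1 : pair_spec [:: i; ti; i].

Lemma pairP : pair_spec (r_word D i).
Proof.
have [tii|tii] := eqVneq ti i.
  have c2 : c i ti = 2 by rewrite tii cartan_diag.
  by rewrite /r_word c2 eqxx; constructor.
have : c i ti <= 0 by apply: cartan_off_le0; rewrite eq_sym.
move: ci; rewrite /r_word !inE => /or3P[] /eqP cE; rewrite cE //= => _.
  by constructor.
by constructor.
Qed.

(** In the last case the word is the longest element of type A_2, which is the reflection in the
    root alpha_i + alpha_(tau i); hence only the sum of the two pairings enters. *)
Lemma r_formula mu : r mu =
  if ti == i then mu - alpha i *~ pair i mu
  else if c i ti == 0 then mu - alpha i *~ pair i mu - alpha ti *~ pair ti mu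
  else mu - (alpha i + alpha ti) *~ (pair i mu + pair ti mu).
Proof.
case: pairP => [-> _|/negbTE -> c0|/negbTE -> c1] /=.
- by rewrite eqxx reflE.
- rewrite c0 eqxx reflE reflE pairD pairN pairZ pair_alpha c0 mulr0 oppr0 addr0.
  by rewrite addrAC.
- rewrite c1 /=; set a := pair i mu; set b := pair ti mu.
  rewrite !(reflE, pairD, pairN, pairZ, pair_alpha) -/a -/b cti c1 cartan_diag.
  apply/ffunP => j; rewrite !(ffunE, ffunMzE); ring.
Qed.

Lemma r_tau mu : r (lat_map tau mu) = lat_map tau (r mu).
Proof.
rewrite !r_formula !pair_tau tauK; case: eqP => [tii|_].
  by rewrite lat_mapD lat_mapN lat_mapZ lat_map_alpha !tii.
case: ifP => _; rewrite !(lat_mapD, lat_mapN, lat_mapZ, lat_map_alpha) tauK.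
  by rewrite addrAC.
by rewrite [alpha ti + _]addrC [pair ti mu + _]addrC.
Qed.
Lemma rD mu nu : r (mu + nu) = r mu + r nu. Proof. exact: refl_wordD. Qed.
Lemma r0 : r 0 = 0. Proof. by apply: (addrI (r 0)); rewrite -rD !addr0. Qed.
Lemma rN mu : r (- mu) = - r mu.
Proof. by apply: (addrI (r mu)); rewrite -rD !subrr r0. Qed.
Lemma rf_r mu nu : rf (r mu) (r nu) = rf mu nu. Proof. exact: rf_refl_word. Qed.

Lemma rK : involutive r.
Proof.
move=> mu; rewrite (r_formula (r mu)) r_formula.
case: pairP => [tii _|/negbTE tii c0|/negbTE tii c1]; rewrite ?tii ?eqxx ?c0 ?c1 /=;
  rewrite !(pairD, pairN, pairZ, pair_alpha) ?cti ?c0 ?c1 ?cartan_diag;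
  apply/ffunP => j; rewrite !(ffunE, ffunMzE); ring.
Qed.
Lemma rf_rC mu nu : rf (r mu) nu = rf mu (r nu).
Proof. by rewrite -{1}(rK nu) rf_r. Qed.

Lemma r_alphaJ k : inJ k ->
  r (alpha k) = - alpha (if c i ti == -1 then tau k else k).
Proof.
move=> kJ; have {kJ} kE : k = i \/ k = ti by case/orP: kJ => /eqP; auto.
rewrite r_formula; case: pairP => [tii cE|/negbTE tii cE|/negbTE tii cE];
  case: kE => ->; rewrite !pair_alpha ?tauK ?cti ?cE ?tii ?cartan_diag ?eqxx /=;
  apply/ffunP => j; rewrite !(ffunE, ffunMzE); ring.
Qed.
Lemma tlE k : inJ k -> tl k = if c i ti == -1 then tau k else k.
Proof.
move=> kJ; rewrite /tau_loc; set l := if _ then _ else _.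
case: pickP => [m /eqP|/(_ l)]; rewrite r_alphaJ // ?eqxx //.
by move=> /oppr_inj /alpha_inj.
Qed.
Lemma r_loc k : inJ k -> r (alpha k) = - alpha (tl k).
Proof. by move=> kJ; rewrite r_alphaJ // tlE. Qed.
Lemma tl_J k : inJ k -> inJ (tl k).
Proof. by move=> kJ; rewrite tlE //; case: ifP; rewrite ?inJ_tau. Qed.
Lemma tl_tau k : inJ k -> tl (tau k) = tau (tl k).
Proof. by move=> kJ; rewrite !tlE ?inJ_tau //; case: ifP. Qed.
Lemma tlK k : inJ k -> tl (tl k) = k.
Proof.
move=> kJ; rewrite tlE ?tl_J // tlE //.
by case: ifP => -> //; rewrite tauK.
Qed.
End Pair.
End Lattice.

(** * Cartan part, Borel embeddings and the Chevalley involution *)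

Section CartanPart.
Variables (I : finType) (D : satake I) (F : fieldType) (q : F).
Hypothesis q0 : q != 0.
Local Notation rf := (root_form D).
Local Notation v_ := (vi D q).
Local Notation c := (cartan D).
Local Notation B := (B_alg D q).
Local Notation U := (U_alg D q).
Local Notation th := (Btheta D q).
Local Notation hm := (Bh_mon D q).
Local Notation Km := (UK_mon D q).
Local Notation K'm := (UK'_mon D q).
Implicit Types mu nu : lattice I.

(** Since [q] stands for v^(1/2), this is v^((mu,nu)), the scalar by which h_mu commutes past an
    element of weight nu. *)
Definition chi mu nu : F := q ^ (2 * rf mu nu).

Lemma qE (m n : int) : q ^ m * q ^ n = q ^ (m + n).
Proof. by rewrite expfzDr. Qed.
Lemma chi_neq0 mu nu : chi mu nu != 0. Proof. exact: expfz_neq0. Qed.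
Lemma chiDl mu mu' nu : chi (mu + mu') nu = chi mu nu * chi mu' nu.
Proof. by rewrite /chi qE rfDl mulrDr. Qed.
Lemma chiDr mu nu nu' : chi mu (nu + nu') = chi mu nu * chi mu nu'.
Proof. by rewrite /chi qE rfDr mulrDr. Qed.
Lemma chiNl mu nu : chi (- mu) nu = (chi mu nu)^-1.
Proof. by rewrite /chi rfNl mulrN invr_expz. Qed.
Lemma chiNr mu nu : chi mu (- nu) = (chi mu nu)^-1.
Proof. by rewrite /chi rfNr mulrN invr_expz. Qed.
Lemma chi0l mu : chi 0 mu = 1. Proof. by rewrite /chi rf0l mulr0 expr0z. Qed.
Lemma chi0r mu : chi mu 0 = 1. Proof. by rewrite /chi rf0r mulr0 expr0z. Qed.
Lemma chiC mu nu : chi mu nu = chi nu mu. Proof. by rewrite /chi rfC. Qed.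
Lemma vi_z i : v_ i = q ^ (2 * (symz D i)%:Z).
Proof. by rewrite /vi -PoszM. Qed.
Lemma vi_neq0 i : v_ i != 0. Proof. exact: expf_neq0. Qed.
Lemma chi_alpha i j : chi (alpha i) (alpha j) = v_ i ^ c i j.
Proof. by rewrite /chi rf_alpha vi_z exprz_exp mulrA. Qed.
Lemma chi_alpha2 i : chi (alpha i) (alpha i) = v_ i ^+ 2.
Proof. by rewrite chi_alpha cartan_diag. Qed.

Lemma mon_ahom (A A' : algType F) (f : A -> A') (X XV : I -> A) (Y YV : I -> A') mu :
  ahom f -> (forall i, f (X i) = Y i) -> (forall i, f (XV i) = YV i) ->
  f (mon X XV mu) = mon Y YV mu.
Proof.
move=> fH fX fXV; rewrite /mon (ahom_prod fH); apply: eq_bigr => i _.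
by case: (mu i) => n /=; rewrite (ahomX fH) ?fX ?fXV.
Qed.

Section MonComm.
Variables (A : algType F) (X XV Y : I -> A).
Hypotheses (XXV : forall i, X i * XV i = 1) (XVX : forall i, XV i * X i = 1)
  (XX : forall i j, X i * X j = X j * X i).
(** The flag [s] selects the sign of the exponent, so that one proof serves both K and K' against
    the E_j and the F_j. *)
Lemma mon_qcomm (s : bool) :
  (forall i j, X i * Y j = chi (alpha i) (if s then alpha j else - alpha j)
     *: (Y j * X i)) ->
  forall mu j, mon X XV mu * Y j =
    chi mu (if s then alpha j else - alpha j) *: (Y j * mon X XV mu).
Proof.
move=> XY mu j; elim/lattice_ind: mu => [|mu i IH|mu i IH].
- by rewrite mon0 chi0l scale1r mul1r mulr1.
- rewrite monD // mon_alpha -mulrA XY -scalerAr [mon _ _ mu * (_ * _)]mulrA IH -scalerAl scalerA.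
  by rewrite chiDl mulrC mulrA.
- rewrite monD // mon_alphaN // -mulrA (qcomm_inv (chi_neq0 _ _) (XXV i) (XVX i) (XY i j)).
  by rewrite -scalerAr [mon _ _ mu * (_ * _)]mulrA IH -scalerAl scalerA chiDl chiNl mulrC mulrA.
Qed.
End MonComm.

Lemma hm0 : hm 0 = 1. Proof. exact: mon0. Qed.
Lemma hmD mu nu : hm (mu + nu) = hm mu * hm nu.
Proof. by apply: monD => *; [exact: Bh_V|exact: BhV_h|exact: Bh_h]. Qed.
Lemma hm_alpha i : hm (alpha i) = Bh D q i. Proof. exact: mon_alpha. Qed.
Lemma hm_alphaN i : hm (- alpha i) = BhV D q i.
Proof. by apply: mon_alphaN => *; [exact: Bh_V|exact: BhV_h|exact: Bh_h]. Qed.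
Lemma hmC mu nu : hm mu * hm nu = hm nu * hm mu.
Proof. by rewrite -!hmD addrC. Qed.
Lemma hmN mu : hm mu * hm (- mu) = 1. Proof. by rewrite -hmD subrr hm0. Qed.
Lemma hmNl mu : hm (- mu) * hm mu = 1. Proof. by rewrite -hmD addNr hm0. Qed.
Lemma hm_theta mu j : hm mu * th j = chi mu (alpha j) *: (th j * hm mu).
Proof.
apply: (@mon_qcomm _ _ _ (th) (@Bh_V _ D _ q) (@BhV_h _ D _ q) (@Bh_h _ D _ q) true) => k l.
by rewrite chi_alpha Bh_theta.
Qed.

Lemma Km0 : Km 0 = 1. Proof. exact: mon0. Qed.
Lemma KmD mu nu : Km (mu + nu) = Km mu * Km nu.
Proof. by apply: monD => *; [exact: UK_V|exact: UKV_K|exact: UK_K]. Qed.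
Lemma Km_alpha i : Km (alpha i) = UK D q i. Proof. exact: mon_alpha. Qed.
Lemma Km_alphaN i : Km (- alpha i) = UKV D q i.
Proof. by apply: mon_alphaN => *; [exact: UK_V|exact: UKV_K|exact: UK_K]. Qed.
Lemma KmN mu : Km mu * Km (- mu) = 1. Proof. by rewrite -KmD subrr Km0. Qed.
Lemma Km_E mu j : Km mu * UE D q j = chi mu (alpha j) *: (UE D q j * Km mu).
Proof.
apply: (@mon_qcomm _ _ _ (UE D q) (@UK_V _ D _ q) (@UKV_K _ D _ q) (@UK_K _ D _ q) true) => k l.
by rewrite chi_alpha UK_E.
Qed.

Lemma K'm0 : K'm 0 = 1. Proof. exact: mon0. Qed.
Lemma K'mD mu nu : K'm (mu + nu) = K'm mu * K'm nu.
Proof. by apply: monD => *; [exact: UK'_V|exact: UK'V_K'|exact: UK'_K']. Qed.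
Lemma K'm_alpha i : K'm (alpha i) = UK' D q i. Proof. exact: mon_alpha. Qed.
Lemma K'm_alphaN i : K'm (- alpha i) = UK'V D q i.
Proof. by apply: mon_alphaN => *; [exact: UK'_V|exact: UK'V_K'|exact: UK'_K']. Qed.
Lemma K'mNl mu : K'm (- mu) * K'm mu = 1. Proof. by rewrite -K'mD addNr K'm0. Qed.
Lemma K'm_E mu j : K'm mu * UE D q j = chi mu (- alpha j) *: (UE D q j * K'm mu).
Proof.
apply: (@mon_qcomm _ _ _ (UE D q) (@UK'_V _ D _ q) (@UK'V_K' _ D _ q) (@UK'_K' _ D _ q) false) => k l.
by rewrite chiNr chi_alpha invr_expz UK'_E.
Qed.
Lemma K'm_F mu j : K'm mu * UF D q j = chi mu (alpha j) *: (UF D q j * K'm mu).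
Proof.
apply: (@mon_qcomm _ _ _ (UF D q) (@UK'_V _ D _ q) (@UK'V_K' _ D _ q) (@UK'_K' _ D _ q) true) => k l.
by rewrite chi_alpha UK'_F.
Qed.
Lemma Km_K'm mu nu : Km mu * K'm nu = K'm nu * Km mu.
Proof.
have KK' i nu' : UK D q i * K'm nu' = K'm nu' * UK D q i.
  elim/lattice_ind: nu' => [|nu' k IH|nu' k IH].
  - by rewrite K'm0 mul1r mulr1.
  - rewrite K'mD K'm_alpha mulrA IH; by rewrite <- !mulrA, -> UK_K'.
  - rewrite K'mD K'm_alphaN mulrA IH; rewrite <- !mulrA; congr (_ * _).
    have := @qcomm_inv _ _ 1 _ (UK'V D q k) (UK D q i) (oner_neq0 _) (UK'_V D q k)
      (UK'V_K' D q k); rewrite invr1; rewrite -> !scale1r; move=> -> //.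
    by rewrite UK_K'.
elim/lattice_ind: mu => [|mu k IH|mu k IH].
- by rewrite Km0 mul1r mulr1.
- by rewrite KmD Km_alpha -mulrA KK' [Km mu * (_ * _)]mulrA IH mulrA.
- rewrite KmD Km_alphaN -mulrA.
  have := @qcomm_inv _ _ 1 _ (UKV D q k) (K'm nu) (oner_neq0 _) (UK_V D q k)
    (UKV_K D q k); rewrite invr1 !scale1r => -> //.
  by rewrite [Km mu * (_ * _)]mulrA IH -mulrA.
Qed.

Lemma bplus_rels : B_rels D q (UE D q) (UK D q) (UKV D q).
Proof.
by split; [exact: UE_serre|exact: UK_V|exact: UKV_K|exact: UK_K|exact: UK_E].
Qed.
Lemma bminus_rels : B_rels D q (UF D q) (UK' D q) (UK'V D q).
Proof.
by split; [exact: UF_serre|exact: UK'_V|exact: UK'V_K'|exact: UK'_K'|exact: UK'_F].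
Qed.
(** Exchanging E with F and K with K' changes the sign of both sides of the commutator relation;
    therefore this involution is a homomorphism and not an antihomomorphism. *)
Lemma omega_rels : U_rels D q (UF D q) (UE D q) (UK' D q) (UK'V D q) (UK D q) (UKV D q).
Proof.
split.
- exact: UK'_V.
- exact: UK'V_K'.
- exact: UK_V.
- exact: UKV_K.
- exact: UK'_K'.
- by move=> i j; rewrite UK_K'.
- exact: UK_K.
- move=> i j; rewrite -[LHS]opprB UE_F -scalerN opprB eq_sym.
  by case: eqP => [->|] //; rewrite !mul0r; rewrite -> !scale0r.
- exact: UK'_F.
- exact: UK'_E.
- exact: UK_F.
- exact: UK_E.
- exact: UF_serre.
- exact: UE_serre.
Qed.
Definition bplus : B -> U := B_lift bplus_rels.
Definition bminus : B -> U := B_lift bminus_rels.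
Definition omega : U -> U := U_lift omega_rels.
Lemma bplusH : ahom bplus. Proof. exact: B_liftH. Qed.
Lemma bminusH : ahom bminus. Proof. exact: B_liftH. Qed.
Lemma omegaH : ahom omega. Proof. exact: U_liftH. Qed.
Lemma bplus_theta i : bplus (th i) = UE D q i. Proof. exact: B_lift_theta. Qed.
Lemma bminus_theta i : bminus (th i) = UF D q i. Proof. exact: B_lift_theta. Qed.
Lemma bplus_h i : bplus (Bh D q i) = UK D q i. Proof. exact: B_lift_h. Qed.
Lemma bplus_hV i : bplus (BhV D q i) = UKV D q i. Proof. exact: B_lift_hV. Qed.
Lemma bminus_h i : bminus (Bh D q i) = UK' D q i. Proof. exact: B_lift_h. Qed.
Lemma bminus_hV i : bminus (BhV D q i) = UK'V D q i. Proof. exact: B_lift_hV. Qed.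
Lemma omega_E i : omega (UE D q i) = UF D q i. Proof. exact: U_liftE. Qed.
Lemma omega_F i : omega (UF D q i) = UE D q i. Proof. exact: U_liftF. Qed.
Lemma omega_K i : omega (UK D q i) = UK' D q i. Proof. exact: U_liftK. Qed.
Lemma omega_KV i : omega (UKV D q i) = UK'V D q i. Proof. exact: U_liftKV. Qed.
Lemma omega_K' i : omega (UK' D q i) = UK D q i. Proof. exact: U_liftK'. Qed.
Lemma omega_K'V i : omega (UK'V D q i) = UKV D q i. Proof. exact: U_liftK'V. Qed.
Lemma bplus_hm mu : bplus (hm mu) = Km mu.
Proof. exact: mon_ahom bplusH bplus_h bplus_hV. Qed.
Lemma bminus_hm mu : bminus (hm mu) = K'm mu.
Proof. exact: mon_ahom bminusH bminus_h bminus_hV. Qed.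
Lemma omega_Km mu : omega (Km mu) = K'm mu.
Proof. exact: mon_ahom omegaH omega_K omega_KV. Qed.
Lemma omega_K'm mu : omega (K'm mu) = Km mu.
Proof. exact: mon_ahom omegaH omega_K' omega_K'V. Qed.
Lemma omega_bplus b : omega (bplus b) = bminus b.
Proof.
apply: (B_ahom_eq (ahom_comp bplusH omegaH) bminusH) => i /=.
- by rewrite bplus_theta omega_E bminus_theta.
- by rewrite bplus_h omega_K bminus_h.
- by rewrite bplus_hV omega_KV bminus_hV.
Qed.
Lemma omegaK : involutive omega.
Proof.
apply: (U_ahom_eq (ahom_comp omegaH omegaH) (@ahom_id _ _)) => i /=.
- by rewrite omega_E omega_F.
- by rewrite omega_F omega_E.
- by rewrite omega_K omega_K'.
- by rewrite omega_KV omega_K'V.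
- by rewrite omega_K' omega_K.
- by rewrite omega_K'V omega_KV.
Qed.
Lemma omega_bminus b : omega (bminus b) = bplus b.
Proof. by rewrite -omega_bplus omegaK. Qed.
Lemma f_plusE x : f_plus x = bplus (f_iota x).
Proof.
apply: (ahom_eq (f_plusH D q) (ahom_comp (f_iotaH D q) bplusH)) => i /=.
by rewrite -/(theta D q i) f_plus_theta f_iota_theta bplus_theta.
Qed.
Lemma tauB_hm mu : tauB (hm mu) = hm (lat_map (tau D) mu).
Proof.
elim/lattice_ind: mu => [|mu k IH|mu k IH].
- by rewrite lat_map0 !hm0 (ahom1 (tauBH D q)).
- by rewrite lat_mapD !hmD (ahomM (tauBH D q)) IH lat_map_alpha !hm_alpha tauB_h.
- rewrite lat_mapD lat_mapN !hmD (ahomM (tauBH D q)) IH lat_map_alpha !hm_alphaN.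
  by rewrite tauB_hV.
Qed.
Lemma tauBK : involutive (@tauB I D F q).
Proof.
apply: (B_ahom_eq (ahom_comp (tauBH D q) (tauBH D q)) (@ahom_id _ _)) => i /=.
- by rewrite !tauB_theta tauK.
- by rewrite !tauB_h tauK.
- by rewrite !tauB_hV tauK.
Qed.
End CartanPart.

(** * The coproduct as a functional on bilinear maps *)

Section Bilinear.
Variables (I : finType) (D : satake I) (F : fieldType) (q : F).
Local Notation B := (B_alg D q).

Lemma bilP (V : lmodType F) (beta : B -> B -> V) :
  (forall x, lin (beta^~ x)) -> (forall x, lin (beta x)) -> is_bilinear beta.
Proof. by move=> bl br; split=> *; [apply: bl|apply: br]. Qed.
Lemma bil_l (V : lmodType F) (beta : B -> B -> V) x :
  is_bilinear beta -> lin (beta^~ x).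
Proof. by move=> [bl _] c a b; apply: bl. Qed.
Lemma bil_r (V : lmodType F) (beta : B -> B -> V) x :
  is_bilinear beta -> lin (beta x).
Proof. by move=> [_ br] c a b; apply: br. Qed.
Definition trilinear (V : lmodType F) (g : B -> B -> B -> V) :=
  [/\ forall y z, lin (fun x => g x y z), forall x z, lin (fun y => g x y z)
    & forall x y, lin (fun z => g x y z)].

Lemma tri1 (V : lmodType F) (g : B -> B -> B -> V) y z :
  trilinear g -> lin (fun x => g x y z).
Proof. by case. Qed.
Lemma tri2 (V : lmodType F) (g : B -> B -> B -> V) x z :
  trilinear g -> lin (fun y => g x y z).
Proof. by case. Qed.
Lemma tri3 (V : lmodType F) (g : B -> B -> B -> V) x y :
  trilinear g -> lin (g x y).
Proof. by case. Qed.
End Bilinear.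

Section Coproduct.
Variables (I : finType) (D : satake I) (F : fieldType) (q : F).
Hypothesis q0 : q != 0.
Local Notation B := (B_alg D q).
Local Notation th := (Btheta D q).
Local Notation h := (Bh D q).
Variable Delta : B -> seq (B * B).

(** Sweedler notation: the sum of beta(b_(1), b_(2)). Tensors are compared only through bilinear
    maps, which is why the laws of the coproduct ask for bilinearity of [beta]. *)
Definition cop (V : lmodType F) (b : B) (beta : B -> B -> V) : V :=
  \sum_(p <- Delta b) beta p.1 p.2.

Lemma eq_cop (V : lmodType F) b (beta gam : B -> B -> V) :
  (forall x y, beta x y = gam x y) -> cop b beta = cop b gam.
Proof. by move=> bg; apply: eq_bigr => p _; apply: bg. Qed.
Lemma cop_swap (V : lmodType F) a b (g : B -> B -> B -> B -> V) :
  cop a (fun x y => cop b (fun z t => g x y z t)) =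
  cop b (fun z t => cop a (fun x y => g x y z t)).
Proof. exact: exchange_big. Qed.
Lemma lin_cop (V W : lmodType F) (f : V -> W) b (beta : B -> B -> V) :
  lin f -> f (cop b beta) = cop b (fun x y => f (beta x y)).
Proof. by move=> fL; rewrite /cop (lin_sum fL). Qed.
Lemma cop_in (V W : lmodType F) b (beta : V -> B -> B -> W) :
  (forall x y, lin (fun v => beta v x y)) -> lin (fun v => cop b (beta v)).
Proof. by move=> bL; apply: lin_bigsum => p. Qed.
Lemma copD (V : lmodType F) b (beta gam : B -> B -> V) :
  cop b (fun x y => beta x y + gam x y) = cop b beta + cop b gam.
Proof. exact: big_split. Qed.
Lemma copZ (V : lmodType F) c b (beta : B -> B -> V) :
  cop b (fun x y => c *: beta x y) = c *: cop b beta.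
Proof. by rewrite /cop scaler_sumr. Qed.
Lemma cop_scalel (V : lmodType F) b (beta : B -> B -> F^o) (w : V) :
  (cop b beta : F) *: w = cop b (fun x y => (beta x y : F) *: w).
Proof. by rewrite /cop scaler_suml. Qed.
Lemma copMl (A : algType F) b (beta : B -> B -> A) w :
  w * cop b beta = cop b (fun x y => w * beta x y).
Proof. by rewrite /cop mulr_sumr. Qed.
Lemma copMr (A : algType F) b (beta : B -> B -> A) w :
  cop b beta * w = cop b (fun x y => beta x y * w).
Proof. by rewrite /cop mulr_suml. Qed.

Hypothesis Delta_spec : is_coproduct Delta.

Lemma cop_lin (V : lmodType F) (beta : B -> B -> V) :
  is_bilinear beta -> lin (fun b => cop b beta).
Proof.
move=> bb c a b; rewrite /cop (coproduct_lin Delta_spec c a b bb).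
rewrite big_cat big_map scaler_sumr; congr (_ + _); apply: eq_bigr => p _ /=.
by rewrite (linZ (bil_l _ bb)).
Qed.
Lemma cop_arg (V W : lmodType F) (f : V -> B) (beta : B -> B -> W) :
  is_bilinear beta -> lin f -> lin (fun v => cop (f v) beta).
Proof. by move=> bb fL c x y; rewrite fL (cop_lin bb). Qed.
Lemma cop1 (V : lmodType F) (beta : B -> B -> V) :
  is_bilinear beta -> cop 1 beta = beta 1 1.
Proof. by move=> bb; rewrite /cop (coproduct_1 Delta_spec bb) big_seq1. Qed.
Lemma copM (V : lmodType F) a b (beta : B -> B -> V) : is_bilinear beta ->
  cop (a * b) beta =
  cop a (fun a1 a2 => cop b (fun b1 b2 => beta (a1 * b1) (a2 * b2))).
Proof.
by move=> bb; rewrite /cop (coproduct_M Delta_spec a b bb) big_allpairs_dep.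
Qed.
Lemma cop_theta (V : lmodType F) i (beta : B -> B -> V) : is_bilinear beta ->
  cop (th i) beta = beta (th i) 1 + beta (h i) (th i).
Proof.
by move=> bb; rewrite /cop (coproduct_theta Delta_spec i bb) big_cons big_seq1.
Qed.
Lemma cop_h (V : lmodType F) i (beta : B -> B -> V) : is_bilinear beta ->
  cop (h i) beta = beta (h i) (h i).
Proof. by move=> bb; rewrite /cop (coproduct_h Delta_spec i bb) big_seq1. Qed.
End Coproduct.
Arguments lin_cop {I D F q Delta V W f b beta}.

(** [lint] proves linearity and bilinearity by the shape of the body; [lint1] is its extension
    point, redefined once the pairing and its operators exist. *)
Ltac lint1 := fail.
Ltac lint_eta :=
  lazymatch goal with
  | |- lin (fun _ => _) => idtac
  | |- lin id => idtac
  | |- @lin ?K ?V ?W ?f => refine (_ : @lin K V W (fun x => f x))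
  | |- _ => idtac
  end.
Ltac lint :=
  cbv beta; lint_eta; match goal with
  | |- is_bilinear _ => apply: bilP => ?; lint
  | |- lin (fun x => x) => exact: lin_id
  | |- lin id => exact: lin_id
  | |- lin (fun x => @?f x + @?g x) => apply: lin_add; lint
  | |- lin (fun x => - (@?f x)) => apply: lin_opp; lint
  | |- lin (fun x => ?a *: @?f x) => apply: lin_scale; lint
  | |- lin (fun x => @?f x *: ?w) => apply: lin_scalel; lint
  | |- lin (fun x => ?a * @?f x) => apply: lin_mull; lint
  | |- lin (fun x => @?f x * ?a) => apply: lin_mulr; lint
  | |- lin (fun x => cop _ ?b (fun u v => @?g x u v)) =>
      apply: cop_in => ? ?; lint
  | |- lin (fun x => cop _ (@?f x) ?beta) =>
      apply: cop_arg; [assumption|lint|lint]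
  | H : is_bilinear ?b |- lin (fun x => ?b (@?f x) ?y) =>
      refine (@lin_comp _ _ _ _ (fun z => b z y) f _ _); [exact: bil_l H|lint]
  | H : is_bilinear ?b |- lin (fun x => ?b ?y (@?f x)) =>
      refine (@lin_comp _ _ _ _ (b y) f _ _); [exact: bil_r H|lint]
  | H : trilinear ?b |- lin (fun x => ?b (@?f x) ?y ?z) =>
      refine (@lin_comp _ _ _ _ (fun t => b t y z) f _ _); [exact: tri1 H|lint]
  | H : trilinear ?b |- lin (fun x => ?b ?y (@?f x) ?z) =>
      refine (@lin_comp _ _ _ _ (fun t => b y t z) f _ _); [exact: tri2 H|lint]
  | H : trilinear ?b |- lin (fun x => ?b ?y ?z (@?f x)) =>
      refine (@lin_comp _ _ _ _ (b y z) f _ _); [exact: tri3 H|lint]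
  | H : is_bilinear ?b |- lin (?b ?y) => exact: bil_r H
  | H : trilinear ?b |- lin (?b ?y ?z) => exact: tri3 H
  | |- trilinear _ => split=> ? ?; lint
  | _ => lint1
  end.

Section Coassociativity.
Variables (I : finType) (D : satake I) (F : fieldType) (q : F).
Hypothesis q0 : q != 0.
Local Notation B := (B_alg D q).
Local Notation h := (Bh D q).
Local Notation hV := (BhV D q).
Local Notation hm := (Bh_mon D q).
Variable Delta : B -> seq (B * B).
Hypothesis Delta_spec : is_coproduct Delta.
Local Notation cop := (cop Delta).

(** The specification gives the coproduct of h_i only. That the inverse is grouplike is forced by
    the coproduct of h_i h_i^-1 = 1, tested on beta with both arguments multiplied by the
    inverse. *)
Lemma cop_hV (V : lmodType F) i (beta : B -> B -> V) : is_bilinear beta ->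
  cop (hV i) beta = beta (hV i) (hV i).
Proof.
move=> bb; have bV : is_bilinear (fun x y => beta (hV i * x) (hV i * y)) by lint.
have : cop (h i * hV i) (fun x y => beta (hV i * x) (hV i * y)) =
    beta (hV i) (hV i) by rewrite Bh_V (cop1 Delta_spec) // !mulr1.
rewrite (copM Delta_spec) // (cop_h Delta_spec) /=; last by lint.
by move=> <-; apply: eq_cop => x y; rewrite !mulrA BhV_h !mul1r.
Qed.
Lemma cop_hm (V : lmodType F) mu (beta : B -> B -> V) : is_bilinear beta ->
  cop (hm mu) beta = beta (hm mu) (hm mu).
Proof.
elim/lattice_ind: mu beta => [|mu i IH|mu i IH] beta bb.
- by rewrite hm0 (cop1 Delta_spec).
- rewrite hmD hm_alpha (copM Delta_spec) // IH; last by lint.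
  by rewrite (cop_h Delta_spec) //; lint.
- rewrite hmD hm_alphaN (copM Delta_spec) // IH; last by lint.
  by rewrite cop_hV //; lint.
Qed.

Lemma trilin_cop (W : lmodType F) (f : B -> B -> B -> W) : trilinear f ->
  is_bilinear (fun x y => cop x (fun x1 x2 => f x1 x2 y)) /\
  is_bilinear (fun x y => cop y (fun y1 y2 => f x y1 y2)).
Proof.
move=> [f1 f2 f3]; split; apply: bilP => z.
- by apply: cop_lin => //; apply: bilP.
- by apply: cop_in.
- by apply: cop_in.
- by apply: cop_lin => //; apply: bilP.
Qed.

Definition coassoc b := forall (V : lmodType F) (g : B -> B -> B -> V),
  trilinear g ->
  cop b (fun x y => cop x (fun x1 x2 => g x1 x2 y)) =
  cop b (fun x y => cop y (fun y1 y2 => g x y1 y2)).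

(** The regrouping of the legs of [b] is done first, inside fixed legs of [a]; the legs of [a] are
    regrouped afterwards. This reduces coassociativity to generators. *)
Lemma coassocM a b : coassoc a -> coassoc b -> coassoc (a * b).
Proof.
move=> Ha Hb V g gt; have [b1 b2] := trilin_cop gt; have [g1 g2 g3] := gt.
have gl z : is_bilinear (fun x y => g x y z) by apply: bilP.
have gr z : is_bilinear (g z) by apply: bilP.
rewrite !(copM Delta_spec) //.
transitivity (cop a (fun a1 a2 => cop a1 (fun x y => cop b (fun b1 b2 =>
    cop b1 (fun z t => g (x * z) (y * t) (a2 * b2)))))).
  apply: eq_cop => a1 a2; rewrite cop_swap; apply: eq_cop => b1' b2'.
  by rewrite (copM Delta_spec).
transitivity (cop a (fun a1 a2 => cop a1 (fun x y => cop b (fun b1 b2 =>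
    cop b2 (fun z t => g (x * b1) (y * z) (a2 * t)))))).
  apply: eq_cop => a1 a2; apply: eq_cop => x y.
  apply: (Hb _ (fun b1 b2 b3 => g (x * b1) (y * b2) (a2 * b3))).
  by lint.
rewrite (Ha _ (fun x y z => cop b (fun b1 b2 =>
    cop b2 (fun z' t => g (x * b1) (y * z') (z * t))))).
  apply: eq_cop => a1 a2; rewrite cop_swap; apply: eq_cop => b1' b2'.
  by rewrite (copM Delta_spec).
by lint.
Qed.

Lemma coassocP b : coassoc b.
Proof.
elim/B_ind: b => [|c x y IHx IHy|i b|i b|i b].
- move=> V g gt; have [b1 b2] := trilin_cop gt; have [g1 g2 g3] := gt.
  by rewrite !(cop1 Delta_spec) //; apply: bilP.
- move=> V g gt; have [b1 b2] := trilin_cop gt.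
  by rewrite !(cop_lin Delta_spec) ?IHx ?IHy.
all: apply: coassocM => V g gt; have [b1 b2] := trilin_cop gt; have [g1 g2 g3] := gt.
all: have gl z : is_bilinear (fun x y => g x y z) by apply: bilP.
all: have gr z : is_bilinear (g z) by apply: bilP.
- rewrite !(cop_theta Delta_spec) //;
  rewrite -> !(cop_h Delta_spec);
  by rewrite // !(cop1 Delta_spec) // addrA.
- by rewrite !(cop_h Delta_spec).
- by rewrite !cop_hV.
Qed.
Lemma copA (V : lmodType F) b (g : B -> B -> B -> V) : trilinear g ->
  cop b (fun x y => cop x (fun x1 x2 => g x1 x2 y)) =
  cop b (fun x y => cop y (fun y1 y2 => g x y1 y2)).
Proof. exact: coassocP. Qed.
End Coassociativity.

(** * Skew derivations from the Hopf pairing *)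

Section PairingOperators.
Variables (I : finType) (D : satake I) (F : fieldType) (q : F).
Local Notation B := (B_alg D q).
Variables (Delta : B -> seq (B * B)) (phi : B -> B -> F).
(** [rho a] contracts the second leg with a, and [lam a] the first one. At a = theta_i these are, up
    to normalization and a Cartan factor for [rho], the two skew derivations of f. *)
Definition rho (a b : B) : B := cop Delta b (fun x y => phi y a *: x).
Definition lam (a b : B) : B := cop Delta b (fun x y => phi x a *: y).

Hypothesis phi_spec : is_hopf_pairing Delta phi.
Lemma phi_linl a : lin (fun x => phi x a : F^o).
Proof. exact: bil_l (pairing_bilin phi_spec). Qed.
Lemma phi_linr a : lin (fun x => phi a x : F^o).
Proof. exact: bil_r (pairing_bilin phi_spec). Qed.
Lemma phi_compl (V : lmodType F) (f : V -> B) a :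
  lin f -> lin (fun x => phi (f x) a : F^o).
Proof. by move=> fL c x y; rewrite fL (phi_linl a). Qed.
Lemma phi_compr (V : lmodType F) (f : V -> B) a :
  lin f -> lin (fun x => phi a (f x) : F^o).
Proof. by move=> fL c x y; rewrite fL (phi_linr a). Qed.
End PairingOperators.

Ltac lint1 ::=
  match goal with
  | H : is_hopf_pairing _ ?p |- lin (fun x => ?p (@?f x) ?a) =>
      refine (@phi_compl _ _ _ _ _ _ H _ f a _); lint
  | H : is_hopf_pairing _ ?p |- lin (fun x => ?p ?a (@?f x)) =>
      refine (@phi_compr _ _ _ _ _ _ H _ f a _); lint
  | H : is_hopf_pairing _ ?p |- lin (?p ?a) => exact: phi_linr H _
  | |- lin (@tauB _ _ _ _) => exact: ahomL (tauBH _ _)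
  | |- lin (@bplus _ _ _ _) => exact: ahomL (bplusH _ _)
  | |- lin (@bminus _ _ _ _) => exact: ahomL (bminusH _ _)
  | |- lin (rho _ _ _) => rewrite /rho; lint
  | |- lin (lam _ _ _) => rewrite /lam; lint
  | |- lin (fun x => tauB (@?f x)) =>
      refine (@lin_comp _ _ _ _ (@tauB _ _ _ _) f _ _); [exact: ahomL (tauBH _ _)|lint]
  | |- lin (fun x => bplus (@?f x)) =>
      refine (@lin_comp _ _ _ _ (@bplus _ _ _ _) f _ _); [exact: ahomL (bplusH _ _)|lint]
  | |- lin (fun x => bminus (@?f x)) =>
      refine (@lin_comp _ _ _ _ (@bminus _ _ _ _) f _ _); [exact: ahomL (bminusH _ _)|lint]
  | |- lin (fun x => rho _ _ _ (@?f x)) => rewrite /rho; lint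
  | |- lin (fun x => lam _ _ _ (@?f x)) => rewrite /lam; lint
  | |- lin (fun x => rho _ _ (@?f x) _) => rewrite /rho; lint
  | |- lin (fun x => lam _ _ (@?f x) _) => rewrite /lam; lint
  end.

Section Pairing.
Variables (I : finType) (D : satake I) (F : fieldType) (q : F).
Hypothesis q0 : q != 0.
Local Notation B := (B_alg D q).
Local Notation th := (Btheta D q).
Local Notation h := (Bh D q).
Local Notation hm := (Bh_mon D q).
Local Notation chi := (@chi I D F q).
Local Notation v_ := (vi D q).
Variables (Delta : B -> seq (B * B)) (phi : B -> B -> F).
Hypotheses (Delta_spec : is_coproduct Delta) (phi_spec : is_hopf_pairing Delta phi).
Local Notation cop := (cop Delta).
Local Notation rho := (rho Delta phi).
Local Notation lam := (lam Delta phi).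

Lemma rho_lin a : lin (rho a).
Proof. by rewrite /rho; lint. Qed.
Lemma lam_lin a : lin (lam a).
Proof. by rewrite /lam; lint. Qed.
Lemma rho_linl b : lin (rho^~ b). Proof. by rewrite /rho; lint. Qed.
Lemma lam_linl b : lin (lam^~ b). Proof. by rewrite /lam; lint. Qed.

Lemma phiC a b : phi a b = phi b a. Proof. exact: pairing_sym phi_spec a b. Qed.
Lemma phiMl a b x : phi (a * b) x = cop x (fun y z => phi a y * phi b z : F^o).
Proof. exact: (pairing_Ml phi_spec). Qed.
Lemma phiMr x a b : phi x (a * b) = cop x (fun y z => phi y a * phi z b : F^o).
Proof. exact: (pairing_Mr phi_spec). Qed.
Lemma eq_copF b (beta gam : B -> B -> F) : (forall x y, beta x y = gam x y) ->
  cop b (beta : B -> B -> F^o) = cop b (gam : B -> B -> F^o) :> F.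
Proof. by move=> bg; apply: eq_bigr => p _; apply: bg. Qed.
Lemma phiZr c a b : phi b (c *: a) = c * phi b a.
Proof. exact: linZ (phi_linr phi_spec b) c a. Qed.
Lemma phi_linE c a a' b : phi (c *: a + a') b = c * phi a b + phi a' b.
Proof. exact: phi_linl phi_spec b c a a'. Qed.
Lemma bil_phiphi a b : is_bilinear (fun x y => phi x a * phi y b : F^o).
Proof.
split=> c x y z; rewrite phi_linE.
  by transitivity (c * (phi x a * phi z b) + phi y a * phi z b) => //; ring.
by transitivity (c * (phi z a * phi x b) + phi z a * phi y b) => //; ring.
Qed.
Lemma phi_copr a b (beta : B -> B -> B) :
  phi a (cop b beta) = cop b (fun x y => phi a (beta x y) : F^o).
Proof. exact: (lin_cop (phi_linr phi_spec a)). Qed.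
Lemma phi0l b : phi 0 b = 0. Proof. exact: (lin0 (phi_linl phi_spec b)). Qed.
(** Left multiplication is adjoint to [lam]; inductions on the first argument of the pairing then
    only need to know [lam] at generators. *)
Lemma phiMll a b x : phi (a * b) x = phi b (lam a x).
Proof.
rewrite phiMl /lam phi_copr; apply: eq_copF => y z.
by rewrite phiZr [phi a y]phiC.
Qed.

(** The Hopf property of the pairing moves the coproduct from the product a b to the index c. At c =
    theta_i it becomes a skew Leibniz rule with two terms. *)
Lemma rho_M c a b :
  rho c (a * b) = cop c (fun c1 c2 => rho c1 a * rho c2 b).
Proof.
rewrite /rho (copM Delta_spec); last by lint.
transitivity (cop a (fun a1 a2 => cop c (fun c1 c2 => cop b (fun b1 b2 =>
    phi a2 c1 *: (phi b2 c2 *: (a1 * b1)))))).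
  apply: eq_cop => a1 a2; rewrite -[RHS]cop_swap; apply: eq_cop => b1 b2.
  by rewrite phiMl cop_scalel; apply: eq_cop => c1 c2; rewrite scalerA.
rewrite cop_swap; apply: eq_cop => c1 c2; rewrite copMr; apply: eq_cop => a1 a2.
rewrite copMl; apply: eq_cop => b1 b2.
by rewrite -scalerAl -scalerAr.
Qed.
Lemma lam_M c a b :
  lam c (a * b) = cop c (fun c1 c2 => lam c1 a * lam c2 b).
Proof.
rewrite /lam (copM Delta_spec); last by lint.
transitivity (cop a (fun a1 a2 => cop c (fun c1 c2 => cop b (fun b1 b2 =>
    phi a1 c1 *: (phi b1 c2 *: (a2 * b2)))))).
  apply: eq_cop => a1 a2; rewrite -[RHS]cop_swap; apply: eq_cop => b1 b2.
  by rewrite phiMl cop_scalel; apply: eq_cop => c1 c2; rewrite scalerA.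
rewrite cop_swap; apply: eq_cop => c1 c2; rewrite copMr; apply: eq_cop => a1 a2.
rewrite copMl; apply: eq_cop => b1 b2.
by rewrite -scalerAl -scalerAr.
Qed.

Lemma bil_rr a b : is_bilinear (fun x y => rho x a * rho y b).
Proof. by lint. Qed.
Lemma bil_ll a b : is_bilinear (fun x y => lam x a * lam y b).
Proof. by lint. Qed.

Lemma rho_thM i a b :
  rho (th i) (a * b) = rho (th i) a * rho 1 b + rho (h i) a * rho (th i) b.
Proof. by rewrite rho_M (cop_theta Delta_spec) //; apply: bil_rr. Qed.
Lemma lam_thM i a b :
  lam (th i) (a * b) = lam (th i) a * lam 1 b + lam (h i) a * lam (th i) b.
Proof. by rewrite lam_M (cop_theta Delta_spec) //; apply: bil_ll. Qed.
Lemma rho_1M a b : rho 1 (a * b) = rho 1 a * rho 1 b.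
Proof. by rewrite rho_M (cop1 Delta_spec) //; apply: bil_rr. Qed.
Lemma lam_1M a b : lam 1 (a * b) = lam 1 a * lam 1 b.
Proof. by rewrite lam_M (cop1 Delta_spec) //; apply: bil_ll. Qed.
Lemma rho_hmM mu a b : rho (hm mu) (a * b) = rho (hm mu) a * rho (hm mu) b.
Proof. by rewrite rho_M (cop_hm Delta_spec) //; apply: bil_rr. Qed.
Lemma lam_hmM mu a b : lam (hm mu) (a * b) = lam (hm mu) a * lam (hm mu) b.
Proof. by rewrite lam_M (cop_hm Delta_spec) //; apply: bil_ll. Qed.

Lemma phi_th_th i j : phi (th i) (th j) = (i == j)%:R * (v_ i - (v_ i)^-1).
Proof. exact: (pairing_theta phi_spec). Qed.
Lemma phi_1l b : phi 1 b = counit b. Proof. exact: (pairing_1l phi_spec). Qed.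
Lemma phi_th1 i : phi (th i) 1 = 0. Proof. by rewrite phiC phi_1l counit_theta. Qed.
Lemma phi_11 : phi 1 1 = 1. Proof. by rewrite phi_1l (ahom1 (counitH D q)). Qed.
Lemma phi_hm1 mu : phi (hm mu) 1 = 1.
Proof.
rewrite phiC phi_1l; elim/lattice_ind: mu => [|mu i IH|mu i IH].
- by rewrite hm0 (ahom1 (counitH D q)).
- by rewrite hmD hm_alpha (ahomM (counitH D q)) IH counit_h mulr1.
- by rewrite hmD hm_alphaN (ahomM (counitH D q)) IH counit_hV mulr1.
Qed.

Lemma rho_1l b : rho b 1 = phi 1 b *: 1.
Proof. by rewrite /rho (cop1 Delta_spec) //; lint. Qed.
Lemma lam_1l b : lam b 1 = phi 1 b *: 1.
Proof. by rewrite /lam (cop1 Delta_spec) //; lint. Qed.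
Lemma rho_thE a i : rho a (th i) = phi 1 a *: th i + phi (th i) a *: h i.
Proof. by rewrite /rho (cop_theta Delta_spec) //; lint. Qed.
Lemma lam_thE a i : lam a (th i) = phi (th i) a *: 1 + phi (h i) a *: th i.
Proof. by rewrite /lam (cop_theta Delta_spec) //; lint. Qed.
Lemma rho_hmE a mu : rho a (hm mu) = phi (hm mu) a *: hm mu.
Proof. by rewrite /rho (cop_hm Delta_spec) //; lint. Qed.
Lemma lam_hmE a mu : lam a (hm mu) = phi (hm mu) a *: hm mu.
Proof. by rewrite /lam (cop_hm Delta_spec) //; lint. Qed.

Lemma rho1 b : rho 1 b = b.
Proof.
elim/B_ind: b => [|c x y IHx IHy|i b IH|i b IH|i b IH].
- by rewrite rho_1l phi_11 scale1r.
- by rewrite (rho_lin 1) IHx IHy.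
- by rewrite rho_1M IH rho_thE phi_11 phi_th1 scale1r scale0r addr0.
- by rewrite rho_1M IH -hm_alpha rho_hmE phi_hm1 scale1r.
- by rewrite rho_1M IH -hm_alphaN // rho_hmE phi_hm1 scale1r.
Qed.
Lemma lam1 b : lam 1 b = b.
Proof.
elim/B_ind: b => [|c x y IHx IHy|i b IH|i b IH|i b IH].
- by rewrite lam_1l phi_11 scale1r.
- by rewrite (lam_lin 1) IHx IHy.
- by rewrite lam_1M IH lam_thE -hm_alpha phi_hm1 phi_th1 scale1r scale0r add0r.
- by rewrite lam_1M IH -hm_alpha lam_hmE phi_hm1 scale1r.
- by rewrite lam_1M IH -hm_alphaN // lam_hmE phi_hm1 scale1r.
Qed.

(** Both operators consume legs of an iterated coproduct, from opposite ends: this makes [rho] a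
    left action, [lam] a right action, and lets the two commute. *)
Lemma rho_mul a b x : rho (a * b) x = rho a (rho b x).
Proof.
rewrite {3}/rho (lin_cop (rho_lin a)) {1}/rho.
transitivity (cop x (fun x1 y => cop y (fun y1 y2 => phi y1 a *: (phi y2 b *: x1)))).
  apply: eq_cop => y z; rewrite phiMr cop_scalel.
  by apply: eq_cop => s t; rewrite scalerA.
rewrite -(copA Delta_spec x (g := fun x1 y1 y2 => phi y1 a *: (phi y2 b *: x1)));
  last by lint.
apply: eq_cop => y z; rewrite (linZ (rho_lin a)) -copZ.
by apply: eq_cop => s t; rewrite !scalerA mulrC.
Qed.
Lemma lam_mul a b x : lam (a * b) x = lam b (lam a x).
Proof.
rewrite {3}/lam (lin_cop (lam_lin b)) {1}/lam.
transitivity (cop x (fun y z => cop y (fun y1 y2 => phi y1 a *: (phi y2 b *: z)))).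
  apply: eq_cop => y z; rewrite phiMr cop_scalel.
  by apply: eq_cop => s t; rewrite scalerA.
rewrite (copA Delta_spec x (g := fun y1 y2 z => phi y1 a *: (phi y2 b *: z)));
  last by lint.
by apply: eq_cop => y z; rewrite (linZ (lam_lin b)) copZ.
Qed.
Lemma rho_lam a b x : rho a (lam b x) = lam b (rho a x).
Proof.
rewrite {1}/lam (lin_cop (rho_lin a)) {2}/rho (lin_cop (lam_lin b)).
transitivity (cop x (fun y z => cop z (fun z1 z2 => phi y b *: (phi z2 a *: z1)))).
  by apply: eq_cop => y z; rewrite (linZ (rho_lin a)) copZ.
rewrite -(copA Delta_spec x (g := fun y z1 z2 => phi y b *: (phi z2 a *: z1)));
  last by lint.
apply: eq_cop => y z; rewrite (linZ (lam_lin b)) -copZ.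
by apply: eq_cop => s t; rewrite !scalerA mulrC.
Qed.

Lemma rho_theta i a b :
  rho (th i) (a * b) = rho (th i) a * b + rho (h i) a * rho (th i) b.
Proof. by rewrite rho_thM; congr (_ * _ + _); apply: rho1. Qed.
Lemma lam_theta i a b :
  lam (th i) (a * b) = lam (th i) a * b + lam (h i) a * lam (th i) b.
Proof. by rewrite lam_thM; congr (_ * _ + _); apply: lam1. Qed.

Lemma phi_hmM mu a b : phi (hm mu) (a * b) = phi (hm mu) a * phi (hm mu) b.
Proof. by rewrite phiMr (cop_hm Delta_spec) //; apply: bil_phiphi. Qed.
(** As h_mu is grouplike, pairing with it is multiplicative; its value 1 at h_k h_k^-1 then
    determines it at the inverses, for which the specification gives no value. *)
Lemma phi_hm_hm mu nu : phi (hm mu) (hm nu) = chi mu nu.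
Proof.
have hh i : forall nu, phi (hm nu) (h i) = chi nu (alpha i).
  elim/lattice_ind => [|mu' k IH|mu' k IH].
  - by rewrite hm0 phi_1l counit_h chi0l.
  - rewrite phiC hmD // hm_alpha -{1}(hm_alpha _ _ i) phi_hmM hm_alpha phiC IH.
    by rewrite (pairing_h phi_spec) chiDl // -chi_alpha // (chiC D q (alpha k)).
  - rewrite phiC hmD // hm_alphaN // -{1}(hm_alpha _ _ i) phi_hmM hm_alpha phiC IH.
    rewrite chiDl // chiNl //; congr (_ * _).
    have := phi_hm1 (alpha i); rewrite -(Bh_V D q k) phi_hmM hm_alpha.
    rewrite -> (pairing_h phi_spec); rewrite -chi_alpha // chiC => /(canRL (mulKf _)) ->.
      by rewrite mulr1.
    exact: chi_neq0.
elim/lattice_ind: nu => [|nu k IH|nu k IH].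
- by rewrite hm0 phi_hm1 chi0r.
- by rewrite hmD // hm_alpha phi_hmM IH hh chiDr.
- rewrite hmD // hm_alphaN // phi_hmM IH chiDr // chiNr //; congr (_ * _).
  have := phi_hm1 mu; rewrite -(Bh_V D q k) phi_hmM hh => /(canRL (mulKf _)) ->.
    by rewrite mulr1.
  exact: chi_neq0.
Qed.
(** At an inverse the value is forced by 0 = phi(theta_i, h_k h_k^-1): one summand contains
    phi(theta_i, h_k) = 0, and in the other the factor phi(h_i, h_k) is nonzero. *)
Lemma phi_th_hm i mu : phi (th i) (hm mu) = 0.
Proof.
have thM a b : phi (th i) (a * b) = phi (th i) a * phi 1 b + phi (h i) a * phi (th i) b.
  by rewrite phiMr (cop_theta Delta_spec) //; apply: bil_phiphi.
elim/lattice_ind: mu => [|mu k IH|mu k IH].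
- by rewrite hm0 phi_th1.
- rewrite hmD // thM;
  rewrite -> IH;
  rewrite hm_alpha;
  rewrite -> (pairing_theta_h phi_spec);
  by rewrite mul0r mulr0 addr0.
- rewrite hmD // hm_alphaN // thM; rewrite -> IH; rewrite mul0r add0r.
  have := phi_th1 i; rewrite -(Bh_V D q k);
  rewrite -> thM, -> (pairing_theta_h phi_spec);
  rewrite mul0r add0r.
  rewrite -!hm_alpha phi_hm_hm => /eqP; rewrite mulf_eq0 (negbTE (chi_neq0 _ _ _ _)) //=.
  by move=> /eqP ->; rewrite mulr0.
Qed.
Lemma phi_th_h i j : phi (th i) (h j) = 0.
Proof. exact: (pairing_theta_h phi_spec). Qed.

Lemma rho_theta_th i j : rho (th i) (th j) = ((i == j)%:R * (v_ i - (v_ i)^-1)) *: h j.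
Proof.
rewrite rho_thE; rewrite -> phiC, -> phi_th1; rewrite scale0r add0r phi_th_th eq_sym.
by case: eqP => [->|_] //; rewrite !mul0r.
Qed.
Lemma lam_theta_th i j : lam (th i) (th j) = ((i == j)%:R * (v_ i - (v_ i)^-1)) *: 1.
Proof.
rewrite lam_thE [phi (h j) _]phiC; rewrite -> phi_th_h; rewrite scale0r addr0 phi_th_th eq_sym.
by case: eqP => [->|_] //; rewrite !mul0r.
Qed.
Lemma rho_theta_hm i mu : rho (th i) (hm mu) = 0.
Proof. by rewrite rho_hmE phiC phi_th_hm scale0r. Qed.
Lemma lam_theta_hm i mu : lam (th i) (hm mu) = 0.
Proof. by rewrite lam_hmE phiC phi_th_hm scale0r. Qed.
Lemma rho_hm_th mu j : rho (hm mu) (th j) = th j.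
Proof. by rewrite rho_thE phi_th_hm scale0r addr0 phiC phi_hm1 scale1r. Qed.
Lemma lam_hm_th mu j : lam (hm mu) (th j) = chi mu (alpha j) *: th j.
Proof.
by rewrite lam_thE phi_th_hm scale0r add0r -hm_alpha phi_hm_hm chiC.
Qed.
Lemma rho_hm_hm mu nu : rho (hm mu) (hm nu) = chi mu nu *: hm nu.
Proof. by rewrite rho_hmE phi_hm_hm chiC. Qed.
Lemma lam_hm_hm mu nu : lam (hm mu) (hm nu) = chi mu nu *: hm nu.
Proof. by rewrite lam_hmE phi_hm_hm chiC. Qed.

End Pairing.

(** * Two actions of the quantum group on B *)

Section Representations.
Variables (I : finType) (D : satake I) (F : fieldType) (q : F).
Hypothesis q0 : q != 0.
Local Notation B := (B_alg D q).
Local Notation U := (U_alg D q).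
Local Notation th := (Btheta D q).
Local Notation h := (Bh D q).
Local Notation hV := (BhV D q).
Local Notation hm := (Bh_mon D q).
Local Notation chi := (@chi I D F q).
Local Notation v_ := (vi D q).
Variables (Delta : B -> seq (B * B)) (phi : B -> B -> F).
Hypotheses (Delta_spec : is_coproduct Delta) (phi_spec : is_hopf_pairing Delta phi).
Local Notation cop := (cop Delta).
Local Notation rho := (rho Delta phi).
Local Notation lam := (lam Delta phi).
Local Notation w_ i := (v_ i - (v_ i)^-1).

Let rhoL a : lin (rho a) := rho_lin Delta_spec phi_spec a.
Let lamL a : lin (lam a) := lam_lin Delta_spec phi_spec a.

Lemma rho_th_thM i j b : rho (th i) (th j * b) =
  ((i == j)%:R * w_ i) *: (h j * b) + th j * rho (th i) b.
Proof.
rewrite (rho_theta Delta_spec phi_spec) (rho_theta_th Delta_spec phi_spec).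
by rewrite -scalerAl -(hm_alpha _ _ i) (rho_hm_th _ Delta_spec phi_spec).
Qed.
Lemma rho_th_hmM i mu b : rho (th i) (hm mu * b) =
  chi (alpha i) mu *: (hm mu * rho (th i) b).
Proof.
rewrite (rho_theta Delta_spec phi_spec) (rho_theta_hm q0 Delta_spec phi_spec).
rewrite mul0r add0r -(hm_alpha _ _ i) (rho_hm_hm q0 Delta_spec phi_spec).
by rewrite -scalerAl.
Qed.
Lemma lam_th_thM i j b : lam (th i) (th j * b) =
  ((i == j)%:R * w_ i) *: b + chi (alpha i) (alpha j) *: (th j * lam (th i) b).
Proof.
rewrite (lam_theta Delta_spec phi_spec) (lam_theta_th Delta_spec phi_spec).
by rewrite -scalerAl mul1r -(hm_alpha _ _ i) (lam_hm_th q0 Delta_spec phi_spec) -scalerAl.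
Qed.
Lemma lam_th_hmM i mu b : lam (th i) (hm mu * b) =
  chi (alpha i) mu *: (hm mu * lam (th i) b).
Proof.
rewrite (lam_theta Delta_spec phi_spec) (lam_theta_hm q0 Delta_spec phi_spec).
rewrite mul0r add0r -(hm_alpha _ _ i) (lam_hm_hm q0 Delta_spec phi_spec).
by rewrite -scalerAl.
Qed.
Lemma rho_hm_thM mu j b : rho (hm mu) (th j * b) = th j * rho (hm mu) b.
Proof. by rewrite (rho_hmM Delta_spec phi_spec) (rho_hm_th q0 Delta_spec phi_spec). Qed.
Lemma rho_hm_hmM mu nu b : rho (hm mu) (hm nu * b) = chi mu nu *: (hm nu * rho (hm mu) b).
Proof.
by rewrite (rho_hmM Delta_spec phi_spec) (rho_hm_hm q0 Delta_spec phi_spec) -scalerAl.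
Qed.
Lemma lam_hm_thM mu j b :
  lam (hm mu) (th j * b) = chi mu (alpha j) *: (th j * lam (hm mu) b).
Proof.
by rewrite (lam_hmM Delta_spec phi_spec) (lam_hm_th q0 Delta_spec phi_spec) -scalerAl.
Qed.
Lemma lam_hm_hmM mu nu b : lam (hm mu) (hm nu * b) = chi mu nu *: (hm nu * lam (hm mu) b).
Proof.
by rewrite (lam_hmM Delta_spec phi_spec) (lam_hm_hm q0 Delta_spec phi_spec) -scalerAl.
Qed.

Let nt : nontrivial B := algType_nontrivial B.
Local Notation E := (endo nt).
Definition Lop (a : B) : E := Endo nt (lin_mull a (@lin_id F B)).
Definition rhoE (a : B) : E := Endo nt (rhoL a).
Definition lamE (a : B) : E := Endo nt (lamL a).
Lemma LopE a b : Lop a b = a * b. Proof. by []. Qed.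
Lemma Lop_ahom : ahom Lop.
Proof.
split=> [s a b||a b]; apply: endo_eq => x; rewrite ?endoE /= ?mul1r ?mulrA //.
by rewrite mulrDl scalerAl.
Qed.
Lemma rhoE_ahom : ahom rhoE.
Proof.
split=> [s a b||a b]; apply: endo_eq => x; rewrite ?endoE /=.
- exact: (rho_linl phi_spec x).
- exact: (rho1 Delta_spec phi_spec).
- exact: (rho_mul Delta_spec phi_spec).
Qed.
Lemma lamE_lin : lin lamE.
Proof.
by move=> s a b; apply: endo_eq => x; rewrite ?endoE /=; exact: (lam_linl phi_spec x).
Qed.
Lemma lamE1 : lamE 1 = 1.
Proof. by apply: endo_eq => x; exact: (lam1 Delta_spec phi_spec). Qed.
Lemma lamE_mul a b : lamE (a * b) = lamE b * lamE a.
Proof. by apply: endo_eq => x; exact: (lam_mul Delta_spec phi_spec). Qed.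
Lemma rhoE_lamE a b : rhoE a * lamE b = lamE b * rhoE a.
Proof. by apply: endo_eq => x; exact: (rho_lam Delta_spec phi_spec). Qed.

Lemma hV_theta i j : hV i * th j = chi (- alpha i) (alpha j) *: (th j * hV i).
Proof. by rewrite -hm_alphaN hm_theta. Qed.

Lemma serre_th_hV i j : i != j -> serre D q (fun k => th k * hV k) i j = 0.
Proof.
move=> ij; rewrite (@serre_twist _ _ _ _ _ th hV
  (fun i j => chi (- alpha i) (alpha j)) hV_theta) => [|k l|k l].
- by rewrite Btheta_serre // mul0r scaler0.
- by rewrite -!hm_alphaN hmC.
- by rewrite !chiNl chiC.
Qed.

(* The antipode is not constructed; [nu] is the action of its values. *)
Lemma nu_rels : B_rels D q (fun i => - lamE (th i * hV i))
  (fun i => lamE (hV i)) (fun i => lamE (h i)).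
Proof.
split=> [i j ij|i|i|i j|i j].
- have [s ->] : exists s, serre D q (fun i => - lamE (th i * hV i)) i j =
      s *: serre D q (lamE \o (fun k => th k * hV k)) i j.
    have [s sE] := serre_scale D q (lamE \o (fun k => th k * hV k)) (fun=> -1) i j.
    by exists s; rewrite -sE; apply: serre_eq => k; rewrite /= scaleN1r.
  have := serre_anti D q (fun k => th k * hV k) i j lamE_lin lamE1 lamE_mul.
  rewrite (serre_th_hV ij) (lin0 lamE_lin) => /esym/eqP.
  by rewrite scaler_eq0 signr_eq0 /= => /eqP ->; rewrite scaler0.
- by rewrite -lamE_mul Bh_V lamE1.
- by rewrite -lamE_mul BhV_h lamE1.
- rewrite <- !lamE_mul; by rewrite -!hm_alphaN hmC.
- rewrite mulrN mulNr -!lamE_mul scalerN; congr (- _).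
  rewrite [hV i * _]mulrA;
  rewrite -> hV_theta;
  rewrite -!scalerAl (linZ lamE_lin) scalerA -chi_alpha //.
  rewrite chiNl // mulfV ?chi_neq0 //; rewrite -> scale1r; rewrite -!mulrA; congr (lamE (_ * _)).
  by rewrite -!hm_alphaN hmC.
Qed.
Definition nu : B -> E := B_lift nu_rels.
Lemma nuH : ahom nu. Proof. exact: B_liftH. Qed.
Lemma nu_th i : nu (th i) = - lamE (th i * hV i). Proof. exact: B_lift_theta. Qed.
Lemma nu_h i : nu (h i) = lamE (hV i). Proof. exact: B_lift_h. Qed.
Lemma nu_hV i : nu (hV i) = lamE (h i). Proof. exact: B_lift_hV. Qed.
Lemma rhoE_nu a b : rhoE a * nu b = nu b * rhoE a.
Proof.
elim/B_ind: b => [|s x y IHx IHy|i b IH|i b IH|i b IH].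
- by rewrite (ahom1 nuH) mul1r mulr1.
- by rewrite (ahomL nuH) mulrDr mulrDl -scalerAr -scalerAl IHx IHy.
- by rewrite (ahomM nuH) mulrA nu_th mulrN rhoE_lamE mulNr -mulrA IH -mulNr mulrA.
- by rewrite (ahomM nuH) mulrA nu_h rhoE_lamE -mulrA IH mulrA.
- by rewrite (ahomM nuH) mulrA nu_hV rhoE_lamE -mulrA IH mulrA.
Qed.
(** An adjoint type action. It is multiplicative in [a] because [rhoE] and [nu] are representations
    whose images commute; at theta_i it is a difference of the two skew derivations. *)
Definition Om (a : B) : E := cop a (fun x y => rhoE x * nu y).
Lemma Om_bil : is_bilinear (fun x y => rhoE x * nu y).
Proof.
by apply: bilP => z; [apply: lin_mulr; exact: ahomL rhoE_ahom
                     |apply: lin_mull; exact: ahomL nuH].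
Qed.
Lemma OmH : ahom Om.
Proof.
split=> [||a b]; first exact: (cop_lin Delta_spec Om_bil).
  by rewrite /Om (cop1 Delta_spec Om_bil) (ahom1 rhoE_ahom) (ahom1 nuH) mulr1.
rewrite /Om (copM Delta_spec _ _ Om_bil) copMr; apply: eq_cop => a1 a2.
rewrite copMl; apply: eq_cop => b1 b2; rewrite (ahomM rhoE_ahom) (ahomM nuH).
by rewrite -!mulrA; congr (_ * _); rewrite !mulrA rhoE_nu.
Qed.
Lemma Om_thE i b : Om (th i) b =
  rho (th i) b - rho (hm (alpha i)) (lam (hm (- alpha i)) (lam (th i) b)).
Proof.
rewrite /Om (cop_theta Delta_spec _ Om_bil) (ahom1 nuH); rewrite -> mulr1; rewrite nu_th lamE_mul.
by rewrite mulrN hm_alpha hm_alphaN.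
Qed.

Definition K'op mu : E := lamE (hm (- mu)) * rhoE (hm mu).
Lemma K'opE mu b : K'op mu b = lam (hm (- mu)) (rho (hm mu) b). Proof. by []. Qed.

(** On the letter theta_i one skew derivation leaves h_i b and the other [K'op]; on the remaining
    factor the Cartan twists cancel. This is the commutator of E and F in the representation. *)
Lemma Om_th_thM i j b : Om (th j) (th i * b) =
  th i * Om (th j) b + ((i == j)%:R * w_ i) *: (h i * b - K'op (alpha i) b).
Proof.
rewrite !Om_thE rho_th_thM lam_th_thM.
rewrite !(linD (lamL _)) !(linZ (lamL _)) !(linD (rhoL _)) !(linZ (rhoL _)).
rewrite lam_hm_thM // (linZ (rhoL _)) rho_hm_thM scalerA -chiDl // subrr chi0l scale1r.
have G (s : F) (x y z t : B) : s *: x + y - (s *: z + t) = (y - t) + s *: (x - z).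
  by rewrite scalerBr opprD addrACA addrC.
rewrite K'opE G -mulrBr; case: (eqVneq j i) => [->|ji].
  by rewrite (rho_lam Delta_spec phi_spec (hm (alpha i)) (hm (- alpha i)) b).
by rewrite !mul0r !scale0r.
Qed.

(** A Verma type module on the space B: E_i and K_i act by left multiplication, while every F_i
    kills the vector 1 and every K'_i fixes it. Its twist [plus] by [omega] exchanges the two
    halves. *)
Lemma minus_rels : U_rels D q (fun i => Lop (th i)) (fun i => Om (th i))
  (fun i => Lop (h i)) (fun i => Lop (hV i))
  (fun i => K'op (alpha i)) (fun i => K'op (- alpha i)).
Proof.
have K'opD mu mu' : K'op (mu + mu') = K'op mu * K'op mu'.
  rewrite /K'op opprD [- mu - mu']addrC !hmD // lamE_mul (ahomM rhoE_ahom).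
  rewrite -!mulrA; congr (_ * _); rewrite !mulrA; congr (_ * _).
  exact: esym (rhoE_lamE _ _).
have K'op0 : K'op 0 = 1.
  by rewrite /K'op oppr0 hm0 lamE1 (ahom1 rhoE_ahom) mulr1.
have LK' i mu : Lop (h i) * K'op mu = K'op mu * Lop (h i).
  apply: endo_eq => b; change (h i * K'op mu b = K'op mu (h i * b)).
  rewrite !K'opE -!hm_alpha rho_hm_hmM.
  by rewrite (linZ (lamL _)) lam_hm_hmM scalerA -chiDl // subrr chi0l scale1r.
split=> [i|i|i|i|i j|i j|i j|i j|i j|i j|i j|i j|i j ij|i j ij]; cbv beta.
- by rewrite -(ahomM Lop_ahom) Bh_V (ahom1 Lop_ahom).
- by rewrite -(ahomM Lop_ahom) BhV_h (ahom1 Lop_ahom).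
- by rewrite -K'opD subrr.
- by rewrite -K'opD addNr.
- rewrite <- !(ahomM Lop_ahom); by rewrite Bh_h.
- exact: LK'.
- by rewrite -!K'opD addrC.
- apply: endo_eq => b; rewrite !endoE; rewrite -> !LopE; rewrite Om_th_thM opprD addNKr.
  by rewrite -scaleNr -mulrN opprB.
- rewrite <- !(ahomM Lop_ahom); by rewrite Bh_theta (ahomZ Lop_ahom).
- apply: endo_eq => b; rewrite !endoE !LopE !Om_thE -!hm_alpha rho_th_hmM lam_th_hmM.
  rewrite (linZ (lamL _)) (linZ (rhoL _)) lam_hm_hmM (linZ (rhoL _)) rho_hm_hmM !scalerA.
  rewrite -!chiDl // addrN add0r -scalerBr -mulrBr scalerA -invr_expz -chi_alpha //.
  by rewrite chiC mulVf ?scale1r // chi_neq0.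
- apply: endo_eq => b; rewrite !endoE /= rho_hm_thM lam_hm_thM.
  by rewrite chiNl // chi_alpha // invr_expz.
- apply: endo_eq => b; rewrite !endoE !Om_thE /=.
  rewrite !(linB (rhoL _)) !(linB (lamL _)) -!(rho_lam Delta_spec phi_spec).
  rewrite -!(rho_mul Delta_spec phi_spec) -!(lam_mul Delta_spec phi_spec).
  rewrite (hm_theta D q0) (linZ (rho_linl phi_spec _)) chi_alpha // scalerBr; congr (_ - _).
  rewrite (hmC D q (alpha j)) [hm (- alpha i) * _]mulrA (hm_theta D q0) -scalerAl.
  rewrite (linZ (lam_linl phi_spec _)) (linZ (rhoL _)) scalerA -chi_alpha // chiNl //.
  by rewrite mulfV ?scale1r -?mulrA ?chi_neq0 // (hmC D q (- alpha i)).
- by rewrite -(serre_ahom _ _ _ _ _ Lop_ahom) Btheta_serre // (ahom0 Lop_ahom).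
- by rewrite -(serre_ahom _ _ _ _ _ OmH) Btheta_serre // (ahom0 OmH).
Qed.

Definition minus : U -> E := U_lift minus_rels.
Lemma minusH : ahom minus. Proof. exact: U_liftH. Qed.
Lemma minusM x y b : minus (x * y) b = minus x (minus y b).
Proof. by rewrite (ahomM minusH). Qed.
Lemma minus_bplus a b : minus (bplus a) b = a * b.
Proof.
apply: (congr1 (@efun _ _ _ ^~ b)
  (B_ahom_eq (ahom_comp (bplusH D q) minusH) Lop_ahom _ _ _ a)) => i /=.
- by rewrite bplus_theta [LHS]U_liftE.
- by rewrite bplus_h [LHS]U_liftK.
- by rewrite bplus_hV [LHS]U_liftKV.
Qed.
(** The image of a acts by left multiplication with a, hence returns a when applied to the vector
    1. *)
Lemma bplus_inj : injective (@bplus I D F q).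
Proof. by move=> a b ab; rewrite -[a]mulr1 -minus_bplus ab minus_bplus mulr1. Qed.
Lemma minus_F i b : minus (UF D q i) b =
  rho (th i) b - rho (hm (alpha i)) (lam (hm (- alpha i)) (lam (th i) b)).
Proof. by rewrite [minus _]U_liftF Om_thE. Qed.

Definition plus (u : U) : E := minus (omega u).
Lemma plusH : ahom plus. Proof. exact: ahom_comp (omegaH D q) minusH. Qed.
Lemma plusM x y b : plus (x * y) b = plus x (plus y b).
Proof. by rewrite (ahomM plusH). Qed.
Lemma plus_bminus a b : plus (bminus a) b = a * b.
Proof. by rewrite /plus omega_bminus minus_bplus. Qed.
Lemma plus_F i b : plus (UF D q i) b = th i * b.
Proof. by rewrite -bminus_theta plus_bminus. Qed.
Lemma plus_E i b : plus (UE D q i) b =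
  rho (th i) b - rho (hm (alpha i)) (lam (hm (- alpha i)) (lam (th i) b)).
Proof. by rewrite /plus omega_E minus_F. Qed.
Lemma plus_K'm mu b : plus (UK'_mon D q mu) b = hm mu * b.
Proof. by rewrite -bminus_hm plus_bminus. Qed.
Lemma plus_K i b : plus (UK D q i) b = lam (hm (- alpha i)) (rho (hm (alpha i)) b).
Proof. by rewrite /plus omega_K [minus _]U_liftK'. Qed.
Lemma plus_KV i b : plus (UKV D q i) b = lam (hm (alpha i)) (rho (hm (- alpha i)) b).
Proof. by rewrite /plus omega_KV [minus _]U_liftK'V K'opE opprK. Qed.
End Representations.

(** * Weights, and f inside B *)

Section Weights.
Variables (I : finType) (D : satake I) (F : fieldType) (q : F).
Hypothesis q0 : q != 0.
Local Notation B := (B_alg D q).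
Local Notation th := (Btheta D q).
Local Notation hV := (BhV D q).
Local Notation hm := (Bh_mon D q).
Local Notation chi := (@chi I D F q).
Local Notation c := (cartan D).
Local Notation tau := (tau D).
Local Notation ltau := (lat_map tau).

Lemma B_indm (P : B -> Prop) :
  P 1 -> (forall c x y, P x -> P y -> P (c *: x + y)) ->
  (forall i x, P x -> P (th i * x)) -> (forall mu x, P x -> P (hm mu * x)) ->
  forall x, P x.
Proof.
move=> P1 PL Pt Ph; apply: B_ind => // i x Px; first by rewrite -hm_alpha; apply: Ph.
by rewrite -hm_alphaN; apply: Ph.
Qed.

(** Weight is a relation: 0 has every weight and Cartan elements have weight 0. That a nonzero
    element has at most one weight is proved later from eigenvalues ([W_unique]). *)
Inductive W : lattice I -> B -> Prop :=
| W_0 mu : W mu 0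
| W_1 : W 0 1
| W_lin mu s x y : W mu x -> W mu y -> W mu (s *: x + y)
| W_th mu i x : W mu x -> W (mu + alpha i) (th i * x)
| W_h mu nu x : W mu x -> W mu (hm nu * x).

Lemma W_add mu x y : W mu x -> W mu y -> W mu (x + y).
Proof. by move=> Wx Wy; rewrite -[x]scale1r; apply: W_lin. Qed.
Lemma W_scale mu s x : W mu x -> W mu (s *: x).
Proof. by move=> Wx; rewrite -[_ *: _]addr0; apply: W_lin => //; apply: W_0. Qed.
Lemma W_eq mu nu x : W mu x -> mu = nu -> W nu x.
Proof. by move=> Wx <-. Qed.
Lemma W_theta i : W (alpha i) (th i).
Proof. by rewrite -[th i]mulr1 -[alpha i]add0r; apply/W_th/W_1. Qed.
Lemma W_hm mu : W 0 (hm mu).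
Proof. by rewrite -[hm mu]mulr1; apply/W_h/W_1. Qed.
Lemma W_mul mu nu x y : W mu x -> W nu y -> W (mu + nu) (x * y).
Proof.
move=> Wx Wy; elim: Wx => {mu x} [mu||mu s x z _ IHx _ IHz|mu i x _ IHx|mu nu' x _ IHx].
- by rewrite mul0r; apply: W_0.
- by rewrite mul1r add0r.
- by rewrite mulrDl -scalerAl; apply: W_lin.
- by rewrite -mulrA addrAC; apply: W_th.
- by rewrite -mulrA; apply: W_h.
Qed.
Lemma W_tau mu x : W mu x -> W (ltau mu) (tauB x).
Proof.
elim=> {mu x} [mu||mu s x z _ IHx _ IHz|mu i x _ IHx|mu nu' x _ IHx].
- by rewrite (ahom0 (tauBH D q)); apply: W_0.
- by rewrite (ahom1 (tauBH D q)) lat_map0; apply: W_1.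
- by rewrite (ahomL (tauBH D q)); apply: W_lin.
- by rewrite (ahomM (tauBH D q)) tauB_theta lat_mapD lat_map_alpha; apply: W_th.
- by rewrite (ahomM (tauBH D q)) tauB_hm; apply: W_h.
Qed.
Lemma W_comm mu nu x : W mu x -> hm nu * x = chi nu mu *: (x * hm nu).
Proof.
elim=> {mu x} [mu||mu s x z _ IHx _ IHz|mu i x _ IHx|mu nu' x _ IHx].
- by rewrite mulr0 mul0r scaler0.
- by rewrite mulr1 mul1r chi0r scale1r.
- by rewrite mulrDr mulrDl -scalerAr -scalerAl IHx IHz scalerDr !scalerA mulrC.
- by rewrite mulrA hm_theta // -scalerAl -[_ * hm nu * x]mulrA IHx -scalerAr
    scalerA mulrA chiDr // mulrC.
- by rewrite mulrA hmC -mulrA IHx -scalerAr mulrA.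
Qed.
Lemma W_conj mu nu x : W mu x -> hm nu * x * hm (- nu) = chi nu mu *: x.
Proof. by move=> /(W_comm nu) ->; rewrite -scalerAl -mulrA hmN mulr1. Qed.

Definition isf (b : B) := exists x, b = f_iota x.
Lemma isf1 : isf 1. Proof. by exists 1; rewrite (ahom1 (f_iotaH D q)). Qed.
Lemma isf_lin s x y : isf x -> isf y -> isf (s *: x + y).
Proof.
by move=> [a ->] [b ->]; exists (s *: a + b); rewrite (ahomL (f_iotaH D q)).
Qed.
Lemma isfM x y : isf x -> isf y -> isf (x * y).
Proof. by move=> [a ->] [b ->]; exists (a * b); rewrite (ahomM (f_iotaH D q)). Qed.
Lemma isfZ s x : isf x -> isf (s *: x).
Proof. by move=> [a ->]; exists (s *: a); rewrite (ahomZ (f_iotaH D q)). Qed.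
Lemma isfD x y : isf x -> isf y -> isf (x + y).
Proof. by move=> fx fy; rewrite -[x]scale1r; apply: isf_lin. Qed.
Lemma isfB x y : isf x -> isf y -> isf (x - y).
Proof. by move=> fx fy; rewrite -scaleN1r addrC; apply: isf_lin. Qed.
Lemma isf0 : isf 0. Proof. by rewrite -(scale0r 1); apply/isfZ/isf1. Qed.
Lemma isf_th i : isf (th i).
Proof. by exists (theta D q i); rewrite f_iota_theta. Qed.
Lemma isf_ind (P : B -> Prop) : P 1 ->
  (forall s x y, isf x -> isf y -> P x -> P y -> P (s *: x + y)) ->
  (forall i x, isf x -> P x -> P (th i * x)) -> forall x, isf x -> P x.
Proof.
move=> P1 PL Pt x [a ->]; elim/f_ind: a => [|s a b Pa Pb|i a Pa].
- by rewrite (ahom1 (f_iotaH D q)).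
- by rewrite (ahomL (f_iotaH D q)); apply: PL => //; [exists a|exists b].
- by rewrite (ahomM (f_iotaH D q)) f_iota_theta; apply: Pt => //; exists a.
Qed.
Lemma isf_conj nu x : isf x -> isf (hm nu * x * hm (- nu)).
Proof.
elim/isf_ind => [|s y z _ _ IHy IHz|i y _ IHy].
- by rewrite mulr1 hmN; apply: isf1.
- by rewrite mulrDr mulrDl -scalerAr -scalerAl; apply: isf_lin.
- rewrite mulrA hm_theta // -scalerAl -scalerAl -!mulrA; apply/isfZ/isfM.
    exact: isf_th.
  by rewrite mulrA.
Qed.
Lemma isf_tau x : isf x -> isf (tauB x).
Proof.
elim/isf_ind => [|s y z _ _ IHy IHz|i y _ IHy].
- by rewrite (ahom1 (tauBH D q)); apply: isf1.
- by rewrite (ahomL (tauBH D q)); apply: isf_lin.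
- by rewrite (ahomM (tauBH D q)) tauB_theta; apply: isfM => //; apply: isf_th.
Qed.

Variables (Delta : B -> seq (B * B)) (phi : B -> B -> F).
Hypotheses (Delta_spec : is_coproduct Delta) (phi_spec : is_hopf_pairing Delta phi).
Local Notation rho := (rho Delta phi).
Local Notation lam := (lam Delta phi).
Let rhoL a : lin (rho a) := rho_lin Delta_spec phi_spec a.
Let lamL a : lin (lam a) := lam_lin Delta_spec phi_spec a.
Local Notation rho_th_thM := (rho_th_thM q0 Delta_spec phi_spec).
Local Notation lam_th_thM := (lam_th_thM q0 Delta_spec phi_spec).
Local Notation rho_th_hmM := (rho_th_hmM q0 Delta_spec phi_spec).
Local Notation lam_th_hmM := (lam_th_hmM q0 Delta_spec phi_spec).
Local Notation rho_hm_thM := (rho_hm_thM q0 Delta_spec phi_spec).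
Local Notation lam_hm_thM := (lam_hm_thM q0 Delta_spec phi_spec).
Local Notation rho_hm_hmM := (rho_hm_hmM q0 Delta_spec phi_spec).
Local Notation lam_hm_hmM := (lam_hm_hmM q0 Delta_spec phi_spec).

Lemma rho_th1 i : rho (th i) 1 = 0.
Proof. by rewrite (rho_1l Delta_spec) // (phiC phi_spec) (phi_th1 phi_spec) scale0r. Qed.
Lemma lam_th1 i : lam (th i) 1 = 0.
Proof. by rewrite (lam_1l Delta_spec) // (phiC phi_spec) (phi_th1 phi_spec) scale0r. Qed.
Lemma rho_hm1 mu : rho (hm mu) 1 = 1.
Proof. by rewrite (rho_1l Delta_spec) // (phiC phi_spec) (phi_hm1 phi_spec) scale1r. Qed.
Lemma lam_hm1 mu : lam (hm mu) 1 = 1.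
Proof. by rewrite (lam_1l Delta_spec) // (phiC phi_spec) (phi_hm1 phi_spec) scale1r. Qed.

Lemma W_lam mu i x : W mu x -> W (mu - alpha i) (lam (th i) x).
Proof.
elim=> {mu x} [mu||mu s x z _ IHx _ IHz|mu j x Wx IHx|mu nu' x _ IHx].
- by rewrite (lin0 (lamL _)); apply: W_0.
- by rewrite lam_th1; apply: W_0.
- by rewrite lamL; apply: W_lin.
- rewrite lam_th_thM; apply: W_add; last first.
    by apply: W_scale; rewrite addrAC; apply: W_th.
  by case: eqP => [->|_]; [rewrite addrK; apply: W_scale|rewrite mul0r scale0r; apply: W_0].
- by rewrite lam_th_hmM; apply/W_scale/W_h.
Qed.
Lemma W_rho mu i x : W mu x -> W (mu - alpha i) (rho (th i) x).
Proof.
elim=> {mu x} [mu||mu s x z _ IHx _ IHz|mu j x Wx IHx|mu nu' x _ IHx].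
- by rewrite (lin0 (rhoL _)); apply: W_0.
- by rewrite rho_th1; apply: W_0.
- by rewrite rhoL; apply: W_lin.
- rewrite rho_th_thM; apply: W_add; last by rewrite addrAC; apply: W_th.
  case: eqP => [->|_]; last by rewrite mul0r scale0r; apply: W_0.
  by rewrite addrK -hm_alpha; apply/W_scale/W_h.
- by rewrite rho_th_hmM; apply/W_scale/W_h.
Qed.
Lemma W_rhoh mu nu x : W mu x -> W mu (rho (hm nu) x).
Proof.
elim=> {mu x} [mu||mu s x z _ IHx _ IHz|mu j x Wx IHx|mu nu' x _ IHx].
- by rewrite (lin0 (rhoL _)); apply: W_0.
- by rewrite rho_hm1; apply: W_1.
- by rewrite rhoL; apply: W_lin.
- by rewrite rho_hm_thM; apply: W_th.
- by rewrite rho_hm_hmM; apply/W_scale/W_h.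
Qed.
Lemma W_lamh mu nu x : W mu x -> W mu (lam (hm nu) x).
Proof.
elim=> {mu x} [mu||mu s x z _ IHx _ IHz|mu j x Wx IHx|mu nu' x _ IHx].
- by rewrite (lin0 (lamL _)); apply: W_0.
- by rewrite lam_hm1; apply: W_1.
- by rewrite lamL; apply: W_lin.
- by rewrite lam_hm_thM; apply/W_scale/W_th.
- by rewrite lam_hm_hmM; apply/W_scale/W_h.
Qed.

Lemma rho_hm_isf nu x : isf x -> rho (hm nu) x = x.
Proof.
elim/isf_ind => [|s y z _ _ IHy IHz|i y _ IHy]; first by rewrite rho_hm1.
  by rewrite rhoL IHy IHz.
by rewrite rho_hm_thM IHy.
Qed.
Lemma lam_hm_isf nu x : isf x -> lam (hm nu) x = hm nu * x * hm (- nu).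
Proof.
elim/isf_ind => [|s y z _ _ IHy IHz|i y _ IHy]; first by rewrite lam_hm1 mulr1 hmN.
  by rewrite lamL IHy IHz mulrDr mulrDl -scalerAr -scalerAl.
by rewrite lam_hm_thM IHy [hm nu * (_ * _)]mulrA hm_theta // -!scalerAl !mulrA.
Qed.
Lemma isf_lam i x : isf x -> isf (lam (th i) x).
Proof.
elim/isf_ind => [|s y z _ _ IHy IHz|j y fy IHy]; first by rewrite lam_th1; apply: isf0.
  by rewrite lamL; apply: isf_lin.
rewrite lam_th_thM; apply: isf_lin => //; apply/isfZ/isfM => //; exact: isf_th.
Qed.
(* [rho (th i) x * hV i] is [v_i - v_i^-1] times Lusztig's [r_i x]. *)
Lemma isf_rho i x : isf x -> isf (rho (th i) x * hV i).
Proof.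
elim/isf_ind => [|s y z _ _ IHy IHz|j y fy IHy].
- by rewrite rho_th1 mul0r; apply: isf0.
- by rewrite rhoL mulrDl -scalerAl; apply: isf_lin.
- rewrite rho_th_thM mulrDl -scalerAl -[_ * _ * hV i]mulrA; apply: isfD; last first.
    by apply: isfM => //; apply: isf_th.
  case: (eqVneq i j) => [->|_]; last by rewrite mul0r scale0r; apply: isf0.
  by apply: isfZ; rewrite -hm_alpha -hm_alphaN; apply: isf_conj.
Qed.

Lemma lam_hm_tau nu b : tauB (lam (hm nu) b) = lam (hm (ltau nu)) (tauB b).
Proof.
elim/B_indm: b => [|s x y IHx IHy|i x IHx|mu x IHx].
- by rewrite !(ahom1 (tauBH D q)) !lam_hm1 (ahom1 (tauBH D q)).
- by rewrite !(ahomL (tauBH D q)) !lamL (ahomL (tauBH D q)) IHx IHy.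
- by rewrite lam_hm_thM (ahomZ (tauBH D q)) !(ahomM (tauBH D q)) tauB_theta
    lam_hm_thM IHx -lat_map_alpha /chi rf_tau.
- by rewrite lam_hm_hmM (ahomZ (tauBH D q)) !(ahomM (tauBH D q)) tauB_hm
    lam_hm_hmM IHx /chi rf_tau.
Qed.
Let tauE i j : (tau i == tau j) = (i == j).
Proof. exact: (inj_eq (can_inj (tauK D))). Qed.
Lemma rho_th_tau i b : tauB (rho (th i) b) = rho (th (tau i)) (tauB b).
Proof.
elim/B_indm: b => [|s x y IHx IHy|j x IHx|mu x IHx].
- by rewrite (ahom1 (tauBH D q)) !rho_th1 (ahom0 (tauBH D q)).
- rewrite !(ahomL (tauBH D q)); rewrite -> !rhoL; by rewrite (ahomL (tauBH D q)) IHx IHy.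
- rewrite rho_th_thM (ahomL (tauBH D q));
  rewrite -> !(ahomM (tauBH D q));
  rewrite tauB_theta tauB_h.
  by rewrite rho_th_thM IHx tauE /vi symz_tau.
- rewrite -> rho_th_hmM;
  rewrite (ahomZ (tauBH D q)) !(ahomM (tauBH D q)) tauB_hm;
  rewrite -> rho_th_hmM;
  by rewrite IHx -lat_map_alpha /chi rf_tau.
Qed.
Lemma lam_th_tau i b : tauB (lam (th i) b) = lam (th (tau i)) (tauB b).
Proof.
elim/B_indm: b => [|s x y IHx IHy|j x IHx|mu x IHx].
- by rewrite (ahom1 (tauBH D q)) !lam_th1 (ahom0 (tauBH D q)).
- rewrite !(ahomL (tauBH D q)); rewrite -> !lamL; by rewrite (ahomL (tauBH D q)) IHx IHy.
- rewrite lam_th_thM (ahomL (tauBH D q)) (ahomZ (tauBH D q)) !(ahomM (tauBH D q)).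
  by rewrite tauB_theta lam_th_thM IHx tauE /vi symz_tau -!lat_map_alpha /chi rf_tau.
- by rewrite lam_th_hmM (ahomZ (tauBH D q)) !(ahomM (tauBH D q)) tauB_hm
    lam_th_hmM IHx -lat_map_alpha /chi rf_tau.
Qed.

Local Notation counit := (@counit I D F q).
Lemma counit_hm mu : counit (hm mu) = 1.
Proof. by rewrite -(phi_1l phi_spec) (phiC phi_spec) (phi_hm1 phi_spec). Qed.
Lemma counit_tau b : counit (tauB b) = counit b.
Proof.
elim/B_indm: b => [|s x y IHx IHy|j x IHx|mu x IHx].
- by rewrite (ahom1 (tauBH D q)).
- by rewrite (ahomL (tauBH D q)) !(ahomL (counitH D q)) IHx IHy.
- by rewrite (ahomM (tauBH D q)) !(ahomM (counitH D q)) tauB_theta !counit_theta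
    !mul0r.
- by rewrite (ahomM (tauBH D q)) !(ahomM (counitH D q)) tauB_hm !counit_hm IHx.
Qed.
(** By adjointness each letter of a becomes a [lam] applied to b, and [lam] at generators is already
    known to commute with tau. *)
Lemma phi_tau a b : phi (tauB a) (tauB b) = phi a b.
Proof.
elim/B_indm: a b => [|s x y IHx IHy|j x IHx|mu x IHx] b.
- by rewrite (ahom1 (tauBH D q)) !(phi_1l phi_spec) counit_tau.
- by rewrite (ahomL (tauBH D q)) !(phi_linE phi_spec) IHx IHy.
- by rewrite (ahomM (tauBH D q)) !(phiMll phi_spec) tauB_theta -lam_th_tau IHx.
- by rewrite (ahomM (tauBH D q)) !(phiMll phi_spec) tauB_hm -lam_hm_tau IHx.
Qed.

Lemma counit_W mu x : W mu x -> mu != 0 -> counit x = 0.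
Proof.
elim=> {mu x} [mu||mu s x z _ IHx _ IHz|mu j x Wx IHx|mu nu' x _ IHx].
- by rewrite (ahom0 (counitH D q)).
- by rewrite eqxx.
- by move=> mu0; rewrite (ahomL (counitH D q)) IHx // IHz // scaler0 addr0.
- by rewrite (ahomM (counitH D q)) counit_theta mul0r.
- by move=> mu0; rewrite (ahomM (counitH D q)) IHx // mulr0.
Qed.
(** A letter of a lowers the weight of b by the same simple root, so unequal weights stay unequal
    until the counit is reached, which vanishes outside weight 0. *)
Lemma phi_W mu nu a b : W mu a -> W nu b -> mu != nu -> phi a b = 0.
Proof.
move=> Wa; elim: Wa nu b => {mu a} [mu||mu s x z _ IHx _ IHz|mu j x Wx IHx|mu nu' x _ IHx]
  nu b Wb mn.
- by rewrite (phi0l phi_spec).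
- by rewrite (phi_1l phi_spec) (counit_W Wb) // eq_sym.
- by rewrite (phi_linE phi_spec) (IHx _ _ Wb mn) (IHz _ _ Wb mn) mulr0 addr0.
- rewrite (phiMll phi_spec); apply: IHx (W_lam j Wb) _.
  by apply: contra mn => /eqP ->; rewrite subrK.
- by rewrite (phiMll phi_spec); apply: IHx (W_lamh nu' Wb) mn.
Qed.

End Weights.

(** * Commutators with F and separation of weights *)

Lemma ind_lin (F : fieldType) (V W : lmodType F) (f g : V -> W) c x y :
  lin f -> lin g -> f x = g x -> f y = g y -> f (c *: x + y) = g (c *: x + y).
Proof. by move=> fL gL fx fy; rewrite fL gL fx fy. Qed.

Lemma FB_step (F : fieldType) (A : algType F) (c dl : F) (f e y K K' R L : A) :
  c != 0 -> f * y = y * f + R - K' * L ->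
  f * e = e * f + dl *: (K - K') -> K' * e = c^-1 *: (e * K') ->
  f * (e * y) = e * y * f + (dl *: (K * y) + e * R) - K' * (dl *: y + c *: (e * L)).
Proof.
move=> c0 fy fe Ke; rewrite mulrA fe mulrDl -mulrA fy.
have -> : K' * (dl *: y + c *: (e * L)) = dl *: (K' * y) + e * (K' * L).
  by rewrite mulrDr -!scalerAr [K' * (e * L)]mulrA Ke -!scalerAl scalerA mulfV // scale1r !mulrA.
rewrite -scalerAl mulrBl scalerBr mulrBr mulrDr opprD !mulrA.
by rewrite !addrA [LHS](ACl (1*4*2*5*3)).
Qed.

Section Weights2.
Variables (I : finType) (D : satake I) (F : fieldType) (q : F).
Hypothesis q0 : q != 0.
Local Notation B := (B_alg D q).
Local Notation th := (Btheta D q).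
Local Notation h := (Bh D q).
Local Notation hV := (BhV D q).
Local Notation hm := (Bh_mon D q).
Local Notation v_ := (vi D q).
Local Notation w_ i := (v_ i - (v_ i)^-1).
Local Notation W := (@W I D F q).
Local Notation isf := (@isf I D F q).

Section Commutation.
Variables (Delta : B -> seq (B * B)) (phi : B -> B -> F).
Hypotheses (Delta_spec : is_coproduct Delta) (phi_spec : is_hopf_pairing Delta phi).
Local Notation rho := (rho Delta phi).
Local Notation lam := (lam Delta phi).
Let rhoL a : lin (rho a) := rho_lin Delta_spec phi_spec a.
Let lamL a : lin (lam a) := lam_lin Delta_spec phi_spec a.

(** Moving F_i through a word in the E_j replaces one letter E_i by K_i - K'_i. Terms with K_i are
    collected by [rho]; in the others K'_i is brought to the front, where they are collected by
    [lam]. *)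
Lemma FB i x : isf x -> UF D q i * bplus x = bplus x * UF D q i
  + bplus (rho (th i) x) - UK' D q i * bplus (lam (th i) x).
Proof.
have bL := bplusH D q; elim/isf_ind => [|s y z _ _|j y fy IHy].
- rewrite (rho_th1 Delta_spec phi_spec) (lam_th1 Delta_spec phi_spec).
  rewrite (ahom1 bL) (ahom0 bL); rewrite -> mulr0, -> mulr1; by rewrite mul1r addr0 subr0.
- by apply: (@ind_lin _ _ _ (fun x => _ * bplus x)
    (fun x => bplus x * _ + bplus (rho _ x) - _ * bplus (lam _ x))); lint.
rewrite (rho_th_thM q0 Delta_spec phi_spec) (lam_th_thM q0 Delta_spec phi_spec).
rewrite !(ahomM bL) !(ahomL bL) !(ahomM bL) (ahomZ bL) (ahomM bL).
rewrite bplus_theta bplus_h.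
have fe : UF D q i * UE D q j = UE D q j * UF D q i +
    ((i == j)%:R * w_ i) *: (UK D q j - UK' D q i).
  have /eqP := UE_F D q j i; rewrite subr_eq => /eqP ->.
  rewrite [j == i]eq_sym; case: eqP => [->|_].
    by rewrite !mul1r addrAC -scalerDl addrA subrK subrr scale0r add0r.
  rewrite !mul0r; rewrite -> !scale0r; by rewrite add0r addr0.
apply: FB_step fe _; [exact: chi_neq0|exact: IHy|].
by rewrite -K'm_alpha K'm_E // chiNr.
Qed.
Lemma EBm i x : isf x -> UE D q i * bminus x = bminus x * UE D q i
  + bminus (rho (th i) x) - UK D q i * bminus (lam (th i) x).
Proof.
move/(FB i)/(congr1 (@omega I D F q)); have oL := omegaH D q.
by rewrite (ahomB oL) (ahomD oL) !(ahomM oL) !omega_bplus omega_F omega_K'.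
Qed.
End Commutation.

(* [D_k] scales [theta_k] by [q]; its eigenvalues separate the weights. *)
Lemma scale_rels k : B_rels D q (fun j => q ^+ (k == j) *: th j) h hV.
Proof.
split.
- move=> i j ij; have [a ->] := serre_scale D q th (fun j => q ^+ (k == j)) i j.
  by rewrite Btheta_serre // scaler0.
- exact: Bh_V.
- exact: BhV_h.
- exact: Bh_h.
- by move=> i j; cbv beta; rewrite -scalerAr Bh_theta -scalerAl scalerA mulrC scalerA.
Qed.
Definition scal k : B -> B := B_lift (scale_rels k).
Lemma scalL k : lin (scal k).
Proof. exact: ahomL (B_liftH _). Qed.
Lemma scal_hm k mu : scal k (hm mu) = hm mu.
Proof.
apply: (mon_ahom (f := scal k)); first exact: B_liftH.
- by move=> i; apply: B_lift_h.
- by move=> i; apply: B_lift_hV.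
Qed.
Lemma scal_W k mu x : W mu x -> scal k x = q ^ mu k *: x.
Proof.
have sH := B_liftH (scale_rels k); elim=> {mu x} [mu||mu s x z _ IHx _ IHz|mu j x Wx IHx|mu nu' x _ IHx].
- by rewrite [LHS](ahom0 sH) scaler0.
- by rewrite [LHS](ahom1 sH) ffunE expr0z scale1r.
- by rewrite scalL IHx IHz scalerDr !scalerA mulrC.
- rewrite [LHS](ahomM sH) B_lift_theta -/(scal k) IHx scalar_mul !ffunE expfzDr //.
  by rewrite [j == k]eq_sym mulrC.
- by rewrite [LHS](ahomM sH) -/(scal k) scal_hm IHx -scalerAr.
Qed.

Hypothesis qn : forall n, (0 < n)%N -> q ^+ n != 1.
Lemma qz_neq1 (n : int) : n != 0 -> q ^ n != 1.
Proof.
case: n => n; first by case: n => // n _; apply: qn.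
by move=> _; rewrite NegzE -invr_expz invr_eq1; apply: qn.
Qed.

(** P is a product of factors D_k - q^(nu_k), one for each weight nu to be killed, with k a
    coordinate at which nu and mu differ. No factor vanishes on weight mu because q has infinite
    order. *)
Lemma weight_sep mu (s : seq (lattice I)) : mu \notin s ->
  exists P : B -> B, [/\ lin P, (forall nu x, nu \in s -> W nu x -> P x = 0),
    (forall nu, exists a, forall x, W nu x -> P x = a *: x) &
    exists a, a != 0 /\ forall x, W mu x -> P x = a *: x].
Proof.
elim: s => [_|nu s IH].
  exists id; split=> //.
    by move=> nu; exists 1 => x _; rewrite scale1r.
  by exists 1; split=> [|x _]; rewrite ?oner_neq0 ?scale1r.
rewrite inE negb_or => /andP [mn /IH [P [PL P0 Pe [a [a0 Pa]]]]].
have [k kP] : exists k, mu k != nu k.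
  apply/existsP; apply: contra_neqT mn; rewrite negb_exists => /forallP H.
  by apply/ffunP => k; apply/eqP; move: (H k); rewrite negbK.
exists (fun x => P (scal k x - q ^ nu k *: x)); split.
- apply: (@lin_comp _ _ _ _ P (fun x => scal k x - q ^ nu k *: x)) => //.
  apply: lin_add; first exact: scalL.
  exact/lin_opp/lin_scale/lin_id.
- move=> nu' x; rewrite inE => /orP [/eqP ->|ns] Wx; rewrite (scal_W k Wx).
    by rewrite subrr (lin0 PL).
  by rewrite -scalerBl (linZ PL) (P0 nu') // scaler0.
- move=> nu'; have [b Pb] := Pe nu'; exists ((q ^ nu' k - q ^ nu k) * b) => x Wx.
  by rewrite (scal_W k Wx) -scalerBl (linZ PL) Pb // scalerA.
- exists ((q ^ mu k - q ^ nu k) * a); split=> [|x Wx].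
    rewrite mulf_neq0 // subr_eq0; apply: contra kP => /eqP e.
    have : q ^ (mu k - nu k) == 1 by rewrite expfzDr // e -expfzDr // subrr.
    by apply: contraLR; rewrite -subr_eq0 => /qz_neq1.
  by rewrite (scal_W k Wx) -scalerBl (linZ PL) Pa // scalerA.
Qed.

(** The discrepancy z has weight mu and is also a sum of terms of other weights. The separating
    operator kills these terms and acts on z by a nonzero scalar, so z = 0. *)
Lemma weight_proj (T : Type) mu (s : seq T) (m : T -> lattice I) (y : T -> B) x :
  W mu x -> (forall t, W (m t) (y t)) -> x = \sum_(t <- s) y t ->
  x = \sum_(t <- s | m t == mu) y t.
Proof.
move=> Wx Wy xs; apply/eqP; rewrite -subr_eq0; apply/eqP.
set z := _ - _; have Wz : W mu z.
  apply: W_add => //; rewrite -scaleN1r; apply: W_scale.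
  apply: (big_ind (W mu)) => [||t /eqP <-] //; [exact: W_0|exact: W_add].
have zs : z = \sum_(t <- s | m t != mu) y t.
  by rewrite /z [in LHS]xs (bigID (fun t => m t == mu)) /= [X in X - _]addrC addrK.
pose l := [seq nu <- [seq m t | t <- s] | nu != mu].
have [|P [PL P0 _ [a [a0 Pa]]]] := @weight_sep mu l.
  by rewrite mem_filter eqxx.
have /eqP : P z = 0.
  have : {subset [seq nu <- [seq m t | t <- s] | nu != mu] <= l} by [].
  rewrite zs; elim: (s) => [|t s' IH] sl; first by rewrite big_nil (lin0 PL).
  have {}IH : P (\sum_(u <- s' | m u != mu) y u) = 0.
    by apply: IH => nu nus; apply: sl; rewrite /=; case: ifP => // _; rewrite inE nus orbT.
  rewrite big_cons; case: ifP => // tm; rewrite (linD PL) IH addr0.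
  by apply: (P0 (m t)) => //; apply: sl; rewrite /= tm inE eqxx.
by rewrite Pa // scaler_eq0 (negbTE a0) => /eqP.
Qed.

Lemma W_unique mu nu x : W mu x -> W nu x -> x != 0 -> mu = nu.
Proof.
move=> Wm Wn; apply: contraNeq => mn.
rewrite (@weight_proj unit mu [:: tt] (fun=> nu) (fun=> x) x) ?big_seq1 //.
by rewrite big_cons big_nil [_ == mu]eq_sym (negbTE mn).
Qed.
End Weights2.

(** * Spans of words and homogeneous elements of f *)

Section WordSpan.
Variables (F : fieldType) (A : algType F) (T : Type) (X : T -> A).
Variable P : seq T -> Prop.
(** Coefficients and words are functions on an ordinal, so that another map can later be applied to
    the same expansion without recomputing it. *)
Definition wspan (x : A) := exists n (c : 'I_n -> F) (w : 'I_n -> seq T),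
  (forall k, P (w k)) /\ x = \sum_k c k *: \prod_(j <- w k) X j.
Lemma wspan1 : P [::] -> wspan 1.
Proof.
by move=> P0; exists 1, (fun=> 1), (fun=> [::]); split=> //;
  rewrite big_ord1 big_nil scale1r.
Qed.
Lemma wspan0 : wspan 0.
Proof. by exists 0, (fun=> 1), (fun=> [::]); split=> [[]|] //; rewrite big_ord0. Qed.
Lemma wspan_word c w : P w -> wspan (c *: \prod_(j <- w) X j).
Proof. by move=> Pw; exists 1, (fun=> c), (fun=> w); split=> //; rewrite big_ord1. Qed.
Lemma wspan_gen j : P [:: j] -> wspan (X j).
Proof. by move/(wspan_word 1); rewrite big_seq1 scale1r. Qed.
Lemma wspanD x y : wspan x -> wspan y -> wspan (x + y).
Proof.
move=> [n [c [w [Pw ->]]]] [m [d [z [Pz ->]]]].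
exists (n + m), (fun k => match split k with inl i => c i | inr j => d j end).
exists (fun k => match split k with inl i => w i | inr j => z j end).
split=> [k|]; first by case: (split k).
rewrite big_split_ord /=; congr (_ + _); apply: eq_bigr => k _.
  by rewrite (unsplitK (inl k)).
by rewrite (unsplitK (inr k)).
Qed.
Lemma wspanZ a x : wspan x -> wspan (a *: x).
Proof.
move=> [n [c [w [Pw ->]]]]; exists n, (fun k => a * c k), w; split=> //.
by rewrite scaler_sumr; apply: eq_bigr => k _; rewrite scalerA.
Qed.
Lemma wspan_sum (J : Type) (s : seq J) (g : J -> A) (Q : pred J) :
  (forall j, Q j -> wspan (g j)) -> wspan (\sum_(j <- s | Q j) g j).
Proof. by move=> H; apply: big_ind => //; [apply: wspan0|apply: wspanD]. Qed.
Lemma wspanM x y : (forall u v, P u -> P v -> P (u ++ v)) ->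
  wspan x -> wspan y -> wspan (x * y).
Proof.
move=> Pc [n [c [w [Pw ->]]]] [m [d [z [Pz ->]]]].
rewrite mulr_suml; apply: wspan_sum => i _; rewrite mulr_sumr.
apply: wspan_sum => j _; rewrite -scalerAl -scalerAr scalerA -big_cat /=.
by apply: wspan_word; apply: Pc.
Qed.
End WordSpan.

Section FAlgebra.
Variables (I : finType) (D : satake I) (F : fieldType) (q : F).
Hypothesis q0 : q != 0.
Local Notation B := (B_alg D q).
Local Notation f := (f_alg D q).
Local Notation th := (Btheta D q).
Local Notation theta := (theta D q).
Local Notation chi := (@chi I D F q).
Local Notation W := (@W I D F q).

Lemma fscale_kills (s : I -> F) :
  kills (Relators (@f_proper I D F q)) idfun (fun j => s j *: theta j).
Proof.
move=> _ [i j ij]; rewrite (serre_morph D _ _ _ _ (free_evalZ idfun _)).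
have [a sE] := serre_scale D q theta s i j; rewrite theta_serre // scaler0 in sE.
by rewrite -[RHS]sE; apply: serre_eq => k; rewrite /= free_eval_gen.
Qed.
Definition fscale s : f -> f := Defs.lift (fscale_kills s).
Lemma fscaleH s : ahom (fscale s). Proof. exact: lift_ahom. Qed.
Lemma fscale_theta s j : fscale s (theta j) = s j *: theta j.
Proof. exact: lift_gen. Qed.
Lemma fscale_comp s t x : fscale s (fscale t x) = fscale (fun j => t j * s j) x.
Proof.
apply: (ahom_eq (ahom_comp (fscaleH t) (fscaleH s)) (fscaleH _)) => j /=.
by rewrite [LHS](congr1 (fscale s) (fscale_theta t j)) (ahomZ (fscaleH s))
  fscale_theta scalerA [RHS]fscale_theta.
Qed.
Lemma fscale_eq s t x : s =1 t -> fscale s x = fscale t x.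
Proof.
move=> st; apply: (ahom_eq (fscaleH s) (fscaleH t)) => j.
by rewrite [LHS]fscale_theta [RHS]fscale_theta st.
Qed.
Lemma fscale1 s x : (forall j, s j = 1) -> fscale s x = x.
Proof.
move=> s1; apply: (ahom_eq (fscaleH s) (@ahom_id F _)) => j.
by rewrite [LHS]fscale_theta s1 scale1r.
Qed.

Let nt : nontrivial f := algType_nontrivial f.
Let kap mu : endo nt := Endo nt (ahomL (fscaleH (fun j => chi mu (alpha j)))).
Let fL (x : f) : endo nt := Endo nt (lin_mull x (@lin_id F f)).
Let fL_ahom : ahom fL.
Proof.
split=> [s x y||x y]; apply: endo_eq => b; rewrite ?endoE /=.
- by rewrite mulrDl scalerAl.
- by rewrite mul1r.
- by rewrite mulrA.
Qed.
Let frep_rels : B_rels D q (fun i => fL (theta i)) (fun i => kap (alpha i))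
  (fun i => kap (- alpha i)).
Proof.
split.
- by move=> i j ij; rewrite -(serre_ahom D q theta i j fL_ahom) theta_serre //
    (ahom0 fL_ahom).
- move=> i; apply: endo_eq => x; rewrite !endoE /= fscale_comp fscale1 // => j.
  by rewrite chiNl mulVf ?chi_neq0.
- move=> i; apply: endo_eq => x; rewrite !endoE /= fscale_comp fscale1 // => j.
  by rewrite chiNl mulfV ?chi_neq0.
- by move=> i j; apply: endo_eq => x; rewrite !endoE /= !fscale_comp;
    apply: fscale_eq => k; rewrite mulrC.
- move=> i j; apply: endo_eq => x; rewrite !endoE /= (ahomM (fscaleH _)).
  by rewrite fscale_theta -scalerAl chi_alpha.
Qed.
(** f is itself a module over B, with theta_i acting by left multiplication and h_mu by the
    character [chi] of the weight; the image of x sends 1 to x. *)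
Lemma f_iota_inj : injective (@f_iota I D F q).
Proof.
have frepH := B_liftH frep_rels.
have frep x : B_lift frep_rels (f_iota x) 1 = x.
  elim/f_ind: x => [|s x y IHx IHy|i x IHx].
  - by rewrite (ahom1 (f_iotaH D q)) (ahom1 frepH) endoE.
  - rewrite (ahomL (f_iotaH D q)) (ahomL frepH) !endoE; rewrite -> IHx; by rewrite IHy.
  - by rewrite (ahomM (f_iotaH D q)) (ahomM frepH) f_iota_theta B_lift_theta
      !endoE IHx.
by move=> x y xy; rewrite -(frep x) xy frep.
Qed.
Definition wtw (w : seq I) : lattice I := \sum_(j <- w) alpha j.
Definition bw (w : seq I) : B := \prod_(j <- w) th j.
Lemma bw_cons k w : bw (k :: w) = th k * bw w.
Proof. by rewrite /bw big_cons. Qed.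
Lemma bw_cat w w' : bw (w ++ w') = bw w * bw w'.
Proof. by rewrite /bw big_cat. Qed.
Lemma bw_rcons w k : bw (rcons w k) = bw w * th k.
Proof. by rewrite -cats1 bw_cat /bw big_seq1. Qed.
Lemma wtw_cons k w : wtw (k :: w) = alpha k + wtw w.
Proof. by rewrite /wtw big_cons. Qed.
Lemma wtw_cat w w' : wtw (w ++ w') = wtw w + wtw w'.
Proof. by rewrite /wtw big_cat. Qed.
Lemma W_bw w : W (wtw w) (bw w).
Proof.
elim: w => [|k w IH]; first by rewrite /wtw /bw !big_nil; apply: W_1.
by rewrite wtw_cons bw_cons addrC; apply: W_th.
Qed.
Lemma f_iota_word w : f_iota (\prod_(j <- w) theta j) = bw w.
Proof.
rewrite (ahom_prod (f_iotaH D q)); apply: eq_bigr => j _; exact: f_iota_theta.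
Qed.

Lemma has_weightP mu (x : f) : has_weight theta mu x <->
  wspan theta (fun w => wtw w = mu) x.
Proof.
split=> [[s [/allP sm ->]]|[n [c [w [wm ->]]]]].
  rewrite big_seq; apply: wspan_sum => p /sm /eqP; exact: wspan_word.
exists [seq (c k, w k) | k <- enum 'I_n]; rewrite big_map big_enum /=; split=> //.
by apply/allP => _ /mapP [k _ ->] /=; apply/eqP/wm.
Qed.
Lemma has_weight_W mu (x : f) : has_weight theta mu x -> W mu (f_iota x).
Proof.
case/has_weightP => n [c [w [wm ->]]]; rewrite (ahom_sum (f_iotaH D q)).
apply: (big_ind (W mu)) => [||k _]; [exact: W_0|by move=> *; apply: W_add|].
rewrite (ahomZ (f_iotaH D q)) f_iota_word; apply: W_scale; rewrite -(wm k).
exact: W_bw.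
Qed.
Hypothesis qn : forall n, (0 < n)%N -> q ^+ n != 1.

(** In an expansion of a homogeneous element the words of foreign weight cancel by [weight_proj];
    dropping them keeps any restriction [P] on the letters. *)
Lemma wspan_proj (P : seq I -> Prop) mu (x : f) : wspan theta P x ->
  W mu (f_iota x) -> wspan theta (fun w => P w /\ wtw w = mu) x.
Proof.
move=> [n [c [w [Pw xE]]]] Wx.
have := @weight_proj _ _ _ _ q0 qn _ mu (enum 'I_n) (fun k => wtw (w k))
  (fun k => c k *: bw (w k)) _ Wx.
have fE (Q : pred 'I_n) : \sum_(k <- enum 'I_n | Q k) c k *: bw (w k) =
    f_iota (\sum_(k | Q k) c k *: \prod_(j <- w k) theta j).
  rewrite big_enum_cond (big_morph _ (ahomD (f_iotaH D q)) (ahom0 (f_iotaH D q))).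
  apply: eq_bigr => k _.
  by rewrite (ahomZ (f_iotaH D q)) f_iota_word.
rewrite !fE /= -xE => H; rewrite (f_iota_inj (H _ _)) //; last first.
  by move=> k; apply/W_scale/W_bw.
by apply: wspan_sum => k /eqP wk; apply: wspan_word.
Qed.

Lemma f_words (x : f) : wspan theta (fun=> True) x.
Proof.
elim/f_ind: x => [|s x y Px Py|i x Px]; first exact: wspan1.
  by apply: wspanD => //; apply: wspanZ.
by apply: wspanM => //; apply: wspan_gen.
Qed.
Lemma W_has_weight mu (x : f) : W mu (f_iota x) -> has_weight theta mu x.
Proof.
move=> Wx; apply/has_weightP; have [n [c [w [wP ->]]]] := wspan_proj (f_words x) Wx.
by exists n, c, w; split=> // k; case: (wP k).
Qed.
Lemma wt_eq mu (x : f) : W mu (f_iota x) -> x != 0 -> wt x = mu.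
Proof.
move=> Wx x0; rewrite /wt; case: xgetP => [nu _ /has_weight_W Wn|H].
  apply: (W_unique q0 qn Wn Wx); apply: contra x0 => /eqP e.
  by apply/eqP/f_iota_inj; rewrite e (ahom0 (f_iotaH D q)).
by case: (H mu); apply: W_has_weight.
Qed.
Lemma f_pair_words i (u : f_pair D q i) :
  wspan theta (fun w => all (inJ D i) w) (f_pair_val u).
Proof.
have /asboolP : f_pair_val u \in subalg _ := valP u.
elim=> [_ [->| ->]||s x y _ Px _ Py|x y _ Px _ Py].
- by apply: wspan_gen; rewrite /= inJi.
- by apply: wspan_gen; rewrite /= inJt.
- exact: wspan1.
- by apply: wspanD => //; apply: wspanZ.
- by apply: wspanM => // w w'; rewrite all_cat => -> ->.
Qed.
End FAlgebra.

(** * Iterated q-commutators of theta_l with the rank one part *)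

Lemma add3ACA (V : zmodType) (a b c x y z : V) :
  (a + x) + (b + y) + (c + z) = (a + b + c) + (x + y + z).
Proof. by rewrite [a + x + _]addrACA [LHS]addrACA. Qed.

Section AdIdentities.
Variables (F : fieldType) (A : algType F).
Implicit Types (a b x d : F) (z r t y e : A).

Lemma ad_rho_id z r t e d x : e * z = x *: (z * e) ->
  r * t + z * (d *: e) - x *: ((d *: e) * z + t * r) =
  (r * t - x *: (t * r)) + (d * (1 - x ^+ 2)) *: z * e.
Proof.
move=> ez; rewrite -scalerAr -!scalerAl ez scalerDr !scalerA opprD.
rewrite [- _ - _]addrC addrACA; congr (_ + _); rewrite -scalerBl; congr (_ *: _).
by ring.
Qed.
Lemma ad_lam_id z x d : (x *: z) * d%:A - x *: (d%:A * z) = 0.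
Proof. by rewrite -scalerAr mulr1 -scalerAl mul1r !scalerA [d * x]mulrC subrr. Qed.
Lemma Zst_id (V : lmodType F) x (p1 p2 p3 p4 s1 s2 q2 q3 q4 t1 t2 : V) :
  (x *: p1 + p2 + (p3 + p4) + (s1 + s2)) - x *: (p1 + q3 + t1 + (q2 + q4 + t2)) =
  (p2 - x *: q2) + (p3 - x *: q3) +
  ((p4 - x *: q4) + ((s1 - x *: t1) + (s2 + (- x) *: t2))).
Proof.
rewrite scaleNr !scalerDr !opprD !addrA.
rewrite [LHS](ACl ((1*7)*2*10*3*8*4*11*5*9*6*12)) /= subrr add0r.
reflexivity.
Qed.
Lemma ad_rho_id2 y t e a b : e * t = a *: (t * e) ->
  y * e * t - (b * a) *: (t * (y * e)) = (a *: (y * t - b *: (t * y))) * e.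
Proof.
move=> et; rewrite -mulrA et -scalerAr -scalerAl mulrBl -scalerAl scalerBr scalerA.
by rewrite !mulrA [a * b]mulrC.
Qed.
End AdIdentities.

Section AdWords.
Variables (I : finType) (D : satake I) (F : fieldType) (q : F).
Hypothesis q0 : q != 0.
Local Notation B := (B_alg D q).
Local Notation th := (Btheta D q).
Local Notation h := (Bh D q).
Local Notation hm := (Bh_mon D q).
Local Notation chi := (@chi I D F q).
Local Notation v_ := (vi D q).
Local Notation tau := (tau D).
Local Notation ltau := (lat_map tau).
Local Notation w_ i := (v_ i - (v_ i)^-1).
Local Notation W := (@W I D F q).
Local Notation isf := (@isf I D F q).
Local Notation bw := (@bw I D F q).
Variable i : I.
Local Notation J := (inJ D i).

Definition wt_off (l : I) (mu : lattice I) := forall j, ~~ J j -> mu j = (l == j)%:Z.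

(** These are the elements of degree one outside J, among which the preimages of the E_l are found.
    The scalar in the q-commutator is the one for which [lam (th k)] vanishes. The number n of
    commutators is recorded because [rho] lowers it, and inductions run on it. *)
Inductive C1 : nat -> I -> lattice I -> B -> Prop :=
| C1_th l : ~~ J l -> C1 0 l (alpha l) (th l)
| C1_z n l mu : ~~ J l -> wt_off l mu -> C1 n l mu 0
| C1_lin n l mu s x y : C1 n l mu x -> C1 n l mu y -> C1 n l mu (s *: x + y)
| C1_ad n l mu k z : J k -> C1 n l mu z ->
    C1 n.+1 l (mu + alpha k) (z * th k - chi (alpha k) mu *: (th k * z)).

Lemma C1_J n l mu z : C1 n l mu z -> ~~ J l.
Proof. by elim. Qed.
Lemma wt_offD l mu k : J k -> wt_off l mu -> wt_off l (mu + alpha k).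
Proof.
move=> Jk H j Jj; rewrite !ffunE H // (_ : (k == j) = false) ?addr0 //.
by apply: contraNF Jj => /eqP <-.
Qed.
Lemma wt_offB l mu k : J k -> wt_off l mu -> wt_off l (mu - alpha k).
Proof.
move=> Jk H j Jj; rewrite !ffunE H // (_ : (k == j) = false) ?subr0 //.
by apply: contraNF Jj => /eqP <-.
Qed.
Lemma C1_off n l mu z : C1 n l mu z -> wt_off l mu.
Proof.
elim=> {n l mu z} // [l _ j _|n l mu k z Jk _]; first by rewrite ffunE.
exact: wt_offD.
Qed.
Lemma wt_off_wtw l mu w : wt_off l mu -> all J w -> wt_off l (mu - wtw w).
Proof.
elim: w mu => [|k w IH] mu H /=; first by rewrite /wtw big_nil subr0.
by move=> /andP [Jk /IH]; rewrite wtw_cons opprD addrA; apply; apply: wt_offB.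
Qed.
Lemma wt_off_neq l w mu : ~~ J l -> wt_off l mu -> all J w -> mu != wtw w.
Proof.
move=> Jl H Jw; apply/eqP => e; have := wt_off_wtw H Jw Jl.
by rewrite e subrr ffunE eqxx.
Qed.
Lemma wt_off_neq0 l mu : ~~ J l -> wt_off l mu -> mu != 0.
Proof. by move=> Jl /(wt_off_neq (w := [::]) Jl); rewrite /wtw big_nil; apply. Qed.
Lemma C1_W n l mu z : C1 n l mu z -> W mu z.
Proof.
elim=> {n l mu z} [l _|n l mu _ _|n l mu s x y _ Wx _ Wy|n l mu k z Jk _ Wz].
- exact: W_theta.
- exact: W_0.
- exact: W_lin.
- apply: W_add; first by apply: W_mul => //; apply: W_theta.
  by rewrite -scaleNr; apply: W_scale; rewrite addrC; apply: W_mul => //; apply: W_theta.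
Qed.
Lemma C1_isf n l mu z : C1 n l mu z -> isf z.
Proof.
elim=> {n l mu z} [l _|n l mu _ _|n l mu s x y _ Wx _ Wy|n l mu k z Jk _ fz].
- exact: isf_th.
- exact: isf0.
- exact: isf_lin.
- have fk : isf (th k) by exact: isf_th.
  by apply: isfB; [|apply: isfZ]; apply: isfM.
Qed.
Lemma C1_scale n l mu s z : C1 n l mu z -> C1 n l mu (s *: z).
Proof.
move=> Cz; rewrite -[_ *: _]addr0; apply: C1_lin => //.
by apply: C1_z; [apply: C1_J Cz|apply: C1_off Cz].
Qed.
Lemma C1_eq n l mu nu z y : C1 n l mu z -> mu = nu -> z = y -> C1 n l nu y.
Proof. by move=> Cz <- <-. Qed.
Lemma C1_tau n l mu z : C1 n l mu z -> C1 n (tau l) (ltau mu) (tauB z).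
Proof.
have tH := tauBH D q.
elim=> {n l mu z} [l Jl|n l mu Jl H|n l mu s x y _ Wx _ Wy|n l mu k z Jk _ Cz].
- by rewrite tauB_theta lat_map_alpha; apply: C1_th; rewrite inJ_tau.
- rewrite (ahom0 tH); apply: C1_z; rewrite ?inJ_tau // => j Jj.
  by rewrite lat_mapE H ?inJ_tau // -[l == _](inj_eq (can_inj (tauK D))) tauK.
- by rewrite (ahomL tH); apply: C1_lin.
- rewrite (ahomB tH) (ahomZ tH) !(ahomM tH) tauB_theta lat_mapD lat_map_alpha.
  have -> : chi (alpha k) mu = chi (alpha (tau k)) (ltau mu).
    by rewrite /chi -lat_map_alpha rf_tau.
  by apply: C1_ad; rewrite ?inJ_tau.
Qed.

Variables (Delta : B -> seq (B * B)) (phi : B -> B -> F).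
Hypotheses (Delta_spec : is_coproduct Delta) (phi_spec : is_hopf_pairing Delta phi).
Local Notation cop := (cop Delta).
Local Notation rho := (rho Delta phi).
Local Notation lam := (lam Delta phi).
Let rhoL a : lin (rho a) := rho_lin Delta_spec phi_spec a.
Let lamL a : lin (lam a) := lam_lin Delta_spec phi_spec a.

(** By the Leibniz rule the letter theta_k contributes chi(alpha_k, mu) z from the right end and z
    from the left end; the coefficient of the q-commutator cancels the two. *)
Lemma C1_lam n l mu z k : C1 n l mu z -> J k -> lam (th k) z = 0.
Proof.
move=> Cz Jk; elim: Cz => {n l mu z} [l Jl|n l mu _ _|n l mu s x y _ Wx _ Wy|n l mu j z Jj Cz lz].
- rewrite (lam_theta_th Delta_spec phi_spec) (_ : (k == l) = false) ?mul0r ?scale0r //.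
  by apply: contraNF Jl => /eqP <-.
- exact: lin0.
- by rewrite lamL Wx Wy scaler0 addr0.
- rewrite (linB (lamL _)) (linZ (lamL _));
  rewrite -> !(lam_theta Delta_spec phi_spec), -> lz;
  rewrite mul0r add0r.
  rewrite -> mulr0; rewrite addr0 (lam_theta_th Delta_spec phi_spec) -hm_alpha.
  rewrite (lam_hm_isf q0 Delta_spec phi_spec _ (C1_isf Cz)) (W_conj q0 _ (C1_W Cz)).
  case: eqP => [->|_]; last by rewrite mul0r !scale0r mulr0 mul0r scaler0 subrr.
  exact: ad_lam_id.
Qed.

(** Here the two ends contribute 1 and chi(alpha_j, mu)^2, which need not cancel. A commutator is
    lost and h_k is left on the right, while the outer commutators keep their shape. *)
Lemma C1_rho n l mu z k : C1 n l mu z -> J k ->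
  if n is n'.+1 then exists y, C1 n' l (mu - alpha k) y /\ rho (th k) z = y * h k
  else rho (th k) z = 0.
Proof.
move=> Cz Jk.
elim: Cz => {n l mu z} [l Jl|n l mu Jl H|n l mu s x y Cx Wx Cy Wy|n l mu j z Jj Cz lz].
- rewrite (rho_theta_th Delta_spec phi_spec) (_ : (k == l) = false) ?mul0r ?scale0r //.
  by apply: contraNF Jl => /eqP <-.
- rewrite (lin0 (rhoL _)); case: n => // n; exists 0; rewrite mul0r; split=> //.
  by apply: C1_z => //; apply: wt_offB.
- rewrite rhoL; case: n Cx Wx Cy Wy => [_ -> _ ->|n _ [x' [Cx ->]] _ [y' [Cy ->]]].
    by rewrite scaler0 addr0.
  exists (s *: x' + y'); split; first exact: C1_lin.
  by rewrite mulrDl scalerAl.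
- have fz := C1_isf Cz; have Wz := C1_W Cz.
  have -> : rho (th k) (z * th j - chi (alpha j) mu *: (th j * z)) =
      (rho (th k) z * th j - chi (alpha j) mu *: (th j * rho (th k) z)) +
      ((k == j)%:R * w_ k * (1 - chi (alpha j) mu ^+ 2)) *: z * h k.
    rewrite (linB (rhoL _)) (linZ (rhoL _)); rewrite -> !(rho_theta Delta_spec phi_spec).
    rewrite -[h k]hm_alpha (rho_hm_isf q0 Delta_spec phi_spec _ fz).
    rewrite (rho_hm_th q0 Delta_spec phi_spec) (rho_theta_th Delta_spec phi_spec).
    have e : h j * z = chi (alpha j) mu *: (z * h j).
      by rewrite -hm_alpha (W_comm q0 _ Wz).
    case: eqP => [->|_]; first by rewrite mul1r hm_alpha; apply: ad_rho_id.
    rewrite !mul0r !scale0r !mul0r mulr0 !addr0 add0r; reflexivity.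
  have Cd : C1 n l (mu + alpha j - alpha k)
      (((k == j)%:R * w_ k * (1 - chi (alpha j) mu ^+ 2)) *: z).
    case: eqP => [->|_]; first by rewrite addrK; apply: C1_scale.
    rewrite !mul0r scale0r; apply: C1_z; first exact: C1_J Cz.
    by apply/wt_offB => //; apply/wt_offD => //; apply: C1_off Cz.
  case: n Cz lz Cd => [|n] Cz lz Cd.
    by exists (((k == j)%:R * w_ k * (1 - chi (alpha j) mu ^+ 2)) *: z);
      rewrite lz mul0r mulr0 scaler0 subr0 add0r.
  case: lz => y [Cy ->].
  have -> : chi (alpha j) mu = chi (alpha j) (mu - alpha k) * chi (alpha k) (alpha j).
    by rewrite [chi _ (alpha j)]chiC -chiDr // subrK.
  exists (chi (alpha k) (alpha j) *: (y * th j - chi (alpha j) (mu - alpha k) *: (th j * y))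
    + ((k == j)%:R * w_ k * (1 - chi (alpha j) mu ^+ 2)) *: z); split.
    apply: C1_lin => //; apply: C1_eq (C1_ad Jj Cy) _ _ => //.
    by rewrite addrAC.
  rewrite mulrDl -ad_rho_id2; last by rewrite -hm_alpha hm_theta.
  by rewrite [chi _ (alpha j)]chiC -chiDr // subrK.
Qed.

Definition good_rest mu (s : seq (B * seq I)) :=
  forall p, List.In p s -> [/\ W (mu - wtw p.2) p.1, all J p.2 & p.2 != [::]].
Definition Zst mu z := exists s, good_rest mu s /\
  forall (V : lmodType F) (beta : B -> B -> V), is_bilinear beta ->
    cop z beta = beta (hm mu) z + beta z 1 + \sum_(p <- s) beta p.1 (bw p.2).

(** A new commutator produces from $h_\mu\otimes z$ two terms with right leg z; they cancel because
    h_mu theta_k = chi(alpha_k, mu) theta_k h_mu. Thus $h_\mu\otimes z$ remains the only term whose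
    right leg contains theta_l. *)
Lemma C1_Zst n l mu z : C1 n l mu z -> Zst mu z.
Proof.
elim=> {n l mu z} [l Jl|n l mu Jl H|n l mu s x y Cx [sx [Gx Zx]] Cy [sy [Gy Zy]]|
  n l mu k z Jk Cz [s [G Z]]].
- exists [::]; split=> // V beta bb; rewrite big_nil addr0 hm_alpha (cop_theta Delta_spec) //.
  by rewrite addrC.
- exists [::]; split=> // V beta bb; rewrite big_nil addr0.
  rewrite (lin0 (cop_lin Delta_spec bb)) (lin0 (bil_l _ bb)) (lin0 (bil_r _ bb)).
  by rewrite addr0.
- exists ([seq (s *: p.1, p.2) | p <- sx] ++ sy); split.
    move=> p /(@List.in_app_or _ _ _ _) [|/Gy //] /(@List.in_map_iff _ _ _ _ _) [p' [<- p'x]]; have [Wp Jp pn] := Gx _ p'x.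
    by split=> //; apply: W_scale.
  move=> V beta bb; rewrite (cop_lin Delta_spec bb) Zx // Zy // big_cat big_map /=.
  rewrite (bil_l _ bb) (bil_r _ bb).
  have -> : \sum_(p <- sx) beta (s *: p.1) (bw p.2) = s *: \sum_(p <- sx) beta p.1 (bw p.2).
    by rewrite scaler_sumr; apply: eq_bigr => p _; rewrite (linZ (bil_l _ bb)).
  by rewrite !scalerDr add3ACA.
have Wz := C1_W Cz; set x := chi (alpha k) mu.
(* The first entry comes from $z\otimes 1$. The three lists come from the old rest terms, with
   theta_k going into the left leg, or to the right or the left end of the word in the right leg. *)
exists ((z * h k - x *: (h k * z), [:: k]) ::
  [seq (p.1 * th k - x *: (th k * p.1), p.2) | p <- s] ++
  [seq (p.1 * h k, rcons p.2 k) | p <- s] ++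
  [seq (- x *: (h k * p.1), k :: p.2) | p <- s]); split.
  have Wh p nu : W nu p -> W nu (p * h k).
    move=> Wp; rewrite -hm_alpha -[nu]addr0; apply: W_mul => //; exact: W_hm.
  have Wh' p nu : W nu p -> W nu (h k * p) by rewrite -hm_alpha; apply: W_h.
  have Wt p nu : W nu p -> W (nu + alpha k) (p * th k).
    by move=> Wp; apply: W_mul => //; apply: W_theta.
  move=> p /= [<-|/(@List.in_app_or _ _ _ _) [|/(@List.in_app_or _ _ _ _) []]].
  - split=> /=; [|by rewrite Jk|by []].
    rewrite wtw_cons /wtw big_nil addr0 addrK -scaleNr; apply: W_add; first exact: Wh.
    by apply/W_scale/Wh'.
  - move=> /(@List.in_map_iff _ _ _ _ _) [p' [<- p's]]; have [Wp Jp pn] := G _ p's; split=> //=.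
    rewrite addrAC -scaleNr; apply: W_add; first exact: Wt.
    by apply/W_scale/W_th.
  - move=> /(@List.in_map_iff _ _ _ _ _) [p' [<- p's]]; have [Wp Jp pn] := G _ p's; split.
    + by rewrite -cats1 wtw_cat [wtw [:: k]]wtw_cons /wtw big_nil addr0 opprD addrACA subrr addr0; apply: Wh.
    + by rewrite all_rcons Jk.
    + by case: (p'.2).
  - move=> /(@List.in_map_iff _ _ _ _ _) [p' [<- p's]]; have [Wp Jp pn] := G _ p's; split=> //=; last by rewrite Jk.
    by rewrite wtw_cons opprD addrA addrK; apply/W_scale/Wh'.
move=> V beta bb.
rewrite (linB (cop_lin Delta_spec bb)) (linZ (cop_lin Delta_spec bb)) !(copM Delta_spec) //.
rewrite (cop_theta Delta_spec); last by lint.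
rewrite (@eq_cop _ _ _ _ Delta _ z _
    (fun a1 a2 => beta (a1 * th k) a2 + beta (a1 * h k) (a2 * th k)));
  last by move=> a1 a2; rewrite (cop_theta Delta_spec) ?mulr1 //; lint.
rewrite (@eq_cop _ _ _ _ Delta _ z (fun b1 b2 => beta (th k * b1) (1 * b2))
  (fun b1 b2 => beta (th k * b1) b2)); last by move=> *; rewrite -> mul1r.
rewrite !Z; try lint.
rewrite big_cons !big_cat !big_map /= !big_split /=.
have e1 : beta (hm mu * th k) z = x *: beta (th k * hm mu) z.
  by rewrite hm_theta // (linZ (bil_l _ bb)) chiC.
have e2 : hm (mu + alpha k) = h k * hm mu by rewrite addrC hmD hm_alpha.
have e3 : \sum_(p <- s) beta (p.1 * th k - x *: (th k * p.1)) (bw p.2) =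
    \sum_(p <- s) beta (p.1 * th k) (bw p.2) - x *: \sum_(p <- s) beta (th k * p.1) (bw p.2).
  rewrite scaler_sumr -sumrB; apply: eq_bigr => p _.
  by rewrite (linB (bil_l _ bb)) (linZ (bil_l _ bb)).
have e4 : \sum_(p <- s) beta (- x *: (h k * p.1)) (bw (k :: p.2)) =
    - x *: \sum_(p <- s) beta (h k * p.1) (th k * bw p.2).
  rewrite scaler_sumr; apply: eq_bigr => p _.
  by rewrite (linZ (bil_l _ bb)) bw_cons.
have e5 : \sum_(p <- s) beta (p.1 * h k) (bw (rcons p.2 k)) =
    \sum_(p <- s) beta (p.1 * h k) (bw p.2 * th k).
  by apply: eq_bigr => p _; rewrite bw_rcons.
have e6 : bw [:: k] = th k by rewrite /bw big_seq1.
rewrite -> e1;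
  rewrite e3 e4 e5 e6;
  rewrite -> !(linB (bil_l _ bb));
  rewrite !(linB (bil_r _ bb));
  rewrite -> !(linZ (bil_l _ bb));
  rewrite !(linZ (bil_r _ bb));
  rewrite -> mul1r, -> mulr1;
  rewrite e2 -!hm_alpha [hm mu * hm _]hmC.
exact: Zst_id.
Qed.

Lemma rest_sum0 (V : lmodType F) mu s (g : B * seq I -> V) : good_rest mu s ->
  (forall p, W (mu - wtw p.2) p.1 -> all J p.2 -> p.2 != [::] -> g p = 0) ->
  \sum_(p <- s) g p = 0.
Proof.
move=> G H; elim: s G => [|p s IH] G; first by rewrite big_nil.
rewrite big_cons IH ?addr0; last by move=> p' p's; apply: G; right.
by have [|Wp Jp pn] := G p; [left|apply: H].
Qed.
Lemma C1_phi_h n l mu z nu : C1 n l mu z -> phi z (hm nu) = 0.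
Proof.
move=> Cz; apply: (phi_W q0 Delta_spec phi_spec (C1_W Cz) (W_hm D q nu)).
exact: wt_off_neq0 (C1_J Cz) (C1_off Cz).
Qed.
Lemma C1_phi_word n l mu z w : C1 n l mu z -> all J w -> phi z (bw w) = 0.
Proof.
move=> Cz Jw; apply: (phi_W q0 Delta_spec phi_spec (C1_W Cz) (W_bw D q w)).
exact: wt_off_neq (C1_J Cz) (C1_off Cz) Jw.
Qed.
(** The right legs of the coproduct of z' are z', 1 and words in J, and by weight only z' can pair
    with z to something nonzero. *)
Lemma C1_rho_C1 n l mu z n' l' mu' z' : C1 n l mu z -> C1 n' l' mu' z' ->
  rho z z' = phi z z' *: hm mu'.
Proof.
move=> Cz Cz'; have [s [G Z]] := C1_Zst Cz'.
rewrite [LHS]Z; last by lint.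
rewrite (phiC phi_spec z') -[1]hm0 (phiC phi_spec (hm 0)) (C1_phi_h _ Cz) scale0r addr0.
rewrite (rest_sum0 G) ?addr0 // => p _ Jp _.
by rewrite (phiC phi_spec) (C1_phi_word Cz Jp) scale0r.
Qed.
End AdWords.

(** * Sums of Lusztig as iterated q-commutators *)

Section AdExpansion.
Variables (F : fieldType) (A : algType F) (x y : A) (c : nat -> F).
Fixpoint adw (m : nat) : A :=
  if m is m'.+1 then x * adw m' - c m' *: (adw m' * x) else y.
Fixpoint adc (m r : nat) : F :=
  match m, r with
  | 0, 0 => 1 | 0, _.+1 => 0
  | m'.+1, 0 => adc m' 0
  | m'.+1, r'.+1 => adc m' r'.+1 - c m' * adc m' r'
  end.
Lemma adc_gt m r : (m < r)%N -> adc m r = 0.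
Proof.
elim: m r => [|m IH] [|r] //= mr; rewrite !IH ?mulr0 ?subr0 //; exact: ltnW.
Qed.
Lemma adwE m : adw m = \sum_(r < m.+1) adc m r *: (x ^+ (m - r) * y * x ^+ r).
Proof.
elim: m => [|m IH]; first by rewrite big_ord1 /= mul1r mulr1 scale1r.
have hx : x * adw m = \sum_(r < m.+2) adc m r *: (x ^+ (m.+1 - r) * y * x ^+ r).
  rewrite big_ord_recr /= adc_gt // scale0r addr0 IH mulr_sumr; apply: eq_bigr => r _.
  by rewrite -scalerAr !mulrA -exprS -subSn // -ltnS.
have hy : c m *: (adw m * x) =
    \sum_(r < m.+1) (c m * adc m r) *: (x ^+ (m - r) * y * x ^+ r.+1).
  rewrite IH mulr_suml scaler_sumr; apply: eq_bigr => r _.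
  by rewrite -scalerAl scalerA -!mulrA -exprSr.
rewrite [LHS]/= hx hy big_ord_recl [RHS]big_ord_recl -addrA; congr (_ + _).
by rewrite -sumrB; apply: eq_bigr => r _; rewrite -scalerBl.
Qed.
End AdExpansion.

Section QIntegers.
Variables (F : fieldType) (v : F).
Hypotheses (v0 : v != 0) (vn : forall n, (0 < n)%N -> v ^+ n != 1).
Lemma vsub_neq0 : v - v^-1 != 0.
Proof.
apply: contra_neq (vn (n := 2) isT) => /subr0_eq e.
by rewrite expr2 {2}e mulfV.
Qed.
Lemma qint_neq0 n : (0 < n)%N -> qint v n != 0.
Proof.
move=> n0; rewrite mulf_neq0 // ?invr_eq0 ?vsub_neq0 //.
have := vn (n := n + n); rewrite addn_gt0 n0 => /(_ isT).
by apply: contra_neq => /subr0_eq e; rewrite exprD {2}e mulfV ?expf_neq0.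
Qed.
Lemma qfactS n : qfact v n.+1 = qfact v n * qint v n.+1.
Proof. by rewrite /qfact big_nat_recr. Qed.
Lemma qfact0 : qfact v 0 = 1.
Proof. by rewrite /qfact big_nil. Qed.
Lemma qfact_neq0 n : qfact v n != 0.
Proof.
elim: n => [|n IH]; first by rewrite qfact0 oner_neq0.
by rewrite qfactS mulf_neq0 ?qint_neq0.
Qed.
Lemma qfact1 : qfact v 1 = 1.
Proof. by rewrite qfactS qfact0 mul1r /qint expr1 mulfV ?vsub_neq0. Qed.

Lemma qint_split m r : (r <= m)%N ->
  v ^+ r * qint v m = qint v (m - r) + v ^+ m * qint v r.
Proof.
move=> rm; rewrite /qint !mulrA -mulrDl; congr (_ / _).
have -> : v ^+ m = v ^+ (m - r) * v ^+ r by rewrite -exprD subnK.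
have := expf_neq0 r v0; have := expf_neq0 (m - r) v0.
set a := v ^+ (m - r); set b := v ^+ r => a0 b0.
by field; rewrite a0 b0.
Qed.

(** For these scalars the recursion of [adc] is the q-Pascal rule ([qint_split]), so the
    coefficients are signed q-binomials times powers of v. The q-factorials are kept as factors to
    avoid division within the induction. *)
Lemma adcE (z : int) (c := fun m => v ^ (z + 2 * m%:Z)) m r : (r <= m)%N ->
  adc c m r * (qfact v r * qfact v (m - r)) =
  (-1) ^+ r * v ^ (r%:Z * (z + m%:Z - 1)) * qfact v m.
Proof.
elim: m r => [|m IH] [|r] // rm; rewrite /=.
- by rewrite qfact0 mul0r expr0z !mulr1.
- rewrite subn0 qfact0 mul0r expr0z !mul1r.
  have := IH 0 isT; rewrite subn0 qfact0 mul0r expr0z !mul1r => /eqP.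
  by rewrite -subr_eq0 -{2}[qfact v m]mul1r -mulrBl mulf_eq0 (negbTE (qfact_neq0 _))
    orbF subr_eq0 => /eqP ->; rewrite mul1r.
have IH2 := IH r rm; rewrite ltnS in rm.
have vz (a b : int) : v ^ a * v ^ b = v ^ (a + b) by rewrite expfzDr.
have IH1 : adc c m r.+1 * (qfact v r.+1 * qfact v (m - r)) =
    (-1) ^+ r.+1 * v ^ (r.+1%:Z * (z + m%:Z - 1)) * qfact v m * qint v (m - r).
  (* At the boundary r = m both sides vanish: the coefficient is out of range, and the q-integer of
     0 is 0. *)
  move: rm; rewrite leq_eqVlt => /orP [/eqP <-|rm].
    by rewrite adc_gt // mul0r subnn /qint expr0 invr1 subrr mul0r mulr0.
  by rewrite -IH // -[in LHS](subnSK rm) [qfact v (m - r.+1).+1]qfactS (subnSK rm) !mulrA.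
rewrite subSS mulrBl IH1.
have -> : c m * adc c m r * (qfact v r.+1 * qfact v (m - r)) =
    c m * qint v r.+1 * (adc c m r * (qfact v r * qfact v (m - r))).
  by rewrite qfactS; ring.
rewrite IH2 qfactS /c.
have h := @qint_split m.+1 r.+1 rm.
have -> : v ^ (r.+1%:Z * (z + m.+1%:Z - 1)) =
    v ^ (r%:Z * (z + m%:Z - 1)) * v ^ (z + m%:Z - 1) * v ^+ r * v.
  transitivity (v ^ (r%:Z * (z + m%:Z - 1)) * v ^ (z + m%:Z - 1) * v ^ r%:Z * v ^ 1).
    by rewrite !vz; congr (v ^ _); lia.
  by rewrite expr1z -exprnP.
have -> : v ^ (r.+1%:Z * (z + m%:Z - 1)) =
    v ^ (r%:Z * (z + m%:Z - 1)) * v ^ (z + m%:Z - 1).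
  by rewrite vz; congr (v ^ _); lia.
have -> : v ^ (z + 2 * m%:Z) = v ^ (z + m%:Z - 1) * v ^+ m.+1.
  by rewrite exprnP vz; congr (v ^ _); lia.
move: h; rewrite subSS exprSr [(-1) ^+ r.+1]exprS.
set a := v ^ (_ * _); set b := v ^ (z + _ - _); set V := v ^+ m.+1 => h.
have -> : -1 * (-1) ^+ r * (a * b * v ^+ r * v) * (qfact v m * qint v m.+1) =
  -1 * (-1) ^+ r * (a * b) * qfact v m * (v ^+ r * v * qint v m.+1) by ring.
by rewrite h; ring.
Qed.
End QIntegers.

Section LusztigIdentities.
Variables (F : fieldType) (A : algType F).
Implicit Types (t y l e : A).
Lemma lam_ad_id t y l w V x cm : V *: t * l - x *: (l * t) = cm *: y ->
  w%:A * y + V *: t * l - x *: (l * t + x *: y * w%:A) = (w * (1 - x ^+ 2) + cm) *: y.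
Proof.
move=> e; rewrite scalerDl -e scalerDr opprD addrA -[_ + _ - x *: (l * t)]addrA addrAC.
congr (_ + _); rewrite -scalerAl mul1r -scalerAr mulr1 !scalerA -scalerBl.
by congr (_ *: _); ring.
Qed.
Lemma T_ad_id y f k' k'V l a v : a != 0 -> k' * k'V = 1 -> k'V * k' = 1 ->
  f * y = y * f - k' * l -> k' * y = a^-1 *: (y * k') ->
  y * (v *: (k'V * f)) - a^-1 *: (v *: (k'V * f) * y) = (v / a) *: l.
Proof.
move=> a0 kk kk' fy ky; have yk : y * k'V = a^-1 *: (k'V * y).
  have : k'V * (k' * y) * k'V = a^-1 *: (k'V * (y * k') * k'V).
    by rewrite ky -scalerAr -scalerAl.
  by rewrite mulrA kk' mul1r -[k'V * (y * k') * k'V]mulrA -[y * k' * k'V]mulrA kk mulr1.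
rewrite -scalerAr -scalerAl mulrA yk -scalerAl !scalerA.
rewrite [a^-1 * v]mulrC -scalerBr -!mulrA fy mulrBr opprB addrC subrK.
by rewrite mulrA kk' mul1r.
Qed.
Lemma adp_other_id y e (s l x : F) :
  (s *: y) * (l *: e) - x *: ((l *: e) * (s *: y)) = (s * l) *: (y * e - x *: (e * y)).
Proof.
rewrite !scalar_mul scalerBr !scalerA; congr (_ - _ *: _).
by rewrite mulrC [l * s]mulrC.
Qed.
Lemma adtk_id (a b p : F) (x t y : A) : y * t = b *: (t * y) ->
  y * (x * t - p *: (t * x)) - (a * b) *: ((x * t - p *: (t * x)) * y) =
  (y * x - a *: (x * y)) * t - (b * p) *: (t * (y * x - a *: (x * y))).
Proof.
move=> yt; rewrite !mulrBl !mulrBr -!scalerAr -!scalerAl !mulrA yt -!scalerAl.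
rewrite -[x * y * t]mulrA yt -scalerAr !scalerBr !scalerA !mulrA !opprB !addrA.
rewrite [b * p]mulrC [a * b * p]mulrAC.
have -> : a * p * b = p * b * a by ring.
by rewrite [LHS](ACl (1*4*3*2)).
Qed.
End LusztigIdentities.

Section LusztigSum.
Variables (I : finType) (D : satake I) (F : fieldType) (q : F).
Hypotheses (q0 : q != 0) (qn : forall n, (0 < n)%N -> q ^+ n != 1).
Local Notation B := (B_alg D q).
Local Notation U := (U_alg D q).
Local Notation E := (UE D q).
Local Notation Fg := (UF D q).
Local Notation Km := (UK_mon D q).
Local Notation K'm := (UK'_mon D q).
Local Notation th := (Btheta D q).
Local Notation chi := (@chi I D F q).
Local Notation v_ := (vi D q).
Local Notation c := (cartan D).
Local Notation w_ i := (v_ i - (v_ i)^-1).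
Local Notation W := (@W I D F q).
Local Notation isf := (@isf I D F q).
Local Notation bplus := (@bplus I D F q).
Local Notation bminus := (@bminus I D F q).
Local Notation omega := (@omega I D F q).

Lemma vin i n : (0 < n)%N -> v_ i ^+ n != 1.
Proof.
by move=> n0; rewrite /vi -exprM; apply: qn; rewrite !muln_gt0 symz_gt0.
Qed.
Lemma w_neq0 i : w_ i != 0.
Proof. exact: vsub_neq0 (vi_neq0 D q0 i) (@vin i). Qed.

Lemma lusztig_sum_ahom (f : U -> U) X Y i j : ahom f -> (forall k, f (X k) = Y k) ->
  f (lusztig_sum X i j) = lusztig_sum Y i j.
Proof.
move=> fH fX; rewrite /lusztig_sum (ahom_sum fH); apply: eq_bigr => r _.
by rewrite (ahomZ fH) !(ahomM fH) fX /divpow !(ahomZ fH) !(ahomX fH) fX.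
Qed.

Lemma K'm_bplus mu nu y : W nu y ->
  K'm mu * bplus y = (chi mu nu)^-1 *: (bplus y * K'm mu).
Proof.
have bH := bplusH D q.
elim=> {nu y} [nu||nu s x z _ IHx _ IHz|nu j x _ IHx|nu nu' x _ IHx].
- by rewrite (ahom0 bH) mulr0 mul0r scaler0.
- by rewrite (ahom1 bH) mulr1 mul1r chi0r invr1 scale1r.
- apply: (@ind_lin _ _ _ (fun x => _ * bplus x) (fun x => _ *: (bplus x * _))) => //; lint.
- by rewrite (ahomM bH) bplus_theta mulrA K'm_E // -scalerAl -mulrA IHx -scalerAr
    scalerA !mulrA chiNr // chiDr // invfM mulrC.
- by rewrite (ahomM bH) bplus_hm mulrA -Km_K'm -mulrA IHx -scalerAr mulrA.
Qed.
Lemma Km_bminus mu nu y : W nu y ->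
  Km mu * bminus y = (chi mu nu)^-1 *: (bminus y * Km mu).
Proof.
move/(K'm_bplus mu)/(congr1 omega); have oH := omegaH D q.
by rewrite (ahomZ oH) !(ahomM oH) omega_bplus omega_K'm.
Qed.
Lemma refl_alpha k : refl D k (alpha k) = - alpha k.
Proof. by rewrite reflE pair_alpha cartan_diag mulrz_nat mulr2n opprD addrA subrr add0r. Qed.
Lemma refl_invol k mu : refl D k (refl D k mu) = mu.
Proof.
rewrite !reflE pairD pairN pairZ pair_alpha cartan_diag.
rewrite (_ : pair D k mu - _ = - pair D k mu); last by ring.
by rewrite mulrNz opprK subrK.
Qed.
Lemma rf_reflC k mu nu : root_form D mu (refl D k nu) = root_form D (refl D k mu) nu.
Proof. by rewrite -[RHS](rf_refl D k) refl_invol. Qed.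
Lemma chi_refl_alpha k nu : chi (alpha k) (refl D k nu) = (chi (alpha k) nu)^-1.
Proof. by rewrite /chi rf_reflC refl_alpha -/(chi _ _) chiNl. Qed.

(** These commutators put theta_k on the left, the mirror image of those in [C1]: T_k maps E_l to
    one of this kind, and its inverse maps E_l to one of the other kind. *)
Fixpoint adn k l m : B :=
  if m is m'.+1 then th k * adn k l m' -
    chi (alpha k) (alpha l + alpha k *+ m') *: (adn k l m' * th k)
  else th l.
Lemma W_adn k l m : W (alpha l + alpha k *+ m) (adn k l m).
Proof.
elim: m => [|m IH]; first by rewrite mulr0n addr0; apply: W_theta.
rewrite mulrSr addrA /= -scaleNr; apply: W_add; first exact: W_th.
by apply: W_scale; apply: W_mul => //; apply: W_theta.
Qed.
Lemma isf_adn k l m : isf (adn k l m).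
Proof.
elim: m => [|m IH] /=; first exact: isf_th.
have fk : isf (th k) by exact: isf_th.
by apply: isfB; [|apply: isfZ]; apply: isfM.
Qed.

Lemma chiMn mu nu m : chi mu (nu *+ m) = chi mu nu ^+ m.
Proof.
elim: m => [|m IH]; first by rewrite mulr0n chi0r.
by rewrite mulrSr chiDr // IH exprSr.
Qed.

(** The normalization v_i^(n/2) (v_i - v_i^-1)^(-n) / [n]! of the rescaled symmetry, taken at n =
    -c_ij. *)
Definition lcoef i (n : nat) := q ^ ((symz D i)%:Z * n%:Z) * (w_ i) ^- n / qfact (v_ i) n.
Lemma lcoef_neq0 i n : lcoef i n != 0.
Proof.
rewrite /lcoef mulf_neq0 ?invr_eq0 ?qfact_neq0 ?vi_neq0 //; last by move=> ?; apply: vin.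
by rewrite mulf_neq0 ?expfz_neq0 // invr_eq0 expf_neq0 // w_neq0.
Qed.
Lemma lusztig_adn i j : i != j ->
  lusztig_sum E i j = lcoef i `|c i j| *: bplus (adn i j `|c i j|).
Proof.
move=> ij; set n := `|c i j|%N.
have cn : c i j = - n%:Z by rewrite /n; have := cartan_off_le0 D ij; lia.
have bH := bplusH D q.
have -> : bplus (adn i j n) = adw (E i) (E j) (fun m => v_ i ^ (c i j + 2 * m%:Z)) n.
  elim: (n) => [|m IH] /=; first by rewrite bplus_theta.
  rewrite (ahomB bH) (ahomZ bH) !(ahomM bH) bplus_theta IH.
  congr (_ - _ *: _); rewrite chiDr // chi_alpha expfzDr ?vi_neq0 //; congr (_ * _).
  by rewrite chiMn chi_alpha2 -exprM exprnP; congr (_ ^ _); lia.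
rewrite adwE scaler_sumr; apply: eq_bigr => -[r /= rn] _.
rewrite /divpow -scalerAl -scalerAr -scalerAl !scalerA; congr (_ *: _).
have qf m : qfact (v_ i) m != 0 by apply: qfact_neq0; [exact: vi_neq0|exact: vin].
have := @adcE _ (v_ i) (vi_neq0 D q0 i) (@vin i) (c i j) n r rn.
have := qf r; have := qf (n - r)%N; have := qf n.
rewrite /lcoef; set a := qfact _ n; set b := qfact _ (n - r); set e := qfact _ r.
have -> : (v_ i) ^ (r%:Z * (c i j + n%:Z - 1)) = q ^ (- (2 * (symz D i)%:Z * r%:Z)).
  by rewrite vi_z exprz_exp; congr (_ ^ _); rewrite cn; ring.
have -> : - ((symz D i)%:Z * ((2 * r)%N%:Z + c i j)) =
    (symz D i)%:Z * n%:Z + - (2 * (symz D i)%:Z * r%:Z).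
  by rewrite cn PoszM; ring.
rewrite expfzDr // cn -invr_expz -exprnP => a0 b0 e0 /(canRL (mulfK (mulf_neq0 e0 b0))) ->.
have := expf_neq0 n (w_neq0 i).
rewrite -exprnN; set y := q ^+ (_ * r); have y0 : y != 0 by apply: expf_neq0.
set x := q ^ (_ * n%:Z); set w := (v_ i - _) ^+ n; set sg := _ ^+ r => w0.
by field; rewrite a0 b0 e0 w0 y0.
Qed.

Variable T : I -> {lrmorphism U -> U}.
Hypothesis T_spec : is_lusztig T.
Let TH i : ahom (T i) := ahom_lr (T i).
Lemma T_inj i : injective (T i).
Proof. exact: bij_inj (lusztig_bij T_spec i). Qed.
Lemma T_Km i mu : T i (Km mu) = Km (refl D i mu).
Proof. exact: (lusztig_K T_spec). Qed.
Lemma T_K'm i mu : T i (K'm mu) = K'm (refl D i mu).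
Proof. exact: (lusztig_K' T_spec). Qed.

(** A check on generators. For E_i and F_i the normalizations v_i and v_i^-1 correspond after a
    Cartan element is commuted past E_i or F_i, at the cost of v_i^-2 or its analogue with the roles
    exchanged. *)
Lemma T_omega i x : T i (omega x) = omega (T i x).
Proof.
have oH := omegaH D q.
apply: (U_ahom_eq (ahom_comp oH (TH i)) (ahom_comp (TH i) oH)) => j /=; last first.
- rewrite omega_K'V -Km_alphaN -K'm_alphaN; rewrite -> T_Km; by rewrite T_K'm omega_K'm.
- rewrite omega_K' -Km_alpha -K'm_alpha; rewrite -> T_Km; by rewrite T_K'm omega_K'm.
- by rewrite omega_KV -Km_alphaN -K'm_alphaN T_Km T_K'm omega_Km.
- by rewrite omega_K -Km_alpha -K'm_alpha T_Km T_K'm omega_Km.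
- rewrite omega_F; have [->|ji] := eqVneq j i.
    rewrite -> (lusztig_Ei T_spec);
  rewrite (lusztig_Fi T_spec) (ahomZ oH) (ahomM oH) omega_E omega_KV.
    rewrite -K'm_alphaN K'm_F // chiNl chi_alpha2 scalerA; congr (_ *: _).
    by rewrite expr2 invfM mulrA mulfV ?vi_neq0 // mul1r.
  rewrite (lusztig_Ej T_spec) // (lusztig_Fj T_spec) //.
  by rewrite (lusztig_sum_ahom (f := omega) (Y := E)) // => k; rewrite omega_F.
- rewrite omega_E; have [->|ji] := eqVneq j i.
    rewrite (lusztig_Ei T_spec) (lusztig_Fi T_spec) (ahomZ oH) (ahomM oH) omega_F omega_K'V.
    rewrite -Km_alphaN Km_E // chiNl chi_alpha2 scalerA; congr (_ *: _).
    by rewrite expr2 invfM mulrA mulfV ?vi_neq0 // mul1r.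
  rewrite (lusztig_Ej T_spec) // (lusztig_Fj T_spec) //.
  by rewrite (lusztig_sum_ahom (f := omega) (Y := Fg)) // => k; rewrite omega_E.
Qed.

End LusztigSum.

(** * Lusztig symmetries on q-commutators *)

Section Lusztig.
Variables (I : finType) (D : satake I) (F : fieldType) (q : F).
Hypotheses (q0 : q != 0) (qn : forall n, (0 < n)%N -> q ^+ n != 1).
Local Notation B := (B_alg D q).
Local Notation U := (U_alg D q).
Local Notation E := (UE D q).
Local Notation Fg := (UF D q).
Local Notation K' := (UK' D q).
Local Notation K'V := (UK'V D q).
Local Notation th := (Btheta D q).
Local Notation chi := (@chi I D F q).
Local Notation v_ := (vi D q).
Local Notation c := (cartan D).
Local Notation w_ i := (v_ i - (v_ i)^-1).
Local Notation W := (@W I D F q).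
Local Notation isf := (@isf I D F q).
Local Notation bplus := (@bplus I D F q).

Variable T : I -> {lrmorphism U -> U}.
Hypothesis T_spec : is_lusztig T.
Let TH i : ahom (T i) := ahom_lr (T i).
Local Notation adn := (adn D q).
Local Notation lcoef := (lcoef D q).
Variables (Delta : B -> seq (B * B)) (phi : B -> B -> F).
Hypotheses (Delta_spec : is_coproduct Delta) (phi_spec : is_hopf_pairing Delta phi).
Local Notation rho := (rho Delta phi).
Local Notation lam := (lam Delta phi).
Let rhoL a : lin (rho a) := rho_lin Delta_spec phi_spec a.
Let lamL a : lin (lam a) := lam_lin Delta_spec phi_spec a.

Lemma T_E k l : k != l -> T k (E l) = lcoef k `|c k l| *: bplus (adn k l `|c k l|).
Proof. by move=> kl; rewrite (lusztig_Ej T_spec) 1?eq_sym // lusztig_adn. Qed.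

Definition adp k mu (z : B) := z * th k - chi (alpha k) mu *: (th k * z).
Lemma bplus_adp k mu z :
  bplus (adp k mu z) = bplus z * E k - chi (alpha k) mu *: (E k * bplus z).
Proof.
by rewrite (ahomB (bplusH D q)) (ahomZ (bplusH D q)) !(ahomM (bplusH D q)) bplus_theta.
Qed.

(* [c_m] with [lam_k (ad^m) = c_m ad^(m-1)] *)
Definition cad k l (m : nat) : F :=
  w_ k * ((v_ k ^+ (2 * m) - 1) / (v_ k ^+ 2 - 1)) *
  (1 - v_ k ^ (2 * (m%:Z - 1 + c k l))).
(** The two nontrivial factors vanish at m = 0 and at m = 1 - c_kl, just outside the range. *)
Lemma cad_neq0 k l m : (0 < m <= `|c k l|)%N -> k != l -> cad k l m != 0.
Proof.
move=> /andP [m0 mn] kl; have v2 : v_ k ^+ 2 - 1 != 0 by rewrite subr_eq0 (vin D qn).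
rewrite /cad !mulf_neq0 ?invr_eq0 ?(w_neq0 D q0 qn) //.
  by rewrite subr_eq0 (vin D qn) // muln_gt0.
have : exists2 p, (0 < p)%N & 2 * (m%:Z - 1 + c k l) = - p%:Z.
  exists (2 * (`|c k l| + 1 - m))%N; have := cartan_off_le0 D kl; lia.
by case=> p p0 ->; rewrite subr_eq0 eq_sym -exprnN invr_eq1 (vin D qn).
Qed.
Lemma cadS k l m : cad k l m.+1 =
  w_ k * (1 - (chi (alpha k) (alpha l + alpha k *+ m)) ^+ 2) + v_ k ^+ 2 * cad k l m.
Proof.
have v2 : v_ k ^+ 2 - 1 != 0 by rewrite subr_eq0 (vin D qn).
rewrite /cad chiDr // chiMn // chi_alpha2 // chi_alpha //.
have v0 := vi_neq0 D q0 k.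
have -> : 2 * (m%:Z - 1 + c k l) = 2 * c k l + (2 * m)%N%:Z + - 2%:Z by lia.
have -> : 2 * (m.+1%:Z - 1 + c k l) = 2 * c k l + (2 * m)%N%:Z by lia.
rewrite !expfzDr // mulrC -!exprnP -exprz_exp.
have -> : (2 * m.+1 = 2 * m + 2)%N by lia.
rewrite exprD -exprnN -exprM.
have := w_neq0 D q0 qn k; set w := w_ k.
set a := v_ k ^+ (2 * m).
have -> : (v_ k ^ 2) ^ c k l = (v_ k ^ c k l) ^+ 2 by rewrite [RHS]exprnP !exprz_exp mulrC.
set b := v_ k ^ c k l.
move=> w0; have := expf_neq0 2 v0; set V := v_ k ^+ 2 in v2 *; move=> V0.
by field; rewrite v2 V0.
Qed.

Lemma rho_adn k l m : k != l -> rho (th k) (adn k l m) = 0.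
Proof.
move=> kl; elim: m => [|m IH] /=.
  by rewrite (rho_theta_th Delta_spec phi_spec) (negbTE kl) mul0r scale0r.
rewrite (linB (rhoL _)) (linZ (rhoL _)); rewrite -> !(rho_theta Delta_spec phi_spec), -> IH.
rewrite -> mulr0;
  rewrite mul0r add0r addr0 -hm_alpha (rho_hm_isf q0 Delta_spec phi_spec _ (isf_adn D q k l m)).
rewrite (rho_theta_th Delta_spec phi_spec) eqxx mul1r -hm_alpha.
by rewrite -scalerAl (W_comm q0 _ (W_adn D q k l m)) -scalerAr scalerA mulrC -scalerA subrr.
Qed.
Lemma lam_adn k l m : k != l ->
  lam (th k) (adn k l m) = if m is m'.+1 then cad k l m *: adn k l m' else 0.
Proof.
move=> kl; elim: m => [|m IH].
  by rewrite (lam_theta_th Delta_spec phi_spec) (negbTE kl) mul0r scale0r.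
rewrite [adn _ _ _.+1]/= (linB (lamL _)) (linZ (lamL _));
  rewrite -> !(lam_theta Delta_spec phi_spec).
rewrite -hm_alpha (lam_hm_isf q0 Delta_spec phi_spec _ (isf_adn D q k l m)).
rewrite (lam_hm_isf q0 Delta_spec phi_spec _ (isf_th D q k)).
rewrite (W_conj q0 _ (W_adn D q k l m)) (W_conj q0 _ (W_theta D q k)) chi_alpha2.
rewrite (lam_theta_th Delta_spec phi_spec) eqxx mul1r cadS.
set x := chi _ _; set y := adn k l m.
apply: lam_ad_id; rewrite IH /y /x; case: m {IH x y} => [|m].
  by rewrite mulr0 mul0r scaler0 subr0 /cad muln0 expr0 subrr mul0r mulr0 mul0r mulr0 scale0r.
rewrite mulrSr addrA chiDr // chi_alpha2 [adn k l m.+1]/=.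
set x := chi _ _; set y := adn k l m.
rewrite -!scalerAl -!scalerAr !scalerA scalerBr scalerA.
by congr (_ *: _ - _ *: _); ring.
Qed.
(** T_k sends E_k to v_k K'_k^-1 F_k, so a q-commutator with E_k becomes one with F_k. By [FB] and
    the vanishing of [rho] the latter is the skew derivative [lam] of y. *)
Lemma T_adp k nu x y : T k x = bplus y -> isf y -> W nu y -> rho (th k) y = 0 ->
  T k (x * E k - chi (alpha k) (refl D k nu) *: (E k * x)) =
  (v_ k / chi (alpha k) nu) *: bplus (lam (th k) y).
Proof.
move=> Tx fy Wy ry.
rewrite (ahomB (TH k)) (ahomZ (TH k)) !(ahomM (TH k)) Tx (lusztig_Ei T_spec).
have := FB q0 Delta_spec phi_spec k fy; rewrite ry (ahom0 (bplusH D q)) addr0 => Fy.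
have ky := K'm_bplus q0 (alpha k) Wy; rewrite K'm_alpha in ky.
have -> : chi (alpha k) (refl D k nu) = (chi (alpha k) nu)^-1.
  by rewrite chi_refl_alpha.
apply: (@T_ad_id _ _ (bplus y) (Fg k) (K' k) (K'V k)); first exact: chi_neq0.
- exact: UK'_V.
- exact: UK'V_K'.
- exact: Fy.
- exact: ky.
Qed.

Lemma T_adpB k mu nu x y s : T k (bplus x) = s *: bplus y -> isf y -> W nu y ->
  rho (th k) y = 0 -> chi (alpha k) mu = (chi (alpha k) nu)^-1 ->
  T k (bplus (adp k mu x)) = (s * (v_ k / chi (alpha k) nu)) *: bplus (lam (th k) y).
Proof.
move=> Tx fy Wy ry cm; rewrite bplus_adp cm -(chi_refl_alpha D q).
rewrite (@T_adp k nu (bplus x) (s *: y)).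
- by rewrite (linZ (lamL _)) (ahomZ (bplusH D q)) scalerA (chi_refl_alpha D q) [s * _]mulrC.
- by rewrite Tx (ahomZ (bplusH D q)).
- exact: isfZ.
- exact: W_scale.
- by rewrite (linZ (rhoL _)) ry scaler0.
Qed.

Fixpoint adi k m mu (z : B) : B :=
  if m is m'.+1 then adp k (mu + alpha k *+ m') (adi k m' mu z) else z.
Lemma C1_adi i k m n l mu z : inJ D i k -> C1 i n l mu z ->
  C1 i (n + m) l (mu + alpha k *+ m) (adi k m mu z).
Proof.
move=> Jk Cz; elim: m => [|m IH]; first by rewrite addn0 mulr0n addr0.
by rewrite addnS mulrSr addrA; apply: C1_ad.
Qed.
Lemma adi_eq k m mu mu' z : chi (alpha k) mu = chi (alpha k) mu' ->
  adi k m mu z = adi k m mu' z.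
Proof. by move=> e; elim: m => //= m ->; rewrite /adp !chiDr // e. Qed.

(** T_k E_l is a left q-commutator of length -c_kl. Each right q-commutator with E_k turns under T_k
    into [lam], which shortens it by one with a nonzero factor; after -c_kl of them only E_l is
    left. *)
Lemma T_adi k l m : k != l -> (m <= `|c k l|)%N ->
  exists s, s != 0 /\
  T k (bplus (adi k m (alpha l) (th l))) = s *: bplus (adn k l (`|c k l| - m)).
Proof.
move=> kl; have cn : c k l = - (`|c k l|%N)%:Z by have := cartan_off_le0 D kl; lia.
set n := `|c k l|%N in cn *; elim: m => [|m IH] mn.
  exists (lcoef k n); split; first exact: lcoef_neq0.
  by rewrite subn0 /= bplus_theta T_E.
have [s [s0 Ts]] := IH (ltnW mn).
have e : (n - m = (n - m.+1).+1)%N by rewrite subnSK.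
(* The two weights are exchanged by s_k, which inverts chi(alpha_k, -). *)
have cm : chi (alpha k) (alpha l + alpha k *+ m) =
    (chi (alpha k) (alpha l + alpha k *+ (n - m)))^-1.
  rewrite !chiDr // !chiMn // !chi_alpha // !cartan_diag !exprnP !exprz_exp.
  by rewrite -!expfzDr ?vi_neq0 // invr_expz; congr (_ ^ _); rewrite cn; lia.
have := T_adpB Ts (isf_adn D q k l _) (W_adn D q k l _) (rho_adn _ kl) cm.
rewrite (lam_adn _ kl) e (ahomZ (bplusH D q)) scalerA -/(adi k m.+1 _ _) => ->.
eexists; split; last reflexivity.
have k0 : cad k l (n - m.+1).+1 != 0.
  by apply: cad_neq0 => //; rewrite -e subn_gt0 mn leq_subr.
by rewrite mulf_neq0 // mulf_neq0 // mulf_neq0 ?invr_eq0 ?chi_neq0 ?vi_neq0.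
Qed.
Lemma T_adi_n k l : k != l -> exists s, s != 0 /\
  T k (bplus (adi k `|c k l| (alpha l) (th l))) = s *: E l.
Proof.
move=> kl; have [s [s0]] := T_adi kl (leqnn _); rewrite subnn /= bplus_theta => Ts.
by exists s.
Qed.

Lemma T_E0 k l : k != l -> c k l = 0 -> T k (E l) = E l.
Proof.
move=> kl c0; rewrite T_E // c0 /= bplus_theta /lcoef mulr0 expr0z expr0 qfact0.
by rewrite invr1 !mulr1 scale1r.
Qed.
Lemma T_F0 k l : k != l -> c k l = 0 -> T k (Fg l) = Fg l.
Proof.
by move=> kl c0; rewrite -[Fg l]omega_E (T_omega q0 T_spec) T_E0 // omega_E.
Qed.

Lemma adi_fixed k t m mu x y : T k (E t) = E t -> T k (bplus x) = bplus y ->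
  T k (bplus (adi t m mu x)) = bplus (adi t m mu y).
Proof.
move=> Et xy; elim: m => //= m IH.
by rewrite !bplus_adp (ahomB (TH k)) (ahomZ (TH k)) !(ahomM (TH k)) Et IH.
Qed.

Section RankTwo.
Variables (k t : I).
Hypotheses (kt : k != t) (ckt : c k t = -1).
Local Notation e := (adn k t 1).
Let chikt : chi (alpha k) (alpha t) = (v_ k)^-1.
Proof. by rewrite chi_alpha ckt. Qed.
Let eE : e = th k * th t - (v_ k)^-1 *: (th t * th k).
Proof. by rewrite /= mulr0n addr0 chikt. Qed.
Let refl_t : refl D k (alpha t) = alpha t + alpha k.
Proof. by rewrite reflE pair_alpha ckt mulrN1z opprK. Qed.
Let TEt : T k (E t) = lcoef k 1 *: bplus e.
Proof. by rewrite T_E // ckt. Qed.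

Lemma T_adp_other mu x y s : T k (bplus x) = s *: bplus y ->
  T k (bplus (adp t mu x)) =
  (s * lcoef k 1) *: bplus (y * e - chi (alpha t) mu *: (e * y)).
Proof.
move=> Tx; have bH := bplusH D q.
rewrite bplus_adp (ahomB (TH k)) (ahomZ (TH k)) !(ahomM (TH k)) Tx TEt.
rewrite adp_other_id; congr (_ *: _); generalize (adn k t 1) => e'.
by rewrite (ahomB bH) (ahomZ bH) !(ahomM bH).
Qed.

(** Under T_k the bracket with E_t becomes a bracket with the commutator of E_k and E_t; the next
    bracket becomes [lam (th k)], which strips this E_k off again, as y is killed by both skew
    derivations. *)
Lemma T_adp_adp nu x y s : T k (bplus x) = s *: bplus y -> isf y -> W nu y ->
  rho (th k) y = 0 -> lam (th k) y = 0 -> s != 0 -> exists s', s' != 0 /\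
  T k (bplus (adp k (refl D k nu + alpha t) (adp t (refl D k nu) x))) =
  s' *: bplus (adp t nu y).
Proof.
move=> Tx fy Wy ry ly s0.
have Tx' := T_adp_other (refl D k nu) Tx.
set x2 := chi (alpha t) _ in Tx'.
have fe : isf e by apply: isf_adn.
have We : W (alpha t + alpha k) e by apply: (W_adn D q k t 1).
have re : rho (th k) e = 0 by apply: rho_adn.
have le : lam (th k) e = cad k t 1 *: th t by rewrite lam_adn.
have chtn : x2 = chi (alpha k) nu * chi (alpha t) nu.
  by rewrite /x2 -chiDl // /chi rf_reflC refl_t addrC.
have fy2 : isf (y * e - x2 *: (e * y)).
  by apply: isfB; [|apply: isfZ]; apply: isfM.
have Wy2 : W (nu + (alpha t + alpha k)) (y * e - x2 *: (e * y)).
  apply: W_add; first exact: W_mul.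
  by rewrite -scaleNr; apply: W_scale; rewrite addrC; apply: W_mul.
have ry2 : rho (th k) (y * e - x2 *: (e * y)) = 0.
  rewrite (linB (rhoL _)) (linZ (rhoL _));
  rewrite -> !(rho_theta Delta_spec phi_spec), -> re, -> ry.
  by rewrite !mul0r !mulr0 addr0 scaler0 subr0.
have ly2 : lam (th k) (y * e - x2 *: (e * y)) =
    (cad k t 1 * chi (alpha k) nu) *: adp t nu y.
  rewrite (linB (lamL _)) (linZ (lamL _)) !(lam_theta Delta_spec phi_spec); rewrite -> le, -> ly.
  rewrite mul0r add0r mulr0 addr0 -hm_alpha (lam_hm_isf q0 Delta_spec phi_spec _ fy).
  rewrite (W_conj q0 _ Wy) /adp scalerBr !scalerA chtn.
  rewrite -!scalerAl -scalerAr !scalerA; congr (_ *: _ - _ *: _); ring.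
have cm : chi (alpha k) (refl D k nu + alpha t) =
    (chi (alpha k) (nu + (alpha t + alpha k)))^-1.
  rewrite -(chi_refl_alpha D q) !reflD refl_t refl_alpha.
  by rewrite -[_ + alpha k - _]addrA subrr addr0.
rewrite (T_adpB Tx' fy2 Wy2 ry2 cm) ly2 (ahomZ (bplusH D q)) scalerA.
eexists; split; last reflexivity.
have k0 : cad k t 1 != 0 by apply: cad_neq0 => //; rewrite ckt.
rewrite mulf_neq0 // mulf_neq0 ?chi_neq0 // mulf_neq0 ?lcoef_neq0 //.
all: by rewrite ?invr_eq0 ?chi_neq0 ?vi_neq0.
Qed.
End RankTwo.
End Lusztig.

(** * The preimage of E_l under T_r *)

Section Lusztig.
Variables (I : finType) (D : satake I) (F : fieldType) (q : F).
Hypotheses (q0 : q != 0) (qn : forall n, (0 < n)%N -> q ^+ n != 1).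
Local Notation B := (B_alg D q).
Local Notation U := (U_alg D q).
Local Notation E := (UE D q).
Local Notation Fg := (UF D q).
Local Notation KV := (UKV D q).
Local Notation Km := (UK_mon D q).
Local Notation K'm := (UK'_mon D q).
Local Notation th := (Btheta D q).
Local Notation chi := (@chi I D F q).
Local Notation v_ := (vi D q).
Local Notation c := (cartan D).
Local Notation tau := (tau D).
Local Notation W := (@W I D F q).
Local Notation isf := (@isf I D F q).
Local Notation bplus := (@bplus I D F q).
Local Notation omega := (@omega I D F q).

Variable T : I -> {lrmorphism U -> U}.
Hypothesis T_spec : is_lusztig T.
Let TH i : ahom (T i) := ahom_lr (T i).
Local Notation adn := (adn D q).
Local Notation lcoef := (lcoef D q).
Variables (Delta : B -> seq (B * B)) (phi : B -> B -> F).
Hypotheses (Delta_spec : is_coproduct Delta) (phi_spec : is_hopf_pairing Delta phi).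
Local Notation rho := (rho Delta phi).
Local Notation lam := (lam Delta phi).
Let rhoL a : lin (rho a) := rho_lin Delta_spec phi_spec a.
Let lamL a : lin (lam a) := lam_lin Delta_spec phi_spec a.


Local Notation adp := (@adp I D F q).
Local Notation adi := (@adi I D F q).
Local Notation T_E := (T_E q0 qn T_spec).

(* In type A_2, T_j T_k maps E_j to E_k. *)
Lemma T_swap j k : j != k -> c k j = -1 -> c j k = -1 -> T j (T k (E j)) = E k.
Proof.
move=> jk ckj cjk; have kj : k != j by rewrite eq_sym.
have bH := bplusH D q.
have l1 : lcoef k 1 = lcoef j 1.
  rewrite /lcoef /vi; have : symz D k = symz D j; last by move=> ->.
  by have := symz_cartan D k j; rewrite ckj cjk; lia.
have dk : symz D k = symz D j by have := symz_cartan D k j; rewrite ckj cjk; lia.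
have vk : v_ k = v_ j by rewrite /vi dk.
have ckj' : chi (alpha k) (alpha j) = (v_ j)^-1 by rewrite chi_alpha ckj vk.
have cjk' : chi (alpha j) (alpha k) = (v_ j)^-1 by rewrite chi_alpha cjk.
rewrite T_E // ckj (ahomZ (TH j)).
have -> : bplus (adn k j 1) = bplus (adp j (alpha k) (th k)).
  by rewrite /= mulr0n addr0 /adp ckj' cjk'.
have Tk : T j (bplus (th k)) = lcoef j 1 *: bplus (adn j k 1).
  by rewrite bplus_theta T_E // cjk.
have cm : chi (alpha j) (alpha k) = (chi (alpha j) (alpha k + alpha j *+ 1))^-1.
  by rewrite chiDr // mulr1n chi_alpha2 // cjk' expr2 mulrA mulVf ?vi_neq0 // mul1r.
rewrite (T_adpB q0 T_spec Delta_spec phi_spec Tk (isf_adn D q j k 1) (W_adn D q j k 1)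
  (rho_adn q0 Delta_spec phi_spec 1 jk) cm).
rewrite (lam_adn q0 qn Delta_spec phi_spec 1 jk) -cm cjk' (ahomZ bH) bplus_theta !scalerA.
rewrite [X in X *: _](_ : _ = 1) ?scale1r // l1 /cad /lcoef cjk (qfact1 (vi_neq0 D q0 j) (@vin _ D _ _ qn j)).
have v0 := vi_neq0 D q0 j; have w0 := w_neq0 D q0 qn j.
have v2 : v_ j ^+ 2 - 1 != 0 by rewrite subr_eq0 (vin D qn).
(* All scalars are expressed through x = q^(d_j), a square root of v_j, in which the claim is an
   identity of rational functions. *)
have -> : q ^ ((symz D j)%:Z * 1%N%:Z) = q ^+ symz D j by rewrite mulr1.
have -> : 2 * (1%N%:Z - 1 + -1) = - 2%N%:Z :> int by [].
have vE : v_ j = (q ^+ symz D j) ^+ 2 by rewrite /vi mulnC exprM.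
rewrite -exprnN muln1 vE in v0 w0 v2 *; set x := q ^+ symz D j in v0 w0 v2 *.
have x0 : x != 0 by rewrite expf_neq0.
have -> : 1 - x ^+ 2 ^- 2 = (x ^+ 2 - x ^- 2) / x ^+ 2 by field.
move: w0 v2; set w := x ^+ 2 - _; set b := _ - 1 => w0 v2.
rewrite !expr1 !divr1 !divff ?expf_neq0 // !mulr1.
by field; rewrite x0 w0.
Qed.

Section Pair.
Variable i : I.
Local Notation ti := (tau i).
Local Notation J := (inJ D i).
Local Notation r := (refl_word D (r_word D i)).
Local Notation C1 := (@C1 I D F q i).
Hypothesis ci : c i ti \in [:: 2; 0; -1].

Let natc k l : k != l -> c k l = - (`|c k l|%N)%:Z.
Proof. by move=> kl; have := cartan_off_le0 D kl; lia. Qed.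
Let Jneq k l : J k -> ~~ J l -> k != l.
Proof. by move=> Jk; apply: contraNneq => <-. Qed.
Let Ji := inJi D i.
Let Jt := inJt D i.

(* [(ad_t ad_k)^m z] *)
Fixpoint adtk k t m mu (z : B) : B :=
  if m is m'.+1 then
    let nu := mu + (alpha k + alpha t) *+ m' in
    adp t (nu + alpha k) (adp k nu (adtk k t m' mu z))
  else z.
Lemma C1_adtk k t m n l mu z : J k -> J t -> C1 n l mu z ->
  C1 (n + (m + m)) l (mu + (alpha k + alpha t) *+ m) (adtk k t m mu z).
Proof.
move=> Jk Jt' Cz; elim: m => [|m IH]; first by rewrite !addn0 mulr0n addr0.
have -> : (n + (m.+1 + m.+1) = (n + (m + m)).+2)%N by lia.
rewrite mulrSr !addrA.
by apply: C1_ad => //; apply: C1_ad.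
Qed.
Lemma T_adtk k t nu m x y s : t != k -> c t k = -1 ->
  T t (bplus x) = s *: bplus y -> isf y -> W nu y ->
  (forall m', rho (th t) (adi k m' nu y) = 0 /\ lam (th t) (adi k m' nu y) = 0) ->
  s != 0 -> exists s', s' != 0 /\
  T t (bplus (adtk k t m (refl D t nu) x)) = s' *: bplus (adi k m nu y).
Proof.
move=> tk ctk Tx fy Wy ry s0; elim: m => [|m [s' [s'0 IH]]]; first by exists s.
have Wm : W (nu + alpha k *+ m) (adi k m nu y).
  elim: (m) => [|p Wp] /=; first by rewrite addr0.
  rewrite mulrSr addrA; apply: W_add.
    by apply: W_mul => //; apply: W_theta.
  by rewrite -scaleNr; apply/W_scale/W_th.
have fm : isf (adi k m nu y).
  elim: (m) => [|p fp] //=; have fk : isf (th k) by apply: isf_th.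
  by apply: isfB; [|apply: isfZ]; apply: isfM.
have [rm lm] := ry m.
have := T_adp_adp q0 qn T_spec Delta_spec phi_spec tk ctk IH fm Wm rm lm s'0.
have -> : refl D t (nu + alpha k *+ m) = refl D t nu + (alpha k + alpha t) *+ m.
  rewrite reflD; congr (_ + _); elim: (m) => [|p IHp].
    by rewrite !mulr0n reflE pair0 mulr0z subr0.
  by rewrite !mulrSr reflD IHp reflE pair_alpha ctk mulrN1z opprK.
by [].
Qed.

Lemma refl_mul k mu m : refl D k (mu *+ m) = refl D k mu *+ m.
Proof.
elim: m => [|m IH]; first by rewrite !mulr0n reflE pair0 mulr0z subr0.
by rewrite !mulrSr reflD IH.
Qed.
Lemma adpZ k mu s z : adp k mu (s *: z) = s *: adp k mu z.
Proof. by rewrite /adp -scalerAl -scalerAr scalerBr !scalerA mulrC. Qed.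
Lemma adiZ k m mu s z : adi k m mu (s *: z) = s *: adi k m mu z.
Proof. by elim: m => //= m ->; rewrite adpZ. Qed.
Lemma T_word_bij w : bijective (T_word T w).
Proof.
elim: w => [|k w IH]; first by exists id.
exact: bij_comp (lusztig_bij T_spec k) IH.
Qed.
Lemma T_word_ahom w : ahom (T_word T w).
Proof.
elim: w => [|k w IH]; first exact: ahom_id.
exact: ahom_comp IH (TH k).
Qed.
Lemma T_word_omega w x : T_word T w (omega x) = omega (T_word T w x).
Proof. by elim: w => //= k w ->; rewrite (T_omega q0 T_spec). Qed.
Lemma T_word_Km w mu : T_word T w (Km mu) = Km (refl_word D w mu).
Proof. by elim: w => //= k w ->; rewrite (T_Km T_spec). Qed.
Lemma T_word_K'm w mu : T_word T w (K'm mu) = K'm (refl_word D w mu).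
Proof. by elim: w => //= k w ->; rewrite (T_K'm T_spec). Qed.

(** The analogue for r_i of the value of T_i at F_i. The index moves by tau_i because r_i sends
    alpha_(tau_i k) to -alpha_k; in type A_2 the move is made by [T_swap]. *)
Lemma T_r_F k : J k ->
  T_r T i (Fg (tau_loc D i k)) = (v_ k)^-1 *: (E k * KV k).
Proof.
move=> Jk; rewrite tlE // /T_r; case: pairP => // [ei c2|ei c0|ei c1] /=.
- move: Jk; rewrite /inJ ei orbb => /eqP ->.
  by rewrite cartan_diag /= (lusztig_Fi T_spec).
- rewrite c0 /=; move: Jk => /orP [] /eqP ->.
    rewrite (T_F0 q0 qn T_spec) ?(lusztig_Fi T_spec) //.
    by rewrite cti.
  rewrite (lusztig_Fi T_spec) (ahomZ (TH i)) (ahomM (TH i)) -Km_alphaN (T_Km T_spec).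
  rewrite (T_E0 q0 qn T_spec) // 1?eq_sym //; congr (_ *: (_ * Km _)).
  by rewrite reflE pairN pair_alpha c0 mulrNz mulr0z oppr0 subr0.
- rewrite c1 /=; have ct : c ti i = -1 by rewrite cti.
  have ie : i != ti by rewrite eq_sym.
  have swapF j k' : j != k' -> c k' j = -1 -> c j k' = -1 -> T j (T k' (Fg j)) = Fg k'.
    by move=> *; rewrite -[Fg j]omega_E !(T_omega q0 T_spec) T_swap // omega_E.
  move: Jk => /orP [] /eqP ->; first by rewrite swapF // (lusztig_Fi T_spec).
  rewrite tauK (lusztig_Fi T_spec) !(ahomZ (TH _)) !(ahomM (TH _)); rewrite -> T_swap; rewrite //.
  rewrite -!Km_alphaN !(T_Km T_spec) /vi symz_tau; congr (_ *: (_ * Km _)).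
  rewrite !reflE !(pairD, pairN, pairZ) !pair_alpha !cartan_diag c1 ct.
  rewrite (_ : -2 - - (-1) * -1 = -1 :> int) // opprK mulr1z mulrN1z opprK.
  by rewrite addrAC addNr add0r.
Qed.
Lemma T_r_inv_E k : J k ->
  T_r T i (v_ k *: (Fg (tau_loc D i k) * KV (tau_loc D i k))) = E k.
Proof.
move=> Jk; have TrH := T_word_ahom (r_word D i).
rewrite /T_r (ahomZ TrH) (ahomM TrH) [X in X * _]T_r_F // -[KV (tau_loc _ _ _)]Km_alphaN.
rewrite [X in _ * X](T_word_Km (r_word D i)) rN r_loc ?tl_J // tlK // opprK.
by rewrite -scalerAl scalerA mulfV ?vi_neq0 // scale1r -mulrA Km_alpha UKV_K mulr1.
Qed.

(** The symmetries in the word are undone one at a time, starting from E_l. Each adds to the bracket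
    as many letters as its reflection adds simple roots to the weight. *)
Lemma T_r_inv_l l : ~~ J l -> exists n z s, [/\ C1 n l (r (alpha l)) z, s != 0 &
  T_r T i (bplus z) = s *: E l].
Proof.
move=> Jl; rewrite r_formula // /T_r.
have il := Jneq Ji Jl; have tl := Jneq Jt Jl.
have C0 := C1_th q Jl.
case: pairP => // [ei c2|ei c0|ei c1] /=.
- rewrite ei eqxx; have [s [s0 Ts]] := T_adi_n q0 qn T_spec Delta_spec phi_spec il.
  exists (0 + `|c i l|)%N, (adi i `|c i l| (alpha l) (th l)), s; split=> //.
  apply: C1_eq (C1_adi _ Ji C0) _ _ => //.
  by rewrite pair_alpha {2}(natc il) mulrNz opprK.
- rewrite (negbTE ei) c0 eqxx.
  have ct : c ti i = 0 by rewrite cti.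
  have ie : i != ti by rewrite eq_sym.
  have [s [s0 Ts]] := T_adi_n q0 qn T_spec Delta_spec phi_spec il.
  have [s' [s'0 Ts']] := T_adi_n q0 qn T_spec Delta_spec phi_spec tl.
  exists (0 + `|c ti l| + `|c i l|)%N.
  exists (adi i `|c i l| (alpha l + alpha ti *+ `|c ti l|) (adi ti `|c ti l| (alpha l) (th l))).
  exists (s' * s); split; last 1 first.
  + have -> : T ti (bplus (adi i `|c i l| (alpha l + alpha ti *+ `|c ti l|)
        (adi ti `|c ti l| (alpha l) (th l)))) = s' *: bplus (adi i `|c i l| (alpha l) (th l)).
      have Hx : T ti (bplus (adi ti `|c ti l| (alpha l) (th l))) = bplus (s' *: th l).
        by rewrite Ts' (ahomZ (bplusH D q)) bplus_theta.
      rewrite (adi_fixed _ _ (T_E0 q0 qn T_spec ei ct) Hx).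
      rewrite (@adi_eq _ _ _ _ q0 i _ _ (alpha l)) ?adiZ ?(ahomZ (bplusH D q)) //.
      by rewrite chiDr // chiMn // [chi _ (alpha ti)]chi_alpha c0 expr0z expr1n mulr1.
    by rewrite (ahomZ (TH i)) Ts scalerA.
  + apply: C1_eq (C1_adi _ Ji (C1_adi _ Jt C0)) _ _ => //.
    rewrite !pair_alpha {2}(natc il) {2}(natc tl) !mulrNz !opprK.
    by rewrite addrAC.
  + by rewrite mulf_neq0.
- rewrite (negbTE ei) c1 /=.
  have ct : c ti i = -1 by rewrite cti.
  have ie : i != ti by rewrite eq_sym.
  set n := `|c i l|%N; set m := `|c ti l|%N.
  have bH := bplusH D q.
  have nE := natc il; have mE := natc tl; rewrite -/n in nE; rewrite -/m in mE.
  have [s1 [s10 Ts1]] := T_adi_n q0 qn T_spec Delta_spec phi_spec il.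
  have [s2 [s20 Ts2]] := T_adi_n q0 qn T_spec Delta_spec phi_spec tl.
  (* Words without the letter theta_k are killed by both of its skew derivations. *)
  have zero k k' m' : k != k' -> ~~ (k == l) ->
      rho (th k) (adi k' m' (alpha l) (th l)) = 0 /\
      lam (th k) (adi k' m' (alpha l) (th l)) = 0.
    move=> kk' kl; elim: m' => [|m' [IHr IHl]] /=.
      rewrite (rho_theta_th Delta_spec phi_spec) (lam_theta_th Delta_spec phi_spec).
      by rewrite (negbTE kl) mul0r !scale0r.
    rewrite /adp (linB (rhoL _)) (linZ (rhoL _)) (linB (lamL _)) (linZ (lamL _)).
    set y := adi _ _ _ _ in IHr IHl *; rewrite !(rho_theta Delta_spec phi_spec);
  rewrite -> !(lam_theta Delta_spec phi_spec), -> IHr, -> IHl.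
    rewrite -> (rho_theta_th Delta_spec phi_spec), -> (lam_theta_th Delta_spec phi_spec).
    by rewrite (negbTE kk') !(mul0r, scale0r, mulr0, addr0, scaler0, subr0).
  have Ts1' : T i (bplus (adi i n (alpha l) (th l))) = s1 *: bplus (th l).
    by rewrite Ts1 bplus_theta.
  have Ts2' : T ti (bplus (adi ti m (alpha l) (th l))) = s2 *: bplus (th l).
    by rewrite Ts2 bplus_theta.
  have fl : isf (th l) by apply: isf_th.
  have Wl : W (alpha l) (th l) by apply: W_theta.
  have [s3 [s30 Ts3]] := T_adtk m ie c1 Ts1' fl Wl (fun m' => zero _ _ m' ie il) s10.
  set X0 := adtk _ _ _ _ _ in Ts3.
  have CX0 : C1 (0 + n + (m + m)) l (refl D i (alpha l) + (alpha ti + alpha i) *+ m) X0.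
    apply: C1_adtk => //; apply: C1_eq (C1_adi _ Ji C0) _ _ => //.
    by rewrite reflE pair_alpha nE mulrNz opprK.
  have e0 : th l = adn ti l 0 by [].
  (* T_i turns a further bracket with E_(tau i) into a bracket with the commutator of E_i and E_(tau
     i). Expanding it into two successive brackets ([adtk_id]) requires that the inner element y
     q-commute with theta_(tau i), which is [y0]. *)
  have [s4 [s40 Ts4]] : exists s, s != 0 /\
      T i (bplus (adi ti n (refl D i (alpha l) + (alpha ti + alpha i) *+ m) X0)) =
      s *: bplus (adtk i ti n (alpha l + alpha ti *+ m) (adi ti m (alpha l) (th l))).
    elim: (n) => [|j [s [sn0 IH]]]; first by exists s3.
    set y := adtk i ti j _ _ in IH.
    pose nu := alpha l + alpha ti *+ m + (alpha i + alpha ti) *+ j.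
    have nuE : nu = refl D ti (alpha l + alpha i *+ j).
      by rewrite reflD refl_mul (reflE D ti (alpha i)) pair_alpha ct mulrN1z opprK
        reflE pair_alpha mE mulrNz opprK.
    have munu : refl D i (alpha l) + (alpha ti + alpha i) *+ m + alpha ti *+ j =
        refl D i nu.
      rewrite /nu !reflD !refl_mul reflD refl_alpha (reflE D i (alpha ti)) pair_alpha c1.
      by rewrite mulrN1z opprK [alpha ti + alpha i]addrC addKr.
    (* Tested after the injective map T_(tau i), which turns this bracket into a multiple of a skew
       derivative that is 0. *)
    have y0 : adp ti nu y = 0.
      have [s' [s'0 Ty]] := T_adtk j ei ct Ts2' fl Wl (fun m' => zero _ _ m' ei tl) s20.
      have [r0' l0'] := zero _ _ j ei tl.
      have yE : refl D ti (alpha l) = alpha l + alpha ti *+ m.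
        by rewrite reflE pair_alpha mE mulrNz opprK.
      rewrite yE -/y in Ty.
      apply: (@bplus_inj _ _ _ _ q0 _ _ Delta_spec phi_spec); apply: (T_inj T_spec (i := ti)).
      have fj : isf (adi i j (alpha l) (th l)).
        exact: C1_isf (C1_adi j Ji C0).
      have Wj := C1_W (C1_adi j Ji C0).
      rewrite (T_adpB q0 T_spec Delta_spec phi_spec Ty fj Wj r0'); last first.
        by rewrite nuE chi_refl_alpha.
      by rewrite l0' !(ahom0 (bplusH D q)) scaler0 (ahom0 (TH ti)).
    exists (s * lcoef i 1); split; first by rewrite mulf_neq0 ?lcoef_neq0.
    rewrite [adi _ _ _ _]/= (T_adp_other q0 qn T_spec ie c1 _ IH); congr (_ *: bplus _).
    rewrite [adtk _ _ _.+1 _ _]/= -/y -/nu /adp.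
    have -> : chi (alpha ti) (refl D i (alpha l) + (alpha ti + alpha i) *+ m + alpha ti *+ j)
        = chi (alpha i) nu * chi (alpha ti) nu.
      rewrite munu -chiDl // /chi rf_reflC; congr (q ^ (2 * root_form D _ _)).
      by rewrite reflE pair_alpha c1 mulrN1z opprK addrC.
    rewrite [adn _ _ _]/= mulr0n addr0 [chi _ (nu + _)]chiDr // [chi (alpha ti) (alpha i)]chiC.
    by apply: adtk_id; apply/eqP; rewrite -subr_eq0; apply/eqP.
  have [s5 [s50 Ts5]] : exists s, s != 0 /\
      T ti (bplus (adtk i ti n (alpha l + alpha ti *+ m) (adi ti m (alpha l) (th l)))) =
      s *: bplus (adi i n (alpha l) (th l)).
    have := T_adtk n ei ct Ts2' fl Wl (fun m' => zero _ _ m' ei tl) s20.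
    by rewrite reflE pair_alpha mE mulrNz opprK.
  exists (0 + n + (m + m) + n)%N.
  exists (adi ti n (refl D i (alpha l) + (alpha ti + alpha i) *+ m) X0), (s4 * s5 * s1).
  split; last 1 first.
  + by rewrite Ts4 !(ahomZ (TH _)) Ts5 (ahomZ (TH _)) Ts1 !scalerA.
  + apply: C1_eq (C1_adi _ Jt CX0) _ _ => //.
    rewrite reflE !pair_alpha nE mE !(mulrNz, mulrzDl, opprD, opprK) !mulrnDl.
    rewrite -!mulrNz opprD !opprK !mulrzDr !addrA.
    by rewrite [LHS](ACl (1*2*4*5*3)).
  + by rewrite !mulf_neq0.
Qed.
End Pair.
End Lusztig.

(** * Descent along a linear retraction *)

Section Retraction.
Variables (F L : fieldType) (emb : {rmorphism F -> L}).
Local Open Scope classical_set_scope.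

(** A maximal F-subspace of L that avoids 1 is a complement of the image of F, and [r] is the
    projection along it. *)
Lemma retraction : exists r : L -> F,
  (forall c x y, r (emb c * x + y) = c * r x + r y) /\ forall c, r (emb c) = c.
Proof.
pose sub (M : set L) := forall c x y, M x -> M y -> M (emb c * x + y).
have [|M [[Ms M1] Mmax]] := @Zorn_bigcup L [set M | sub M /\ ~ M 1].
  move=> C CP Ct; split; last by move=> [M /CP [_ M1] /M1].
  move=> c x y [M CM Mx] [N CN Ny]; have [MN|NM] := Ct _ _ CM CN.
    by exists N => //; apply: (CP _ CN).1 => //; apply: MN.
  by exists M => //; apply: (CP _ CM).1 => //; apply: NM.
(* The empty set satisfies [sub], so 0 has to be adjoined before M can serve as a subspace. *)
pose M' x := x = 0 \/ M x.
have M's c x y : M' x -> M' y -> M' (emb c * x + y).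
  move=> [->|Mx] [->|My]; rewrite ?mulr0 ?add0r ?addr0; [by left|by right| |by right; apply: Ms].
  right; have -> : emb c * x = emb (c - 1) * x + x.
    by rewrite rmorphB rmorph1 mulrBl mul1r subrK.
  exact: Ms.
have M'1 : ~ M' 1 by case=> [/eqP|//]; rewrite oner_eq0.
have M'Z c x : M' x -> M' (emb c * x).
  by move=> Mx; rewrite -[_ * x]addr0; apply: M's => //; left.
have dec x : exists c, M' (x - emb c).
  have [Mx|Mx] := pselect (M' x); first by exists 0; rewrite rmorph0 subr0.
  pose N y := exists m c, M' m /\ y = m + emb c * x.
  have [m [c [Mm e1]]] : N 1.
    apply: contrapT => N1; apply: (Mmax N).
      split=> [y My|NM].
        by exists y, 0; rewrite rmorph0 mul0r addr0; split=> //; right.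
      apply: Mx; right; apply: NM; exists 0, 1; rewrite rmorph1 mul1r add0r.
      by split=> //; left.
    split=> // c y z [m [a [Mm ->]]] [m' [a' [Mm' ->]]].
    exists (emb c * m + m'), (c * a + a'); split; first exact: M's.
    by rewrite rmorphD rmorphM mulrDr mulrDl mulrA addrACA.
  have c0 : c != 0.
    by apply/eqP => c0; apply: M'1; rewrite e1 c0 rmorph0 mul0r addr0.
  exists c^-1; have -> : x - emb c^-1 = emb (- c^-1) * m.
    have -> : m = 1 - emb c * x by rewrite e1 addrK.
    rewrite mulrBr mulr1 mulrA -rmorphM mulNr mulVf // rmorphN1 mulN1r opprK rmorphN.
    by rewrite addrC.
  exact: M'Z.
have [r rP] := choice dec.
have ru x c : M' (x - emb c) -> r x = c.
  move=> Mc; apply/eqP; rewrite -subr_eq0; apply/negP => /negP d0; apply: M'1.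
  have := M's (-1) _ _ (rP x) Mc; rewrite rmorphN1 mulN1r opprB addrA subrK -rmorphB.
  by move/(M'Z (r x - c)^-1); rewrite -rmorphM mulVf // rmorph1.
exists r; split=> [c x y|c]; apply: ru; last by rewrite subrr; left.
rewrite rmorphD rmorphM opprD addrACA -mulrBr.
by apply: M's; apply: rP.
Qed.
End Retraction.

Section Descent.
Variables (F L : fieldType) (emb : {rmorphism F -> L}) (G : choiceType).
Variable r : L -> F.
Hypotheses (rL : forall c x y, r (emb c * x + y) = c * r x + r y)
  (rE : forall c, r (emb c) = c).
Lemma ret0 : r 0 = 0. Proof. by rewrite -(rmorph0 emb) rE. Qed.
Lemma retD x y : r (x + y) = r x + r y.
Proof. by rewrite -{1}[x]mul1r -(rmorph1 emb) rL mul1r. Qed.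
Lemma retZ c x : r (emb c * x) = c * r x.
Proof. by rewrite -[_ * x]addr0 rL ret0 addr0. Qed.

Local Notation FA := (free_alg F G).
Local Notation LA := (free_alg L G).
(** Applying [r] to coefficients is not multiplicative, but it commutes with multiplication by a
    generator on either side. Since the relators over L are images of relators over F, this suffices
    to carry the ideal into the ideal. *)
Definition fmapr (x : LA) : FA := [malg k in msupp x => r x@_k].
Lemma fmaprE x k : (fmapr x)@_k = r x@_k.
Proof. by rewrite mcoeffE; case: msuppP => // _; rewrite ret0. Qed.
Lemma fmaprD x y : fmapr (x + y) = fmapr x + fmapr y.
Proof. by apply/malgP => k; rewrite mcoeffD !fmaprE mcoeffD retD. Qed.
Lemma fmapr0 : fmapr 0 = 0.
Proof. by apply/malgP => k; rewrite fmaprE !mcoeff0 ret0. Qed.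
Lemma fmaprZ c x : fmapr (emb c *: x) = c *: fmapr x.
Proof. by apply/malgP => k; rewrite mcoeffZ !fmaprE mcoeffZ retZ. Qed.
Lemma fmapr_word c (w : seq G) :
  fmapr (c *: \prod_(a <- w) free_gen L a) = r c *: \prod_(a <- w) free_gen F a.
Proof.
rewrite -!free_word; apply/malgP => k; rewrite fmaprE !mcoeffZ !mcoeffU.
by case: (_ == k) => /=; rewrite ?mulr1n ?mulr0n ?mulr1 ?mulr0 ?ret0.
Qed.
Lemma fmapr_sum (s : seq (L * seq G)) :
  fmapr (\sum_(p <- s) p.1 *: \prod_(a <- p.2) free_gen L a) =
  \sum_(p <- s) r p.1 *: \prod_(a <- p.2) free_gen F a.
Proof.
elim: s => [|p s IH]; first by rewrite !big_nil fmapr0.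
by rewrite !big_cons fmaprD fmapr_word IH.
Qed.
Lemma fmapr_genl a x : fmapr (free_gen L a * x) = free_gen F a * fmapr x.
Proof.
have [s ->] := free_span x; rewrite fmapr_sum !mulr_sumr.
have := fmapr_sum [seq (p.1, a :: p.2) | p <- s]; rewrite !big_map /=.
under eq_bigr do rewrite big_cons scalerAr.
by under [in X in _ = X -> _]eq_bigr do rewrite big_cons scalerAr.
Qed.
Lemma fmapr_genr a x : fmapr (x * free_gen L a) = fmapr x * free_gen F a.
Proof.
have [s ->] := free_span x; rewrite fmapr_sum !mulr_suml.
have := fmapr_sum [seq (p.1, rcons p.2 a) | p <- s]; rewrite !big_map /=.
under eq_bigr do rewrite -cats1 big_cat /= big_seq1 scalerAl.
by under [in X in _ = X -> _]eq_bigr do rewrite -cats1 big_cat /= big_seq1 scalerAl.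
Qed.

Definition fmap_emb : FA -> LA := free_eval emb (@free_gen L G).
Lemma fmap_embD x y : fmap_emb (x + y) = fmap_emb x + fmap_emb y.
Proof. exact: rmorphD. Qed.
Lemma fmap_embM x y : fmap_emb (x * y) = fmap_emb x * fmap_emb y.
Proof. exact: rmorphM. Qed.
Lemma fmap_embZ c x : fmap_emb (c *: x) = emb c *: fmap_emb x.
Proof. exact: free_evalZ. Qed.
Lemma fmapr_emb c x : fmapr (c *: fmap_emb x) = r c *: x.
Proof.
elim/free_ind: x c => [|b x y IHx IHy|a x IHx] c.
- rewrite [fmap_emb 1]rmorph1; have := fmapr_word c [::]; by rewrite !big_nil.
- rewrite fmap_embD fmap_embZ scalerDr fmaprD;
  rewrite -> IHy;
  rewrite scalerA mulrC -scalerA fmaprZ IHx.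
  by rewrite [RHS]scalerDr !scalerA [b * _]mulrC.
- rewrite fmap_embM {1}/fmap_emb free_eval_gen [X in fmapr X](_ : _ = free_gen L a * (c *: fmap_emb x)).
    by rewrite fmapr_genl IHx -scalerAr.
  by rewrite -scalerAr.
Qed.

Variables (RF : relators FA) (RL : relators LA).
Hypothesis RFL : forall x, RL x -> exists2 y, RF y & x = fmap_emb y.

Lemma fmapr_ideal_l c a x : ideal_gen RF x -> ideal_gen RF (fmapr (c *: (a * fmap_emb x))).
Proof.
elim/free_ind: a c => [|b a a' IHa IHa'|g a IHa] c Rx.
- by rewrite mul1r fmapr_emb; apply: ideal_Z.
- rewrite mulrDl scalerDr fmaprD -scalerAl scalerA.
  by apply: ideal_D; [apply: IHa|apply: IHa'].
- by rewrite -mulrA scalerAr fmapr_genl; apply/ideal_Ml/IHa.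
Qed.
Lemma fmapr_ideal_lr c a x b : ideal_gen RF x ->
  ideal_gen RF (fmapr (c *: (a * fmap_emb x * b))).
Proof.
elim/free_ind: b c x => [|d b b' IHb IHb'|g b IHb] c x Rx.
- by rewrite mulr1; apply: fmapr_ideal_l.
- rewrite mulrDr scalerDr fmaprD -scalerAr scalerA.
  by apply: ideal_D; [apply: IHb|apply: IHb'].
- have := IHb c (x * free_gen F g); rewrite fmap_embM {2}/fmap_emb free_eval_gen;
  rewrite -> !mulrA.
  by apply; apply: ideal_Mr.
Qed.
Lemma fmapr_ideal x : ideal_gen RL x -> ideal_gen RF (fmapr x).
Proof.
move=> Rx; suff /(_ 1 1) : forall a b, ideal_gen RF (fmapr (a * x * b)).
  by rewrite mul1r mulr1.
elim: Rx => {x} [x /RFL [y Ry ->]||x y _ Px _ Py|c x _ Px|x c _ Px] a b.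
- by rewrite -[_ * b]scale1r; apply/fmapr_ideal_lr/ideal_rel.
- by rewrite mulr0 mul0r fmapr0; apply: ideal_0.
- by rewrite mulrDr mulrDl fmaprD; apply: ideal_D.
- by rewrite mulrA.
- by rewrite mulrA -[_ * c * b]mulrA.
Qed.

Definition qret (y : quot_alg RL) : quot_alg RF := quot_pi RF (fmapr (repr y)).
Lemma qret_pi x : qret (quot_pi RL x) = quot_pi RF (fmapr x).
Proof.
apply: quot_pi_eq; have := fmapr_ideal (quot_repr RL x).
by rewrite -scaleN1r -(rmorphN1 emb) fmaprD fmaprZ scaleN1r.
Qed.
Lemma qretL c x y : qret (emb c *: x + y) = c *: qret x + qret y.
Proof.
rewrite -(quot_reprK x) -(quot_reprK y) -(ahomL (quot_pi_ahom RL)) !qret_pi.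
by rewrite fmaprD fmaprZ (ahomL (quot_pi_ahom RF)).
Qed.
Lemma qret_genl a x : qret (pres_gen RL a * x) = pres_gen RF a * qret x.
Proof.
rewrite -(quot_reprK x) -(ahomM (quot_pi_ahom RL)) !qret_pi fmapr_genl.
exact: (ahomM (quot_pi_ahom RF)).
Qed.
Lemma qret_genr a x : qret (x * pres_gen RL a) = qret x * pres_gen RF a.
Proof.
rewrite -(quot_reprK x) -(ahomM (quot_pi_ahom RL)) !qret_pi fmapr_genr.
exact: (ahomM (quot_pi_ahom RF)).
Qed.

Variable bc : quot_alg RF -> quot_alg RL.
Hypotheses (bcH : semi_hom emb bc) (bcg : forall a, bc (pres_gen RF a) = pres_gen RL a).
Lemma qret_bcl x y : qret (bc x * y) = x * qret y.
Proof.
elim/pres_ind: x => [|c x x' IHx IHx'|a x IHx].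
- by rewrite (semi_1 bcH) !mul1r.
- by rewrite (semi_lin bcH) mulrDl -scalerAl qretL IHx IHx' mulrDl -scalerAl.
- by rewrite (semi_M bcH) bcg -!mulrA qret_genl IHx.
Qed.
Lemma qret_bcr x y : qret (y * bc x) = qret y * x.
Proof.
elim/pres_indr: x => [|c x x' IHx IHx'|a x IHx].
- by rewrite (semi_1 bcH) !mulr1.
- by rewrite (semi_lin bcH) mulrDr -scalerAr qretL IHx IHx' mulrDr -scalerAr.
- by rewrite (semi_M bcH) bcg !mulrA qret_genr IHx.
Qed.
Lemma qret_1 : qret 1 = 1.
Proof.
rewrite -(rmorph1 (quot_pi RL)) qret_pi.
have := fmapr_emb 1 1; rewrite [fmap_emb 1]rmorph1 !scale1r -(rmorph1 emb) rE scale1r => ->.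
exact: rmorph1.
Qed.
Lemma qret_bc x : qret (bc x) = x.
Proof. by rewrite -[bc x]mulr1 qret_bcl qret_1 mulr1. Qed.
End Descent.

Section UDescent.
Variables (I : finType) (D : satake I) (F L : fieldType) (emb : {rmorphism F -> L}) (q : F).
Local Notation U := (U_alg D q).
Local Notation UL := (U_alg D (emb q)).
Local Notation bc := (base_change (D := D) (q := q) emb).

Lemma U_rel_emb x : U_rel D (emb q) x -> exists2 y, U_rel D q y & x = fmap_emb emb y.
Proof.
have vE k : vi D (emb q) k = emb (vi D q k) by rewrite /vi rmorphXn.
have sE (X : I -> U_gen I) k j : serre D (emb q) (fun l => free_gen L (X l)) k j =
    fmap_emb emb (serre D q (fun l => free_gen F (X l)) k j).
  rewrite /fmap_emb (serre_morph D _ _ _ _ (free_evalZ emb _)).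
  by apply: serre_eq => l; rewrite /= free_eval_gen.
case=> [k|k|k|k|k j|k j|k j|k j|k j|k j|k j|k j|k j kj|k j kj].
- by eexists; [exact: (U_kkV D q k)|rewrite /fmap_emb free_eval_inv].
- by eexists; [exact: (U_kVk D q k)|rewrite /fmap_emb free_eval_inv].
- by eexists; [exact: (U_k'k'V D q k)|rewrite /fmap_emb free_eval_inv].
- by eexists; [exact: (U_k'Vk' D q k)|rewrite /fmap_emb free_eval_inv].
- by eexists; [exact: (U_kk D q k j)|rewrite /fmap_emb free_eval_comm1].
- by eexists; [exact: (U_kk' D q k j)|rewrite /fmap_emb free_eval_comm1].
- by eexists; [exact: (U_k'k' D q k j)|rewrite /fmap_emb free_eval_comm1].
- eexists; [exact: (U_ef D q k j)|rewrite /fmap_emb free_eval_bracket].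
  by rewrite rmorphM rmorph_nat rmorphB fmorphV vE.
- by eexists; [exact: (U_ke D q k j)|rewrite /fmap_emb free_eval_comm fmorphXz vE].
- by eexists; [exact: (U_kf D q k j)|rewrite /fmap_emb free_eval_comm fmorphXz vE].
- by eexists; [exact: (U_k'e D q k j)|rewrite /fmap_emb free_eval_comm fmorphXz vE].
- by eexists; [exact: (U_k'f D q k j)|rewrite /fmap_emb free_eval_comm fmorphXz vE].
- by eexists; [exact: (U_serre_e D q kj)|rewrite sE].
- by eexists; [exact: (U_serre_f D q kj)|rewrite sE].
Qed.

Lemma bcH : semi_hom emb bc.
Proof. exact: lift_semi_hom. Qed.
Lemma bc_gen a : bc (pres_gen _ a) = pres_gen (Relators (@U_proper I D L (emb q))) a.
Proof. exact: lift_gen. Qed.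

(** A retraction of the base change that is linear over U on both sides: equations among base
    changed elements, and membership in the left ideals of the completion, can be pulled back along
    it. *)
Lemma U_retract : exists R : UL -> U,
  [/\ forall c x y, R (emb c *: x + y) = c *: R x + R y,
      forall x y, R (bc x * y) = x * R y, forall x y, R (y * bc x) = R y * x
    & forall x, R (bc x) = x].
Proof.
have [r [rL rE]] := retraction emb.
exists (@qret F L _ r (Relators (@U_proper I D F q)) (Relators (@U_proper I D L (emb q)))).
split.
- by move=> c x y; apply: qretL => //; apply: U_rel_emb.
- by move=> x y; apply: qret_bcl => //; [apply: U_rel_emb|apply: bcH|apply: bc_gen].
- by move=> x y; apply: qret_bcr => //; [apply: U_rel_emb|apply: bcH|apply: bc_gen].
- by move=> x; apply: qret_bc => //; [apply: U_rel_emb|apply: bcH|apply: bc_gen].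
Qed.

Lemma bc_Km mu : bc (UK_mon D q mu) = UK_mon D (emb q) mu.
Proof.
rewrite /UK_mon; elim/big_rec2: _ => [|k x y _ <-]; first exact: semi_1 bcH.
rewrite (semi_M bcH); congr (_ * _).
have X n : bc (UK D q k ^+ n) = UK D (emb q) k ^+ n.
  by elim: n => [|n IH]; [exact: semi_1 bcH|rewrite !exprS (semi_M bcH) IH [X in X * _]bc_gen].
have XV n : bc (UKV D q k ^+ n) = UKV D (emb q) k ^+ n.
  by elim: n => [|n IH]; [exact: semi_1 bcH|rewrite !exprS (semi_M bcH) IH [X in X * _]bc_gen].
by case: (mu k) => n /=.
Qed.
Lemma bc_K'm mu : bc (UK'_mon D q mu) = UK'_mon D (emb q) mu.
Proof.
rewrite /UK'_mon; elim/big_rec2: _ => [|k x y _ <-]; first exact: semi_1 bcH.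
rewrite (semi_M bcH); congr (_ * _).
have X n : bc (UK' D q k ^+ n) = UK' D (emb q) k ^+ n.
  by elim: n => [|n IH]; [exact: semi_1 bcH|rewrite !exprS (semi_M bcH) IH [X in X * _]bc_gen].
have XV n : bc (UK'V D q k ^+ n) = UK'V D (emb q) k ^+ n.
  by elim: n => [|n IH]; [exact: semi_1 bcH|rewrite !exprS (semi_M bcH) IH [X in X * _]bc_gen].
by case: (mu k) => n /=.
Qed.

Variables (T : I -> {lrmorphism U -> U}) (TL : I -> {lrmorphism UL -> UL}).
Hypotheses (T_spec : is_lusztig T) (TL_spec : is_lusztig TL).
Lemma bc_lusztig_sum (X : I -> U) (Y : I -> UL) k j : (forall l, bc (X l) = Y l) ->
  bc (lusztig_sum X k j) = lusztig_sum Y k j.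
Proof.
move=> XY; have bZ c x : bc (c *: x) = emb c *: bc x.
  have := semi_lin bcH c x 0; rewrite addr0 => ->.
  by have := semi_lin bcH (-1) 0 0; rewrite scaler0 addr0 rmorphN1 scaleN1r addNr => ->;
    rewrite addr0.
have bX x n : bc (x ^+ n) = bc x ^+ n.
  by elim: n => [|n IH]; [exact: semi_1 bcH|rewrite !exprS (semi_M bcH) IH].
have b0 : bc 0 = 0 by have := bZ 0 0; rewrite scale0r rmorph0 scale0r.
have bD x y : bc (x + y) = bc x + bc y.
  by have := semi_lin bcH 1 x y; rewrite scale1r rmorph1 scale1r.
rewrite /lusztig_sum (big_morph _ bD b0); apply: eq_bigr => n _.
have vE : emb (vi D q k) = vi D (emb q) k by rewrite /vi rmorphXn.
have qi v m : emb (qint v m) = qint (emb v) m.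
  by rewrite /qint fmorph_div !rmorphB /= !fmorphV !rmorphXn.
have qf m : emb (qfact (vi D q k) m) = qfact (vi D (emb q) k) m.
  by rewrite -vE /qfact rmorph_prod; apply: eq_bigr.
rewrite bZ !(semi_M bcH) /divpow !bZ !bX !XY !fmorphV !qf; congr (_ *: _).
by rewrite !rmorphM rmorphXn rmorphN1 !fmorphXz rmorphB fmorphV -vE.
Qed.
Lemma bc_T k x : bc (T k x) = TL k (bc x).
Proof.
have H1 : semi_hom emb (bc \o T k).
  split=> [c y z||y z] /=.
  - by rewrite (ahomL (ahom_lr (T k))) (semi_lin bcH).
  - by rewrite (ahom1 (ahom_lr (T k))) (semi_1 bcH).
  - by rewrite (ahomM (ahom_lr (T k))) (semi_M bcH).
have H2 : semi_hom emb (TL k \o bc).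
  split=> [c y z||y z] /=.
  - by rewrite (semi_lin bcH) (ahomL (ahom_lr (TL k))).
  - by rewrite (semi_1 bcH) (ahom1 (ahom_lr (TL k))).
  - by rewrite (semi_M bcH) (ahomM (ahom_lr (TL k))).
apply: (semi_hom_eq H1 H2) => a /=; rewrite bc_gen.
have bcZ c y : bc (c *: y) = emb c *: bc y.
  have := semi_lin bcH c y 0; rewrite addr0 => ->.
  by have := semi_lin bcH (-1) 0 0; rewrite scaler0 addr0 rmorphN1 scaleN1r addNr => ->;
    rewrite addr0.
have vE j : emb (vi D q j) = vi D (emb q) j by rewrite /vi rmorphXn.
case: a => j.
- have [->|jk] := eqVneq j k.
    rewrite [T k _](lusztig_Ei T_spec) [RHS](lusztig_Ei TL_spec) bcZ (semi_M bcH) vE.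
    by congr (_ *: (_ * _)); apply: bc_gen.
  rewrite [T k _](lusztig_Ej T_spec) // [RHS](lusztig_Ej TL_spec) //.
  by apply: bc_lusztig_sum => l; apply: bc_gen.
- have [->|jk] := eqVneq j k.
    rewrite [T k _](lusztig_Fi T_spec) [RHS](lusztig_Fi TL_spec) bcZ (semi_M bcH) fmorphV vE.
    by congr (_ *: (_ * _)); apply: bc_gen.
  rewrite [T k _](lusztig_Fj T_spec) // [RHS](lusztig_Fj TL_spec) //.
  by apply: bc_lusztig_sum => l; apply: bc_gen.
- rewrite -[pres_gen _ (gK j)]/(UK D q j) -[pres_gen _ (gK j)]/(UK D (emb q) j).
  by rewrite -!Km_alpha (T_Km T_spec) (T_Km TL_spec) bc_Km.
- rewrite -[pres_gen _ (gKV j)]/(UKV D q j) -[pres_gen _ (gKV j)]/(UKV D (emb q) j).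
  by rewrite -!Km_alphaN (T_Km T_spec) (T_Km TL_spec) bc_Km.
- rewrite -[pres_gen _ (gK' j)]/(UK' D q j) -[pres_gen _ (gK' j)]/(UK' D (emb q) j).
  by rewrite -!K'm_alpha (T_K'm T_spec) (T_K'm TL_spec) bc_K'm.
- rewrite -[pres_gen _ (gK'V j)]/(UK'V D q j) -[pres_gen _ (gK'V j)]/(UK'V D (emb q) j).
  by rewrite -!K'm_alphaN (T_K'm T_spec) (T_K'm TL_spec) bc_K'm.
Qed.
End UDescent.

(** * Local finiteness of the module *)

Section ModulePlus.
Variables (I : finType) (D : satake I) (F : fieldType) (q : F).
Hypothesis q0 : q != 0.
Local Notation B := (B_alg D q).
Local Notation U := (U_alg D q).
Local Notation E := (UE D q).
Local Notation Fg := (UF D q).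
Local Notation Km := (UK_mon D q).
Local Notation K'm := (UK'_mon D q).
Local Notation th := (Btheta D q).
Local Notation hm := (Bh_mon D q).
Local Notation W := (@W I D F q).
Local Notation bplus := (@bplus I D F q).
Local Notation bminus := (@bminus I D F q).
Variables (Delta : B -> seq (B * B)) (phi : B -> B -> F).
Hypotheses (Delta_spec : is_coproduct Delta) (phi_spec : is_hopf_pairing Delta phi).
Local Notation rho := (rho Delta phi).
Local Notation lam := (lam Delta phi).
Let rhoL a : lin (rho a) := rho_lin Delta_spec phi_spec a.
Let lamL a : lin (lam a) := lam_lin Delta_spec phi_spec a.

Definition act (u : U) (b : B) : B := plus q0 Delta_spec phi_spec u b.
Lemma actL u : lin (act u). Proof. exact: endoP. Qed.
Lemma actLl b : lin (act^~ b).
Proof.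
by move=> c x y; rewrite /act (ahomL (plusH q0 Delta_spec phi_spec)) !endoE.
Qed.
Lemma actM x y b : act (x * y) b = act x (act y b).
Proof. exact: plusM. Qed.
Lemma act1 b : act 1 b = b.
Proof. by rewrite /act (ahom1 (plusH q0 Delta_spec phi_spec)) endoE. Qed.
Lemma act_bminus a b : act (bminus a) b = a * b. Proof. exact: plus_bminus. Qed.
Lemma act_F i b : act (Fg i) b = th i * b. Proof. exact: plus_F. Qed.
Lemma act_E i b : act (E i) b =
  rho (th i) b - rho (hm (alpha i)) (lam (hm (- alpha i)) (lam (th i) b)).
Proof. exact: plus_E. Qed.
Lemma act_K'm mu b : act (K'm mu) b = hm mu * b.
Proof. exact: plus_K'm. Qed.
Lemma act_Km mu b : act (Km mu) b = lam (hm (- mu)) (rho (hm mu) b).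
Proof.
elim/lattice_ind: mu b => [|mu i IH|mu i IH] b.
- by rewrite Km0 act1 oppr0 hm0 (rho1 Delta_spec phi_spec) (lam1 Delta_spec phi_spec).
- rewrite KmD actM IH Km_alpha [act _ b]plus_K opprD !hmD (rho_mul Delta_spec phi_spec).
  by rewrite (rho_lam Delta_spec phi_spec) -(lam_mul Delta_spec phi_spec) hmC.
- rewrite KmD actM IH Km_alphaN [act _ b]plus_KV opprD !hmD (rho_mul Delta_spec phi_spec).
  by rewrite (rho_lam Delta_spec phi_spec) -(lam_mul Delta_spec phi_spec) hmC opprK.
Qed.

(** [Fl n] is spanned by Cartan elements preceded by fewer than n letters theta. With this shift
    [Fl 0] is zero, so truncated subtraction in [Fl_word] gives the right answer. *)
Inductive Fl : nat -> B -> Prop :=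
| Fl_0 n : Fl n 0
| Fl_h n nu : Fl n.+1 (hm nu)
| Fl_th n i x : Fl n x -> Fl n.+1 (th i * x)
| Fl_lin n s x y : Fl n x -> Fl n y -> Fl n (s *: x + y).
Lemma FlD n x y : Fl n x -> Fl n y -> Fl n (x + y).
Proof. by move=> Fx Fy; rewrite -[x]scale1r; apply: Fl_lin. Qed.
Lemma FlZ n s x : Fl n x -> Fl n (s *: x).
Proof. by move=> Fx; rewrite -[_ *: _]addr0; apply: Fl_lin => //; apply: Fl_0. Qed.
Lemma FlN n x : Fl n x -> Fl n (- x).
Proof. by rewrite -scaleN1r; apply: FlZ. Qed.
Lemma FlB n x y : Fl n x -> Fl n y -> Fl n (x - y).
Proof. by move=> Fx Fy; apply: FlD => //; apply: FlN. Qed.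
Lemma Fl0_eq n x : Fl n x -> n = 0%N -> x = 0.
Proof.
elim=> {n x} // n s x y _ IHx _ IHy n0.
by rewrite IHx // IHy // scaler0 addr0.
Qed.
Lemma FlS n x : Fl n x -> Fl n.+1 x.
Proof.
elim=> {n x} [n|n nu|n i x _ IH|n s x y _ IHx _ IHy];
  [exact: Fl_0|exact: Fl_h|exact: Fl_th|exact: Fl_lin].
Qed.
Lemma Fl_leq n m x : (n <= m)%N -> Fl n x -> Fl m x.
Proof. by move=> /subnK <- Fx; elim: (m - n)%N => //= k IH; apply: FlS. Qed.
Lemma Fl_pred_th n i x : Fl n.-1 x -> Fl n (th i * x).
Proof.
case: n => [/Fl0_eq -> //|n]; last exact: Fl_th.
by rewrite mulr0; apply: Fl_0.
Qed.
Lemma Fl_hM n mu x : Fl n x -> Fl n (hm mu * x).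
Proof.
elim=> {n x} [n|n nu|n i x _ IH|n s x y _ IHx _ IHy].
- by rewrite mulr0; apply: Fl_0.
- by rewrite -hmD; apply: Fl_h.
- by rewrite mulrA hm_theta // -scalerAl -mulrA; apply/FlZ/Fl_th.
- by rewrite mulrDr -scalerAr; apply: Fl_lin.
Qed.
Lemma Fl_ex x : exists n, Fl n x.
Proof.
elim/B_indm: x => [|s x y [n Fx] [m Fy]|i x [n Fx]|mu x [n Fx]].
- by exists 1%N; rewrite -(hm0 D q); apply: Fl_h.
- exists (maxn n m); apply: Fl_lin; [apply: Fl_leq Fx|apply: Fl_leq Fy].
    exact: leq_maxl.
  exact: leq_maxr.
- by exists n.+1; apply: Fl_th.
- by exists n; apply: Fl_hM.
Qed.
Lemma Fl_rhoh n mu x : Fl n x -> Fl n (rho (hm mu) x).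
Proof.
elim=> {n x} [n|n nu|n i x _ IH|n s x y _ IHx _ IHy].
- by rewrite (lin0 (rhoL _)); apply: Fl_0.
- by rewrite (rho_hm_hm q0 Delta_spec phi_spec); apply/FlZ/Fl_h.
- by rewrite (rho_hm_thM q0 Delta_spec phi_spec); apply: Fl_th.
- by rewrite rhoL; apply: Fl_lin.
Qed.
Lemma Fl_lamh n mu x : Fl n x -> Fl n (lam (hm mu) x).
Proof.
elim=> {n x} [n|n nu|n i x _ IH|n s x y _ IHx _ IHy].
- by rewrite (lin0 (lamL _)); apply: Fl_0.
- by rewrite (lam_hm_hm q0 Delta_spec phi_spec); apply/FlZ/Fl_h.
- by rewrite (lam_hm_thM q0 Delta_spec phi_spec); apply/FlZ/Fl_th.
- by rewrite lamL; apply: Fl_lin.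
Qed.
Lemma Fl_rho n i x : Fl n x -> Fl n.-1 (rho (th i) x).
Proof.
elim=> {n x} [n|n nu|n j x Fx IH|n s x y _ IHx _ IHy].
- by rewrite (lin0 (rhoL _)); apply: Fl_0.
- by rewrite (rho_theta_hm q0 Delta_spec phi_spec); apply: Fl_0.
- rewrite (rho_th_thM q0 Delta_spec phi_spec) /=; apply: FlD; last exact: Fl_pred_th.
  by apply: FlZ; rewrite -hm_alpha; apply: Fl_hM.
- by rewrite rhoL; apply: Fl_lin.
Qed.
Lemma Fl_lam n i x : Fl n x -> Fl n.-1 (lam (th i) x).
Proof.
elim=> {n x} [n|n nu|n j x Fx IH|n s x y _ IHx _ IHy].
- by rewrite (lin0 (lamL _)); apply: Fl_0.
- by rewrite (lam_theta_hm q0 Delta_spec phi_spec); apply: Fl_0.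
- rewrite (lam_th_thM q0 Delta_spec phi_spec) /=; apply: FlD; last exact/FlZ/Fl_pred_th.
  exact: FlZ.
- by rewrite lamL; apply: Fl_lin.
Qed.
Lemma Fl_E n i x : Fl n x -> Fl n.-1 (act (E i) x).
Proof.
by move=> Fx; rewrite act_E; apply: FlB; [|apply/Fl_rhoh/Fl_lamh];
  [apply: Fl_rho|apply: Fl_lam].
Qed.
Lemma Fl_word n (w : seq I) x : Fl n x -> Fl (n - size w) (act (\prod_(j <- w) E j) x).
Proof.
elim: w => [|j w IH] Fx; first by rewrite big_nil act1 subn0.
by rewrite big_cons actM subnS; apply/Fl_E/IH.
Qed.
(** Each E_j removes a letter, so N of them annihilate [Fl N]. Every vector lies in some [Fl N];
    hence only finitely many terms of the quasi K-matrix matter on it. *)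
Lemma act_deep N u x : deep_ideal N u -> Fl N x -> act u x = 0.
Proof.
move=> [s ->] Fx; elim: s => [|[p w] s IH]; first by rewrite big_nil (lin0 (actLl x)).
rewrite big_cons (linD (actLl x)) IH addr0 actM /=.
by rewrite (Fl0_eq (Fl_word w Fx)) ?size_tuple ?subnn // (lin0 (actL _)).
Qed.
Lemma act_E_hm i nu : act (E i) (hm nu) = 0.
Proof. exact: (Fl0_eq (Fl_E i (Fl_h 0 nu))). Qed.
Lemma act_Km_hm mu nu : act (Km mu) (hm nu) = hm nu.
Proof.
rewrite act_Km (rho_hm_hm q0 Delta_spec phi_spec) (linZ (lamL _)).
by rewrite (lam_hm_hm q0 Delta_spec phi_spec) scalerA chiNl mulfV ?chi_neq0 // scale1r.
Qed.

Lemma W_actE nu i x : W nu x -> W (nu - alpha i) (act (E i) x).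
Proof.
move=> Wx; rewrite act_E -scaleN1r; apply: W_add; first exact: W_rho.
by apply: W_scale; apply/W_rhoh => //; apply/W_lamh => //; apply: W_lam.
Qed.
Lemma W_actKm nu mu x : W nu x -> W nu (act (Km mu) x).
Proof. by move=> Wx; rewrite act_Km; apply/W_lamh => //; apply/W_rhoh. Qed.
Lemma W_act_bplus mu y nu x : W mu y -> W nu x -> W (nu - mu) (act (bplus y) x).
Proof.
have bH := bplusH D q; move=> Wy Wx.
elim: Wy => {mu y} [mu||mu s y z _ IHy _ IHz|mu i y _ IHy|mu nu' y _ IHy].
- by rewrite (ahom0 bH) (lin0 (actLl x)); apply: W_0.
- by rewrite (ahom1 bH) act1 subr0.
- by rewrite (ahomL bH) actLl; apply: W_lin.
- by rewrite (ahomM bH) actM bplus_theta opprD addrA; apply: W_actE.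
- by rewrite (ahomM bH) actM bplus_hm; apply: W_actKm.
Qed.
Lemma W_nneg nu x : W nu x -> (forall j, 0 <= nu j) \/ x = 0.
Proof.
elim=> {nu x} [mu||mu s x z _ IHx _ IHz|mu i x _ IHx|mu nu' x _ IHx].
- by right.
- by left=> j; rewrite ffunE.
- by case: IHx => [|->]; [left|case: IHz => [|->]; [left|right; rewrite scaler0 addr0]].
- case: IHx => [H|->]; last by right; rewrite mulr0.
  by left=> j; rewrite !ffunE Num.Theory.addr_ge0.
- by case: IHx => [|->]; [left|right; rewrite mulr0].
Qed.
End ModulePlus.

(** * Recovering an element of the iHopf algebra from its action on 1 *)

Section Injectivity.
Variables (I : finType) (D : satake I) (F : fieldType) (q : F).
Hypothesis q0 : q != 0.
Local Notation B := (B_alg D q).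
Local Notation U := (U_alg D q).
Local Notation E := (UE D q).
Local Notation Km := (UK_mon D q).
Local Notation K'm := (UK'_mon D q).
Local Notation th := (Btheta D q).
Local Notation h := (Bh D q).
Local Notation hV := (BhV D q).
Local Notation hm := (Bh_mon D q).
Local Notation chi := (@chi I D F q).
Local Notation tau := (tau D).
Local Notation ltau := (lat_map tau).
Variables (Delta : B -> seq (B * B)) (phi : B -> B -> F).
Hypotheses (Delta_spec : is_coproduct Delta) (phi_spec : is_hopf_pairing Delta phi).
Local Notation rho := (rho Delta phi).
Local Notation lam := (lam Delta phi).
Local Notation cop := (cop Delta).
Local Notation act := (act q0 Delta_spec phi_spec).
Local Notation star := (istar Delta phi).
Local Notation Fl := (@Fl I D F q).
Let rhoL a : lin (rho a) := rho_lin Delta_spec phi_spec a.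
Let lamL a : lin (lam a) := lam_lin Delta_spec phi_spec a.

Lemma starE a b : star a b =
  cop a (fun a1 a2 => cop b (fun b1 b2 => phi (tauB b2) a1 *: (a2 * b1))).
Proof. by []. Qed.
Lemma phi_tauC a b : phi (tauB a) b = phi a (tauB b).
Proof. by rewrite -(phi_tau q0 Delta_spec phi_spec a) tauBK. Qed.
(** The coproduct of theta_i has two terms, so multiplying by theta_i in the iHopf algebra adds one
    skew derivative, of index tau i, to the ordinary product; [star_thr] is the version on the
    right. *)
Lemma star_thl i b :
  star (th i) b = th i * rho (hm (alpha (tau i))) b + rho (th (tau i)) b.
Proof.
rewrite starE (cop_theta Delta_spec); last by lint.
rewrite addrC; congr (_ + _).
  rewrite -hm_alpha /rho copMl; apply: eq_cop => x y.
  by rewrite -scalerAr phi_tauC tauB_hm lat_map_alpha.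
by apply: eq_cop => x y; rewrite mul1r phi_tauC tauB_theta.
Qed.
Lemma star_hl mu b : star (hm mu) b = hm mu * rho (hm (ltau mu)) b.
Proof.
rewrite starE (cop_hm Delta_spec); last by lint.
rewrite /rho copMl; apply: eq_cop => x y.
by rewrite -scalerAr phi_tauC tauB_hm.
Qed.
Lemma star_thr i b :
  star b (th i) = b * th i + lam (th (tau i)) b * h i.
Proof.
rewrite starE.
under eq_cop do (rewrite (cop_theta Delta_spec); last by lint).
rewrite copD (ahom1 (tauBH D q)); congr (_ + _).
  rewrite -[X in _ = X * _](lam1 Delta_spec phi_spec) /lam copMr; apply: eq_cop => x y.
  by rewrite (phiC phi_spec) -scalerAl.
rewrite /lam copMr; apply: eq_cop => x y.
by rewrite (phiC phi_spec) tauB_theta -scalerAl.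
Qed.
Lemma star_hr mu b : star b (hm mu) = lam (hm (ltau mu)) b * hm mu.
Proof.
rewrite starE.
under eq_cop do (rewrite (cop_hm Delta_spec); last by lint).
rewrite /lam copMr; apply: eq_cop => x y.
by rewrite (phiC phi_spec) tauB_hm -scalerAl.
Qed.

Definition ell (mu : lattice I) : int := \sum_l mu l * root_form D (alpha l) (alpha (tau l)).
(** The iHopf product of Cartan elements is twisted by chi(mu, tau nu). [cm] trivializes this twist,
    with value 1 at simple roots, and so compares the image of h_mu with K_(tau mu) K'_mu. *)
Definition cm mu : F := q ^ (ell mu - root_form D mu (ltau mu)).
Lemma ellD mu nu : ell (mu + nu) = ell mu + ell nu.
Proof. by rewrite /ell -big_split; apply: eq_bigr => l _; rewrite ffunE mulrDl. Qed.
Lemma ell_alpha i : ell (alpha i) = root_form D (alpha i) (alpha (tau i)).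
Proof.
rewrite /ell (bigD1 i) //= big1 ?addr0 => [|l li]; rewrite ffunE ?eqxx ?mul1r //.
by rewrite eq_sym (negbTE li) mul0r.
Qed.
Lemma cm_neq0 mu : cm mu != 0. Proof. exact: expfz_neq0. Qed.
Lemma cm0 : cm 0 = 1.
Proof. by rewrite /cm /ell rf0l big1 ?subr0 ?expr0z // => l _; rewrite ffunE mul0r. Qed.
Lemma cm_alpha i : cm (alpha i) = 1.
Proof. by rewrite /cm ell_alpha lat_map_alpha subrr expr0z. Qed.
Lemma cmD mu nu : cm (mu + nu) = cm mu * cm nu / chi mu (ltau nu).
Proof.
rewrite /cm /chi ellD lat_mapD rfDl !rfDr [root_form D nu (ltau mu)]rfC rf_tauC.
by rewrite invr_expz -!expfzDr //; congr (q ^ _); ring.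
Qed.

Variable Xi : {linear B -> iU_alg D q}.
Hypothesis Xi_spec : is_iHopf_iso Delta phi Xi.
Definition XU (b : B) : U := iU_val (Xi b).
Lemma XUL : lin XU.
Proof. by move=> c x y; rewrite /XU linearP. Qed.
Lemma XU1 : XU 1 = 1.
Proof. by rewrite /XU (iHopf_iso_1 Xi_spec). Qed.
Lemma XUM a b : XU (star a b) = XU a * XU b.
Proof. by rewrite /XU (iHopf_iso_M Xi_spec). Qed.
Lemma XU_th i : XU (th i) = UB D q i. Proof. exact: (iHopf_iso_theta Xi_spec). Qed.
Lemma XU_hmD mu nu : XU (hm (mu + nu)) = (chi mu (ltau nu))^-1 *: (XU (hm mu) * XU (hm nu)).
Proof.
rewrite -XUM star_hl (rho_hm_hm q0 Delta_spec phi_spec) -scalerAr -hmD (linZ XUL) scalerA.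
by rewrite -[chi (ltau mu) nu]/(q ^ _) rf_tauC mulVf ?chi_neq0 // scale1r.
Qed.
Lemma XU_hm mu : XU (hm mu) = cm mu *: (Km (ltau mu) * K'm mu).
Proof.
have Xa i : XU (hm (alpha i)) = Km (alpha (tau i)) * K'm (alpha i).
  rewrite /XU hm_alpha (iHopf_iso_h Xi_spec) /Uk tauK.
  by rewrite Km_alpha K'm_alpha.
have KK a b a' b' : Km a * K'm b * (Km a' * K'm b') = Km (a + a') * K'm (b + b').
  by rewrite KmD K'mD -!mulrA; congr (_ * _); rewrite mulrA -Km_K'm -mulrA.
elim/lattice_ind: mu => [|mu i IH|mu i IH].
- by rewrite hm0 XU1 cm0 lat_map0 Km0 K'm0 mulr1 scale1r.
- rewrite XU_hmD IH Xa -scalerAl KK cmD cm_alpha mulr1 scalerA mulrC lat_mapD lat_map_alpha.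
  by [].
(* The downward step is the product formula read backwards, multiplied by the inverse of the image
   of h_i. *)
- have := XU_hmD (mu - alpha i) (alpha i); rewrite subrK Xa IH.
  move/(congr1 (fun x => x * (Km (- alpha (tau i)) * K'm (- alpha i)))).
  rewrite -scalerAl KK -scalerAl -mulrA KK !subrr Km0 K'm0 !mulr1 => e.
  have -> : XU (hm (mu - alpha i)) = chi (mu - alpha i) (ltau (alpha i)) *:
      ((chi (mu - alpha i) (ltau (alpha i)))^-1 *: XU (hm (mu - alpha i))).
    by rewrite scalerA mulfV ?scale1r ?chi_neq0.
  rewrite -e scalerA lat_mapD lat_mapN lat_map_alpha; congr (_ *: _).
  have := cmD (mu - alpha i) (alpha i); rewrite subrK cm_alpha mulr1 lat_map_alpha => ->.
  by rewrite mulrC divfK ?chi_neq0.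
Qed.

Definition ev (b : B) : B := act (XU b) 1.
Lemma evL : lin ev.
Proof. by move=> c x y; rewrite /ev XUL actLl. Qed.
Lemma ev_star a b : ev (star a b) = act (XU a) (ev b).
Proof. by rewrite /ev XUM actM. Qed.
Lemma ev_hm mu : ev (hm mu) = cm mu *: hm mu.
Proof. by rewrite /ev XU_hm (linZ (actLl _ _ _ _)) actM act_K'm mulr1 act_Km_hm. Qed.
(** Only the first summand can keep the number of letters; the part with E and the skew derivative
    lower it. This triangularity is the source of the injectivity of [ev]. *)
Lemma ev_th i y (y' := rho (hm (- alpha (tau i))) y) :
  ev (th i * y) = th i * ev y' + act (E (tau i)) (hm (alpha i) * ev y') -
    ev (rho (th (tau i)) y').
Proof.
have -> : th i * y = star (th i) y' - rho (th (tau i)) y'.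
  rewrite star_thl addrK /y' -(rho_mul Delta_spec phi_spec) hmN.
  by rewrite (rho1 Delta_spec phi_spec).
rewrite (linB evL) ev_star XU_th /UB (linD (actLl _ _ _ _)) act_F actM.
by rewrite -K'm_alpha act_K'm.
Qed.

(* The inverse of the leading part of [ev]. *)
Let nt : nontrivial B := algType_nontrivial B.
Let Lo (a : B) : endo nt := Endo nt (lin_mull a (@lin_id F B)).
Let Ro (a : B) : endo nt := Endo nt (rhoL a).
Let Ao (a : B) : endo nt := Endo nt (lamL a).
(** To leading order [ev] twists y by rho(h_(tau i)^-1) each time a letter theta_i is put in front.
    The operators that insert the opposite twist satisfy the relations of B, which defines [sigma]
    on all of B. *)
Let kap_rels : B_rels D q (fun i => Lo (th i) * Ro (hm (alpha (tau i))))
  (fun i => Lo (h i) * Ao (hm (alpha (tau i))))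
  (fun i => Ao (hm (- alpha (tau i))) * Lo (hV i)).
Proof.
have rfs i j : chi (alpha (tau i)) (alpha j) = chi (alpha (tau j)) (alpha i).
  by rewrite -[alpha (tau i)]lat_map_alpha /chi rf_tauC lat_map_alpha rfC.
split.
- move=> i j ij; have LH : ahom Lo.
    split=> [s x y||x y]; apply: endo_eq => b; rewrite ?endoE /=.
    + by rewrite mulrDl scalerAl.
    + by rewrite mul1r.
    + by rewrite mulrA.
  rewrite (@serre_twist I D F q _ (fun k => Lo (th k))
    (fun k => Ro (hm (alpha (tau k)))) (fun _ _ => 1)); first last.
  + by [].
  + move=> k l; apply: endo_eq => b; rewrite !endoE /= -!(rho_mul Delta_spec phi_spec).
    by rewrite hmC.
  + move=> k l; apply: endo_eq => b; rewrite !endoE /= scale1r.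
    by rewrite (rho_hm_thM q0 Delta_spec phi_spec).
  rewrite -(serre_ahom D q th i j LH) Btheta_serre // (ahom0 LH) mul0r scaler0.
  by [].
- move=> i; apply: endo_eq => b; rewrite !endoE /= -(lam_mul Delta_spec phi_spec).
  by rewrite hmNl (lam1 Delta_spec phi_spec) mulrA Bh_V mul1r.
- move=> i; apply: endo_eq => b; rewrite !endoE /= mulrA BhV_h mul1r.
  by rewrite -(lam_mul Delta_spec phi_spec) hmN (lam1 Delta_spec phi_spec).
- move=> i j; apply: endo_eq => b; rewrite !endoE /= -!hm_alpha.
  rewrite !(lam_hm_hmM q0 Delta_spec phi_spec) rfs -!scalerAr !mulrA [hm (alpha i) * _]hmC.
  by rewrite -!(lam_mul Delta_spec phi_spec) [hm _ * hm (alpha (tau i))]hmC.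
- move=> i j; apply: endo_eq => b; rewrite !endoE /= -!hm_alpha.
  rewrite (lam_hm_thM q0 Delta_spec phi_spec) (rho_hm_hmM q0 Delta_spec phi_spec).
  rewrite -!scalerAr !mulrA hm_theta // -!scalerAl !scalerA -chi_alpha rfs.
  by rewrite (rho_lam Delta_spec phi_spec) [X in X *: _]mulrC.
Qed.
Let sigma (b : B) : B := B_lift kap_rels b 1.
Let sigmaL : lin sigma.
Proof. by move=> c x y; rewrite /sigma (ahomL (B_liftH kap_rels)) !endoE. Qed.
Let sigma_th i b : sigma (th i * b) = th i * rho (hm (alpha (tau i))) (sigma b).
Proof. by rewrite /sigma (ahomM (B_liftH kap_rels)) B_lift_theta !endoE. Qed.
Let sigma_hm mu : sigma (hm mu) = (cm mu)^-1 *: hm mu.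
Proof.
have kM := ahomM (B_liftH kap_rels).
elim/lattice_ind: mu => [|mu i IH|mu i IH].
- by rewrite hm0 /sigma (ahom1 (B_liftH kap_rels)) endoE cm0 invr1 scale1r.
- rewrite addrC hmD hm_alpha /sigma kM B_lift_h !endoE /= -/(sigma _) IH.
  rewrite (linZ (lamL _)) (lam_hm_hm q0 Delta_spec phi_spec) -!scalerAr scalerA.
  congr (_ *: _); rewrite cmD cm_alpha mul1r invfM invrK; congr (_ * _).
  by rewrite -[alpha (tau i)]lat_map_alpha /chi rf_tauC.
- rewrite addrC hmD hm_alphaN /sigma kM B_lift_hV !endoE /= -/(sigma _) IH -hm_alphaN.
  rewrite -scalerAr -hmD (linZ (lamL _)) (lam_hm_hm q0 Delta_spec phi_spec) scalerA.
  congr (_ *: _); have := cmD (mu - alpha i) (alpha i).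
  rewrite subrK cm_alpha mulr1 lat_map_alpha => ->; rewrite invfM invrK -mulrA.
  rewrite [- alpha i + mu]addrC chiNl // [chi (alpha (tau i)) _]chiC mulfV ?mulr1 //.
  exact: chi_neq0.
Qed.
Let Fl_sigma n x : Fl n x -> Fl n (sigma x).
Proof.
elim=> {n x} [n|n nu|n i x _ IH|n s x y _ IHx _ IHy].
- by rewrite (lin0 sigmaL); apply: Fl_0.
- by rewrite sigma_hm; apply/FlZ/Fl_h.
- by rewrite sigma_th; apply: Fl_th; apply: Fl_rhoh.
- by rewrite sigmaL; apply: Fl_lin.
Qed.
(** The error terms of [ev_th] have fewer letters, and they keep this property only because [ev] and
    [sigma] respect the filtration; hence the two claims share an induction. *)
Lemma ev_sigma n x : Fl n x -> Fl n (ev x) /\ Fl n.-1 (sigma (ev x) - x).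
Proof.
elim: n x => [|n IH] x Fx.
  rewrite (Fl0_eq Fx) // (lin0 evL) (lin0 sigmaL) subr0; split; exact: Fl_0.
move: Fx; move En : n.+1 => n1 Fx; elim: Fx En => {n1 x} [n1|n1 nu|n1 i y Fy _|n1 s x y _ IHx _ IHy] En.
- by rewrite (lin0 evL) (lin0 sigmaL) subr0; split; apply: Fl_0.
- rewrite ev_hm (linZ sigmaL) sigma_hm scalerA mulfV ?cm_neq0 // scale1r subrr.
  by split; [apply/FlZ/Fl_h|apply: Fl_0].
- case: En Fy => <- Fy; set y' := rho (hm (- alpha (tau i))) y.
  have Fy' : Fl n y' by apply: Fl_rhoh.
  have [Fe Fs] := IH _ Fy'.
  have Fr : Fl n (ev (rho (th (tau i)) y')).
    by apply: (IH _ _).1; apply: (Fl_leq (leq_pred n)); apply: Fl_rho.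
  have FE : Fl n (act (E (tau i)) (hm (alpha i) * ev y')).
    by apply: (Fl_leq (leq_pred n)); apply: Fl_E => //; apply: Fl_hM.
  rewrite ev_th -/y' -addrA; split.
    by apply: FlD; [apply: Fl_th|apply/FlS/FlB].
  rewrite (linD sigmaL) sigma_th addrAC; apply: FlD; last by apply/Fl_sigma/FlB.
  have -> : th i * rho (hm (alpha (tau i))) (sigma (ev y')) - th i * y =
      th i * rho (hm (alpha (tau i))) (sigma (ev y') - y').
    rewrite (linB (rhoL _)) mulrBr /y' -[rho _ (rho _ y)](rho_mul Delta_spec phi_spec).
    by rewrite hmN (rho1 Delta_spec phi_spec).
  by apply: Fl_pred_th; apply: Fl_rhoh.
- have [Fx Gx] := IHx En; have [Fy Gy] := IHy En; rewrite evL; split; first exact: Fl_lin.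
  by rewrite sigmaL opprD addrACA -scalerBr; apply: Fl_lin.
Qed.
Lemma ev_inj0 b : ev b = 0 -> b = 0.
Proof.
move=> e0; have [n Fb] := Fl_ex q0 b; elim: n Fb => [|n IH] Fb; first exact: Fl0_eq Fb _.
apply: IH; have [_] := ev_sigma Fb; rewrite e0 (lin0 sigmaL) sub0r => /FlN.
by rewrite opprK.
Qed.
End Injectivity.

(** * Intertwiners of the quasi K-matrix *)

Section XIdentities.
Variables (F : fieldType) (A : algType F).
Lemma split_id (tz ty E Fk Kp Kk KK Kt Ky : A) (a x cy y : F) :
  Kp * E = a *: (E * Kp) -> Kk * tz = a *: (tz * Kk) -> Kk * Kp = Kp * Kk ->
  Kp * Fk = x *: (Fk * Kp) -> Fk * tz = tz * Fk + ty * KK -> Ky * (KK * Kt) = KK * Kp ->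
  ((cy * y) *: (tz * Kp)) * (Fk + E * Kk) - x *: ((Fk + E * Kk) * ((cy * y) *: (tz * Kp)))
    + (x * y) *: ((cy *: (ty * Ky)) * (KK * Kt)) =
  (cy * y * a) *: ((tz * E - x *: (E * tz)) * (Kp * Kk)).
Proof.
move=> hE hz hK hF hzF hy; set c := cy * y.
have e1 : (c *: (tz * Kp)) * (Fk + E * Kk) =
    (c * x) *: (tz * Fk * Kp) + (c * a) *: (tz * E * (Kp * Kk)).
  rewrite -scalerAl mulrDr -!mulrA hF [Kp * (E * Kk)]mulrA hE -!scalerAl -!scalerAr.
  by rewrite scalerDr !scalerA !mulrA.
have e2 : (Fk + E * Kk) * (c *: (tz * Kp)) =
    c *: (tz * Fk * Kp + ty * KK * Kp) + (c * a) *: (E * tz * (Kp * Kk)).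
  rewrite -scalerAr mulrDl [Fk * (tz * _)]mulrA hzF mulrDl -[E * Kk * _]mulrA.
  rewrite [Kk * (tz * _)]mulrA hz -!scalerAl -!scalerAr scalerDr scalerA -!mulrA hK.
  by rewrite !mulrA.
have e3 : (cy *: (ty * Ky)) * (KK * Kt) = cy *: (ty * KK * Kp).
  by rewrite -scalerAl -[ty * Ky * _]mulrA hy mulrA.
rewrite e1 e2 e3 mulrBl -scalerAl scalerBr !scalerDr !scalerA.
set P := tz * Fk * Kp; set Q := ty * KK * Kp.
rewrite [x * c]mulrC !opprD !addrA.
have -> : c * a * x = x * (c * a) by ring.
have -> : x * y * cy = c * x by rewrite /c; ring.
by rewrite [LHS](ACl (((1*3)*(4*6))*(2*5))) /= subrr addNr !add0r.
Qed.
Lemma lower_id (z y E Fk KK Kt : A) (x s : F) : x != 0 ->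
  E * z = z * E + y * Kt -> KK * z = x^-1 *: (z * KK) -> KK * y = s *: (y * KK) ->
  z * (Fk + KK * E) - x *: ((Fk + KK * E) * z) + (x * s) *: (y * (KK * Kt)) =
  z * Fk - x *: (Fk * z).
Proof.
move=> x0 hE hz hy; rewrite mulrDr mulrDl -mulrA hE mulrDr !mulrA hz hy.
rewrite -!scalerAl scalerDr scalerDr !scalerA mulfV // scale1r.
rewrite opprD addrACA; have -> : z * KK * E - (z * KK * E + (x * s) *: (y * KK * Kt)) =
  - ((x * s) *: (y * KK * Kt)) by rewrite opprD addrA subrr add0r.
by rewrite subrK.
Qed.
End XIdentities.

Section Intertwiners.
Variables (I : finType) (D : satake I) (F : fieldType) (q : F).
Hypothesis q0 : q != 0.
Local Notation B := (B_alg D q).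
Local Notation U := (U_alg D q).
Local Notation E := (UE D q).
Local Notation Fg := (UF D q).
Local Notation hm := (Bh_mon D q).
Local Notation tau := (tau D).
Local Notation W := (@W I D F q).
Local Notation bplus := (@bplus I D F q).
Variables (Delta : B -> seq (B * B)) (phi : B -> B -> F).
Hypotheses (Delta_spec : is_coproduct Delta) (phi_spec : is_hopf_pairing Delta phi).
Local Notation act := (act q0 Delta_spec phi_spec).
Variable i : I.
Local Notation J := (inJ D i).
Variable Ups : lattice I -> U.
Hypothesis Ups_spec : is_quasi_K i Ups.
Local Notation PS := (partial_sum Ups).

Lemma PS_split M : (0 < M)%N -> exists s : seq (lattice I),
  (forall mu, mu \in s -> mu != 0 /\ forall j, 0 <= mu j) /\
  PS M = 1 + \sum_(mu <- s) Ups mu.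
Proof.
case: M => // M _; pose z : {ffun I -> 'I_M.+1} := [ffun => ord0].
pose f (mu : {ffun I -> 'I_M.+1}) : lattice I := [ffun j => (mu j : nat)%:Z].
pose P (mu : {ffun I -> 'I_M.+1}) := (\sum_j mu j < M.+1)%N && (mu != z).
exists [seq f mu | mu <- [seq mu <- index_enum _ | P mu]]; split.
  move=> nu /mapP [mu]; rewrite mem_filter => /andP [/andP [_ mz] _] ->.
  split; last by move=> j; rewrite ffunE.
  apply: contra mz => /eqP fz; apply/eqP/ffunP => j; apply/val_inj.
  by have /ffunP/(_ j) := fz; rewrite !ffunE => -[].
rewrite /partial_sum (bigD1 z) /=; last first.
  by rewrite big1 // => j _; rewrite ffunE.
rewrite big_map big_filter; congr (_ + _).
rewrite -(quasi_K_0 Ups_spec); congr Ups; apply/ffunP => j; rewrite !ffunE.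
by [].
Qed.

Lemma Ups_words mu : exists n (c : 'I_n -> F) (w : 'I_n -> seq I),
  (forall k, wtw (w k) = mu) /\ Ups mu = \sum_k c k *: \prod_(j <- w k) E j.
Proof.
have [s [/allP sm ->]] := quasi_K_wt Ups_spec mu.
exists (size s), (fun k => (tnth (in_tuple s) k).1), (fun k => (tnth (in_tuple s) k).2).
split=> [k|]; first by apply/eqP/sm/mem_tnth.
by rewrite (big_tnth _ _ s).
Qed.
Lemma act_Ups_hm mu nu : mu != 0 -> act (Ups mu) (hm nu) = 0.
Proof.
move=> mu0; have [n [c [w [wm ->]]]] := Ups_words mu.
rewrite (lin_sum (actLl q0 Delta_spec phi_spec _)) big1 // => k _.
rewrite (linZ (actLl q0 Delta_spec phi_spec _)).
have wk : w k != [::] by apply: contraNneq mu0 => e; rewrite -(wm k) e /wtw big_nil.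
rewrite (Fl0_eq (Fl_word q0 Delta_spec phi_spec (w k) (Fl_h _ _ 0 nu))) ?scaler0 //.
by case: (w k) wk.
Qed.
Lemma act_PS_hm M nu : (0 < M)%N -> act (PS M) (hm nu) = hm nu.
Proof.
move=> /PS_split [s [sP ->]]; rewrite (linD (actLl q0 Delta_spec phi_spec _)) act1.
rewrite (lin_sum (actLl q0 Delta_spec phi_spec _)) big_seq big1 ?addr0 // => mu /sP [mu0 _].
exact: act_Ups_hm.
Qed.
Lemma W_act_Ups mu nu x : W nu x -> W (nu - mu) (act (Ups mu) x).
Proof.
move=> Wx; have [n [c [w [wm ->]]]] := Ups_words mu.
rewrite (lin_sum (actLl q0 Delta_spec phi_spec _)).
apply: (big_ind (W (nu - mu))) => [||k _]; [exact: W_0|by move=> *; apply: W_add|].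
rewrite (linZ (actLl q0 Delta_spec phi_spec _)); apply: W_scale; rewrite -(wm k).
have -> : \prod_(j <- w k) E j = bplus (bw D q (w k)).
  rewrite (ahom_prod (bplusH D q)); apply: eq_bigr => j _.
  by rewrite bplus_theta.
by apply: W_act_bplus => //; apply: W_bw.
Qed.

(** The relation a Upsilon = Upsilon b read on vectors. The bound may depend on m, which is what
    makes the relation stable under products ([Int_mul]). *)
Definition Int (a b : U) := forall m, exists M0, forall M, (M0 <= M)%N ->
  act a (act (PS M) m) = act (PS M) (act b m).
Lemma Int_intertwines a b : intertwines Ups a b -> Int a b.
Proof.
move=> ab m; have [N Fm] := Fl_ex q0 m; have [M0 H] := ab N; exists M0 => M M0M.
have /(act_deep q0 Delta_spec phi_spec) /(_ Fm) := H M M0M.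
by rewrite (linB (actLl _ _ _ _)) !actM => /eqP; rewrite subr_eq0 => /eqP.
Qed.
Lemma Int_mul a b a' b' : Int a b -> Int a' b' -> Int (a * a') (b * b').
Proof.
move=> ab ab' m; have [M1 H1] := ab' m; have [M2 H2] := ab (act b' m).
exists (maxn M1 M2) => M; rewrite geq_max => /andP [/H1 {}H1 /H2 {}H2].
transitivity (act a (act a' (act (PS M) m))); first exact: actM.
by rewrite H1 H2; symmetry; congr (act _ _); apply: actM.
Qed.
Lemma Int_lin c a b a' b' : Int a b -> Int a' b' -> Int (c *: a + a') (c *: b + b').
Proof.
move=> ab ab' m; have [M1 H1] := ab' m; have [M2 H2] := ab m.
exists (maxn M1 M2) => M; rewrite geq_max => /andP [/H1 {}H1 /H2 {}H2].
by rewrite !(actLl q0 Delta_spec phi_spec _) actL H1 H2.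
Qed.
Lemma Int0 : Int 0 0.
Proof. by move=> m; exists 0 => M _; rewrite !(lin0 (actLl q0 Delta_spec phi_spec _)) (lin0 (actL _ _ _ _)). Qed.
Lemma IntZ c a b : Int a b -> Int (c *: a) (c *: b).
Proof. by move=> ab; rewrite -[c *: a]addr0 -[c *: b]addr0; apply: Int_lin Int0. Qed.
Lemma IntD a b a' b' : Int a b -> Int a' b' -> Int (a + a') (b + b').
Proof. by move=> ab ab'; rewrite -[a]scale1r -[b]scale1r; apply: Int_lin. Qed.
Lemma IntB a b a' b' : Int a b -> Int a' b' -> Int (a - a') (b - b').
Proof. by move=> ab ab'; have := IntD ab (IntZ (-1) ab'); rewrite !scaleN1r. Qed.
Lemma Int_B k : J k -> Int (UB D q k) (Fg k + UK D q k * E (tau k)).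
Proof. by move=> /orP Jk; apply/Int_intertwines/(quasi_K_B Ups_spec); case: Jk => /eqP; [left|right]. Qed.
Lemma Int_k k : J k -> Int (Uk D q k) (Uk D q k).
Proof. by move=> /orP Jk; apply/Int_intertwines/(quasi_K_k Ups_spec); case: Jk => /eqP; [left|right]. Qed.
(** The components of Upsilon are polynomials in E_i and E_(tau i), and these commute with F_l for l
    outside J. *)
Lemma Ups_F l mu : ~~ J l -> Fg l * Ups mu = Ups mu * Fg l.
Proof.
move=> Jl; have := quasi_K_sub Ups_spec mu => /asboolP.
have EF k : J k -> Fg l * E k = E k * Fg l.
  move=> Jk; have := UE_F D q k l; rewrite (_ : (k == l) = false) ?mul0r ?scale0r.
    by move/subr0_eq.
  by apply: contraNF Jl => /eqP <-.
elim=> [_ [->|->]||s x y _ IHx _ IHy|x y _ IHx _ IHy].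
- exact/EF/inJi.
- exact/EF/inJt.
- by rewrite mulr1 mul1r.
- by rewrite mulrDr mulrDl -scalerAr -scalerAl IHx IHy.
- by rewrite mulrA IHx -mulrA IHy mulrA.
Qed.
Lemma Int_F l : ~~ J l -> Int (Fg l) (Fg l).
Proof.
move=> Jl m; exists 0 => M _; rewrite -!actM; congr (act _ m).
by rewrite /partial_sum mulr_sumr mulr_suml; apply: eq_bigr => mu _; apply: Ups_F.
Qed.

End Intertwiners.

(** * Splitting the images of q-commutators *)

Lemma split_sum (F : fieldType) (A : algType F) (X Z Y V B k : A) (x y : F) :
  (X + Z) * B - x *: (B * (X + Z)) + y *: ((Y + V) * k) =
  X * B - x *: (B * X) + y *: (Y * k) + (Z * B - x *: (B * Z) + y *: (V * k)).
Proof.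
rewrite !mulrDl !mulrDr !scalerDr !opprD !addrA.
by rewrite [LHS](ACl (1*3*5*2*4*6)).
Qed.

Section Splitting.
Variables (I : finType) (D : satake I) (F : fieldType) (q : F).
Hypothesis q0 : q != 0.
Local Notation B := (B_alg D q).
Local Notation U := (U_alg D q).
Local Notation E := (UE D q).
Local Notation Fg := (UF D q).
Local Notation K'm := (UK'_mon D q).
Local Notation th := (Btheta D q).
Local Notation h := (Bh D q).
Local Notation chi := (@chi I D F q).
Local Notation tau := (tau D).
Local Notation ltau := (lat_map tau).
Local Notation W := (@W I D F q).
Local Notation isf := (@isf I D F q).
Local Notation bplus := (@bplus I D F q).
Local Notation bminus := (@bminus I D F q).
Variables (Delta : B -> seq (B * B)) (phi : B -> B -> F).
Hypotheses (Delta_spec : is_coproduct Delta) (phi_spec : is_hopf_pairing Delta phi).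
Local Notation rho := (rho Delta phi).
Local Notation star := (istar Delta phi).
Variable i : I.
Local Notation J := (inJ D i).
Local Notation C1 := (@C1 I D F q i).
Variable Ups : lattice I -> U.
Hypothesis Ups_spec : is_quasi_K i Ups.

Local Notation Int := (Int q0 Delta_spec phi_spec Ups).
Variable Xi : {linear B -> iU_alg D q}.
Hypothesis Xi_spec : is_iHopf_iso Delta phi Xi.
Local Notation XU := (XU Xi).
Local Notation cm := (@cm I D F q).

Definition split_at mu z := exists X, Int X (bminus z) /\
  XU z = X + cm mu *: (bplus (tauB z) * K'm mu).

(** In terms of iHopf products the q-commutator of z and theta_k acquires a correction by y times a
    Cartan element. On the lower side this correction removes what K_k E_(tau k) contributes
    ([lower_id]), on the upper side what F_k contributes ([split_id]), so the two halves stay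
    separate. *)
Lemma split_ad n l mu k z y : C1 n l mu z -> J k -> rho (th (tau k)) z = y * h (tau k) ->
  isf y -> W (mu - alpha (tau k)) y -> split_at mu z -> split_at (mu - alpha (tau k)) y ->
  split_at (mu + alpha k) (z * th k - chi (alpha k) mu *: (th k * z)).
Proof.
move=> Cz Jk rz fy Wy [X [IX Xz]] [Y [IY Yy]].
have fz := C1_isf Cz; have Wz := C1_W Cz.
set x := chi (alpha k) mu; set s := (chi (alpha k) (mu - alpha (tau k)))^-1.
exists (X * UB D q k - x *: (UB D q k * X) + (x * s) *: (Y * Uk D q k)); split.
  have -> : bminus (z * th k - x *: (th k * z)) =
      bminus z * (Fg k + UK D q k * E (tau k)) - x *: ((Fg k + UK D q k * E (tau k)) * bminus z)
      + (x * s) *: (bminus y * Uk D q k).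
    have bH := bminusH D q; rewrite (ahomB bH) (ahomZ bH) !(ahomM bH) bminus_theta /Uk.
    rewrite (@lower_id _ _ (bminus z) (bminus y) (E (tau k)) (Fg k)) ?chi_neq0 //.
    + rewrite (EBm q0 Delta_spec phi_spec _ fz) (C1_lam q0 Delta_spec phi_spec Cz) ?inJ_tau //.
      by rewrite (ahom0 bH) mulr0 subr0 rz (ahomM bH) bminus_h.
    + by rewrite -Km_alpha (Km_bminus q0 _ Wz).
    + by rewrite -Km_alpha (Km_bminus q0 _ Wy).
  have IB := Int_B q0 Delta_spec phi_spec Ups_spec Jk.
  have Ik := Int_k q0 Delta_spec phi_spec Ups_spec Jk.
  exact: IntD (IntB (Int_mul IX IB) (IntZ x (Int_mul IB IX))) (IntZ (x * s) (Int_mul IY Ik)).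
have sE : z * th k - x *: (th k * z) = star z (th k) - x *: star (th k) z
    + (x * s) *: star y (h (tau k)).
  rewrite (star_thr Delta_spec phi_spec) (C1_lam q0 Delta_spec phi_spec Cz) ?inJ_tau //.
  rewrite mul0r addr0 (star_thl q0 Delta_spec phi_spec) (rho_hm_isf q0 Delta_spec phi_spec _ fz).
  rewrite rz -hm_alpha (star_hr Delta_spec phi_spec) lat_map_alpha tauK.
  rewrite (lam_hm_isf q0 Delta_spec phi_spec _ fy) (W_conj q0 _ Wy) -scalerAl scalerA.
  rewrite -mulrA mulVf ?chi_neq0 //; rewrite -> mulr1; by rewrite scalerDr opprD addrA subrK.
have XL := XUL Xi.
rewrite [in LHS]sE (linD XL) (linB XL) !(linZ XL); rewrite -> !(XUM Xi_spec), -> (XU_th Xi_spec).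
have -> : XU (h (tau k)) = Uk D q k.
  by rewrite /XU (iHopf_iso_h Xi_spec) tauK.
have cE : cm mu = cm (mu - alpha (tau k)) * s.
  have := @cmD I D F q q0 (mu - alpha (tau k)) (alpha (tau k)).
  by rewrite subrK cm_alpha // mulr1 lat_map_alpha tauK /s chiC.
have cE2 : cm (mu + alpha k) = cm mu * (chi mu (alpha (tau k)))^-1.
  by rewrite cmD // cm_alpha // mulr1 lat_map_alpha.
have tH := tauBH D q; have bH := bplusH D q.
have ftz : isf (tauB z) by apply: isf_tau.
have Wtz : W (ltau mu) (tauB z) by apply: W_tau.
have := @split_id F U (bplus (tauB z)) (bplus (tauB y)) (E (tau k)) (Fg k) (K'm mu)
  (UK' D q k) (UK D q k) (UK' D q (tau k)) (K'm (mu - alpha (tau k)))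
  (chi mu (alpha (tau k)))^-1 x (cm (mu - alpha (tau k))) s.
rewrite -cE -cE2 -/(UB D q k) -/(Uk D q k).
have -> : (bplus (tauB z) * E (tau k) - x *: (E (tau k) * bplus (tauB z))) *
    (K'm mu * UK' D q k) =
    bplus (tauB (z * th k - x *: (th k * z))) * K'm (mu + alpha k).
  rewrite (ahomB tH) (ahomZ tH) !(ahomM tH) tauB_theta.
  by rewrite (ahomB bH) (ahomZ bH) !(ahomM bH) bplus_theta K'mD K'm_alpha.
move=> H; rewrite -H => {H}.
- by rewrite Xz Yy; apply: split_sum.
- by rewrite K'm_E // chiNr.
- rewrite -K'm_alpha (K'm_bplus q0 _ Wtz); congr (_^-1 *: _).
  by rewrite /chi -rf_tauC lat_map_alpha rfC.
- by rewrite -!K'm_alpha -!K'mD addrC.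
- by rewrite K'm_F // chiC.
- rewrite (FB q0 Delta_spec phi_spec _ ftz).
  rewrite (C1_lam q0 Delta_spec phi_spec (C1_tau Cz) Jk) (ahom0 bH) mulr0 subr0.
  have := rho_th_tau q0 Delta_spec phi_spec (tau k) z; rewrite tauK => <-.
  by rewrite rz (ahomM tH) tauB_h tauK (ahomM bH) bplus_h.
- rewrite /Uk -!Km_alpha -!K'm_alpha; rewrite -> mulrA; rewrite -Km_K'm -mulrA -K'mD subrK.
  by [].
Qed.

(** Structural induction does not reach the derivative y, which is a new element with one commutator
    fewer; the outer induction on the number of commutators supplies its splitting. *)
Lemma C1_split n l mu z : C1 n l mu z -> split_at mu z.
Proof.
suff H : forall N n l mu z, (n <= N)%N -> C1 n l mu z -> split_at mu z by apply: H (leqnn _).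
have XL := XUL Xi.
elim=> [|N IH] {n l mu z} n l mu z nN Cz; elim: Cz nN => {n l mu z}
  [l Jl|n l mu Jl H|n l mu s x y Cx IHx Cy IHy|n l mu k z Jk Cz IHz] nN //.
1,4: exists (Fg l); rewrite bminus_theta; split; first exact: (Int_F q0 Delta_spec phi_spec Ups_spec Jl);
  by rewrite (XU_th Xi_spec) cm_alpha // scale1r tauB_theta bplus_theta K'm_alpha.
1,3: exists 0; rewrite (ahom0 (bminusH D q)) (ahom0 (tauBH D q)) (ahom0 (bplusH D q));
  by rewrite mul0r scaler0 addr0 (lin0 XL); split=> //; apply: Int0.
1,2: have [X [IX Xx]] := IHx nN; have [Y [IY Yy]] := IHy nN;
  exists (s *: X + Y); rewrite (ahomL (bminusH D q)); split; [exact: Int_lin|];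
  rewrite XL Xx Yy (ahomL (tauBH D q)) (ahomL (bplusH D q)) mulrDl -scalerAl;
  by rewrite !scalerDr !scalerA [s * _]mulrC addrACA.
have Jt : J (tau k) by rewrite inJ_tau.
have := C1_rho q0 Delta_spec phi_spec Cz Jt; case: n Cz IHz nN => [|n] Cz IHz nN.
  move=> r0; apply: (@split_ad _ _ _ _ _ 0 Cz Jk) => //.
  + by rewrite mul0r.
  + exact: isf0.
  + exact: W_0.
  + exact: IHz.
  + exists 0; rewrite (ahom0 (bminusH D q)) (ahom0 (tauBH D q)) (ahom0 (bplusH D q)).
    by rewrite mul0r scaler0 addr0 (lin0 XL); split=> //; apply: Int0.
case=> y [Cy ry]; apply: (split_ad Cz Jk ry).
- exact: C1_isf Cy.
- exact: C1_W Cy.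
- by apply: IHz; apply: ltnW.
- by apply: IH Cy; rewrite -ltnS; apply: ltnW.
Qed.
End Splitting.

Lemma fun_invP (A : zmodType) (B : Type) (f : A -> B) : bijective f ->
  cancel f (fun_inv f) /\ cancel (fun_inv f) f.
Proof.
move=> [g fK gK]; have fi := can_inj fK; split=> x.
  by rewrite /fun_inv; case: xgetP => [y _ /= /fi -> //|/(_ x) /= []].
by rewrite /fun_inv; case: xgetP => [y _ //|/(_ (g x))] /=; rewrite gK => -[].
Qed.

(** * The rescaling Psi and the twisted symmetries *)

Section Rescaling.
Variables (I : finType) (D : satake I) (L : fieldType) (q : L).
Hypothesis q0 : q != 0.
Local Notation Km := (UK_mon D q).
Local Notation K'm := (UK'_mon D q).
Variables (a : I -> L) (a0 : forall j, a j != 0).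
Local Notation Ps := (rescale (D := D) (q := q) a0).
Lemma PsH : ahom Ps. Proof. exact: lift_ahom. Qed.
Lemma Ps_E j : Ps (UE D q j) = a j *: UE D q j. Proof. exact: lift_gen. Qed.
Lemma Ps_F j : Ps (UF D q j) = UF D q j. Proof. exact: lift_gen. Qed.
Lemma Ps_K j : Ps (UK D q j) = a j *: UK D q j. Proof. exact: lift_gen. Qed.
Lemma Ps_KV j : Ps (UKV D q j) = (a j)^-1 *: UKV D q j. Proof. exact: lift_gen. Qed.
Lemma Ps_K' j : Ps (UK' D q j) = a j *: UK' D q j. Proof. exact: lift_gen. Qed.
Lemma Ps_K'V j : Ps (UK'V D q j) = (a j)^-1 *: UK'V D q j. Proof. exact: lift_gen. Qed.

Definition pmon (mu : lattice I) : L := \prod_j a j ^ mu j.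
Lemma pmonD mu nu : pmon (mu + nu) = pmon mu * pmon nu.
Proof. by rewrite /pmon -big_split; apply: eq_bigr => j _; rewrite ffunE expfzDr. Qed.
Lemma pmon_alpha j : pmon (alpha j) = a j.
Proof.
rewrite /pmon (bigD1 j) //= big1 ?mulr1 => [|k kj]; first by rewrite ffunE eqxx expr1z.
by rewrite ffunE eq_sym (negbTE kj) expr0z.
Qed.
Lemma pmon0 : pmon 0 = 1.
Proof. by rewrite /pmon big1 // => j _; rewrite ffunE expr0z. Qed.
Lemma pmon_alphaN j : pmon (- alpha j) = (a j)^-1.
Proof.
apply: (mulfI (a0 j)); rewrite mulfV // -{1}pmon_alpha -pmonD subrr; exact: pmon0.
Qed.
Lemma Ps_Km mu : Ps (Km mu) = pmon mu *: Km mu.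
Proof.
elim/lattice_ind: mu => [|mu j IH|mu j IH].
- by rewrite Km0 pmon0 scale1r (ahom1 PsH).
- by rewrite KmD (ahomM PsH) IH Km_alpha Ps_K scalar_mul pmonD pmon_alpha.
- by rewrite KmD (ahomM PsH) IH Km_alphaN Ps_KV scalar_mul pmonD pmon_alphaN.
Qed.
Lemma Ps_K'm mu : Ps (K'm mu) = pmon mu *: K'm mu.
Proof.
elim/lattice_ind: mu => [|mu j IH|mu j IH].
- by rewrite K'm0 pmon0 scale1r (ahom1 PsH).
- by rewrite K'mD (ahomM PsH) IH K'm_alpha Ps_K' scalar_mul pmonD pmon_alpha.
- by rewrite K'mD (ahomM PsH) IH K'm_alphaN Ps_K'V scalar_mul pmonD pmon_alphaN.
Qed.
End Rescaling.

Section RescalingInverse.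
Variables (I : finType) (D : satake I) (L : fieldType) (q : L).
Variables (a : I -> L) (a0 : forall j, a j != 0).
Local Notation Ps := (rescale (D := D) (q := q) a0).
Lemma Ps_bij : bijective Ps.
Proof.
have b0 j : (a j)^-1 != 0 by rewrite invr_eq0.
exists (rescale (D := D) (q := q) b0).
  apply: (U_ahom_eq (ahom_comp (PsH D q a0) (PsH D q b0)) (@ahom_id _ _)) => j /=.
  - by rewrite Ps_E (ahomZ (PsH D q b0)) Ps_E scalerA mulfV // scale1r.
  - by rewrite !Ps_F.
  - by rewrite Ps_K (ahomZ (PsH D q b0)) Ps_K scalerA mulfV // scale1r.
  - by rewrite Ps_KV (ahomZ (PsH D q b0)) Ps_KV scalerA invrK mulVf // scale1r.
  - by rewrite Ps_K' (ahomZ (PsH D q b0)) Ps_K' scalerA mulfV // scale1r.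
  - by rewrite Ps_K'V (ahomZ (PsH D q b0)) Ps_K'V scalerA invrK mulVf // scale1r.
apply: (U_ahom_eq (ahom_comp (PsH D q b0) (PsH D q a0)) (@ahom_id _ _)) => j /=.
- by rewrite Ps_E (ahomZ (PsH D q a0)) Ps_E scalerA mulVf // scale1r.
- by rewrite !Ps_F.
- by rewrite Ps_K (ahomZ (PsH D q a0)) Ps_K scalerA mulVf // scale1r.
- by rewrite Ps_KV (ahomZ (PsH D q a0)) Ps_KV scalerA invrK mulfV // scale1r.
- by rewrite Ps_K' (ahomZ (PsH D q a0)) Ps_K' scalerA mulVf // scale1r.
- by rewrite Ps_K'V (ahomZ (PsH D q a0)) Ps_K'V scalerA invrK mulfV // scale1r.
Qed.
End RescalingInverse.

Section Twist.
Variables (I : finType) (D : satake I) (F L : fieldType) (emb : {rmorphism F -> L}) (q : F).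
Hypotheses (q0 : q != 0) (qn : forall n, (0 < n)%N -> q ^+ n != 1).
Local Notation B := (B_alg D q).
Local Notation U := (U_alg D q).
Local Notation UL := (U_alg D (emb q)).
Local Notation bc := (base_change (D := D) (q := q) emb).
Local Notation E := (UE D q).
Local Notation Fg := (UF D q).
Local Notation Km := (UK_mon D q).
Local Notation K'm := (UK'_mon D q).
Local Notation tau := (tau D).
Local Notation ltau := (lat_map tau).
Local Notation isf := (@isf I D F q).
Local Notation bplus := (@bplus I D F q).
Local Notation bminus := (@bminus I D F q).
Local Notation rf := (root_form D).
Local Notation v_ := (vi D q).
Local Notation cm := (@cm I D F q).
Variables (a : I -> L) (a0 : forall j, a j != 0).
Hypotheses (a2 : forall j, a j ^+ 2 = emb (q ^ (- rf (alpha j) (alpha (tau j)))))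
  (atau : forall j, a (tau j) = a j).
Local Notation Ps := (rescale (D := D) (q := emb q) a0).
Local Notation p := (pmon a).
Variables (T : I -> {lrmorphism U -> U}) (TL : I -> {lrmorphism UL -> UL}).
Hypotheses (T_spec : is_lusztig T) (TL_spec : is_lusztig TL).
Variable i : I.
Local Notation J := (inJ D i).
Local Notation C1 := (@C1 I D F q i).
Local Notation rw := (r_word D i).
Local Notation r := (refl_word D rw).
Hypothesis ci : cartan D i (tau i) \in [:: 2; 0; -1].
Definition scr (x : UL) : UL := fun_inv Ps (T_word TL rw (Ps x)).

Let eq0 : emb q != 0. Proof. by rewrite fmorph_eq0. Qed.
Let bH := bcH D emb q.
Let bcM x y : bc (x * y) = bc x * bc y. Proof. by rewrite (semi_M bH). Qed.
Let bcL c x y : bc (c *: x + y) = emb c *: bc x + bc y. Proof. by rewrite (semi_lin bH). Qed.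
Let bc0 : bc 0 = 0.
Proof.
have := bcL (-1) 0 0; rewrite scaler0 addr0 rmorphN1 scaleN1r => e.
by rewrite {1}e addNr.
Qed.
Let bcZ c x : bc (c *: x) = emb c *: bc x.
Proof. by rewrite -[c *: x]addr0 bcL bc0 addr0. Qed.
Let bcD x y : bc (x + y) = bc x + bc y.
Proof. by rewrite -[x]scale1r bcL rmorph1 !scale1r. Qed.
Let bcB x y : bc (x - y) = bc x - bc y.
Proof. by rewrite bcD -!scaleN1r bcZ rmorphN1. Qed.
Let bcE j : bc (E j) = UE D (emb q) j. Proof. exact: lift_gen. Qed.
Let bcF j : bc (Fg j) = UF D (emb q) j. Proof. exact: lift_gen. Qed.

Lemma TL_bc w x : T_word TL w (bc x) = bc (T_word T w x).
Proof. by elim: w => //= k w ->; rewrite (bc_T T_spec TL_spec). Qed.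

Lemma scr_inv x y : T_word TL rw (Ps x) = Ps y -> fun_inv scr y = x.
Proof.
have [PK KP] := fun_invP (Ps_bij D (emb q) a0).
have sK : cancel (fun x => T_word TL rw (Ps x)) (fun_inv (fun x => T_word TL rw (Ps x))).
  by apply: (fun_invP _).1; apply: bij_comp (T_word_bij TL_spec rw) (Ps_bij D (emb q) a0).
have si : injective scr.
  move=> u v; rewrite /scr => /(congr1 Ps); rewrite !KP => uv.
  by rewrite -(sK u) uv sK.
move=> e; have : scr x = y by rewrite /scr e PK.
by rewrite /fun_inv; case: xgetP => [z _ /= <- /si //|H /H].
Qed.

Lemma Ps_bc_minus z : isf z -> Ps (bc (bminus z)) = bc (bminus z).
Proof.
elim/isf_ind => [|s x y _ _ IHx IHy|j x _ IHx].
- by rewrite (ahom1 (bminusH D q)) (semi_1 bH) (ahom1 (PsH D _ a0)).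
- rewrite (ahomL (bminusH D q)) bcL (ahomL (PsH D _ a0)); rewrite -> IHx; by rewrite IHy.
- rewrite (ahomM (bminusH D q)) bcM (ahomM (PsH D _ a0));
  rewrite -> IHx;
  by rewrite bminus_theta bcF Ps_F.
Qed.
Lemma Ps_bc_plus n l mu z : C1 n l mu z -> Ps (bc (bplus z)) = p mu *: bc (bplus z).
Proof.
have bpH := bplusH D q.
elim=> {n l mu z} [l Jl|n l mu Jl H|n l mu s x y _ IHx _ IHy|n l mu k z Jk _ IHz].
- by rewrite bplus_theta bcE Ps_E pmon_alpha.
- by rewrite (ahom0 bpH) bc0 (ahom0 (PsH D _ a0)) scaler0.
- rewrite (ahomL bpH) bcL (ahomL (PsH D _ a0));
  rewrite -> IHx;
  by rewrite IHy scalerDr !scalerA mulrC.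
- rewrite (ahomB bpH) (ahomZ bpH) !(ahomM bpH) bplus_theta bcB bcZ !bcM bcE.
  rewrite (ahomB (PsH D _ a0)) (ahomZ (PsH D _ a0)) !(ahomM (PsH D _ a0)) IHz Ps_E !scalar_mul.
  rewrite pmonD // pmon_alpha scalerBr !scalerA; congr (_ - _ *: _).
  by ring.
Qed.
Lemma p_tau mu : p (ltau mu) = p mu.
Proof.
rewrite /pmon [RHS](reindex_inj (can_inj (tauK D))) /=; apply: eq_bigr => j _.
by rewrite lat_mapE atau.
Qed.
Lemma p_square mu : p mu * p mu = emb (q ^ (- ell D mu)).
Proof.
elim/lattice_ind: mu => [|mu j IH|mu j IH].
- by rewrite pmon0 mulr1 /ell big1 ?oppr0 ?expr0z ?rmorph1 // => l _; rewrite ffunE mul0r.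
- rewrite pmonD // mulrACA IH pmon_alpha -expr2 a2 -rmorphM -expfzDr //.
  by rewrite ellD ell_alpha opprD.
- rewrite pmonD // mulrACA IH pmon_alphaN // -expr2 exprVn a2 -fmorphV -rmorphM.
  rewrite invr_expz -expfzDr // opprK ellD.
  have -> : ell D (- alpha j) = - rf (alpha j) (alpha (tau j)).
    have := ellD D (alpha j) (- alpha j); rewrite subrr ell_alpha.
    by rewrite {1}/ell big1 => [|l _]; [lia|rewrite ffunE mul0r].
  by rewrite opprD opprK.
Qed.
(** As a_(tau j) = a_j, the product p(tau mu) p(mu) is a square and lies in the image of F. It turns
    [cm mu] into v^(-(mu,tau mu)/2), which r_i leaves invariant; so the twisted symmetry permutes
    the normalized images of the h_mu. *)
Lemma cm_p mu : emb (cm mu) * (p (ltau mu) * p mu) = emb (q ^ (- rf mu (ltau mu))).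
Proof.
by rewrite p_tau p_square -rmorphM /cm -expfzDr //; congr (emb (q ^ _)); ring.
Qed.

Lemma scr_h mu : fun_inv scr (bc (cm mu *: (Km (ltau mu) * K'm mu))) =
  bc (cm (r mu) *: (Km (ltau (r mu)) * K'm (r mu))).
Proof.
have Psc nu : Ps (bc (cm nu *: (Km (ltau nu) * K'm nu))) =
    emb (q ^ (- rf nu (ltau nu))) *: bc (Km (ltau nu) * K'm nu).
  rewrite bcZ (ahomZ (PsH D _ a0)) !bcM bc_Km bc_K'm (ahomM (PsH D _ a0)) Ps_Km // Ps_K'm //.
  by rewrite scalar_mul scalerA cm_p.
apply: scr_inv; rewrite !Psc (ahomZ (T_word_ahom TL rw)) TL_bc (ahomM (T_word_ahom T rw)).
rewrite (T_word_Km T_spec) (T_word_K'm T_spec); rewrite <- !r_tau; rewrite // !rK //.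
by rewrite rf_r.
Qed.
Lemma scr_B n n' l g g' : C1 n l (r (alpha l)) g -> C1 n' (tau l) (r (alpha (tau l))) g' ->
  T_word T rw (bplus g) = E l -> T_word T rw (bplus g') = E (tau l) ->
  fun_inv scr (bc (UB D q l)) =
  bc (bminus g + cm (r (alpha l)) *: (bplus g' * K'm (r (alpha l)))).
Proof.
move=> Cg Cg' Tg Tg'; apply: scr_inv.
have Tm : T_word T rw (bminus g) = Fg l.
  by rewrite -omega_bplus (T_word_omega q0 T_spec) Tg omega_E.
have TLH := T_word_ahom TL rw.
rewrite bcD (ahomD (PsH D _ a0)) (ahomD TLH) (Ps_bc_minus (C1_isf Cg)) TL_bc Tm.
rewrite bcZ (ahomZ (PsH D _ a0)) bcM (ahomM (PsH D _ a0)) (Ps_bc_plus Cg') bc_K'm Ps_K'm //.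
rewrite scalar_mul scalerA.
have -> : r (alpha (tau l)) = ltau (r (alpha l)) by rewrite -r_tau // lat_map_alpha.
rewrite cm_p -bc_K'm -bcM (ahomZ TLH) TL_bc (ahomM (T_word_ahom T rw)) Tg'.
rewrite (T_word_K'm T_spec) rK // -[ltau (r _)]r_tau // rf_r // lat_map_alpha K'm_alpha.
rewrite /UB bcD (ahomD (PsH D _ a0)) bcF Ps_F; congr (_ + _).
rewrite bcM (ahomM (PsH D _ a0));
  rewrite -> bcE;
  rewrite Ps_E -K'm_alpha bc_K'm Ps_K'm // pmon_alpha scalar_mul.
by rewrite atau -expr2 a2.
Qed.
Variables (Delta : B -> seq (B * B)) (phi : B -> B -> F).
Hypotheses (Delta_spec : is_coproduct Delta) (phi_spec : is_hopf_pairing Delta phi).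
(** For k in J the symmetry exchanges the two triangular halves: F_k comes from E_k' and E_(tau k)
    from F_(tau k'). On Cartan vectors only the summand with F_(tau k') survives, and this
    determines the value at theta_k. *)
Lemma scr_BJ k (k' := tau_loc D i k) : J k -> fun_inv scr (bc (UB D q k)) =
  bc (v_ k *: (E k' * K'm (- alpha k')) +
      (v_ k * cm (- alpha k')) *:
        (Fg (tau k') * Km (- alpha (tau k')) * K'm (- alpha k'))).
Proof.
move=> Jk; apply: scr_inv; have TLH := T_word_ahom TL rw; have TH := T_word_ahom T rw.
have T1 : T_word T rw (v_ k *: (E k' * K'm (- alpha k'))) = Fg k.
  have := congr1 (@omega I D F q) (T_r_inv_E q0 qn T_spec Delta_spec phi_spec ci Jk).
  have oH := omegaH D q; rewrite -(T_word_omega q0 T_spec) (ahomZ oH) (ahomM oH).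
  rewrite -> omega_F, -> omega_KV; by rewrite omega_E -K'm_alphaN.
have T2 : T_word T rw (Fg (tau k') * Km (- alpha (tau k'))) = (v_ k)^-1 *: E (tau k).
  have Jt : J (tau k) by rewrite inJ_tau.
  have := T_r_inv_E q0 qn T_spec Delta_spec phi_spec ci Jt.
  rewrite tl_tau // -/k' /T_r (ahomZ TH) -Km_alphaN => <-.
  by rewrite scalerA /vi symz_tau mulVf ?scale1r // expf_neq0.
have rfk : rf (alpha k') (alpha (tau k')) = rf (alpha k) (alpha (tau k)).
  have := rf_r D i (alpha k) (alpha (tau k)).
  by rewrite !r_loc ?inJ_tau // tl_tau // -/k' rfNl rfNr opprK.
have Kn : r (- alpha k') = alpha k by rewrite rN // r_loc ?tl_J // tlK // opprK.
rewrite bcD !bcZ !(ahomD (PsH D _ a0)) !(ahomZ (PsH D _ a0)) !bcM.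
rewrite !(ahomM (PsH D _ a0));
  rewrite -> bcE;
  rewrite bcF;
  rewrite -> Ps_E;
  rewrite Ps_F;
  rewrite -> bc_K'm;
  rewrite bc_Km;
  rewrite -> Ps_K'm;
  rewrite // Ps_Km //.
rewrite !scalar_mul -[UF _ _ _ * (p _ *: _)]scalerAr scalar_mul.
rewrite pmon_alphaN // pmon_alphaN // mulfV // scale1r atau.
rewrite (ahomD TLH) !(ahomZ TLH) -bcE -bcF -bc_Km -bc_K'm; rewrite <- !bcM; rewrite !TL_bc.
rewrite (ahomM TH (_ * _)) T2 (T_word_K'm T_spec) Kn K'm_alpha.
rewrite -bcZ -(ahomZ TH) T1 /UB -scalerAl bcZ scalerA.
rewrite bcD bcM (ahomD (PsH D _ a0)) (ahomM (PsH D _ a0));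
  rewrite -> bcF;
  rewrite Ps_F;
  rewrite -> bcE;
  rewrite Ps_E.
rewrite -K'm_alpha bc_K'm Ps_K'm // pmon_alpha scalar_mul atau -[a k * a k]expr2 a2.
rewrite scalerA; congr (_ + _ *: _).
rewrite -[(a k')^-1 * _]expr2 exprVn a2 -!fmorphV -!rmorphM; congr (emb _).
have -> : cm (- alpha k') = q ^ (- (2 * rf (alpha k) (alpha (tau k)))).
  rewrite /cm lat_mapN lat_map_alpha rfNl rfNr opprK rfk; congr (q ^ _).
  have := ellD D (alpha k') (- alpha k'); rewrite subrr ell_alpha rfk.
  rewrite {1}/ell big1 => [|l _]; last by rewrite ffunE mul0r.
  lia.
rewrite invr_expz opprK rfk -[v_ k * _ * _]mulrA -expfzDr // mulrAC mulfV ?vi_neq0 // mul1r.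
by congr (q ^ _); lia.
Qed.
End Twist.

(** * Extracting the pairing from the action *)

Section OmAction.
Variables (I : finType) (D : satake I) (F : fieldType) (q : F).
Hypotheses (q0 : q != 0) (qn : forall n, (0 < n)%N -> q ^+ n != 1).
Local Notation B := (B_alg D q).
Local Notation U := (U_alg D q).
Local Notation E := (UE D q).
Local Notation Fg := (UF D q).
Local Notation Km := (UK_mon D q).
Local Notation K'm := (UK'_mon D q).
Local Notation th := (Btheta D q).
Local Notation hm := (Bh_mon D q).
Local Notation chi := (@chi I D F q).
Local Notation isf := (@isf I D F q).
Local Notation v_ := (vi D q).
Local Notation w_ i := (v_ i - (v_ i)^-1).
Local Notation bplus := (@bplus I D F q).
Local Notation bminus := (@bminus I D F q).
Variables (Delta : B -> seq (B * B)) (phi : B -> B -> F).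
Hypotheses (Delta_spec : is_coproduct Delta) (phi_spec : is_hopf_pairing Delta phi).
Local Notation rho := (rho Delta phi).
Local Notation lam := (lam Delta phi).
Local Notation act := (act q0 Delta_spec phi_spec).
Local Notation Om := (Om q0 Delta_spec phi_spec).
Local Notation nu := (nu q0 Delta_spec phi_spec).
Variable i : I.
Local Notation C1 := (@C1 I D F q i).

Lemma act_C1_hm n l mu z ka : C1 n l mu z -> act (bplus z) (hm ka) = 0.
Proof.
have bH := bplusH D q; have aL := actLl q0 Delta_spec phi_spec.
move=> Cz; elim: Cz ka => {n l mu z} [l Jl|n l mu Jl H|n l mu s x y _ IHx _ IHy|n l mu k z Jk Cz IHz] ka.
- by rewrite bplus_theta act_E_hm.
- by rewrite (ahom0 bH) (lin0 (aL _)).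
- by rewrite (ahomL bH) aL IHx IHy scaler0 addr0.
- rewrite (ahomB bH) (ahomZ bH) !(ahomM bH) bplus_theta (linB (aL _)) (linZ (aL _)).
  by rewrite !actM act_E_hm IHz !(lin0 (actL _ _ _ _)) scaler0 subr0.
Qed.

Lemma act_bplus a b : act (bplus a) b = Om a b.
Proof.
have mH := minusH q0 Delta_spec phi_spec.
rewrite /act /plus omega_bplus.
have -> // : minus q0 Delta_spec phi_spec (bminus a) = Om a.
apply: (B_ahom_eq (ahom_comp (bminusH D q) mH) (OmH q0 Delta_spec phi_spec)) => j /=.
- by rewrite bminus_theta [LHS]U_liftF.
- rewrite bminus_h [LHS]U_liftK' /Om (cop_h Delta_spec); last exact: Om_bil.
  rewrite nu_h /K'op hm_alpha hm_alphaN.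
  by rewrite -(rhoE_lamE Delta_spec phi_spec).
- rewrite bminus_hV [LHS]U_liftK'V /Om (cop_hV Delta_spec); last exact: Om_bil.
  rewrite nu_hV /K'op opprK hm_alpha hm_alphaN.
  by rewrite -(rhoE_lamE Delta_spec phi_spec).
Qed.
Lemma nu_isf a b : isf a -> isf b -> isf (nu a b).
Proof.
have nH := nuH q0 Delta_spec phi_spec; move=> fa; elim/isf_ind: fa b => [|s x y _ _ IHx IHy|j x _ IHx] b fb.
- by rewrite (ahom1 nH) endoE.
- by rewrite (ahomL nH) !endoE; apply: isf_lin; [apply: IHx|apply: IHy].
- rewrite (ahomM nH) nu_th !endoE /= (lam_mul Delta_spec phi_spec) -hm_alphaN.
  have fl : isf (lam (th j) (nu x b)) by apply: isf_lam => //; apply: IHx.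
  rewrite (lam_hm_isf q0 Delta_spec phi_spec _ fl) -scaleN1r; apply: isfZ.
  exact: isf_conj.
Qed.
(** The action of a on b is the sum of an element of f, which [rho (hm ka)] fixes, and of phi(a,b)
    h_mu', which it rescales. Their difference isolates the pairing. *)
Lemma Om_C1 n l mu a n' l' mu' b ka : C1 n l mu a -> C1 n' l' mu' b ->
  rho (hm ka) (Om a b) - Om a b = ((chi ka mu' - 1) * phi a b) *: hm mu'.
Proof.
move=> Ca Cb; have [s [G Z]] := C1_Zst q0 Delta_spec Ca.
have nH := nuH q0 Delta_spec phi_spec; have rL c := rho_lin Delta_spec phi_spec c.
have -> : Om a b = rho (hm mu) (nu a b) + rho a b.
  rewrite /Om Z; last exact: Om_bil.
  rewrite (ahom1 nH) mulr1 !endoE /= -[RHS]addr0; congr (_ + _ + _).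
  have eb : lin (fun f : endo (algType_nontrivial B) => f b) by move=> c f g; rewrite !endoE.
  rewrite (lin_sum eb) (rest_sum0 G) // => -[c u] _ /= Ju un.
  rewrite [LHS]/= (_ : nu (bw D q u) b = 0) ?(lin0 (rL _)) //.
  (* The last letter of the word acts first, and b is killed by its [lam]. *)
  case/lastP: u Ju un => // u k; rewrite all_rcons => /andP [Jk _] _.
  rewrite bw_rcons (ahomM nH) endoE nu_th endoE /= (lam_mul Delta_spec phi_spec).
  rewrite (C1_lam q0 Delta_spec phi_spec Cb Jk).
  by rewrite (lin0 (lam_lin Delta_spec phi_spec _)) oppr0 (lin0 (endoP _)).
have fnu : isf (nu a b) by apply: nu_isf; [apply: C1_isf Ca|apply: C1_isf Cb].
rewrite (linD (rL _)) (C1_rho_C1 q0 Delta_spec phi_spec Ca Cb) (linZ (rL _)).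
rewrite !(rho_hm_isf q0 Delta_spec phi_spec _ fnu) (rho_hm_hm q0 Delta_spec phi_spec).
rewrite opprD addrACA subrr add0r scalerA -scalerBl; congr (_ *: _); ring.
Qed.

Section Norm.
Variables (T : I -> {lrmorphism U -> U}) (T_spec : is_lusztig T).
Local Notation rw := (r_word D i).
Local Notation r := (refl_word D rw).
Hypothesis ci : cartan D i (tau D i) \in [:: 2; 0; -1].
Lemma hm_neq0 mu : hm mu != 0.
Proof.
by apply/eqP => e; have := hmN D q mu; rewrite e mul0r => /eqP; rewrite eq_sym oner_eq0.
Qed.
Lemma chi_r_neq1 l : chi (r (alpha l)) (r (alpha l)) != 1.
Proof.
rewrite /chi rf_r rf_alpha cartan_diag; apply: qz_neq1 => //.
by rewrite !mulf_eq0 /= ; have := symz_gt0 D l; case: (symz D l).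
Qed.
(** T_r carries the commutator of g^+ and g^- to that of E_l and F_l. Applied to the vector 1, where
    g^+ vanishes, this commutator contains phi(g,g), which [Om_C1] isolates; the factor to be
    cancelled is nonzero by [chi_r_neq1]. *)
Lemma phi_norm n l g : C1 n l (r (alpha l)) g -> T_word T rw (bplus g) = E l ->
  phi g g = w_ l.
Proof.
move=> Cg Tg; have aL := actLl q0 Delta_spec phi_spec.
have TH := T_word_ahom T rw.
have Tm : T_word T rw (bminus g) = Fg l.
  by rewrite -omega_bplus (T_word_omega q0 T_spec) Tg omega_E.
set mu := r (alpha l).
have e : bplus g * bminus g - bminus g * bplus g = - w_ l *: (Km mu - K'm mu).
  apply: (bij_inj (T_word_bij T_spec rw)).
  rewrite (ahomB TH);
  rewrite -> !(ahomM TH);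
  rewrite (ahomZ TH) (ahomB TH);
  rewrite -> Tg;
  rewrite Tm.
  rewrite -> (T_word_Km T_spec);
  rewrite (T_word_K'm T_spec) /mu rK // Km_alpha K'm_alpha UE_F eqxx.
  by rewrite mul1r opprB.
have := congr1 (fun u => act u 1) e; cbv beta.
rewrite (linB (aL _)) (linZ (aL _)) (linB (aL _)); rewrite -> !actM; rewrite act_bminus mulr1.
have -> : act (bplus g) 1 = 0 by rewrite -(hm0 D q); apply: act_C1_hm Cg.
rewrite (lin0 (actL _ _ _ _)) subr0 act_bplus act_K'm mulr1 -{1}(hm0 D q) act_Km_hm hm0.
move=> e1; have := Om_C1 mu Cg Cg; rewrite e1.
have rL := rho_lin Delta_spec phi_spec (hm mu).
rewrite (linZ rL) (linB rL) (rho_hm1 Delta_spec phi_spec) (rho_hm_hm q0 Delta_spec phi_spec).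
rewrite -scalerBr (_ : 1 - _ - _ = (1 - chi mu mu) *: hm mu); last first.
  by rewrite opprB addrC addrA subrK scalerBl scale1r.
rewrite scalerA => /eqP; rewrite -subr_eq0 -scalerBl scaler_eq0 (negbTE (hm_neq0 _)) orbF.
rewrite subr_eq0 => /eqP e2; apply: (@mulfI _ (chi mu mu - 1)).
  by rewrite subr_eq0 chi_r_neq1.
by rewrite -e2; ring.
Qed.
End Norm.
End OmAction.

(** * The transported automorphism on generators *)

Section Transport.
Variables (I : finType) (D : satake I) (F L : fieldType) (emb : {rmorphism F -> L}) (q : F).
Hypotheses (q0 : q != 0) (qn : forall n, (0 < n)%N -> q ^+ n != 1).
Local Notation B := (B_alg D q).
Local Notation U := (U_alg D q).
Local Notation UL := (U_alg D (emb q)).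
Local Notation bc := (base_change (D := D) (q := q) emb).
Local Notation E := (UE D q).
Local Notation Fg := (UF D q).
Local Notation Km := (UK_mon D q).
Local Notation K'm := (UK'_mon D q).
Local Notation th := (Btheta D q).
Local Notation hm := (Bh_mon D q).
Local Notation chi := (@chi I D F q).
Local Notation tau := (tau D).
Local Notation ltau := (lat_map tau).
Local Notation W := (@W I D F q).
Local Notation bplus := (@bplus I D F q).
Local Notation bminus := (@bminus I D F q).
Local Notation rf := (root_form D).
Local Notation v_ := (vi D q).
Local Notation w_ i := (v_ i - (v_ i)^-1).
Local Notation cm := (@cm I D F q).
Variables (a : I -> L) (a0 : forall j, a j != 0).
Hypotheses (a2 : forall j, a j ^+ 2 = emb (q ^ (- rf (alpha j) (alpha (tau j)))))
  (atau : forall j, a (tau j) = a j).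
Variables (T : I -> {lrmorphism U -> U}) (TL : I -> {lrmorphism UL -> UL}).
Hypotheses (T_spec : is_lusztig T) (TL_spec : is_lusztig TL).
Variables (Delta : B -> seq (B * B)) (phi : B -> B -> F).
Hypotheses (Delta_spec : is_coproduct Delta) (phi_spec : is_hopf_pairing Delta phi).
Variable Xi : {linear B -> iU_alg D q}.
Hypothesis Xi_spec : is_iHopf_iso Delta phi Xi.
Variable i : I.
Local Notation J := (inJ D i).
Local Notation C1 := (@C1 I D F q i).
Local Notation rw := (r_word D i).
Local Notation r := (refl_word D rw).
Hypothesis ci : cartan D i (tau i) \in [:: 2; 0; -1].
Variable Ups : lattice I -> U.
Hypothesis Ups_spec : is_quasi_K i Ups.
Variable bT : {lrmorphism iU_alg D q -> iU_alg D q}.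
Hypothesis bT_bij : bijective bT.
Local Notation scr := (scr a0 TL i).
Hypothesis bT_spec : forall y : iU_alg D q, intertwines (bc \o Ups)
  (bc (iU_val (fun_inv bT y))) (fun_inv scr (bc (iU_val y))).
Local Notation act := (act q0 Delta_spec phi_spec).
Local Notation star := (istar Delta phi).
Local Notation PS := (partial_sum Ups).
Local Notation XU := (XU Xi).
Local Notation ev := (ev q0 Delta_spec phi_spec Xi).
Local Notation Int := (Int q0 Delta_spec phi_spec Ups).
Local Notation aL := (actLl q0 Delta_spec phi_spec).
(** The retraction [R] maps the left ideals over L into those over F: it is linear for right
    multiplication by the products of the E_j, which come from F. *)
Lemma Int_bT y u : fun_inv scr (bc (iU_val y)) = bc u -> Int (iU_val (fun_inv bT y)) u.
Proof.
move=> e; apply: Int_intertwines => N.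
have [R [RL Rl Rr Rbc]] := U_retract D emb q.
have [M0 H] := bT_spec y N; exists M0 => M /H; rewrite e.
have R0 : R 0 = 0.
  by have := RL (-1) 0 0; rewrite scaler0 addr0 scaleN1r addNr.
have RD x z : R (x + z) = R x + R z.
  by have := RL 1 x z; rewrite rmorph1 !scale1r.
have bH := bcH D emb q.
have bL c x z : bc (c *: x + z) = emb c *: bc x + bc z by rewrite (semi_lin bH).
have b0 : bc 0 = 0.
  have := bL (-1) 0 0; rewrite scaler0 addr0 rmorphN1 scaleN1r => e1.
  by rewrite {1}e1 addNr.
have bD x z : bc (x + z) = bc x + bc z by rewrite -[x]scale1r bL rmorph1 !scale1r.
have bN x : bc (- x) = - bc x by rewrite -scaleN1r -[_ *: x]addr0 bL b0 rmorphN1 scaleN1r addr0.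
have -> : partial_sum (bc \o Ups) M = bc (PS M).
  by rewrite /partial_sum (big_morph _ bD b0).
rewrite -!(semi_M bH) -bN -bD => -[s sE].
have bcE (w : seq I) : bc (\prod_(j <- w) E j) = \prod_(j <- w) UE D (emb q) j.
  elim: w => [|j w IH]; first by rewrite !big_nil (semi_1 bH).
  by rewrite !big_cons (semi_M bH) IH; congr (_ * _); apply: lift_gen.
exists [seq (R p.1, p.2) | p <- s]; rewrite -(Rbc (_ - _)) sE big_map /=.
elim: (s) => [|p s' IH]; first by rewrite !big_nil.
by rewrite !big_cons RD IH -bcE Rr.
Qed.

(** On the vector 1 only the constant term of Upsilon acts, so the intertwining relation computes
    the action of bT^-1(y) on 1. Injectivity of [ev] identifies it with Xi z. *)
Lemma bT_char y u z : fun_inv scr (bc (iU_val y)) = bc u ->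
  (exists M0, forall M, (M0 <= M)%N -> ev z = act (PS M) (act u 1)) ->
  fun_inv bT y = Xi z.
Proof.
move=> e [M0 H]; have [Xi' XiK KXi] := iHopf_iso_bij Xi_spec.
rewrite -[LHS]KXi; congr (Xi _); apply/eqP; rewrite -subr_eq0; apply/eqP.
apply: (@ev_inj0 _ _ _ _ q0 _ _ Delta_spec phi_spec _ Xi_spec).
have [M1 H1] := Int_bT e 1; pose M := (maxn M0 M1).+1.
rewrite (linB (evL _ _ _ _)) (H M); last by rewrite /M leqW // leq_maxl.
rewrite /ev /XU KXi -(H1 M); last by rewrite /M leqW // leq_maxr.
have h1 : act (PS M) 1 = 1.
  rewrite -(hm0 D q); exact: (act_PS_hm q0 Delta_spec phi_spec Ups_spec).
by rewrite h1 subrr.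
Qed.

Definition bTinv (x : B) : B := transport Xi (fun_inv bT) x.
Lemma Xi_bTinv x : Xi (bTinv x) = fun_inv bT (Xi x).
Proof. by have [_ ->] := fun_invP (iHopf_iso_bij Xi_spec). Qed.
Lemma bTinv_eq x z : fun_inv bT (Xi x) = Xi z -> bTinv x = z.
Proof.
by move=> e; rewrite /bTinv /transport e; have [-> _] := fun_invP (iHopf_iso_bij Xi_spec).
Qed.
Lemma bTinv_lin : lin bTinv.
Proof.
move=> c x y; apply: bTinv_eq; rewrite linearP [RHS]linearP !Xi_bTinv.
have [bK Kb] := fun_invP bT_bij; apply: (bij_inj bT_bij).
by rewrite (ahomL (ahom_lr bT)) !Kb.
Qed.
Lemma bTinv_star x y : bTinv (star x y) = star (bTinv x) (bTinv y).
Proof.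
apply: bTinv_eq; rewrite !(iHopf_iso_M Xi_spec) !Xi_bTinv.
have [bK Kb] := fun_invP bT_bij; apply: (bij_inj bT_bij).
by rewrite (ahomM (ahom_lr bT)) !Kb.
Qed.
Lemma bT_bTinv x : transport Xi bT (bTinv x) = x.
Proof.
rewrite /transport Xi_bTinv; have [_ Kb] := fun_invP bT_bij; rewrite Kb.
by have [-> _] := fun_invP (iHopf_iso_bij Xi_spec).
Qed.
Lemma bTinv_hm mu : bTinv (hm mu) = hm (r mu).
Proof.
apply: bTinv_eq; apply: (@bT_char _ (XU (hm (r mu)))).
  rewrite -[iU_val (Xi (hm mu))]/(XU _) !(XU_hm q0 Delta_spec phi_spec Xi_spec).
  exact: (scr_h q0 a0 a2 atau T_spec TL_spec ci).
exists 1%N => M M0; rewrite -[act (XU _) 1]/(ev _) (ev_hm q0 Delta_spec phi_spec Xi_spec).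
by rewrite (linZ (actL _ _ _ _)) (act_PS_hm q0 Delta_spec phi_spec Ups_spec).
Qed.

Lemma ev_C1 n l mu z : C1 n l mu z -> exists M0, forall M, (M0 <= M)%N -> ev z = act (PS M) z.
Proof.
move=> Cz; have [X [IX Xz]] := C1_split q0 Delta_spec phi_spec Ups_spec Xi_spec Cz.
have [M0 H] := IX 1; exists (maxn M0 1) => M; rewrite geq_max => /andP [/H {}H M1].
rewrite act_bminus mulr1 in H; rewrite -H -(hm0 D q).
rewrite (act_PS_hm q0 Delta_spec phi_spec Ups_spec) // hm0 /ev Xz (linD (aL _)) (linZ (aL _)).
rewrite actM act_K'm mulr1 (act_C1_hm q0 Delta_spec phi_spec _ (C1_tau Cz)) scaler0.
by rewrite addr0.
Qed.

Section Generators.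
Variables (n n' : nat) (l : I) (g g' : B).
Hypotheses (Cg : C1 n l (r (alpha l)) g) (Cg' : C1 n' (tau l) (r (alpha (tau l))) g')
  (Tg : T_word T rw (bplus g) = E l) (Tg' : T_word T rw (bplus g') = E (tau l)).
Let mu := r (alpha l).
Let u := bminus g + cm mu *: (bplus g' * K'm mu).
Let scrl : fun_inv scr (bc (UB D q l)) = bc u.
Proof. exact: (scr_B q0 a0 a2 atau T_spec TL_spec ci Cg Cg' Tg Tg'). Qed.
Lemma bTinv_l : bTinv (th l) = g.
Proof.
apply: bTinv_eq; apply: (@bT_char _ u); first by rewrite (iHopf_iso_theta Xi_spec) scrl.
have [M0 H] := ev_C1 Cg; exists M0 => M /H ->; congr (act _ _).
rewrite /u (linD (aL _)) (linZ (aL _)) actM; rewrite -> act_bminus; rewrite act_K'm !mulr1.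
by rewrite (act_C1_hm q0 Delta_spec phi_spec _ Cg') scaler0 addr0.
Qed.
(** Two elements are intertwined with known partners: the image of g, by the splitting and by the
    value at theta_l. Subtracting their common part leaves a relation between (tau g)^+ K'_mu and
    g'^+ K'_mu, which replaces phi(tau g, g') by the norm phi(g', g'). *)
Lemma phi_cross : phi (tauB g) g' = w_ l.
Proof.
have Ctg := C1_tau Cg.
have [X [IX Xg]] := C1_split q0 Delta_spec phi_spec Ups_spec Xi_spec Cg.
have IB : Int (XU g) u.
  have := Int_bT (y := Xi (th l)) (u := u); rewrite (iHopf_iso_theta Xi_spec) => /(_ scrl).
  by rewrite -Xi_bTinv bTinv_l.
have IZ : Int (cm mu *: (bplus (tauB g) * K'm mu)) (cm mu *: (bplus g' * K'm mu)).
  have := IntB IB IX; rewrite Xg /u -/mu addrC addKr [X in Int _ X]addrC addKr.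
  exact.
(* K'_mu sends this vector to g', so both sides are of weight 0 up to terms from the higher part of
   Upsilon. Those have weight -nu with nu nonnegative and nonzero, and vanish because weights in B
   are nonnegative. *)
pose m := hm (- mu) * g'.
have Wm : W (r (alpha (tau l))) m by apply: W_h; apply: C1_W Cg'.
have [M0 H] := IZ m; have /H {H} : (M0 <= maxn M0 1)%N by rewrite leq_maxl.
have : (0 < maxn M0 1)%N by rewrite leq_max orbT.
move: (maxn M0 1) => M M1.
have Km_m : act (K'm mu) m = g' by rewrite act_K'm mulrA hmN mul1r.
have cmn : cm mu != 0 by apply: cm_neq0.
rewrite !(linZ (aL _)) (linZ (actL _ _ _ _)) => /(scalerI cmn).
rewrite !actM Km_m.
have W0z (s : seq (lattice I)) (v : lattice I -> B) : (forall nu, nu \in s -> nu != 0 /\ forall j, 0 <= nu j) ->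
    (forall nu, W (- nu) (v nu)) -> \sum_(nu <- s) v nu = 0.
  move=> sP Wv; rewrite big_seq big1 // => nu /sP [nu0 nup].
  case: (W_nneg (Wv nu)) => // H; case/eqP: nu0; apply/ffunP => j.
  have := H j; have := nup j; rewrite !ffunE /=; lia.
have [s [sP PE]] := PS_split Ups_spec M1.
have PSE x : act (PS M) x = x + \sum_(nu <- s) act (Ups nu) x.
  by rewrite PE (linD (aL _)) act1 (lin_sum (aL _)).
rewrite !PSE.
have muE : r (alpha (tau l)) = ltau mu by rewrite -lat_map_alpha r_tau.
rewrite (linD (actL _ _ _ _)) (lin_sum (actL _ _ _ _)) Km_m.
rewrite (linD (actL _ _ _ _)) (lin_sum (actL _ _ _ _)).
rewrite (W0z s _ sP) => [|nu]; last first.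
  have : W (- nu) (act (Ups nu) (act (bplus g') g')).
    apply: (@W_eq _ _ _ _ (r (alpha (tau l)) - r (alpha (tau l)) - nu)).
      apply: (W_act_Ups q0 Delta_spec phi_spec Ups_spec).
      exact: (W_act_bplus q0 Delta_spec phi_spec (C1_W Cg') (C1_W Cg')).
    by rewrite subrr add0r.
  exact.
rewrite (W0z s _ sP) => [|nu]; last first.
  have : W (- nu) (act (bplus (tauB g)) (act (K'm mu) (act (Ups nu) m))).
    apply: (@W_eq _ _ _ _ (r (alpha (tau l)) - nu - ltau mu)).
      apply: (W_act_bplus q0 Delta_spec phi_spec (C1_W Ctg)).
      rewrite act_K'm; apply: W_h; exact: (W_act_Ups q0 Delta_spec phi_spec Ups_spec nu Wm).
    by rewrite muE addrAC subrr add0r.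
  exact.
rewrite [LHS]addr0 [RHS]addr0 => eO.
have {}eO := etrans (esym (act_bplus q0 Delta_spec phi_spec (tauB g) g'))
  (etrans eO (act_bplus q0 Delta_spec phi_spec g' g')).
have e1 := Om_C1 q0 Delta_spec phi_spec (r (alpha (tau l))) Ctg Cg'.
have e2 := Om_C1 q0 Delta_spec phi_spec (r (alpha (tau l))) Cg' Cg'.
move: e1; rewrite eO e2 => /eqP; rewrite -subr_eq0 -scalerBl scaler_eq0.
rewrite (negbTE (hm_neq0 _ _ _)) orbF -mulrBr mulf_eq0 subr_eq0.
rewrite (negbTE (chi_r_neq1 D qn _ _)) /= subr_eq0 => /eqP <-.
rewrite (phi_norm q0 qn Delta_spec phi_spec T_spec ci Cg' Tg').
by rewrite /vi symz_tau.
Qed.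
End Generators.

(** By [scr_BJ] the vector to match is, up to a scalar, F_(tau k') applied to a Cartan vector. There
    F agrees with F + K E, which Upsilon intertwines with B_(tau k'), so the vector is [ev] of an
    iHopf product. *)
Lemma bTinv_J k (k' := tau_loc D i k) : J k ->
  bTinv (th k) = (v_ k)^-1 *: (th (tau k') * hm (- alpha k')).
Proof.
move=> Jk; apply: bTinv_eq.
apply: (@bT_char _ (v_ k *: (E k' * K'm (- alpha k')) +
      (v_ k * cm (- alpha k')) *:
        (Fg (tau k') * Km (- alpha (tau k')) * K'm (- alpha k')))).
  rewrite (iHopf_iso_theta Xi_spec).
  exact: (scr_BJ q0 qn a0 a2 atau T_spec TL_spec ci Delta_spec phi_spec Jk).
rewrite (linD (aL _)) !(linZ (aL _)) !actM !act_K'm !mulr1;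
  rewrite -> act_E_hm;
  rewrite scaler0 add0r.
rewrite act_Km_hm.

have Jt : J (tau k') by rewrite inJ_tau tl_J.
have [M0 H] := Int_B q0 Delta_spec phi_spec Ups_spec Jt (hm (- alpha k')).
exists (maxn M0 1) => M; rewrite geq_max => /andP [/H {}H M1].
have eU : act (Fg (tau k') + UK D q (tau k') * E (tau (tau k'))) (hm (- alpha k')) = th (tau k') * hm (- alpha k').
  rewrite (linD (aL _)) act_F actM tauK act_E_hm.
  by rewrite (lin0 (actL _ _ _ _)) addr0.
have eth : th (tau k') * hm (- alpha k') =
    chi (alpha k') (alpha k') *: star (th (tau k')) (hm (- alpha k')).
  rewrite (star_thl q0 Delta_spec phi_spec) tauK (rho_hm_hm q0 Delta_spec phi_spec).
  rewrite (rho_theta_hm q0 Delta_spec phi_spec) addr0 -scalerAr scalerA chiNr //.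
  by rewrite mulfV ?chi_neq0 // scale1r.
have eL := evL q0 Delta_spec phi_spec Xi.
have h1 : act (PS M) (hm (- alpha k')) = hm (- alpha k').
  exact: (act_PS_hm q0 Delta_spec phi_spec Ups_spec).
have e1 : ev (star (th (tau k')) (hm (- alpha k'))) = cm (- alpha k') *: act (PS M) (th (tau k') * hm (- alpha k')).
  rewrite (ev_star q0 Delta_spec phi_spec Xi_spec) (XU_th Xi_spec).
  rewrite (ev_hm q0 Delta_spec phi_spec Xi_spec) (linZ (actL _ _ _ _)).
  by rewrite -[X in act _ X]h1 H eU.
rewrite eth !(linZ eL) e1.
rewrite act_F (linZ (actL _ _ _ _)) !scalerA; congr (_ *: _).
have vE : v_ k' = v_ k by rewrite /k' /vi (tlE ci Jk); case: ifP => _ //; rewrite symz_tau.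
rewrite chi_alpha2 vE expr2; have v0 := vi_neq0 D q0 k.
by rewrite !mulrA mulVf // mul1r.
Qed.
End Transport.

(** * Elements with their preimages under T_r *)

Lemma ad_conj (F : fieldType) (A : algType F) (v c : F) (K K1 e x : A) :
  v != 0 -> K * K1 = 1 -> K * e = v ^+ 2 *: (e * K) -> K * x = c *: (x * K) ->
  v^-1 *: (K * (v^-1 *: (e * K1) * x - x * (v^-1 *: (e * K1)))) =
  e * x - c *: (x * e).
Proof.
move=> v0 KK Ke Kx; rewrite -scalerAr -scalerAl mulrBr -!scalerAr -scalerBr scalerA.
have -> : K * (e * K1 * x) = v ^+ 2 *: (e * x).
  by rewrite !mulrA Ke -!scalerAl -[e * K * K1]mulrA KK mulr1.
have -> : K * (x * (e * K1)) = (v ^+ 2 * c) *: (x * e).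
  rewrite !mulrA Kx -!scalerAl -[x * K * e]mulrA Ke -scalerAr -scalerAl.
  by rewrite mulrA -[x * e * K * K1]mulrA KK mulr1 scalerA mulrC.
rewrite -[(_ * c) *: _]scalerA -scalerBr scalerA expr2.
by rewrite [X in X *: _](_ : _ = 1) ?scale1r //; field.
Qed.
Lemma lam_ad_split (F : fieldType) (A : algType F) (d w c1 c2 c3 c4 : F) (x y t : A) :
  c1 * c4 = c2 ->
  d *: x + c1 *: (t * y) - c2 *: (y * t + (c3 *: x) * (d *: 1)) =
  c1 *: (t * y - c4 *: (y * t)) + (d * (1 - c2 * c3)) *: x.
Proof.
move=> <-; rewrite -scalerAr mulr1 scalerDr !scalerA opprD scalerBr scalerA.
rewrite addrA [LHS](ACl ((2*3)*(1*4))) /=; congr (_ + _).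
by rewrite mulrBr mulr1 scalerBl; congr (_ - _ *: _); ring.
Qed.

Section Adapted.
Variables (I : finType) (D : satake I) (F : fieldType) (q : F).
Hypotheses (q0 : q != 0) (qn : forall n, (0 < n)%N -> q ^+ n != 1).
Local Notation B := (B_alg D q).
Local Notation U := (U_alg D q).
Local Notation E := (UE D q).
Local Notation Fg := (UF D q).
Local Notation K'm := (UK'_mon D q).
Local Notation th := (Btheta D q).
Local Notation hm := (Bh_mon D q).
Local Notation chi := (@chi I D F q).
Local Notation tau := (tau D).
Local Notation W := (@W I D F q).
Local Notation isf := (@isf I D F q).
Local Notation bplus := (@bplus I D F q).
Local Notation v_ := (vi D q).
Local Notation w_ i := (v_ i - (v_ i)^-1).
Variables (T : I -> {lrmorphism U -> U}).
Hypotheses (T_spec : is_lusztig T).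
Variables (Delta : B -> seq (B * B)) (phi : B -> B -> F).
Hypotheses (Delta_spec : is_coproduct Delta) (phi_spec : is_hopf_pairing Delta phi).
Variable i : I.
Local Notation J := (inJ D i).
Local Notation C1 := (@C1 I D F q i).
Local Notation rw := (r_word D i).
Local Notation r := (refl_word D rw).
Local Notation tl := (tau_loc D i).
Hypothesis ci : cartan D i (tau i) \in [:: 2; 0; -1].
Local Notation rho := (rho Delta phi).
Local Notation lam := (lam Delta phi).
Variable g : I -> B.
Hypotheses (gC : forall l, ~~ J l -> exists n, C1 n l (r (alpha l)) (g l))
  (gT : forall l, ~~ J l -> T_word T rw (bplus (g l)) = E l).

Let rhoL a : lin (rho a) := rho_lin Delta_spec phi_spec a.
Let lamL a : lin (lam a) := lam_lin Delta_spec phi_spec a.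
Let TH : ahom (T_word T rw) := T_word_ahom T rw.
Let bH := bplusH D q.

(** The second component is the preimage of the first under T_r. In the last rule the preimage of a
    q-commutator with E_k is, up to a Cartan factor, a commutator with F_(tau_i k); since [lam]
    kills x' this is the skew derivative [rho]. The index n counts letters and drives the later
    inductions. *)
Inductive adapted : nat -> lattice I -> B -> B -> Prop :=
| adapted_z n mu : adapted n mu 0 0
| adapted_1 : adapted 0 0 1 1
| adapted_lin n mu s x x' y y' : adapted n mu x x' -> adapted n mu y y' ->
    adapted n mu (s *: x + y) (s *: x' + y')
| adapted_th n mu l x x' : ~~ J l -> adapted n mu x x' ->
    adapted n.+1 (mu + alpha l) (th l * x) (g l * x')
| adapted_ad n mu k x x' : J k -> adapted n mu x x' ->
    adapted n.+1 (mu + alpha k) (th k * x - chi (alpha k) mu *: (x * th k))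
      ((v_ k)^-1 *: (hm (- alpha (tl k)) * rho (th (tl k)) x')).

Lemma T_r_injective : injective (T_word T rw \o bplus).
Proof.
by apply: inj_comp; [apply/bij_inj/(T_word_bij T_spec)|apply: (bplus_inj q0 Delta_spec phi_spec)].
Qed.

Lemma adapted_W n mu x x' : adapted n mu x x' -> W mu x /\ W (r mu) x'.
Proof.
elim=> {n mu x x'} [n mu||n mu s x x' y y' _ [Wx Wx'] _ [Wy Wy']|
  n mu l x x' Jl _ [Wx Wx']|n mu k x x' Jk _ [Wx Wx']].
- by split; apply: W_0.
- by rewrite r0; split; apply: W_1.
- by split; apply: W_lin.
- split; first exact: W_th.
  have [n' /C1_W Wg] := gC Jl.
  by rewrite rD addrC; apply: W_mul.
- split.
    apply: W_add; first exact: W_th.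
    by rewrite -scaleNr; apply/W_scale/W_mul/W_theta.
  apply/W_scale/W_h; rewrite rD (r_loc ci Jk).
  exact: (W_rho q0 Delta_spec phi_spec).
Qed.

Lemma isf_hV_rho k x nu : isf x -> W nu x -> isf (hm (- alpha k) * rho (th k) x).
Proof.
move=> fx Wx; have Wr := W_rho q0 Delta_spec phi_spec k Wx.
rewrite (W_comm q0 _ Wr) hm_alphaN; apply/isfZ.
exact: (isf_rho q0 Delta_spec phi_spec).
Qed.

Lemma adapted_isf n mu x x' : adapted n mu x x' -> isf x /\ isf x'.
Proof.
elim=> {n mu x x'} [n mu||n mu s x x' y y' _ [Wx Wx'] _ [Wy Wy']|
  n mu l x x' Jl _ [Wx Wx']|n mu k x x' Jk Ax [Wx Wx']].
- by split; apply: isf0.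
- by split; apply: isf1.
- by split; apply: isf_lin.
- have [n' /C1_isf fg] := gC Jl.
  by split; apply: isfM => //; apply: isf_th.
- have [_ Wr] := adapted_W Ax; split; last exact/isfZ/(isf_hV_rho _ _ Wr).
  by apply: isfB; [|apply: isfZ]; apply: isfM => //; apply: isf_th.
Qed.

(** The g_l are killed by these operators, and the last rule applies [rho], which commutes with
    [lam]. *)
Lemma adapted_lam0 n mu x x' k : adapted n mu x x' -> J k -> lam (th k) x' = 0.
Proof.
move=> Ax Jk; elim: Ax => {n mu x x'} [n mu||n mu s x x' y y' _ Wx _ Wy|
  n mu l x x' Jl _ Wx|n mu j x x' Jj Ax Wx].
- exact: lin0.
- exact: (lam_th1 Delta_spec phi_spec).
- by rewrite lamL Wx Wy scaler0 addr0.
- have [n' Cg] := gC Jl.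
  rewrite (lam_theta Delta_spec phi_spec); rewrite -> Wx, -> mulr0; rewrite addr0.
  by rewrite (C1_lam q0 Delta_spec phi_spec Cg Jk) mul0r.
- rewrite (linZ (lamL _)) (lam_th_hmM q0 Delta_spec phi_spec).
  rewrite -(rho_lam Delta_spec phi_spec) Wx (lin0 (rhoL _)) mulr0.
  by rewrite !scaler0.
Qed.

Lemma adapted_rho0 n mu x x' k : adapted n mu x x' -> J k -> rho (th k) x = 0.
Proof.
move=> Ax Jk; elim: Ax => {n mu x x'} [n mu||n mu s x x' y y' _ Wx _ Wy|
  n mu l x x' Jl _ Wx|n mu j x x' Jj Ax Wx].
- exact: lin0.
- exact: (rho_th1 Delta_spec phi_spec).
- by rewrite rhoL Wx Wy scaler0 addr0.
- rewrite (rho_th_thM q0 Delta_spec phi_spec) Wx mulr0 addr0.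
  by case: eqP => [kl|_]; [move: Jl; rewrite -kl Jk|rewrite mul0r scale0r].
- have [fx _] := adapted_isf Ax; have [Wmu _] := adapted_W Ax.
  rewrite (linB (rhoL _)) (linZ (rhoL _)) (rho_th_thM q0 Delta_spec phi_spec) Wx.
  rewrite -> mulr0;
  rewrite addr0 (rho_theta Delta_spec phi_spec);
  rewrite -> Wx;
  rewrite mul0r add0r.
  rewrite -(hm_alpha _ _ k) (rho_hm_isf q0 Delta_spec phi_spec _ fx).
  rewrite (rho_theta_th Delta_spec phi_spec) -scalerAr -!hm_alpha (W_comm q0 _ Wmu).
  rewrite !scalerA; case: eqP => [->|_]; last by rewrite !(mul0r, mulr0) subrr.
  by rewrite mulrC subrr.
Qed.

(* For [l] outside [J], [E_l] commutes with the [F_k], whose preimages are the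
   [E_k'] up to the Cartan part. *)
Lemma g_th l k : ~~ J l -> J k ->
  g l * th k = chi (alpha k) (r (alpha l)) *: (th k * g l).
Proof.
move=> Jl Jk; apply: T_r_injective; have Jtk := tl_J ci Jk.
have e : T_word T rw (E k) = (v_ (tl k))^-1 *: (Fg (tl k) * K'm (- alpha (tl k))).
  have := T_r_F q0 qn T_spec Delta_spec phi_spec ci Jtk; rewrite (tlK ci Jk) => /(congr1 (@omega _ D _ q)).
  rewrite /T_r -(T_word_omega q0 T_spec) omega_F (linZ (ahomL (omegaH D q))).
  by rewrite (ahomM (omegaH D q)) omega_E omega_KV K'm_alphaN.
rewrite /= (ahomZ bH) !(ahomM bH) (ahomZ TH) !(ahomM TH) bplus_theta e !gT //.
have EF : E l * Fg (tl k) = Fg (tl k) * E l.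
  apply: subr0_eq; rewrite UE_F; case: eqP => [lk|_]; last by rewrite mulr0n mul0r scale0r.
  by move: Jl; rewrite lk Jtk.
have -> : chi (alpha k) (r (alpha l)) = chi (- alpha (tl k)) (alpha l).
  by rewrite /chi -(rf_rC ci) (r_loc ci Jk).
rewrite -scalerAr mulrA EF -scalerAl scalerA -mulrA; rewrite -[X in _ = _ *: X]mulrA.
rewrite (K'm_E D q0); rewrite -> chiNr; rewrite // -scalerAr scalerA; congr (_ *: _).
by rewrite mulrAC mulfV ?chi_neq0 // mul1r.
Qed.

Lemma adapted_T n mu x x' : adapted n mu x x' -> T_word T rw (bplus x') = bplus x.
Proof.
elim=> {n mu x x'} [n mu||n mu s x x' y y' _ Wx _ Wy|
  n mu l x x' Jl _ Wx|n mu k x x' Jk Ax IH].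
- by rewrite (ahom0 bH) (ahom0 TH).
- by rewrite (ahom1 bH) (ahom1 TH).
- by rewrite !(ahomL bH) (ahomL TH) Wx Wy.
- by rewrite !(ahomM bH) (ahomM TH) gT // Wx bplus_theta.
- have [fx fx'] := adapted_isf Ax; have [Wx Wx'] := adapted_W Ax.
  have := FB q0 Delta_spec phi_spec (tl k) fx'.
  rewrite (adapted_lam0 Ax (tl_J ci Jk)) (ahom0 bH) mulr0 subr0 => e.
  have {}e : bplus (rho (th (tl k)) x') = Fg (tl k) * bplus x' - bplus x' * Fg (tl k).
    by rewrite e addrC addKr.
  have TF := T_r_F q0 qn T_spec Delta_spec phi_spec ci Jk.
  rewrite (ahomZ bH) (ahomM bH) bplus_hm (ahomZ TH) (ahomM TH).
  rewrite (T_word_Km T_spec) e (ahomB TH) !(ahomM TH) IH.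
  rewrite -[T_word T rw (Fg _)]/(T_r T i _) TF (ahomB bH) (ahomZ bH) !(ahomM bH) bplus_theta.
  rewrite rN (r_loc ci (tl_J ci Jk)) (tlK ci Jk) opprK -Km_alphaN.
  apply: ad_conj; [exact: vi_neq0|by rewrite KmN| |].
    by rewrite (Km_E D q0) chi_alpha2.
  have := congr1 bplus (W_comm q0 (alpha k) Wx).
  by rewrite (ahomZ bH) !(ahomM bH) bplus_hm.
Qed.

Lemma adapted_eq n mu nu x y x' y' :
  adapted n mu x x' -> mu = nu -> x = y -> x' = y' -> adapted n nu y y'.
Proof. by move=> A <- <- <-. Qed.
(** Only the existence of a partner is claimed here; its value is identified in [adapted_lamT] by
    injectivity of T_r. *)
Lemma adapted_lam n mu x x' k : adapted n mu x x' -> J k ->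
  if n is n'.+1 then exists y', adapted n' (mu - alpha k) (lam (th k) x) y'
  else lam (th k) x = 0.
Proof.
move=> Ax Jk; elim: Ax => {n mu x x'} [n mu||n mu s x x' y y' _ IHx _ IHy|
  n mu l x x' Jl _ IH|n mu j x x' Jj Ax IH].
- by case: n => [|n]; rewrite (lin0 (lamL _)) //; exists 0; apply: adapted_z.
- exact: (lam_th1 Delta_spec phi_spec).
- case: n IHx IHy => [|n]; first by move=> ex ey; rewrite lamL ex ey scaler0 addr0.
  move=> [z Az] [z' Az']; exists (s *: z + z'); rewrite lamL; exact: adapted_lin.
- have -> : lam (th k) (th l * x) = chi (alpha k) (alpha l) *: (th l * lam (th k) x).
    rewrite (lam_th_thM q0 Delta_spec phi_spec); case: eqP => [kl|_].
      by move: Jl; rewrite -kl Jk.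
    by rewrite mul0r scale0r add0r.
  case: n IH => [|n].
    by move=> ->; rewrite mulr0 scaler0; exists 0; apply: adapted_z.
  move=> [z Az]; exists (chi (alpha k) (alpha l) *: (g l * z) + 0).
  apply: (@adapted_eq n.+1 (mu - alpha k + alpha l) _
    (chi (alpha k) (alpha l) *: (th l * lam (th k) x) + 0) _ _ _ _ (addrAC _ _ _)); last by [].
    by apply: adapted_lin; [apply: adapted_th|apply: adapted_z].
  by rewrite addr0.
- have [Wx _] := adapted_W Ax; have [fx _] := adapted_isf Ax.
  set y := lam (th k) x in IH *.
  have -> : lam (th k) (th j * x - chi (alpha j) mu *: (x * th j)) =
      chi (alpha k) (alpha j) *: (th j * y - chi (alpha j) (mu - alpha k) *: (y * th j)) +
      (((k == j)%:R * w_ k) * (1 - chi (alpha j) mu * chi (alpha k) mu)) *: x.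
    rewrite (linB (lamL _)) (linZ (lamL _)) (lam_th_thM q0 Delta_spec phi_spec) -/y.
    rewrite (lam_theta Delta_spec phi_spec) -/y -(hm_alpha _ _ k).
    rewrite (lam_hm_isf q0 Delta_spec phi_spec _ fx) (W_conj q0 _ Wx).
    rewrite (lam_theta_th Delta_spec phi_spec); apply: lam_ad_split => //.
    by rewrite [chi (alpha k) _]chiC -chiDr // addrCA subrr addr0.
  have [z1 Az1] : exists z, adapted n (mu + alpha j - alpha k)
      (((k == j)%:R * w_ k * (1 - chi (alpha j) mu * chi (alpha k) mu)) *: x) z.
    case: eqP => [<-|_]; last by rewrite !mul0r scale0r; exists 0; apply: adapted_z.
    rewrite addrK -[X in adapted _ _ X]addr0; eexists.
    by apply: adapted_lin; [exact: Ax|exact: adapted_z].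
  have [z2 Az2] : exists z, adapted n (mu + alpha j - alpha k)
      (th j * y - chi (alpha j) (mu - alpha k) *: (y * th j)) z.
    case: n IH {Ax Az1} => [|n].
      by move=> ->; rewrite mul0r mulr0 scaler0 subrr; exists 0; apply: adapted_z.
    move=> [z Az]; rewrite addrAC; eexists; apply: adapted_ad => //; exact: Az.
  by eexists; apply: adapted_lin; [exact: Az2|exact: Az1].
Qed.
End Adapted.

(** * Skew derivatives of adapted elements *)

Section Corrections.
Variables (I : finType) (D : satake I) (F : fieldType) (q : F).
Hypotheses (q0 : q != 0) (qn : forall n, (0 < n)%N -> q ^+ n != 1).
Local Notation B := (B_alg D q).
Local Notation U := (U_alg D q).
Local Notation E := (UE D q).
Local Notation th := (Btheta D q).
Local Notation hm := (Bh_mon D q).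
Local Notation chi := (@chi I D F q).
Local Notation tau := (tau D).
Local Notation ltau := (lat_map tau).
Local Notation W := (@W I D F q).
Local Notation isf := (@isf I D F q).
Local Notation bplus := (@bplus I D F q).
Local Notation rf := (root_form D).
Local Notation v_ := (vi D q).
Variables (T : I -> {lrmorphism U -> U}).
Hypotheses (T_spec : is_lusztig T).
Variables (Delta : B -> seq (B * B)) (phi : B -> B -> F).
Hypotheses (Delta_spec : is_coproduct Delta) (phi_spec : is_hopf_pairing Delta phi).
Variable i : I.
Local Notation J := (inJ D i).
Local Notation C1 := (@C1 I D F q i).
Local Notation rw := (r_word D i).
Local Notation r := (refl_word D rw).
Local Notation tl := (tau_loc D i).
Hypothesis ci : cartan D i (tau i) \in [:: 2; 0; -1].
Local Notation rho := (rho Delta phi).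
Local Notation lam := (lam Delta phi).
Variable g : I -> B.
Hypotheses (gC : forall l, ~~ J l -> exists n, C1 n l (r (alpha l)) (g l))
  (gT : forall l, ~~ J l -> T_word T rw (bplus (g l)) = E l).

Let rhoL a : lin (rho a) := rho_lin Delta_spec phi_spec a.
Let lamL a : lin (lam a) := lam_lin Delta_spec phi_spec a.
Let TH : ahom (T_word T rw) := T_word_ahom T rw.
Let bH := bplusH D q.

Local Notation adapted := (adapted Delta phi i g).
Local Notation kk k := (tau (tl k)).

Inductive fJ : nat -> lattice I -> B -> B -> Prop :=
| fJ_z n mu : fJ n mu 0 0
| fJ_1 : fJ 0 0 1 1
| fJ_lin n mu s u u' x x' : fJ n mu u u' -> fJ n mu x x' ->
    fJ n mu (s *: u + x) (s *: u' + x')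
| fJ_r n mu k u u' : J k -> fJ n mu u u' ->
    fJ n.+1 (mu + alpha k) (u * th k) (u' * th (kk k)).

Lemma r_kk k : J k -> - ltau (r (alpha k)) = alpha (kk k).
Proof. by move=> Jk; rewrite (r_loc ci Jk) lat_mapN opprK lat_map_alpha. Qed.
Lemma fJ_W n mu u u' : fJ n mu u u' -> W mu u /\ W (- ltau (r mu)) u'.
Proof.
elim=> {n mu u u'} [n mu||n mu s u u' x x' _ [Wu Wu'] _ [Wx Wx']|n mu k u u' Jk _ [Wu Wu']].
- by split; apply: W_0.
- by rewrite r0 lat_map0 oppr0; split; apply: W_1.
- by split; apply: W_lin.
- split; first exact/W_mul/W_theta.
  by rewrite rD lat_mapD opprD r_kk //; apply/W_mul/W_theta.
Qed.
Lemma fJ_isf n mu u u' : fJ n mu u u' -> isf u /\ isf u'.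
Proof.
elim=> {n mu u u'} [n mu||n mu s u u' x x' _ [Wu Wu'] _ [Wx Wx']|n mu k u u' Jk _ [Wu Wu']].
- by split; apply: isf0.
- by split; apply: isf1.
- by split; apply: isf_lin.
- by split; apply: isfM => //; apply: isf_th.
Qed.
Lemma fJ_eq n mu nu u u' x x' :
  fJ n mu u u' -> mu = nu -> u = x -> u' = x' -> fJ n nu x x'.
Proof. by move=> H <- <- <-. Qed.
Lemma fJ_l n mu k u u' : J k -> fJ n mu u u' ->
  fJ n.+1 (mu + alpha k) (th k * u) (th (kk k) * u').
Proof.
move=> Jk; elim=> {n mu u u'} [n mu||n mu s u u' x x' _ IHu _ IHx|n mu j u u' Jj _ IH].
- by rewrite !mulr0; apply: fJ_z.
- by apply: (fJ_eq (fJ_r Jk fJ_1)); rewrite ?mul1r ?mulr1.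
- by rewrite !mulrDr -!scalerAr; apply: fJ_lin.
- by apply: (fJ_eq (fJ_r Jj IH)); rewrite ?mulrA // addrAC.
Qed.
Lemma fJ_lam n mu k u u' : J k -> fJ n mu u u' ->
  if n is n'.+1 then fJ n' (mu - alpha k) (lam (th k) u) (lam (th (kk k)) u')
  else lam (th k) u = 0 /\ lam (th (kk k)) u' = 0.
Proof.
move=> Jk; elim=> {n mu u u'} [n mu||n mu s u u' x x' _ IHu _ IHx|n mu j u u' Jj Fu IH].
- by case: n => [|n]; rewrite -> !(lin0 (lamL _)); rewrite //; apply: fJ_z.
- by rewrite !(lam_th1 Delta_spec phi_spec).
- case: n IHu IHx => [|n]; rewrite -> !lamL; last exact: fJ_lin.
  by move=> [-> ->] [-> ->]; rewrite !scaler0 !addr0.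
- have [Wu Wu'] := fJ_W Fu; have [fu fu'] := fJ_isf Fu.
  rewrite -> !(lam_theta Delta_spec phi_spec); rewrite -!hm_alpha.
  rewrite !(lam_hm_isf q0 Delta_spec phi_spec) // (W_conj q0 _ Wu) (W_conj q0 _ Wu').
  rewrite -> !(lam_theta_th Delta_spec phi_spec); rewrite -!scalerAl -!scalerAr !mulr1 !scalerA.
  have -> : chi (alpha (kk k)) (- ltau (r mu)) = chi (alpha k) mu.
    by rewrite -r_kk // chiNl // chiNr // invrK /chi rf_tau rf_r.
  have -> : (kk k == kk j) = (k == j).
    by apply/eqP/eqP => [/(can_inj (@tauK _ D)) /(congr1 tl)|-> //]; rewrite !(tlK ci).
  have -> : v_ (kk k) = v_ k.
    by rewrite /vi symz_tau (tlE ci Jk); case: ifP => _; rewrite ?symz_tau.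
  set s := chi _ _ * _; rewrite [_ + s *: u]addrC [_ + s *: u']addrC.
  have F1 : fJ n (mu + alpha j - alpha k) (lam (th k) u * th j) (lam (th (kk k)) u' * th (kk j)).
    case: n IH {Fu} => [[-> ->]|n IH]; first by rewrite !mul0r; apply: fJ_z.
    by apply: (fJ_eq (fJ_r Jj IH)); rewrite // addrAC.
  have [kj|kj] := eqVneq k j; last first.
    by rewrite /s (negbTE kj) mul0r mulr0 !scale0r !add0r.
  by apply: fJ_lin => //; rewrite kj addrK.
Qed.

Variable j : I.
Hypothesis Jj : ~~ J j.
(** This is v^(-(mu,mu)/2). Its step by alpha_k has the factor v_k^-1 of the image of theta_k and
    the scalar from commuting the Cartan elements. *)
Definition Qf (mu : lattice I) : F := q ^ (- rf mu mu).
Definition corc (mu : lattice I) : F := (chi (alpha (tau j)) mu)^-1 * Qf mu.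
Lemma Qf_step k mu : Qf (mu + alpha k) = Qf mu * (chi (alpha k) mu)^-1 * (v_ k)^-1.
Proof.
rewrite /Qf /chi vi_z !invr_expz !qE //; congr (q ^ _).
by rewrite !rfE rf_alpha cartan_diag [rf mu (alpha k)]rfC; ring.
Qed.
Lemma corc_step k mu : corc (mu + alpha k) =
  corc mu * (v_ k)^-1 * (chi (alpha k) (alpha (tau j)))^-1 * (chi (alpha k) mu)^-1.
Proof.
rewrite /corc Qf_step chiDr // invfM [chi (alpha (tau j)) (alpha k)]chiC.
by rewrite !mulrA [LHS](ACl (1*3*5*2*4)).
Qed.

(** Skew derivatives of adapted elements are sums of terms a u h_(tau j). [L] records the expected
    image of each term as a tensor, rank one factor on the left and adapted factor on the right,
    contracted by beta so that letters can still be inserted in either leg. The strict bound on n1 +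
    n2 lets the induction on total degree apply to every term. *)
Inductive cor : nat -> lattice I -> B -> ((B -> B -> B) -> B) -> Prop :=
| cor_0 n mu : cor n mu 0 (fun _ => 0)
| cor_lin n mu s x y L M : cor n mu x L -> cor n mu y M ->
    cor n mu (s *: x + y) (fun beta => s *: L beta + M beta)
| cor_gen n n1 n2 mu1 mu2 a a' u u' :
    adapted n1 mu1 a a' -> fJ n2 mu2 u u' -> (n1 + n2 < n)%N ->
    cor n (mu1 + mu2 + alpha (tau j)) (a * u * hm (alpha (tau j)))
      (fun beta => corc mu2 *: beta u' (a' * hm (r (alpha (tau j) + mu2))))
| cor_ext n mu x L M : cor n mu x L ->
    (forall beta, is_bilinear beta -> L beta = M beta) -> cor n mu x M.

Lemma cor_eq n mu nu x y L M : cor n mu x L -> mu = nu -> x = y ->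
  (forall beta, is_bilinear beta -> L beta = M beta) -> cor n nu y M.
Proof. by move=> C <- <-; apply: cor_ext. Qed.

Lemma cor_th n mu x L l : ~~ J l -> cor n mu x L ->
  cor n.+1 (mu + alpha l) (th l * x) (fun beta => L (fun x y => beta x (g l * y))).
Proof.
move=> Jl; elim=> {n mu x L} [n mu|n mu s x y L M _ IHx _ IHy|n n1 n2 mu1 mu2 a a' u u' Aa Fu le|
  n mu x L M _ IH LM].
- by apply: (cor_eq (cor_0 _ _)) => //; rewrite mulr0.
- by apply: (cor_eq (cor_lin s IHx IHy)) => //; rewrite mulrDr scalerAr.
- apply: (cor_eq (cor_gen (adapted_th Jl Aa) Fu (n := n.+1) _)) => //.
  + by rewrite [LHS](ACl (1*3*4*2)).
  + by rewrite !mulrA.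
  + by move=> beta _; rewrite mulrA.
- by apply: (cor_ext IH) => beta bb; apply: LM; lint.
Qed.

Lemma ad_split_id (A : algType F) (t a u h1 : A) (c c1 c2 : F) :
  h1 * t = c2 *: (t * h1) ->
  (t * a - c1 *: (a * t)) * u * h1 + (c1 *: (a * (t * u) * h1) +
    (- (c * c2)) *: (a * (u * t) * h1)) = t * (a * u * h1) - c *: (a * u * h1 * t).
Proof.
move=> e; rewrite -[a * u * h1 * t]mulrA e -scalerAr scalerA scaleNr !mulrBl -!scalerAl !mulrA.
by rewrite addrA subrK.
Qed.

(** A bracket of theta_k with a u h splits into a bracket with a and a letter added to u on the left
    or on the right ([ad_split_id]). The three resulting contributions have the shape of
    [crossed_ad]. *)
Lemma cor_ad n mu x L k : J k -> cor n mu x L ->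
  cor n.+1 (mu + alpha k) (th k * x - chi (alpha k) mu *: (x * th k))
    (fun beta => (v_ k)^-1 *: (L (fun x y => beta x (hm (- alpha (tl k)) * rho (th (tl k)) y))
      + L (fun x y => beta (th (kk k) * x) (hm (- alpha (tl k)) * rho (hm (alpha (tl k))) y))
      - chi (alpha k) (alpha (tau j)) *:
        L (fun x y => beta (x * th (kk k)) (hm (- alpha (tl k)) * y)))).
Proof.
move=> Jk; elim=> {n mu x L} [n mu|n mu s x y L M _ IHx _ IHy|n n1 n2 mu1 mu2 a a' u u' Aa Fu le|
  n mu x L M _ IH LM].
- apply: (cor_eq (cor_0 _ _)) => //; first by rewrite mulr0 mul0r scaler0 subrr.
  by move=> *; rewrite scaler0 addr0 subr0 scaler0.
- apply: (cor_eq (cor_lin s IHx IHy)) => //.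
    rewrite mulrDr mulrDl -scalerAl -scalerAr scalerBr scalerDr opprD !scalerA.
    by rewrite [s * _]mulrC addrACA.
  move=> beta _; move: (L _) (L _) (L _) (M _) (M _) (M _) => l1 l2 l3 m1 m2 m3.
  rewrite scalerA [s * _]mulrC -scalerA -scalerDr; congr (_ *: _).
  rewrite scalerBr !scalerDr opprD !scalerA [s * _]mulrC.
  by rewrite addrACA; congr (_ + _); rewrite addrACA.
- have G1 := cor_gen (adapted_ad Jk Aa) Fu (le : n1.+1 + n2 < n.+1)%N.
  have le' : (n1 + n2.+1 < n.+1)%N by rewrite addnS.
  have G2 := cor_gen Aa (fJ_l Jk Fu) le'.
  have G3 := cor_gen Aa (fJ_r Jk Fu) le'.
  have [Wa Wa'] := adapted_W q0 Delta_spec phi_spec ci gC Aa.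
  have [fa fa'] := adapted_isf q0 Delta_spec phi_spec ci gC Aa.
  pose c2 := chi (alpha (tau j)) (alpha k).
  have ht : hm (alpha (tau j)) * th k = c2 *: (th k * hm (alpha (tau j))) by exact: hm_theta.
  have e1 : mu1 + (mu2 + alpha k) + alpha (tau j) = mu1 + mu2 + alpha (tau j) + alpha k.
    by rewrite !addrA [LHS](ACl (1*2*4*3)).
  have e2 : mu1 + alpha k + mu2 + alpha (tau j) = mu1 + mu2 + alpha (tau j) + alpha k.
    by rewrite [LHS](ACl (1*3*4*2)).
  rewrite e1 in G2 G3; rewrite e2 in G1.
  set mu := mu1 + mu2 + alpha (tau j) in G1 G2 G3 *.
  have G23 := cor_lin (chi (alpha k) mu1) G2 (cor_lin (- (chi (alpha k) mu * c2)) G3 (cor_0 _ _)).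
  apply: (cor_eq (cor_lin 1 G1 G23)) => //.
    by rewrite scale1r addr0; apply: ad_split_id.
  move=> beta bb; rewrite addr0 scale1r.
  set ga := r (alpha (tau j) + mu2).
  have gk : r (alpha (tau j) + (mu2 + alpha k)) = ga - alpha (tl k).
    by rewrite addrA rD (r_loc ci Jk).
  rewrite gk.
  have rh : rho (th (tl k)) (a' * hm ga) = rho (th (tl k)) a' * hm ga.
    rewrite (rho_theta Delta_spec phi_spec) (rho_theta_hm q0 Delta_spec phi_spec).
    rewrite -> mulr0; by rewrite addr0.
  have rhh : rho (hm (alpha (tl k))) (a' * hm ga) = chi (alpha (tl k)) ga *: (a' * hm ga).
    rewrite (rho_hmM Delta_spec phi_spec) (rho_hm_isf q0 Delta_spec phi_spec _ fa').
    by rewrite (rho_hm_hm q0 Delta_spec phi_spec) scalerAr.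
  have hh : hm (- alpha (tl k)) * (a' * hm ga) =
      chi (alpha k) mu1 *: (a' * hm (ga - alpha (tl k))).
    rewrite mulrA (W_comm q0 _ Wa') -scalerAl -mulrA -hmD [- _ + _]addrC.
    by congr (_ *: _); rewrite -(r_loc ci Jk) /chi rf_r.
  have chk : chi (alpha (tl k)) ga =
      (chi (alpha k) (alpha (tau j)))^-1 * (chi (alpha k) mu2)^-1.
    rewrite -invfM -chiDr // -chiNl // /ga -[alpha (tl k)]opprK -(r_loc ci Jk) -rN.
    by rewrite /chi rf_r.
  have cc : corc (mu2 + alpha k) * chi (alpha k) mu1 =
      (v_ k)^-1 * (corc mu2 * (chi (alpha (tl k)) ga * chi (alpha k) mu1)).
    by rewrite corc_step chk; ring.
  have cc' : corc (mu2 + alpha k) * (chi (alpha k) mu * c2) =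
      (v_ k)^-1 * (chi (alpha k) (alpha (tau j)) * (corc mu2 * chi (alpha k) mu1)).
    rewrite corc_step /mu !chiDr // /c2 [chi (alpha (tau j)) _]chiC.
    by field; rewrite !chi_neq0 // vi_neq0.
  rewrite rh rhh -scalerAr !hh -scalerAl !(linZ (bil_r _ bb)) mulrA.
  move: cc cc'; move: (beta _ _) (beta _ _) (beta _ _) => b1 b2 b3 cc cc'.
  rewrite scaleNr !scalerBr !scalerDr !scalerA !addrA.
  congr (_ *: _ + _ *: _ - _ *: _); first by rewrite mulrC.
    by rewrite mulrC cc; ring.
  by rewrite mulrC cc'; ring.
- by apply: (cor_ext IH) => beta bb; rewrite !LM //; lint.
Qed.
End Corrections.

(** * The coproduct of g_j against adapted elements *)

Section Claim.
Variables (I : finType) (D : satake I) (F : fieldType) (q : F).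
Hypotheses (q0 : q != 0) (qn : forall n, (0 < n)%N -> q ^+ n != 1).
Local Notation B := (B_alg D q).
Local Notation U := (U_alg D q).
Local Notation E := (UE D q).
Local Notation th := (Btheta D q).
Local Notation hm := (Bh_mon D q).
Local Notation chi := (@chi I D F q).
Local Notation tau := (tau D).
Local Notation ltau := (lat_map tau).
Local Notation W := (@W I D F q).
Local Notation isf := (@isf I D F q).
Local Notation bplus := (@bplus I D F q).
Local Notation v_ := (vi D q).
Local Notation w_ i := (v_ i - (v_ i)^-1).
Variables (T : I -> {lrmorphism U -> U}).
Hypotheses (T_spec : is_lusztig T).
Variables (Delta : B -> seq (B * B)) (phi : B -> B -> F).
Hypotheses (Delta_spec : is_coproduct Delta) (phi_spec : is_hopf_pairing Delta phi).
Variable i : I.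
Local Notation J := (inJ D i).
Local Notation C1 := (@C1 I D F q i).
Local Notation rw := (r_word D i).
Local Notation r := (refl_word D rw).
Local Notation tl := (tau_loc D i).
Hypothesis ci : cartan D i (tau i) \in [:: 2; 0; -1].
Local Notation rho := (rho Delta phi).
Local Notation lam := (lam Delta phi).
Variable g : I -> B.
Hypotheses (gC : forall l, ~~ J l -> exists n, C1 n l (r (alpha l)) (g l))
  (gT : forall l, ~~ J l -> T_word T rw (bplus (g l)) = E l).

Let rhoL a : lin (rho a) := rho_lin Delta_spec phi_spec a.
Let lamL a : lin (lam a) := lam_lin Delta_spec phi_spec a.
Let TH : ahom (T_word T rw) := T_word_ahom T rw.
Let bH := bplusH D q.

Local Notation adapted := (adapted Delta phi i g).
Local Notation kk k := (tau (tl k)).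
Local Notation cop := (cop Delta).

Lemma cop_tauB (V : lmodType F) (x : B) (G : B -> B -> V) : is_bilinear G ->
  cop (tauB x) G = cop x (fun y z => G (tauB y) (tauB z)).
Proof.
have tH := tauBH D q; elim/(B_indm (D := D) (q := q)): x G => [|c x y IHx IHy|l x IH|mu x IH] G bG.
- by rewrite (ahom1 tH) !(cop1 Delta_spec) ?(ahom1 tH) //; lint.
- rewrite (ahomL tH) (cop_lin Delta_spec bG) IHx // IHy //.
  by rewrite -(cop_lin Delta_spec) //; lint.
- rewrite (ahomM tH) tauB_theta !(copM Delta_spec) ?(cop_theta Delta_spec) //; try by lint.
  rewrite !IH; try by lint.
  by congr (_ + _); apply: eq_cop => y z; rewrite !(ahomM tH) ?tauB_theta ?tauB_h ?(ahom1 tH).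
- rewrite (ahomM tH) tauB_hm !(copM Delta_spec) ?(cop_hm Delta_spec) //; try by lint.
  rewrite !IH; try by lint.
  by apply: eq_cop => y z; rewrite !(ahomM tH) tauB_hm.
Qed.
Lemma cop_lam a b (V : lmodType F) (G : B -> B -> V) : is_bilinear G ->
  cop (lam a b) G = cop b (fun x y => G (lam a x) y).
Proof.
move=> bG; have cL := cop_lin Delta_spec bG; rewrite /lam (lin_cop cL).
transitivity (cop b (fun x y => cop y (fun y1 y2 => phi x a *: G y1 y2))).
  by apply: eq_cop => x y; rewrite (linZ cL) copZ.
rewrite -(copA Delta_spec b (g := fun x y z => phi x a *: G y z)); last by lint.
apply: eq_cop => x y; rewrite (lin_cop (bil_l y bG)); apply: eq_cop => x1 x2.
by rewrite (linZ (bil_l y bG)).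
Qed.
Lemma rho_hm_mul x nu y : rho x (hm nu * y) = hm nu * rho (lam (hm nu) x) y.
Proof.
rewrite (rho_M Delta_spec phi_spec) /(lam _ _) (lin_cop (rho_linl phi_spec y)).
rewrite copMl; apply: eq_cop => x1 x2; rewrite (rho_hmE Delta_spec phi_spec).
rewrite (linZ (rho_linl phi_spec y)) -scalerAl -scalerAr.
by rewrite (phiC phi_spec).
Qed.

Lemma wt_off_tau l mu : wt_off D i l mu -> wt_off D i (tau l) (ltau mu).
Proof.
move=> Ho j Jj; rewrite lat_mapE Ho ?inJ_tau //; congr ((_ : bool) : int).
by apply/eqP/eqP => [->|<-]; rewrite tauK.
Qed.
Lemma wtw_neq0 (u : seq I) : u != [::] -> wtw u != 0.
Proof.
have wge (s : seq I) k : 0 <= wtw s k.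
  elim: s => [|a s IH]; first by rewrite /wtw big_nil ffunE.
  by rewrite wtw_cons ffunE Num.Theory.addr_ge0 // ffunE; case: (_ == _).
case: u => [//|k u] _; apply/eqP => /(congr1 (fun f : lattice I => f k)).
by have := wge u k; rewrite wtw_cons !ffunE eqxx /=; lia.
Qed.
Lemma wtw_map_tau u : ltau (wtw u) = wtw (map tau u).
Proof.
elim: u => [|k u IH]; first by rewrite /wtw !big_nil lat_map0.
by rewrite !wtw_cons lat_mapD IH lat_map_alpha.
Qed.

Section OneGenerator.
Variable j : I.
Hypothesis Jj : ~~ J j.
Local Notation cor := (cor Delta phi i g j).
Local Notation mj := (r (alpha j)).

(** With multiplication for beta this is the iHopf product of g_j and a' ([star_istar]); a general
    beta keeps the two legs apart. *)
Definition crossed (a' : B) (beta : B -> B -> B) : B :=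
  cop (g j) (fun x y => beta y (rho (tauB x) a')).

Lemma bil_crossed a' beta : is_bilinear beta ->
  is_bilinear (fun x y => beta y (rho (tauB x) a') : B).
Proof. by move=> bb; lint. Qed.
Lemma crossed_lin s x y beta : is_bilinear beta ->
  crossed (s *: x + y) beta = s *: crossed x beta + crossed y beta.
Proof.
move=> bb; rewrite /crossed -copZ -copD; apply: eq_cop => u v.
by rewrite rhoL (bil_r v bb).
Qed.
Lemma crossed0 beta : is_bilinear beta -> crossed 0 beta = 0.
Proof.
move=> bb; rewrite -[X in crossed X](scale0r 0) -[_ *: _]addr0 crossed_lin //.
by rewrite scale0r add0r; have := crossed_lin 1 0 0 bb; rewrite scaler0 addr0 scale1r => /eqP; rewrite -subr_eq0 opprD addrA subrr sub0r oppr_eq0 => /eqP.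
Qed.
Lemma crossed1 beta : is_bilinear beta -> crossed 1 beta = beta (g j) 1.
Proof.
move=> bb; have [n Cg] := gC Jj; have [s [G Z]] := C1_Zst q0 Delta_spec Cg.
have wo := C1_off Cg.
rewrite /crossed Z; last exact: bil_crossed.
have re x : rho (tauB x) 1 = counit x *: 1.
  by rewrite (rho_1l Delta_spec phi_spec) (phi_1l phi_spec) (counit_tau phi_spec).
rewrite !re (counit_hm phi_spec) scale1r (counit_W (C1_W Cg)) ?(wt_off_neq0 Jj wo) //.
rewrite scale0r (lin0 (bil_r _ bb)) addr0 (rest_sum0 G) ?addr0 // => -[c u] Wc Ju un /=.
rewrite re (counit_W Wc) ?scale0r ?(lin0 (bil_r _ bb)) //.
by apply: (wt_off_neq0 Jj); apply: wt_off_wtw.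
Qed.

(** By weights: if l = tau j, the weights of g_l and tau c differ by that of the nonempty word u,
    and for other l they differ already outside J. The other right legs, 1 and words in J, lack the
    root alpha_(tau j). *)
Lemma rho_rest l c u : ~~ J l -> W (mj - wtw u) c -> all J u -> u != [::] ->
  rho (tauB c) (g l) = 0.
Proof.
move=> Jl Wc Ju un; have [n Cg] := gC Jl; have [s [G Z]] := C1_Zst q0 Delta_spec Cg.
have [n' Cj] := gC Jj; have wo := wt_off_tau (wt_off_wtw (C1_off Cj) Ju).
have Wtc := W_tau Wc.
have Jtj : ~~ J (tau j) by rewrite inJ_tau.
rewrite /rho Z; last by lint.
rewrite (phi_W q0 Delta_spec phi_spec (C1_W Cg) Wtc); last first.
  apply/eqP => e; have := wo l Jl; rewrite -e (C1_off Cg) // eqxx.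
  case: eqP => // el _; move: e; rewrite lat_mapD lat_mapN -(r_tau ci) lat_map_alpha el.
  rewrite -[X in X = _]addr0 => /addrI /eqP; rewrite eq_sym oppr_eq0 wtw_map_tau.
  by apply/negP/wtw_neq0; case: (u) un.
rewrite scale0r add0r (phi_W q0 Delta_spec phi_spec (W_1 D q) Wtc); last first.
  by rewrite eq_sym; apply: (wt_off_neq0 Jtj wo).
rewrite scale0r add0r; apply: (rest_sum0 G) => -[c' u'] Wc' Ju' un' /=.
rewrite (phi_W q0 Delta_spec phi_spec (W_bw D q u') Wtc) ?scale0r // eq_sym.
exact: (wt_off_neq Jtj wo).
Qed.

(** Coassociativity provides one leg of g_j for g_l and two for the rest. By [rho_rest] only
    $h\otimes g_j$ and $g_j\otimes 1$ contribute: the first lets g_l pass, the second pairs it with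
    tau g_j. *)
Lemma crossed_g l b beta : ~~ J l -> is_bilinear beta -> isf b ->
  crossed (g l * b) beta = crossed b (fun x y => beta x (g l * y)) +
    beta 1 (phi (tauB (g j)) (g l) *: (hm (r (alpha l)) * b)).
Proof.
move=> Jl bb fb; have [n Cg] := gC Jj; have [n' Cl] := gC Jl.
have [s [G Z]] := C1_Zst q0 Delta_spec Cg.
transitivity (cop (g j) (fun x y => cop y (fun y1 y2 =>
    beta y2 (rho (tauB x) (g l) * rho (tauB y1) b)))).
  rewrite -(copA Delta_spec (g j) (g := fun x y z => beta z (rho (tauB x) (g l) * rho (tauB y) b)));
    last by lint.
  apply: eq_cop => x y; rewrite (rho_M Delta_spec phi_spec) (lin_cop (bil_r y bb)).
  by rewrite cop_tauB //; lint.
rewrite Z; last by lint.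
rewrite (rest_sum0 G) ?addr0 => [|[c u] Wc Ju un /=]; last first.
  rewrite (rho_rest Jl Wc Ju un).
  by rewrite /cop big1 // => p _; rewrite mul0r (lin0 (bil_r _ bb)).
congr (_ + _).
  apply: eq_cop => x y; rewrite tauB_hm (rho_hm_isf q0 Delta_spec phi_spec) //.
  exact: C1_isf Cl.
rewrite (cop1 Delta_spec); last by lint.
rewrite (ahom1 (tauBH D q)) (rho1 Delta_spec phi_spec).
by rewrite (C1_rho_C1 q0 Delta_spec phi_spec (C1_tau Cg) Cl) scalerAl.
Qed.

Lemma chi_kk k : J k -> chi (alpha k) (alpha (tau j)) * chi (alpha (kk k)) mj = 1.
Proof.
move=> Jk; have Jkk : J (kk k) by rewrite inJ_tau tl_J.
rewrite /chi -(rf_rC ci) (r_loc ci Jkk) tl_tau ?tl_J // (tlK ci Jk).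
rewrite -{1}(tauK D k) -!lat_map_alpha rf_tau rfNl qE // mulrN addrN.
by rewrite expr0z.
Qed.

(** Let theta be the letter of index tau tau_i k. It q-commutes with g_j ([g_th]), so the coproducts
    of g_j theta and theta g_j agree up to a scalar. Expanding both trades the skew derivative on b
    for letters in the other leg. *)
Lemma crossed_ad k b beta : J k -> is_bilinear beta -> isf b ->
  crossed ((v_ k)^-1 *: (hm (- alpha (tl k)) * rho (th (tl k)) b)) beta =
  (v_ k)^-1 *: (
    crossed b (fun x y => beta x (hm (- alpha (tl k)) * rho (th (tl k)) y)) +
    crossed b (fun x y => beta (th (kk k) * x) (hm (- alpha (tl k)) * rho (hm (alpha (tl k))) y))
    - chi (alpha k) (alpha (tau j)) *:
      crossed b (fun x y => beta (x * th (kk k)) (hm (- alpha (tl k)) * y))).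
Proof.
move=> Jk bb fb; have [n Cg] := gC Jj; have tH := tauBH D q.
rewrite -[X in crossed X](addr0) crossed_lin // crossed0 // addr0; congr (_ *: _).
set nu := - alpha (tl k).
have Jkk : J (kk k) by rewrite inJ_tau tl_J.
pose c := chi (alpha (kk k)) mj.
have c0 : c != 0 by apply: chi_neq0.
have cE : chi (alpha k) (alpha (tau j)) = c^-1.
  by apply: (mulIf c0); rewrite mulVf // chi_kk.
rewrite cE.
pose b' := fun x y => beta x (hm nu * y).
have bb' : is_bilinear b' by rewrite /b'; lint.
pose z := rho (th (tl k)) b.
have step1 : crossed (hm nu * z) beta = c^-1 *: crossed z b'.
  rewrite /crossed -copZ.
  transitivity (cop (lam (hm (ltau nu)) (g j)) (fun x y => b' y (rho (tauB x) z))).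
    rewrite cop_lam; last exact: bil_crossed.
    by apply: eq_cop => x y; rewrite rho_hm_mul lam_hm_tau // lat_mapK.
  rewrite (lam_hm_isf q0 Delta_spec phi_spec _ (C1_isf Cg)) (W_conj q0 _ (C1_W Cg)).
  have bc := bil_crossed z bb'.
  rewrite (linZ (cop_lin Delta_spec bc)) copZ; congr (_ *: _).
  by rewrite /nu lat_mapN lat_map_alpha chiNl.
have step2 : crossed z b' =
    c *: (crossed b (fun x y => beta x (hm nu * rho (th (tl k)) y)) +
      crossed b (fun x y => beta (th (kk k) * x) (hm nu * rho (hm (alpha (tl k))) y))) -
    crossed b (fun x y => beta (x * th (kk k)) (hm nu * y)).
  have bc := bil_crossed b bb'.
  have e1 : cop (g j * th (kk k)) (fun x y => b' y (rho (tauB x) b)) =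
      crossed z b' + crossed b (fun x y => beta (x * th (kk k)) (hm nu * y)).
    rewrite (copM Delta_spec) // -copD; apply: eq_cop => x y.
    rewrite (cop_theta Delta_spec); last by lint.
    rewrite -> !(ahomM tH), -> tauB_theta;
  rewrite tauB_h tauK;
  rewrite -> mulr1, -> !(rho_mul Delta_spec phi_spec).
    by rewrite -(hm_alpha _ _ (tl k)) (rho_hm_isf q0 Delta_spec phi_spec _ fb).
  have e2 : cop (th (kk k) * g j) (fun x y => b' y (rho (tauB x) b)) =
      crossed b (fun x y => beta x (hm nu * rho (th (tl k)) y)) +
      crossed b (fun x y => beta (th (kk k) * x) (hm nu * rho (hm (alpha (tl k))) y)).
    rewrite (copM Delta_spec) // (cop_theta Delta_spec); last by lint.
    congr (_ + _); apply: eq_cop => x y.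
      by rewrite (ahomM tH) tauB_theta tauK mul1r (rho_mul Delta_spec phi_spec).
    by rewrite (ahomM tH) tauB_h tauK (rho_mul Delta_spec phi_spec) -hm_alpha.
  move: e1; rewrite (g_th q0 qn T_spec Delta_spec phi_spec ci gT Jj Jkk).
  by rewrite (linZ (cop_lin Delta_spec bc)) e2 => ->; rewrite addrK.
by rewrite step1 step2 scalerBr scalerA mulVf // scale1r.
Qed.

Hypothesis gphi : forall l, ~~ J l -> phi (tauB (g l)) (g (tau l)) = w_ l.

(** [crossed] and [cor] satisfy the same recursion along the rules of [adapted]. New terms arise
    only from a letter l = tau j, and there they agree because the pairing equals v_l - v_l^-1. *)
Lemma adapted_cor n mu a a' : adapted n mu a a' ->
  exists L, cor n mu (rho (th (tau j)) a) L /\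
    forall beta, is_bilinear beta -> crossed a' beta = beta (g j) a' + L beta.
Proof.
have Jtj : ~~ J (tau j) by rewrite inJ_tau.
elim=> {n mu a a'} [n mu||n mu s x x' y y' _ [L [CL HL]] _ [M [CM HM]]|
  n mu l x x' Jl Ax [L [CL HL]]|n mu k x x' Jk Ax [L [CL HL]]].
- exists (fun _ => 0); split; first by rewrite (lin0 (rhoL _)); apply: cor_0.
  by move=> beta bb; rewrite crossed0 // (lin0 (bil_r _ bb)) addr0.
- exists (fun _ => 0); split; first by rewrite rho_th1 //; apply: cor_0.
  by move=> beta bb; rewrite crossed1 // addr0.
- exists (fun beta => s *: L beta + M beta); split; first by rewrite rhoL; apply: cor_lin.
  move=> beta bb; rewrite crossed_lin // HL // HM // scalerDr (bil_r _ bb).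
  by rewrite addrACA.
- have [Wx Wx'] := adapted_W q0 Delta_spec phi_spec ci gC Ax.
  have [fx fx'] := adapted_isf q0 Delta_spec phi_spec ci gC Ax.
  have Cth := cor_th Jl CL.
  rewrite (rho_th_thM q0 Delta_spec phi_spec).
  have [e|ne] := eqVneq (tau j) l; last first.
    eexists; split; first by rewrite mul0r scale0r add0r; exact: Cth.
    move=> beta bb; rewrite crossed_g // HL; last by lint.
    have [n1 C1j] := gC Jj; have [n2 C1l] := gC Jl.
    rewrite (phi_W q0 Delta_spec phi_spec (W_tau (C1_W C1j)) (C1_W C1l)).
      by rewrite scale0r (lin0 (bil_r _ bb)) addr0.
    rewrite -(r_tau ci) lat_map_alpha; apply: contra_neq ne => /(can_inj (rK ci)).
    exact: alpha_inj.
  have G0 := cor_gen j Ax (fJ_1 D q i) (n := n.+1).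
  rewrite addn0 in G0; have {}G0 := G0 (ltnSn n).
  rewrite addr0 mulr1 in G0; subst l.
  have GL := cor_lin (w_ (tau j) * chi (alpha (tau j)) mu) G0 Cth.
  eexists; split.
    apply: (cor_eq GL) => //; congr (_ + _).
    rewrite -(hm_alpha _ _ (tau j)) (W_comm q0 _ Wx) scalerA.
    by rewrite mulr1n mul1r.
  move=> beta bb; rewrite crossed_g // HL; last by lint.
  rewrite /= -addrA; congr (_ + _); rewrite addrC; congr (_ + _).
  rewrite gphi // (W_comm q0 _ Wx') scalerA (linZ (bil_r _ bb)) scalerA.
  have -> : chi (r (alpha (tau j))) (r mu) = chi (alpha (tau j)) mu by rewrite /chi rf_r.
  by rewrite addr0 /corc /Qf chi0r // invr1 mul1r rf0l oppr0 expr0z mulr1 /vi symz_tau.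
- have [fx fx'] := adapted_isf q0 Delta_spec phi_spec ci gC Ax.
  have [Wx Wx'] := adapted_W q0 Delta_spec phi_spec ci gC Ax.
  have Cad := cor_ad q0 Delta_spec phi_spec ci gC Jk CL.
  eexists; split.
    apply: (cor_eq Cad) => //.
    rewrite (linB (rhoL _)) (linZ (rhoL _)) (rho_th_thM q0 Delta_spec phi_spec).
    rewrite (rho_theta Delta_spec phi_spec) (rho_theta_th Delta_spec phi_spec).
    have -> : (tau j == k) = false by apply: contraNF Jtj => /eqP ->.
    rewrite mulr0n mul0r !scale0r; rewrite -> mulr0; by rewrite add0r addr0.
  move=> beta bb; rewrite crossed_ad // !HL; try by lint.
  rewrite /= (rho_hm_isf q0 Delta_spec phi_spec _ fx') (linZ (bil_r _ bb)).
  have Jkk : J (kk k) by rewrite inJ_tau tl_J.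
  have e : chi (alpha k) (alpha (tau j)) *:
      beta (g j * th (kk k)) (hm (- alpha (tl k)) * x') =
      beta (th (kk k) * g j) (hm (- alpha (tl k)) * x').
    rewrite (g_th q0 qn T_spec Delta_spec phi_spec ci gT Jj Jkk) (linZ (bil_l _ bb)).
    by rewrite scalerA chi_kk // scale1r.
  rewrite [chi _ _ *: (_ + _)]scalerDr e; move: (beta _ _) (beta _ _) (L _) (L _) (L _) => b1 b2 l1 l2 l3.
  rewrite -scalerDr; congr (_ *: _); rewrite opprD !addrA.
  by rewrite [LHS](ACl (1*2*4*6*3*5)) /= addrK.
Qed.
End OneGenerator.
End Claim.

(** * The transport formula *)

Lemma lamT_id (F : fieldType) (A : algType F) (v c : F) (K f x : A) :
  K * x = c *: (x * K) -> K * f = (v ^+ 2)^-1 *: (f * K) ->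
  v^-1 *: (c *: (x * (v^-1 *: (f * K))) - v^-1 *: (f * K) * x) =
  K * (x * f) - K * (f * x).
Proof.
move=> Kx Kf; rewrite !mulrA Kx Kf -!scalerAl -[x * K * f]mulrA Kf -!scalerAr.
by rewrite scalerBr !scalerA !mulrA; congr (_ *: _ - _ *: _); rewrite expr2 invfM //; ring.
Qed.

Lemma step_id (F : fieldType) (A : algType F)
    (Q v c1 e1 e2 d1 v1 x c d2 Q2 Q' : F) (u a T H L : A) :
  v * c1 = d1 * v1 * x -> Q * v = c * d2 * Q2 -> Q * d1 * e1 * v1 = Q' ->
  Q *: (v *: (c1 *: (e1 *: (u * a * T * H)) + e2 *: L)) -
  d1 *: (Q *: (e1 *: (u * (v1 *: (x *: (a * T) - T * a)) * H))) -
  c *: (d2 *: (Q2 *: (e2 *: L))) = Q' *: (u * T * a * H).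
Proof.
move=> s1 s2 s3.
rewrite -scalerAr mulrBr -scalerAr -!scalerAl mulrBl -scalerAl !mulrA.
rewrite !scalerBr !scalerDr !scalerA -s3.
have -> : Q * v * c1 * e1 = d1 * Q * e1 * v1 * x by rewrite -[Q * v * c1]mulrA s1; ring.
have -> : c * d2 * Q2 * e2 = Q * v * e2 by rewrite s2.
by rewrite opprB !addrA [LHS](ACl ((1*4)*(2*5)*3)) /= !subrr !add0r; congr (_ *: _); ring.
Qed.

Section TransportFormula.
Variables (I : finType) (D : satake I) (F : fieldType) (q : F).
Hypotheses (q0 : q != 0) (qn : forall n, (0 < n)%N -> q ^+ n != 1).
Local Notation B := (B_alg D q).
Local Notation U := (U_alg D q).
Local Notation E := (UE D q).
Local Notation Fg := (UF D q).
Local Notation K'm := (UK'_mon D q).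
Local Notation th := (Btheta D q).
Local Notation h := (Bh D q).
Local Notation hm := (Bh_mon D q).
Local Notation chi := (@chi I D F q).
Local Notation tau := (tau D).
Local Notation ltau := (lat_map tau).
Local Notation W := (@W I D F q).
Local Notation isf := (@isf I D F q).
Local Notation bplus := (@bplus I D F q).
Local Notation v_ := (vi D q).
Local Notation w_ i := (v_ i - (v_ i)^-1).
Variables (T : I -> {lrmorphism U -> U}).
Hypotheses (T_spec : is_lusztig T).
Variables (Delta : B -> seq (B * B)) (phi : B -> B -> F).
Hypotheses (Delta_spec : is_coproduct Delta) (phi_spec : is_hopf_pairing Delta phi).
Variable i : I.
Local Notation J := (inJ D i).
Local Notation C1 := (@C1 I D F q i).
Local Notation rw := (r_word D i).
Local Notation r := (refl_word D rw).
Local Notation tl := (tau_loc D i).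
Hypothesis ci : cartan D i (tau i) \in [:: 2; 0; -1].
Local Notation rho := (rho Delta phi).
Local Notation lam := (lam Delta phi).
Variable g : I -> B.
Hypotheses (gC : forall l, ~~ J l -> exists n, C1 n l (r (alpha l)) (g l))
  (gT : forall l, ~~ J l -> T_word T rw (bplus (g l)) = E l).

Let rhoL a : lin (rho a) := rho_lin Delta_spec phi_spec a.
Let lamL a : lin (lam a) := lam_lin Delta_spec phi_spec a.
Let TH : ahom (T_word T rw) := T_word_ahom T rw.
Let bH := bplusH D q.

Local Notation adapted := (adapted Delta phi i g).
Local Notation fJ := (@fJ I D F q i).
Local Notation kk k := (tau (tl k)).
Local Notation cop := (cop Delta).
Local Notation star := (istar Delta phi).
Local Notation Qf := (@Qf I D F q).
Hypothesis gphi : forall l, ~~ J l -> phi (tauB (g l)) (g (tau l)) = w_ l.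
Hypothesis starA : associative star.
Variable t : B -> B.
Hypotheses (tL : lin t) (tS : forall x y, t (star x y) = star (t x) (t y))
  (t_hm : forall mu, t (hm mu) = hm (r mu)) (t_l : forall l, ~~ J l -> t (th l) = g l)
  (t_J : forall k, J k -> t (th k) = (v_ k)^-1 *: (th (kk k) * hm (- alpha (tl k)))).

(** The preimage under T_r of the skew derivative of x: by [FB] that derivative is a commutator with
    F_k up to K'_k, and T_r^-1 turns F_k into E_(tau_i k) up to a Cartan factor. *)
Definition lamT k mu (x' : B) : B :=
  (v_ k)^-1 *: (chi (- alpha (tl k)) (r mu) *: (x' * th (tl k)) - th (tl k) * x').

Lemma T_lamT n mu x x' k : adapted n mu x x' -> J k ->
  T_word T rw (bplus (lamT k mu x')) = bplus (lam (th k) x).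
Proof.
move=> Ax Jk; have Jtk := tl_J ci Jk.
have [fx fx'] := adapted_isf q0 Delta_spec phi_spec ci gC Ax.
have [Wx Wx'] := adapted_W q0 Delta_spec phi_spec ci gC Ax.
have Tx := adapted_T q0 qn T_spec Delta_spec phi_spec ci gC gT Ax.
have := FB q0 Delta_spec phi_spec k fx.
rewrite (adapted_rho0 q0 Delta_spec phi_spec ci gC Ax Jk) (ahom0 bH) addr0 => e.
have {}e : bplus (lam (th k) x) = K'm (- alpha k) * (bplus x * Fg k - Fg k * bplus x).
  by rewrite e opprB addrC subrK mulrA -K'm_alpha K'mNl mul1r.
have eE : T_word T rw (E (tl k)) = (v_ k)^-1 *: (Fg k * K'm (- alpha k)).
  have := T_r_F q0 qn T_spec Delta_spec phi_spec ci Jk => /(congr1 (@omega _ D _ q)).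
  rewrite /T_r -(T_word_omega q0 T_spec) omega_F (linZ (ahomL (omegaH D q))).
  by rewrite (ahomM (omegaH D q)) omega_E omega_KV K'm_alphaN.
have Kx : K'm (- alpha k) * bplus x = chi (alpha k) mu *: (bplus x * K'm (- alpha k)).
  by rewrite (K'm_bplus q0 _ Wx) chiNl // invrK.
rewrite /lamT (ahomZ bH) (ahomB bH) (ahomZ bH) !(ahomM bH) (ahomZ TH) (ahomB TH).
rewrite (ahomZ TH) !(ahomM TH) Tx bplus_theta eE e mulrBr.
have -> : chi (- alpha (tl k)) (r mu) = chi (alpha k) mu.
  by rewrite -(r_loc ci Jk) /chi rf_r.
apply: lamT_id => //; have := K'm_F D q0 (- alpha k) k.
by rewrite chiNl // chi_alpha2.
Qed.
Lemma adapted_lamT n mu x x' k : adapted n mu x x' -> J k ->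
  if n is n'.+1 then adapted n' (mu - alpha k) (lam (th k) x) (lamT k mu x')
  else lam (th k) x = 0 /\ lamT k mu x' = 0.
Proof.
move=> Ax Jk; have := adapted_lam q0 Delta_spec phi_spec ci gC Ax Jk.
have e := T_lamT Ax Jk; have inj := T_r_injective q0 T_spec Delta_spec phi_spec (i := i).
case: n Ax => [|n] Ax.
  move=> l0; split=> //; apply: inj; rewrite /= e l0 !(ahom0 bH) (ahom0 TH) //.
move=> [y' Ay]; rewrite (_ : lamT k mu x' = y') //; apply: inj; rewrite /= e.
by rewrite (adapted_T q0 qn T_spec Delta_spec phi_spec ci gC gT Ay).
Qed.

Lemma star_linl z : lin (fun y => star y z).
Proof.
have : lin (fun y => cop y (fun a1 a2 => cop z (fun b1 b2 => phi (tauB b2) a1 *: (a2 * b1)))) by lint.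
exact.
Qed.
Lemma star_linr z : lin (star z).
Proof.
have : lin (fun y => cop z (fun a1 a2 => cop y (fun b1 b2 => phi (tauB b2) a1 *: (a2 * b1)))) by lint.
exact.
Qed.
Lemma star_h x w ga nu : isf x -> W w x ->
  star (x * hm ga) (hm nu) = chi (ltau nu) (w + ga) *: (x * hm (ga + nu)).
Proof.
move=> fx Wx; rewrite (star_hr Delta_spec phi_spec) (lam_hmM Delta_spec phi_spec).
rewrite (lam_hm_isf q0 Delta_spec phi_spec _ fx) (W_conj q0 _ Wx).
rewrite (lam_hm_hm q0 Delta_spec phi_spec) -scalerAr -!scalerAl scalerA.
by rewrite [_ * chi _ w]mulrC -chiDr // -mulrA hmD.
Qed.
Lemma t_mulh x w nu : isf x -> W w x ->
  t (x * hm nu) = (chi (ltau nu) w)^-1 *: star (t x) (hm (r nu)).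
Proof.
move=> fx Wx; rewrite -t_hm -tS (star_hr Delta_spec phi_spec).
rewrite (lam_hm_isf q0 Delta_spec phi_spec _ fx) (W_conj q0 _ Wx) -scalerAl.
by rewrite (linZ tL) scalerA mulVf ?chi_neq0 // scale1r.
Qed.

(** The bound concerns the total degree of a and u, since the corrections met for a alone are again
    products of both kinds. *)
Definition transported N := forall n m mu nu a a' u u',
  adapted n mu a a' -> fJ m nu u u' -> (n + m < N)%N ->
  t (a * u) = Qf nu *: (u' * a' * hm (r nu)).

Lemma t_thJ k : J k -> t (th k) = v_ k *: star (th (kk k)) (hm (- alpha (tl k))).
Proof.
move=> Jk; rewrite t_J // (star_hr Delta_spec phi_spec) (lam_hm_th q0 Delta_spec phi_spec).
rewrite -scalerAl scalerA; congr (_ *: _).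
rewrite lat_mapN lat_map_alpha chiNl // chi_alpha2 /vi symz_tau.
have -> : symz D (tl k) = symz D k by rewrite (tlE ci Jk); case: ifP => _; rewrite ?symz_tau.
by field; exact: vi_neq0.
Qed.

Lemma star_istar (x y : B) : star x y = cop x (fun a b => b * rho (tauB a) y).
Proof.
rewrite starE; apply: eq_cop => a b; rewrite /rho copMl; apply: eq_cop => y1 y2.
by rewrite (phi_tauC q0 Delta_spec phi_spec) scalerAr.
Qed.

(** Here the constant [corc] is accounted for: it gathers the scalars met when h_(tau j) is split
    off, transported, and merged with the Cartan factor of the transported product. *)
Lemma transport_cor N n mu x L j : ~~ J j -> transported N -> (n <= N)%N ->
  cor Delta phi i g j n mu x L -> t x = L (fun a b => a * b).
Proof.
move=> Jj S nN C; elim: C nN => {n mu x L} [n mu|n mu s x y L M _ IHx _ IHy|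
  n n1 n2 mu1 mu2 a a' u u' Aa Fu le|n mu x L M _ IH LM] nN.
- exact: lin0.
- by rewrite tL IHx // IHy.
- have [Wa Wa'] := adapted_W q0 Delta_spec phi_spec ci gC Aa.
  have [fa fa'] := adapted_isf q0 Delta_spec phi_spec ci gC Aa.
  have [Wu Wu'] := fJ_W ci Fu; have [fu fu'] := fJ_isf Fu.
  rewrite (t_mulh (w := mu1 + mu2)); [|exact: isfM|exact: W_mul].
  rewrite (S _ _ _ _ _ _ _ _ Aa Fu (leq_trans le nN)).
  rewrite (linZ (star_linl _)) (star_h (w := - ltau (r mu2) + r mu1)); [|exact: isfM|exact: W_mul].
  rewrite !scalerA mulrA [alpha _ + mu2]addrC rD; congr (_ *: _).
  rewrite lat_map_alpha tauK -(r_tau ci) lat_map_alpha tauK.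
  rewrite -(r_tau ci mu2) -rN -!rD.
  rewrite /corc /Qf /chi rf_r !invr_expz !qE //; congr (q ^ _).
  rewrite !rfE -lat_map_alpha rf_tauC; ring.
- by rewrite -LM ?IH //; lint.
Qed.

(** The last letter is split off by an iHopf product on the right, with one correction removing a
    letter from a and one removing a letter from u. After transport the first turns a' theta into
    theta a', and the second cancels the skew derivative of u'. *)
Lemma transport_step N n m mu nu a a' u u' k : transported N ->
  adapted n mu a a' -> fJ m nu u u' -> J k -> (n + m < N)%N ->
  t (a * (u * th k)) =
  Qf (nu + alpha k) *: (u' * th (kk k) * a' * hm (r (nu + alpha k))).
Proof.
move=> S Aa Fu Jk le.
have [Wa Wa'] := adapted_W q0 Delta_spec phi_spec ci gC Aa.
have [fa fa'] := adapted_isf q0 Delta_spec phi_spec ci gC Aa.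
have [Wu Wu'] := fJ_W ci Fu; have [fu fu'] := fJ_isf Fu.
have Jt : J (tau k) by rewrite inJ_tau.
pose ka := tau k; pose k' := tl k.
have kaE : tl ka = kk k by rewrite /ka tl_tau.
have la := adapted_lamT Aa Jt; have lu := fJ_lam q0 Delta_spec phi_spec ci Jt Fu.
have kkE : kk ka = k' by rewrite kaE tauK.
rewrite -/ka in la; rewrite -/ka kkE in lu.
set b' := lamT ka mu a' in la.
have t1 : t (lam (th ka) a * u) = Qf nu *: (u' * b' * hm (r nu)).
  case: n Aa la le => [_ [-> ->] _|n' Aa la le]; first by rewrite mul0r mulr0 mul0r scaler0 (lin0 tL).
  apply: (S _ _ _ _ _ _ _ _ la Fu); exact: (leq_ltn_trans _ le).
have t2 : t (a * lam (th ka) u) =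
    Qf (nu - alpha ka) *: (lam (th k') u' * a' * hm (r (nu - alpha ka))).
  case: m Fu lu le => [_ [-> ->] _|m' Fu lu le].
    by rewrite mulr0 !mul0r scaler0 (lin0 tL).
  apply: (S _ _ _ _ _ _ _ _ Aa lu); apply: leq_ltn_trans le.
  by rewrite leq_add2l.
have eX : a * (u * th k) = star (a * u) (th k) - (lam (th ka) a * u) * hm (alpha k)
    - chi (alpha ka) mu *: ((a * lam (th ka) u) * hm (alpha k)).
  rewrite (star_thr Delta_spec phi_spec) -/ka (lam_theta Delta_spec phi_spec).
  rewrite -(hm_alpha _ _ ka) (lam_hm_isf q0 Delta_spec phi_spec _ fa) (W_conj q0 _ Wa).
  rewrite -scalerAl mulrDl -scalerAl hm_alpha mulrA -addrA -opprD addrK //.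
rewrite eX !(linB tL) (linZ tL) tS t_thJ // (S _ _ _ _ _ _ _ _ Aa Fu le).
rewrite (linZ (star_linl _)) (linZ (star_linr _)) starA (star_thr Delta_spec phi_spec) tauK -/k'.
pose c1 := chi (r nu) (alpha (kk k)).
have eb : u' * a' * hm (r nu) * th (kk k) + lam (th k') (u' * a' * hm (r nu)) * h (kk k) =
    c1 *: (u' * a' * th (kk k) * hm (r nu)) + lam (th k') u' * a' * hm (r nu + alpha (kk k)).
  congr (_ + _); first by rewrite -mulrA hm_theta // -scalerAr !mulrA.
  rewrite -mulrA (lam_theta Delta_spec phi_spec) [lam (th k') (a' * _)](lam_theta Delta_spec phi_spec).
  rewrite (adapted_lam0 q0 Delta_spec phi_spec gC Aa (tl_J ci Jk)) mul0r add0r.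
  rewrite -> (lam_theta_hm q0 Delta_spec phi_spec), -> !mulr0; rewrite addr0 hmD -hm_alpha.
  by rewrite !mulrA.
have [Wb' fb'] : W (r mu + alpha (kk k)) b' /\ isf b'.
  rewrite /b' /lamT kaE; split.
    apply/W_scale/W_add; first exact/W_scale/W_mul/W_theta.
    rewrite -scaleN1r addrC; apply/W_scale/W_mul => //; exact: W_theta.
  by apply/isfZ/isfB; first apply/isfZ; apply: isfM => //; apply: isf_th.
have Wl := W_lam q0 Delta_spec phi_spec k' Wu'.
have fl := isf_lam q0 Delta_spec phi_spec k' fu'.
have wk : r (alpha k) = - alpha k' by apply: r_loc.
rewrite eb (linD (star_linl _)) (linZ (star_linl _)).
rewrite (star_h (w := - ltau (r nu) + r mu + alpha (kk k))); first last.
- exact/W_mul/W_theta/W_mul.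
- by apply: isfM; [apply: isfM|apply: isf_th].
rewrite (star_h (w := - ltau (r nu) - alpha k' + r mu)); first last.
- exact: W_mul.
- exact: isfM.
rewrite (t_mulh (w := mu - alpha ka + nu)); first last.
- by apply: W_mul => //; apply: (W_lam q0 Delta_spec phi_spec).
- by apply: isfM => //; apply: (isf_lam q0 Delta_spec phi_spec).
rewrite (t_mulh (w := mu + (nu - alpha ka))); first last.
- by apply: W_mul => //; apply: (W_lam q0 Delta_spec phi_spec).
- by apply: isfM => //; apply: (isf_lam q0 Delta_spec phi_spec).
rewrite t1 t2 wk !(linZ (star_linl _)).
rewrite (star_h (w := - ltau (r nu) + (r mu + alpha (kk k)))); first last.
- exact: W_mul.
- exact: isfM.
rewrite (star_h (w := - ltau (r nu) - alpha k' + r mu)); first last.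
- exact: W_mul.
- exact: isfM.
rewrite !lat_mapN !lat_map_alpha.
have r_ka : r (alpha ka) = - alpha (kk k) by rewrite -kaE; apply: r_loc.
rewrite /b' /lamT kaE !rD !rN r_ka wk !opprK.
have chi_r x : chi (- alpha (kk k)) (r x) = chi (alpha ka) x.
  by rewrite -r_ka /chi rf_r.
have vk : v_ ka = v_ k by rewrite /vi symz_tau.
have chi_nu : chi (alpha ka) (ltau nu) = chi (alpha k) nu.
  by rewrite /chi -lat_map_alpha rf_tau.
have Q2 : Qf nu = Qf (nu - alpha ka) * (chi (alpha ka) (nu - alpha ka))^-1 * (v_ k)^-1.
  by rewrite -vk -(Qf_step D q0) subrK.
have -> : - ltau (r nu) + (r mu + alpha (kk k)) + r nu =
          - ltau (r nu) + r mu + alpha (kk k) + r nu by rewrite !addrA.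
have e1 : chi (- alpha (kk k)) (- ltau (r nu) + r mu + alpha (kk k) + r nu) =
    (chi (alpha k) nu)^-1 * chi (alpha ka) mu * (v_ k ^+ 2)^-1 * chi (alpha ka) nu.
  have -> : - ltau (r nu) + r mu + alpha (kk k) + r nu = r (- ltau nu + mu - alpha ka + nu).
    by rewrite !rD !rN r_ka (r_tau ci) opprK.
  by rewrite chi_r !chiDr // !chiNr // chi_nu chi_alpha2 vk.
have v0 := vi_neq0 D q0 k.
(* The three scalar identities concern the terms u' a' theta, which cancel, the terms with the skew
   derivative of u', which cancel, and the surviving u' theta a'. *)
apply: step_id.
- have -> : c1 = (chi (alpha ka) nu)^-1.
    by rewrite /c1 chiC -chi_r chiNl // invrK.
  rewrite chi_r !chiDr // chiNr // chi_alpha2 vk.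
  by field; rewrite !chi_neq0 // v0.
- rewrite Q2 !chiDr // chiNr // chi_alpha2 vk.
  by field; rewrite !chi_neq0 // v0.
- rewrite e1 (Qf_step D q0) !chiDr // chiNr // chi_alpha2 vk.
  by field; rewrite !chi_neq0 // v0.
Qed.

Lemma Qf0 : Qf 0 = 1.
Proof. by rewrite /Qf rf0l oppr0 expr0z. Qed.

(** For l outside J the ordinary and the iHopf product differ by a skew derivative before transport
    and by part of [crossed] after it; [adapted_cor] matches them. For a bracket with theta_k, the
    product with theta_k on the right is [transport_step], and the one on the left has no correction
    because [rho] kills b. *)
Lemma transport_base N n mu a a' : transported N -> adapted n mu a a' -> (n <= N)%N -> t a = a'.
Proof.
move=> S; elim=> {n mu a a'} [n mu||n mu s x x' y y' _ IHx _ IHy|n mu l b b' Jl Ab _|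
  n mu k b b' Jk Ab _] nN.
- exact: lin0.
- by rewrite -(hm0 D q) t_hm r0.
- by rewrite tL IHx // IHy.
- have [fb fb'] := adapted_isf q0 Delta_spec phi_spec ci gC Ab.
  have tb : t b = b'.
    have := S _ _ _ _ _ _ _ _ Ab (fJ_1 D q i); rewrite addn0 => /(_ nN).
    by rewrite Qf0 scale1r r0 hm0 mulr1 mul1r mulr1.
  have -> : th l * b = star (th l) b - rho (th (tau l)) b.
    by rewrite (star_thl q0 Delta_spec phi_spec) (rho_hm_isf q0 Delta_spec phi_spec _ fb) addrK.
  have [L [CL HL]] := adapted_cor q0 qn T_spec Delta_spec phi_spec ci gC gT Jl gphi Ab.
  rewrite (linB tL) tS t_l // tb (transport_cor Jl S (ltnW nN) CL) star_istar.
  have bm : is_bilinear (fun x y : B => x * y) by lint.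
  have := HL _ bm; rewrite /crossed => ->; rewrite addrK.
  by [].
- have [fb fb'] := adapted_isf q0 Delta_spec phi_spec ci gC Ab.
  have [Wb Wb'] := adapted_W q0 Delta_spec phi_spec ci gC Ab.
  have tb : t b = b'.
    have := S _ _ _ _ _ _ _ _ Ab (fJ_1 D q i); rewrite addn0 => /(_ nN).
    by rewrite Qf0 scale1r r0 hm0 mulr1 mul1r mulr1.
  have Jt : J (tau k) by rewrite inJ_tau.
  have v0 := vi_neq0 D q0 k.
  have tbk : t (b * th k) = chi (alpha k) 0 *: ((v_ k)^-1 *: (th (kk k) * b' * hm (- alpha (tl k)))).
    have nN' : (n + 0 < N)%N by rewrite addn0.
    have := transport_step S Ab (fJ_1 D q i) Jk nN'.
    have -> : Qf (0 + alpha k) = (v_ k)^-1 by rewrite (Qf_step D q0) Qf0 chi0r // invr1 !mul1r.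
    by rewrite !mul1r add0r (r_loc ci Jk) chi0r // scale1r.
  have vk' : v_ (tl k) = v_ k.
    by rewrite /vi (tlE ci Jk); case: ifP => _; rewrite ?symz_tau.
  have tkb : t (th k * b) = (v_ k)^-1 *: (th (kk k) * (hm (- alpha (tl k)) * b') +
      hm (- alpha (tl k)) * rho (th (tl k)) b').
    have -> : th k * b = star (th k) b.
      rewrite (star_thl q0 Delta_spec phi_spec) (rho_hm_isf q0 Delta_spec phi_spec _ fb).
      by rewrite (adapted_rho0 q0 Delta_spec phi_spec ci gC Ab Jt) addr0.
    rewrite tS t_thJ // tb (linZ (star_linl _)) -starA (star_hl q0 Delta_spec phi_spec).
    rewrite (rho_hm_isf q0 Delta_spec phi_spec _ fb') (star_thl q0 Delta_spec phi_spec) tauK.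
    rewrite (rho_hm_hmM q0 Delta_spec phi_spec) (rho_th_hmM q0 Delta_spec phi_spec).
    rewrite (rho_hm_isf q0 Delta_spec phi_spec _ fb') chiNr // chi_alpha2 vk'.
    rewrite -scalerAr -scalerDr scalerA; congr (_ *: _).
    by field.
  rewrite (linB tL) (linZ tL) tbk tkb chi0r // scale1r.
  rewrite (W_comm q0 _ Wb') -scalerAr scalerDr !mulrA.
  have -> : chi (- alpha (tl k)) (r mu) = chi (alpha k) mu.
    by rewrite -(r_loc ci Jk) /chi rf_r.
  rewrite !scalerA [_ / _]mulrC addrC addrA [X in X + _](_ : _ = 0) ?add0r //.
  by rewrite addrC subrr.
Qed.

Lemma transport_formula n m mu nu a a' u u' : adapted n mu a a' -> fJ m nu u u' ->
  t (a * u) = Qf nu *: (u' * a' * hm (r nu)).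
Proof.
have S N : transported N.
  elim: N => [//|N S] n1 m1 mu1 nu1 b b' w w' Ab Fw; rewrite ltnS.
  elim: Fw => {m1 nu1 w w'} [m1 nu1||m1 nu1 s w w' x x' _ IHw _ IHx|m1 nu1 k w w' Jk Fw _] le.
  - by rewrite mulr0 !mul0r scaler0 (lin0 tL).
  - rewrite mulr1 mul1r Qf0 scale1r r0 hm0 mulr1.
    by apply: (transport_base S Ab); rewrite addn0 in le.
  - by rewrite mulrDr -scalerAr tL IHw // IHx // !mulrDl -!scalerAl scalerDr !scalerA [s * _]mulrC.
  - by apply: (transport_step S Ab Fw Jk); rewrite addnS in le.
by move=> Aa Fu; exact: (S _ _ _ _ _ _ _ _ _ Aa Fu (ltnSn _)).
Qed.
End TransportFormula.

(** * The sigma-bracket subalgebra *)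

Section SigmaBracket.
Variables (I : finType) (D : satake I) (F : fieldType) (q : F).
Hypotheses (q0 : q != 0) (qn : forall n, (0 < n)%N -> q ^+ n != 1).
Local Notation B := (B_alg D q).
Local Notation U := (U_alg D q).
Local Notation E := (UE D q).
Local Notation Fg := (UF D q).
Local Notation Km := (UK_mon D q).
Local Notation th := (Btheta D q).
Local Notation hm := (Bh_mon D q).
Local Notation chi := (@chi I D F q).
Local Notation tau := (tau D).
Local Notation W := (@W I D F q).
Local Notation isf := (@isf I D F q).
Local Notation bplus := (@bplus I D F q).
Local Notation v_ := (vi D q).
Local Notation w_ i := (v_ i - (v_ i)^-1).
Variables (T : I -> {lrmorphism U -> U}).
Hypotheses (T_spec : is_lusztig T).
Variables (Delta : B -> seq (B * B)) (phi : B -> B -> F).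
Hypotheses (Delta_spec : is_coproduct Delta) (phi_spec : is_hopf_pairing Delta phi).
Variable i : I.
Local Notation J := (inJ D i).
Local Notation C1 := (@C1 I D F q i).
Local Notation rw := (r_word D i).
Local Notation r := (refl_word D rw).
Local Notation tl := (tau_loc D i).
Hypothesis ci : cartan D i (tau i) \in [:: 2; 0; -1].
Local Notation rho := (rho Delta phi).
Local Notation lam := (lam Delta phi).
Variable g : I -> B.
Hypotheses (gC : forall l, ~~ J l -> exists n, C1 n l (r (alpha l)) (g l))
  (gT : forall l, ~~ J l -> T_word T rw (bplus (g l)) = E l).

Let rhoL a : lin (rho a) := rho_lin Delta_spec phi_spec a.
Let lamL a : lin (lam a) := lam_lin Delta_spec phi_spec a.
Let TH : ahom (T_word T rw) := T_word_ahom T rw.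
Let bH := bplusH D q.

Local Notation adapted := (adapted Delta phi i g).
Local Notation fJ := (@fJ I D F q i).
Local Notation kk k := (tau (tl k)).
Local Notation bw := (@bw I D F q).

Inductive adapted_span : B -> B -> Prop :=
| adapted_span_0 : adapted_span 0 0
| adapted_span_lin s x x' y y' : adapted_span x x' -> adapted_span y y' ->
    adapted_span (s *: x + y) (s *: x' + y')
| adapted_span_gen n mu x x' : adapted n mu x x' -> adapted_span x x'.

Lemma adapted_span_T x x' : adapted_span x x' -> T_word T rw (bplus x') = bplus x.
Proof.
elim=> {x x'} [|s x x' y y' _ IHx _ IHy|n mu x x' Ax].
- by rewrite (ahom0 bH) (ahom0 TH).
- by rewrite !(ahomL bH) (ahomL TH) IHx IHy.
- exact: adapted_T Ax.
Qed.

(** Written as one sum of adapted pairs, the weight components on both sides are indexed by the same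
    summands, so a projection on one side is carried to the other by injectivity. *)
Lemma adapted_span_W mu x x' : adapted_span x x' -> W mu x <-> W (r mu) x'.
Proof.
(* Each index carries its weight and its proof of being adapted, so that both components can be
   summed over one list. *)
move=> Sx; pose P := {p : lattice I * (B * B) | exists n, adapted n p.1 p.2.1 p.2.2}.
have [s [xE x'E]] : exists s : seq P,
    x = \sum_(p <- s) (sval p).2.1 /\ x' = \sum_(p <- s) (sval p).2.2.
  elim: Sx => {x x'} [|c x x' y y' _ [s [-> ->]] _ [s' [-> ->]]|n nu x x' Ax].
  - by exists [::]; rewrite !big_nil.
  - have Pc (p : P) : exists n, adapted n (sval p).1 (c *: (sval p).2.1 + 0) (c *: (sval p).2.2 + 0).
      by case: p => p [n Ap]; exists n; apply: adapted_lin => //; apply: adapted_z.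
    pose sc (p : P) : P := exist (fun p : lattice I * (B * B) => exists n, adapted n p.1 p.2.1 p.2.2)
      ((sval p).1, (c *: (sval p).2.1 + 0, c *: (sval p).2.2 + 0)) (Pc p).
    exists (map sc s ++ s'); rewrite !big_cat !big_map /= !scaler_sumr.
    by split; congr (_ + _); apply: eq_bigr => p _; rewrite addr0.
  - have Px : exists n, adapted n (nu, (x, x')).1 (nu, (x, x')).2.1 (nu, (x, x')).2.2 by exists n.
    by exists [:: exist _ (nu, (x, x')) Px]; rewrite !big_seq1.
have PW (p : P) : W (sval p).1 (sval p).2.1 /\ W (r (sval p).1) (sval p).2.2.
  by case: p => p [n Ap]; apply: (adapted_W q0 Delta_spec phi_spec ci gC Ap).
have eT (p : P) : T_word T rw (bplus (sval p).2.2) = bplus (sval p).2.1.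
  by case: p => p [n Ap]; apply: adapted_T Ap.
have eS (Q : pred P) : T_word T rw (bplus (\sum_(p <- s | Q p) (sval p).2.2)) =
    bplus (\sum_(p <- s | Q p) (sval p).2.1).
  elim/big_ind2: _ => [|a b c d ab cd|p _]; last exact: eT.
    by rewrite (ahom0 bH) (ahom0 TH).
  by rewrite !(ahomD bH) (ahomD TH) ab cd.
split=> Wx.
  have xP := weight_proj q0 qn Wx (m := fun p : P => (sval p).1) (fun p => proj1 (PW p)) xE.
  have -> : x' = \sum_(p <- s | (sval p).1 == mu) (sval p).2.2.
    apply: (T_r_injective q0 T_spec Delta_spec phi_spec (i := i)); rewrite /= x'E.
    by rewrite (eS xpredT) (eS (fun p => (sval p).1 == mu)) -xP -xE.
  elim/big_ind: _ => [|a b|p /eqP <-]; [exact: W_0|exact: W_add|exact: (PW p).2].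
have xP := weight_proj q0 qn Wx (m := fun p : P => r (sval p).1) (fun p => proj2 (PW p)) x'E.
have -> : x = \sum_(p <- s | r (sval p).1 == r mu) (sval p).2.1.
  apply: (bplus_inj q0 Delta_spec phi_spec).
  by rewrite -(eS (fun p => r (sval p).1 == r mu)) -xP x'E xE (eS xpredT).
elim/big_ind: _ => [|a b|p /eqP e]; [exact: W_0|exact: W_add|].
by rewrite -(can_inj (rK ci) e); exact: (PW p).1.
Qed.

Inductive factored : B -> Prop :=
| factored_0 : factored 0
| factored_lin s x y : factored x -> factored y -> factored (s *: x + y)
| factored_gen n m mu nu a a' u u' : adapted n mu a a' -> fJ m nu u u' -> factored (a * u).

(** A letter of J in front of a u is moved past a: the q-commutator with a stays adapted, and the
    other term attaches the letter to u. *)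
Lemma isf_factored x : isf x -> factored x.
Proof.
elim/isf_ind => {x} [|s x y _ _|l x _]; first by rewrite -[1]mulr1; apply: factored_gen (fJ_1 _ _ _); exact: adapted_1.
  exact: factored_lin.
elim=> {x} [|s x y _ IHx _ IHy|n m mu nu a a' u u' Aa Fu].
- by rewrite mulr0; apply: factored_0.
- by rewrite mulrDr -scalerAr; apply: factored_lin.
have [Jl|Jl] := boolP (J l); last first.
  by rewrite mulrA; apply: factored_gen Fu; apply: adapted_th Aa.
have -> : th l * (a * u) = 1 *: ((th l * a - chi (alpha l) mu *: (a * th l)) * u) +
    (chi (alpha l) mu *: (a * (th l * u)) + 0).
  by rewrite scale1r addr0 mulrBl -scalerAl !mulrA subrK.
apply: factored_lin; first exact: (factored_gen (adapted_ad Jl Aa) Fu).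
apply: factored_lin; last exact: factored_0.
exact: (factored_gen Aa (fJ_l Jl Fu)).
Qed.

Local Notation mn := (minus q0 Delta_spec phi_spec).

(* The second summand is the part of the preimage of [bplus x] which lies in the left
   ideal generated by the [F_k Km nu]; it vanishes when the preimage is in the image of [bplus]. *)
Lemma factored_preimage x : factored x -> exists x0 x0' m,
  [/\ adapted_span x0 x0', T_word T rw (bplus x0' + m) = bplus x & mn m 1 = 0].
Proof.
have mH := minusH q0 Delta_spec phi_spec.
have m0 : mn 0 1 = 0 by rewrite (ahom0 mH).
have mL : lin (fun m => mn m 1) by move=> c y z; rewrite (ahomL mH).
elim=> {x} [|s x y _ [x0 [x0' [m [Sx Tx mx]]]] _ [y0 [y0' [m' [Sy Ty my]]]]|n m mu nu a a' u u' Aa].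
- by exists 0, 0, 0; split; [exact: adapted_span_0|rewrite addr0 (ahom0 bH) (ahom0 TH)|].
- exists (s *: x0 + y0), (s *: x0' + y0'), (s *: m + m'); split.
  + exact: adapted_span_lin.
  + by rewrite (ahomL bH) addrACA -scalerDr (ahomL TH) Tx Ty (ahomL bH).
  + by rewrite (mL s) mx my scaler0 addr0.
elim=> {m nu u u'} [m nu||m nu s u u' x x' _ [x0 [x0' [m1 [Sx Tx mx]]]] _ [y0 [y0' [m' [Sy Ty my]]]]|m nu k u u' Jk _ [x0 [x0' [m1 [Sx Tx mx]]]]].
- by rewrite mulr0; exists 0, 0, 0; split; [exact: adapted_span_0|rewrite addr0 (ahom0 bH) (ahom0 TH)|].
- rewrite mulr1; exists a, a', 0; split => //; first exact: adapted_span_gen Aa.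
  by rewrite addr0; apply: adapted_T Aa.
- rewrite mulrDr -scalerAr; exists (s *: x0 + y0), (s *: x0' + y0'), (s *: m1 + m'); split.
  + exact: adapted_span_lin.
  + by rewrite (ahomL bH) addrACA -scalerDr (ahomL TH) Tx Ty (ahomL bH).
  + by rewrite (mL s) mx my scaler0 addr0.
exists 0, 0, ((bplus x0' + m1) * (v_ k *: (Fg (tl k) * UKV D q (tl k)))); split.
- exact: adapted_span_0.
- have -> : a * (u * th k) = (a * u) * th k by rewrite mulrA.
  rewrite (ahom0 bH) add0r (ahomM TH) Tx [bplus (a * u * th k)](ahomM bH) bplus_theta; congr (_ * _).
  exact: (T_r_inv_E q0 qn T_spec Delta_spec phi_spec ci Jk).
- rewrite minusM (ahomZ mH) endoE minusM.
  have eK : mn (UKV D q (tl k)) 1 = hm (- alpha (tl k)).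
    by rewrite -Km_alphaN -bplus_hm minus_bplus mulr1.
  rewrite -> eK.
  rewrite minus_F (rho_theta_hm q0 Delta_spec phi_spec) (lam_theta_hm q0 Delta_spec phi_spec).
  rewrite (lin0 (lamL _)) (lin0 (rhoL _)) subrr scaler0.
  exact: lin0 (endoP _).
Qed.

(** The decomposition of x gives a second expression of its preimage. On the vector 1 of [minus] the
    remainder m vanishes and each image under [bplus] returns its argument, so y is the adapted
    partner. *)
Lemma sigma_adapted x y : isf x -> T_word T rw (bplus y) = bplus x -> adapted_span x y.
Proof.
move=> fx Ty; have [x0 [x0' [m [Sx Tx mx]]]] := factored_preimage (isf_factored fx).
have mH := minusH q0 Delta_spec phi_spec.
have yE : y = x0'.
  have := Ty; rewrite -Tx => /(bij_inj (T_word_bij T_spec rw)) /(congr1 (fun z => mn z 1)).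
  rewrite (ahomD mH) endoE;
  rewrite -> mx;
  rewrite addr0;
  rewrite -> !minus_bplus;
  by rewrite !mulr1.
subst y; rewrite (_ : x = x0) //.
by apply: (bplus_inj q0 Delta_spec phi_spec); rewrite -Ty (adapted_span_T Sx).
Qed.

Lemma fJ_word w : all J w ->
  fJ (size w) (wtw w) (bw w) (bw (map (fun k => kk k) w)).
Proof.
elim: w => [_|k w IH /= /andP [Jk /IH Fw]].
  by rewrite /wtw /bw !big_nil; apply: fJ_1.
by rewrite wtw_cons !bw_cons addrC; apply: fJ_l.
Qed.

Section Transported.
Local Notation star := (istar Delta phi).
Hypothesis gphi : forall l, ~~ J l -> phi (tauB (g l)) (g (tau l)) = w_ l.
Hypothesis starA : associative star.
Variable t : B -> B.
Hypotheses (tL : lin t) (tS : forall x y, t (star x y) = star (t x) (t y))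
  (t_hm : forall mu, t (hm mu) = hm (r mu)) (t_l : forall l, ~~ J l -> t (th l) = g l)
  (t_J : forall k, J k -> t (th k) = (v_ k)^-1 *: (th (kk k) * hm (- alpha (tl k)))).

Lemma sigma_formula x y w : isf x -> T_word T rw (bplus y) = bplus x -> all J w ->
  t (x * bw w) = Qf D q (wtw w) *:
    (bw (map (fun k => kk k) w) * y * hm (r (wtw w))).
Proof.
move=> fx Ty Jw; have := sigma_adapted fx Ty; elim=> {x y fx Ty} [|s x x' y y' _ IHx _ IHy|n mu x x' Ax].
- by rewrite mul0r mulr0 mul0r scaler0 (lin0 tL).
- rewrite mulrDl -scalerAl tL IHx IHy mulrDr mulrDl -scalerAr -scalerAl.
  by rewrite scalerDr !scalerA [s * _]mulrC.
- exact: (transport_formula q0 qn T_spec Delta_spec phi_spec ci gC gT gphi starA tL tS t_hm t_l t_J Ax (fJ_word Jw)).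
Qed.
End Transported.
End SigmaBracket.

(** * Assembly of the three formulas *)

Lemma fun_invK (A : zmodType) (B : Type) (f : A -> B) (x : A) :
  injective f -> fun_inv f (f x) = x.
Proof. by move=> fi; rewrite /fun_inv; case: xgetP => [y _ /= /fi //|/(_ x) H]; case: H. Qed.

Section Assembly.
Variables (I : finType) (D : satake I) (F L : fieldType) (emb : {rmorphism F -> L}) (q : F).
Hypotheses (q0 : q != 0) (qn : forall n, (0 < n)%N -> q ^+ n != 1).
Local Notation B := (B_alg D q).
Local Notation U := (U_alg D q).
Local Notation UL := (U_alg D (emb q)).
Local Notation bc := (base_change (D := D) (q := q) emb).
Local Notation E := (UE D q).
Local Notation th := (Btheta D q).
Local Notation hm := (Bh_mon D q).
Local Notation chi := (@chi I D F q).
Local Notation tau := (tau D).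
Local Notation ltau := (lat_map tau).
Local Notation W := (@W I D F q).
Local Notation isf := (@isf I D F q).
Local Notation bplus := (@bplus I D F q).
Local Notation rf := (root_form D).
Local Notation v_ := (vi D q).
Local Notation w_ i := (v_ i - (v_ i)^-1).
Variables (a : I -> L) (a0 : forall j, a j != 0).
Hypotheses (a2 : forall j, a j ^+ 2 = emb (q ^ (- rf (alpha j) (alpha (tau j)))))
  (atau : forall j, a (tau j) = a j).
Variables (T : I -> {lrmorphism U -> U}) (TL : I -> {lrmorphism UL -> UL}).
Hypotheses (T_spec : is_lusztig T) (TL_spec : is_lusztig TL).
Variables (Delta : B -> seq (B * B)) (phi : B -> B -> F).
Hypotheses (Delta_spec : is_coproduct Delta) (phi_spec : is_hopf_pairing Delta phi).
Variable Xi : {linear B -> iU_alg D q}.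
Hypothesis Xi_spec : is_iHopf_iso Delta phi Xi.
Variable i : I.
Local Notation J := (inJ D i).
Local Notation C1 := (@C1 I D F q i).
Local Notation rw := (r_word D i).
Local Notation r := (refl_word D rw).
Hypothesis ci : cartan D i (tau i) \in [:: 2; 0; -1].
Variable Ups : lattice I -> U.
Hypothesis Ups_spec : is_quasi_K i Ups.
Variable bT : {lrmorphism iU_alg D q -> iU_alg D q}.
Hypothesis bT_bij : bijective bT.
Local Notation scr := (scr a0 TL i).
Hypothesis bT_spec : forall y : iU_alg D q, intertwines (bc \o Ups)
  (bc (iU_val (fun_inv bT y))) (fun_inv scr (bc (iU_val y))).
Local Notation star := (istar Delta phi).
Local Notation tl := (tau_loc D i).
Local Notation kk k := (tau (tl k)).
Local Notation bw := (@bw I D F q).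
Local Notation Qf := (@Qf I D F q).
Local Notation f := (f_alg D q).
Local Notation iota := (@f_iota I D F q).
Local Notation tr := (transport Xi (fun_inv bT)).
Local Notation tr' := (transport Xi bT).

Lemma starA : associative star.
Proof.
move=> x y z; apply: (bij_inj (iHopf_iso_bij Xi_spec)).
by rewrite !(iHopf_iso_M Xi_spec) mulrA.
Qed.

Lemma exists_g : exists g : I -> B,
  (forall l, ~~ J l -> exists n, C1 n l (r (alpha l)) (g l)) /\
  (forall l, ~~ J l -> T_word T rw (bplus (g l)) = E l).
Proof.
have H l : exists z, ~~ J l ->
    (exists n, C1 n l (r (alpha l)) z) /\ T_word T rw (bplus z) = E l.
  have [Jl|Jl] := boolP (J l); first by exists 0.
  have [n [z [c [Cz c0 Tz]]]] := T_r_inv_l q0 qn T_spec Delta_spec phi_spec ci Jl.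
  exists (c^-1 *: z) => _; split; first by exists n; apply: C1_scale.
  rewrite (linZ (ahomL (bplusH D q))) (linZ (ahomL (T_word_ahom T rw))).
  by rewrite -[T_word T rw _]/(T_r T i _) Tz scalerA mulVf // scale1r.
have [g gP] := choice H; exists g; split=> l Jl; have [] := gP l Jl; by [].
Qed.

Lemma sigma_span x y : isf x -> T_word T rw (bplus y) = bplus x ->
  (forall mu, W mu x <-> W (r mu) y) /\
  forall w, all J w -> tr (x * bw w) = Qf (wtw w) *:
    (bw (map (fun k => kk k) w) * y * hm (r (wtw w))).
Proof.
move=> fx Ty; have [g [gC gT]] := exists_g; split.
  move=> mu; apply: (adapted_span_W q0 qn T_spec Delta_spec phi_spec ci gC gT).
  exact: (sigma_adapted q0 qn T_spec Delta_spec phi_spec ci gC gT).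
have gl l : ~~ J l -> tr (th l) = g l.
  move=> Jl; have [n Cl] := gC l Jl; have Jtl : ~~ J (tau l) by rewrite inJ_tau.
  have [n' Cl'] := gC _ Jtl.
  exact: (bTinv_l q0 a2 atau T_spec TL_spec Delta_spec phi_spec Xi_spec ci Ups_spec bT_spec Cl Cl' (gT _ Jl) (gT _ Jtl)).
have gphi l : ~~ J l -> phi (tauB (g l)) (g (tau l)) = w_ l.
  move=> Jl; have [n Cl] := gC l Jl; have Jtl : ~~ J (tau l) by rewrite inJ_tau.
  have [n' Cl'] := gC _ Jtl.
  exact: (phi_cross q0 qn a2 atau T_spec TL_spec Delta_spec phi_spec Xi_spec ci Ups_spec bT_spec Cl Cl' (gT _ Jl) (gT _ Jtl)).
move=> w Jw; apply: (sigma_formula q0 qn T_spec Delta_spec phi_spec ci gC gT gphi starA) => //.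
- exact: (bTinv_lin Xi_spec bT_bij).
- exact: (bTinv_star Xi_spec bT_bij).
- exact: (bTinv_hm q0 a2 atau T_spec TL_spec Delta_spec phi_spec Xi_spec ci Ups_spec bT_spec).
- by move=> k Jk; apply: (bTinv_J q0 qn a2 atau T_spec TL_spec Delta_spec phi_spec Xi_spec ci Ups_spec bT_spec).
Qed.

Lemma U_plusP z : z \in @U_plus I D F q -> exists y : f, z = f_plus y.
Proof.
have iH := f_iotaH D q; have bH := bplusH D q.
have pH : ahom (@f_plus I D F q).
  split=> [c x y||x y]; rewrite !f_plusE; first by rewrite (ahomL iH) (ahomL bH).
    by rewrite (ahom1 iH) (ahom1 bH).
  by rewrite (ahomM iH) (ahomM bH).
move=> /asboolP; elim=> {z} [_ [j ->]||c x y _ [x' ->] _ [y' ->]|x y _ [x' ->] _ [y' ->]].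
- by exists (theta D q j); rewrite f_plusE f_iota_theta bplus_theta.
- by exists 1; rewrite (ahom1 pH).
- by exists (c *: x' + y'); rewrite (ahomL pH).
- by exists (x' * y'); rewrite (ahomM pH).
Qed.

Lemma f_plus_inj : injective (@f_plus I D F q).
Proof.
move=> x y; rewrite !f_plusE => /(bplus_inj q0 Delta_spec phi_spec).
exact: f_iota_inj.
Qed.

Variable s : {lrmorphism f_pair D q i -> f_pair D q i}.
Hypothesis s_spec : is_tau_tau_loc s.

Let vH : ahom (@f_pair_val I D F q i).
Proof.
by split=> [||x y]; [move=> *; rewrite /f_pair_val linearP|rewrite /f_pair_val rmorph1|rewrite /f_pair_val rmorphM].
Qed.
Let sH := ahom_lr s.
Let iH := f_iotaH D q.

Lemma f_pair_gens : exists e : I -> f_pair D q i,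
  forall k, J k -> f_pair_val (e k) = theta D q k.
Proof.
have H k : exists x : f_pair D q i, J k -> f_pair_val x = theta D q k.
  have [Jk|Jk] := boolP (J k); last by exists 0.
  have tk : theta D q k \in
      subalg [set x : f | x = theta D q i \/ x = theta D q (tau i)]%classic.
    by apply/asboolP/in_subalg_gen; case/orP: Jk => /eqP ->; [left|right].
  by exists (SubalgOf tk).
by have [e eP] := choice H; exists e.
Qed.

Section Expansion.
Variable e : I -> f_pair D q i.
Hypothesis eP : forall k, J k -> f_pair_val (e k) = theta D q k.

Lemma f_pair_word (x : I -> f_pair D q i) (v : seq I) (m : I -> I) : all J v ->
  (forall k, J k -> f_pair_val (x k) = theta D q (m k)) ->
  f_pair_val (\prod_(k <- v) x k) = \prod_(k <- map m v) theta D q k.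
Proof.
move=> Jv xm; elim: v Jv => [|k v IH] /=; first by rewrite !big_nil (ahom1 vH).
by move=> /andP [Jk Jv]; rewrite !big_cons (ahomM vH) xm // IH.
Qed.
Lemma f_pair_expand n (c : 'I_n -> F) (w : 'I_n -> seq I) (u : f_pair D q i) :
  (forall k, all J (w k)) -> f_pair_val u = \sum_k c k *: \prod_(l <- w k) theta D q l ->
  u = \sum_k c k *: \prod_(l <- w k) e l.
Proof.
move=> Jw uE; apply: val_inj; rewrite -[LHS]/(f_pair_val u) -[RHS]/(f_pair_val _) uE.
rewrite (lin_sum (ahomL vH)); apply: eq_bigr => k _; rewrite (linZ (ahomL vH)).
by rewrite (@f_pair_word _ _ id) ?map_id.
Qed.
Lemma s_prod (x : I -> f_pair D q i) (v : seq I) :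
  s (\prod_(k <- v) x k) = \prod_(k <- v) s (x k).
Proof.
by elim: v => [|k v IH]; rewrite ?big_nil ?(ahom1 sH) // !big_cons (ahomM sH) IH.
Qed.
Lemma s_gen k : J k -> f_pair_val (s (e k)) = theta D q (kk k).
Proof.
by move=> Jk; apply: s_spec; [case/orP: Jk => /eqP; [left|right]|exact: eP].
Qed.
End Expansion.

Lemma s_invol u : s (s u) = u.
Proof.
have [e eP] := f_pair_gens; have [n [c [w [Jw uE]]]] := f_pair_words u.
rewrite (f_pair_expand eP Jw uE) !(lin_sum (ahomL sH)); apply: eq_bigr => k _.
rewrite !(linZ (ahomL sH)) !s_prod; congr (_ *: _).
move: (Jw k); elim: (w k) => [|l v IH] /=; first by rewrite !big_nil.
move=> /andP [Jl Jv]; rewrite !big_cons IH //; congr (_ * _); apply: val_inj.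
have Jkk : J (kk l) by rewrite inJ_tau tl_J.
rewrite -[LHS]/(f_pair_val _) -[RHS]/(f_pair_val _) eP //.
rewrite (s_spec (j := kk l)) ?s_gen //; last by case/orP: Jkk => /eqP; [left|right].
by rewrite tl_tau ?tl_J // (tlK ci Jl) tauK.
Qed.

(** [s] is known only on the two generators; an expansion of u into homogeneous words in them gives
    u and its image with the same coefficients. *)
Lemma f_pair_s (u : f_pair D q i) mu : W mu (iota (f_pair_val u)) ->
  exists n (c : 'I_n -> F) (w : 'I_n -> seq I),
    [/\ forall k, all J (w k) /\ wtw (w k) = mu,
      iota (f_pair_val u) = \sum_k c k *: bw (w k) &
      iota (f_pair_val (s u)) = \sum_k c k *: bw (map (fun k => kk k) (w k))].
Proof.
move=> Wu; have [n [c [w [wP uE]]]] := wspan_proj q0 qn (f_pair_words u) Wu.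
have [e eP] := f_pair_gens.
exists n, c, w; split=> //.
  rewrite uE (lin_sum (ahomL iH)); apply: eq_bigr => k _.
  by rewrite (linZ (ahomL iH)) f_iota_word.
rewrite (f_pair_expand eP (fun k => (wP k).1) uE).
rewrite (lin_sum (ahomL sH)) (lin_sum (ahomL vH)) (lin_sum (ahomL iH)).
apply: eq_bigr => k _; rewrite (linZ (ahomL sH)) (linZ (ahomL vH)) (linZ (ahomL iH)).
rewrite s_prod (@f_pair_word _ _ (fun k => kk k)) ?f_iota_word //; first exact: (wP k).1.
by move=> l Jl; apply: s_gen.
Qed.
Let tL : lin tr := bTinv_lin Xi_spec bT_bij.

Lemma sigma_pair x y (u : f_pair D q i) nu :
  T_word T rw (f_plus y) = f_plus x -> W nu (iota (f_pair_val u)) ->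
  tr (iota (x * f_pair_val u)) = Qf nu *: (iota (f_pair_val (s u) * y) * hm (r nu)).
Proof.
rewrite !f_plusE => Ty Wu; have fx : isf (iota x) by exists x.
have [n [c [w [wP uE suE]]]] := f_pair_s Wu.
have [_ tx] := sigma_span fx Ty.
rewrite !(ahomM iH) uE suE mulr_sumr !mulr_suml (lin_sum tL) scaler_sumr.
apply: eq_bigr => k _; have [Jw <-] := wP k.
by rewrite -scalerAr (linZ tL) tx // -!scalerAl !scalerA mulrC.
Qed.

Lemma sigma_bracketP x : f_sigma_bracket T i x ->
  T_word T rw (f_plus (T_r_inv_f T i x)) = f_plus x.
Proof.
rewrite /f_sigma_bracket /T_r_inv_f => /U_plusP [y e]; rewrite e (fun_invK _ f_plus_inj) -e.
by have [_ ->] := fun_invP (T_word_bij T_spec rw).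
Qed.

Lemma transport_sigma x : f_sigma_bracket T i x ->
  tr (iota x) = iota (T_r_inv_f T i x).
Proof.
move=> /sigma_bracketP; rewrite !f_plusE => Ty; have fx : isf (iota x) by exists x.
have [_ /(_ [::] isT)] := sigma_span fx Ty.
by rewrite /bw /wtw !big_nil mulr1 mul1r Qf0 scale1r r0 hm0 mulr1.
Qed.

Lemma W_sigma x y mu : T_word T rw (f_plus y) = f_plus x ->
  W mu (iota x) <-> W (r mu) (iota y).
Proof.
rewrite !f_plusE => Ty; have fx : isf (iota x) by exists x.
by have [Wy _] := sigma_span fx Ty; apply: Wy.
Qed.

Lemma f_pair_s_W (u : f_pair D q i) nu : W nu (iota (f_pair_val u)) ->
  W (- ltau (r nu)) (iota (f_pair_val (s u))).
Proof.
move=> Wu; have [n [c [w [wP uE suE]]]] := f_pair_s Wu; rewrite suE.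
elim/big_ind: _ => [|x z|k _]; [exact: W_0|exact: W_add|apply: W_scale].
have [Jw <-] := wP k; have [//] := fJ_W ci (@fJ_word _ _ _ q _ _ Jw).
Qed.

(** These maps agree with -r and -tau r only on the span of alpha_i and alpha_(tau i). A nonzero u
    has at least one word in its expansion, and the weight of that word lies in this span. *)
Lemma lat_map_J (u : f_pair D q i) nu : W nu (iota (f_pair_val u)) -> f_pair_val u != 0 ->
  lat_map tl nu = - r nu /\ lat_map (tau \o tl) nu = - ltau (r nu).
Proof.
move=> Wu u0; have [n [c [w [wP uE _]]]] := f_pair_s Wu.
have [k _] : exists k : 'I_n, True.
  case: n c w wP uE => [|n] c w wP uE; last by exists ord0.
  move: u0; rewrite big_ord0 in uE.
  by rewrite (f_iota_inj q0 (etrans uE (esym (ahom0 iH)))) eqxx.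
have [Jw <-] := wP k; elim: (w k) Jw => [_|l v IH /= /andP [Jl /IH [e1 e2]]].
  by rewrite /wtw big_nil r0 lat_map0 oppr0 /lat_map !big1 // => l _; rewrite ffunE mulr0z.
have lD (m : I -> I) a1 a2' : lat_map m (a1 + a2') = lat_map m a1 + lat_map m a2'.
  by rewrite /lat_map -big_split; apply: eq_bigr => l' _; rewrite ffunE mulrzDr.
have la (m : I -> I) k' : lat_map m (alpha k') = alpha (m k').
  rewrite /lat_map (bigD1 k') //= ffunE eqxx big1 ?addr0 ?mulr1z // => l' /negbTE ne.
  by rewrite ffunE eq_sym ne mulr0z.
rewrite wtw_cons !lD !la e1 e2 rD (r_loc ci Jl) lat_mapD lat_mapN lat_map_alpha.
by rewrite !opprD !opprK.
Qed.

(** At z = 0 the value of [wt] is an arbitrary choice, but both sides vanish; for nonzero z it is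
    forced to be w. The later proofs separate the zero cases for the same reason. *)
Lemma K_diamondE a1 w z : W w (iota z) ->
  K_diamond Delta phi a1 z = q ^ (rf a1 (ltau a1) + rf (a1 - ltau a1) w + 2 * rf (ltau a1) w) *:
    (iota z * hm (ltau a1)).
Proof.
move=> Wz; have [z0|z0] := eqVneq z 0.
  rewrite /K_diamond /h_diamond z0 (ahom0 iH) (lin0 (star_linr Delta_spec phi_spec _)).
  by rewrite mul0r !scaler0.
rewrite /K_diamond /h_diamond (wt_eq q0 qn Wz z0) (star_hl q0 Delta_spec phi_spec).
rewrite (rho_hm_isf q0 Delta_spec phi_spec); last by exists z.
by rewrite (W_comm q0 _ Wz) !scalerA !qE // lat_mapK.
Qed.

Lemma transport_sigma_pair x (u : f_pair D q i) : f_sigma_bracket T i x ->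
  homogeneous x -> homogeneous (f_pair_val u) ->
  tr (iota (x * f_pair_val u)) =
  q ^ (- rf (ltau (wt (f_pair_val u)) + wt (f_pair_val u)) (wt x)) *:
  K_diamond Delta phi (- lat_map (tau \o tl) (wt (f_pair_val u)))
    (f_pair_val (s u) * T_r_inv_f T i x).
Proof.
move=> /sigma_bracketP Ty [mu /(has_weight_W) Wx] [nu /(has_weight_W) Wu].
set y := T_r_inv_f T i x in Ty *; have tE := sigma_pair Ty Wu.
have Wy := (W_sigma mu Ty).1 Wx; have Wsu := f_pair_s_W Wu.
have Wz : W (- ltau (r nu) + r mu) (iota (f_pair_val (s u) * y)).
  by rewrite (ahomM iH); apply: W_mul.
have [u0|u0] := eqVneq (f_pair_val u) 0.
  have su0 : f_pair_val (s u) = 0.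
    have -> : u = 0 by apply: val_inj.
    by rewrite (ahom0 (ahom_lr s)) /f_pair_val raddf0.
  by rewrite (K_diamondE _ Wz) su0 u0 mulr0 mul0r (ahom0 iH) mul0r !scaler0 (lin0 tL).
have [x0|x0] := eqVneq x 0.
  have y0 : y = 0.
    by apply: f_plus_inj; apply: (bij_inj (T_word_bij T_spec rw)); rewrite Ty x0 !f_plusE (ahom0 iH) (ahom0 (bplusH D q)) (ahom0 (T_word_ahom T rw)).
  by rewrite (K_diamondE _ Wz) y0 {1}x0 mul0r mulr0 (ahom0 iH) mul0r !scaler0 (lin0 tL).
rewrite (wt_eq q0 qn Wx x0) (wt_eq q0 qn Wu u0) tE (lat_map_J Wu u0).2 opprK (K_diamondE _ Wz).
rewrite lat_mapK scalerA qE //; congr (q ^ _ *: _).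
rewrite !rfE -!(r_tau ci) !rf_r !rf_tau.
rewrite [rf (ltau nu) mu]rf_tauC; rewrite ?lat_mapK [rf (ltau nu) nu]rf_tauC; ring.
Qed.

Lemma transport_pair_bracket x (u : f_pair D q i) : f_bracket T i x ->
  homogeneous x -> homogeneous (f_pair_val u) ->
  tr' (iota (f_pair_val u * x)) =
  q ^ (- rf (ltau (wt (f_pair_val u)) + wt (f_pair_val u)) (wt x)) *:
  K_diamond Delta phi (- lat_map tl (wt (f_pair_val u)))
    (T_r_f T i x * f_pair_val (s u)).
Proof.
rewrite /f_bracket /T_r_f => /U_plusP [y e] [mu /has_weight_W Wx] [nu /has_weight_W Wu].
rewrite e (fun_invK _ f_plus_inj).
have Ty : T_word T rw (f_plus x) = f_plus y by [].
have Wsu := f_pair_s_W Wu.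
have Wy : W (r mu) (iota y) by apply/(W_sigma _ Ty); rewrite (rK ci).
have Wz : W (r mu - ltau (r nu)) (iota (y * f_pair_val (s u))).
  by rewrite (ahomM iH); apply: W_mul.
have fz : isf (iota (y * f_pair_val (s u))) by exists (y * f_pair_val (s u)).
have Wp : W (nu + mu) (iota (f_pair_val u * x)) by rewrite (ahomM iH); apply: W_mul.
have fp : isf (iota (f_pair_val u * x)) by exists (f_pair_val u * x).
have tE := sigma_pair Ty Wsu; rewrite s_invol in tE.
(* The right side is written as the automorphism applied to its inverse image. That image is
   computed by [sigma_pair] at y and [s u], where the preimage of y is x and [s (s u)] is u. *)
rewrite -[RHS](bT_bTinv Xi_spec bT_bij); congr (transport _ _ _); rewrite -[RHS]/(tr _).
have [u0|u0] := eqVneq (f_pair_val u) 0.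
  have su0 : f_pair_val (s u) = 0.
    have -> : u = 0 by apply: val_inj.
    by rewrite (ahom0 (ahom_lr s)) /f_pair_val raddf0.
  by rewrite (K_diamondE _ Wz) su0 u0 mulr0 mul0r (ahom0 iH) mul0r !scaler0 (lin0 tL).
have [x0|x0] := eqVneq x 0.
  have y0 : y = 0.
    by apply: f_plus_inj; rewrite -Ty x0 !f_plusE (ahom0 iH) (ahom0 (bplusH D q)) (ahom0 (T_word_ahom T rw)).
  by rewrite (K_diamondE _ Wz) y0 {1}x0 mul0r mulr0 (ahom0 iH) mul0r !scaler0 (lin0 tL).
rewrite (wt_eq q0 qn Wx x0) (wt_eq q0 qn Wu u0) (lat_map_J Wu u0).1 opprK (K_diamondE _ Wz).
have tS := bTinv_star Xi_spec bT_bij.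
have th' := bTinv_hm q0 a2 atau T_spec TL_spec Delta_spec phi_spec Xi_spec ci Ups_spec bT_spec.
rewrite !(linZ tL) (t_mulh q0 Delta_spec phi_spec tL tS th' _ fz Wz).
rewrite tE (linZ (star_linl Delta_spec phi_spec _)).
rewrite (star_h q0 Delta_spec phi_spec _ _ fp Wp) rN addNr hm0 mulr1 !scalerA.
rewrite -[LHS]scale1r; congr (_ *: _).
rewrite /Qf /chi !lat_mapK !invr_expz !qE // -(expr0z q); congr (q ^ _).
rewrite (r_tau ci) (rK ci) lat_mapK -(r_tau ci) !rfE !rf_r !rf_tau; ring.
Qed.
End Assembly.

Lemma vhalf_neq0 : vhalf != 0.
Proof. by rewrite /vhalf tofrac_eq0 polyX_eq0. Qed.
Lemma vhalf_aperiodic n : (0 < n)%N -> vhalf ^+ n != 1.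
Proof.
move=> n0; rewrite /vhalf -tofracXn -tofrac1 tofrac_eq.
by apply/eqP => /(congr1 (fun p : {poly rat} => size p)); rewrite size_polyXn size_poly1; case: n n0.
Qed.

Theorem theoremA
  (I : finType) (D : satake I)
  (L : closedFieldType) (emb : {rmorphism Qv -> L})
  (L_alg : forall z : L, algebraicOver emb z)
  (sqrt : L -> L) (sqrtP : forall z : L, sqrt z ^+ 2 = z)
  (T : I -> {lrmorphism U_alg D vhalf -> U_alg D vhalf})
  (T_spec : is_lusztig T)
  (TL : I -> {lrmorphism U_alg D (emb vhalf) -> U_alg D (emb vhalf)})
  (TL_spec : is_lusztig TL)
  (Delta : B_alg D vhalf -> seq (B_alg D vhalf * B_alg D vhalf))
  (Delta_spec : is_coproduct Delta)
  (phi : B_alg D vhalf -> B_alg D vhalf -> Qv)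
  (phi_spec : is_hopf_pairing Delta phi)
  (Xi : {linear B_alg D vhalf -> iU_alg D vhalf})
  (Xi_spec : is_iHopf_iso Delta phi Xi)
  (i : I) (ci : cartan D i (tau D i) \in [:: 2; 0; -1])
  (Ups : lattice I -> U_alg D vhalf) (Ups_spec : is_quasi_K i Ups)
  (bT : {lrmorphism iU_alg D vhalf -> iU_alg D vhalf})
  (bT_spec : is_relative_braid sqrtP TL i Ups bT)
  (s : {lrmorphism f_pair D vhalf i -> f_pair D vhalf i})
  (s_spec : is_tau_tau_loc s) :
  [/\ forall x : f_alg D vhalf, f_sigma_bracket T i x ->
        transport Xi (fun_inv bT) (f_iota x) = f_iota (T_r_inv_f T i x),
      forall (x : f_alg D vhalf) (u : f_pair D vhalf i),
        f_sigma_bracket T i x ->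
        homogeneous x -> homogeneous (f_pair_val u) ->
        transport Xi (fun_inv bT) (f_iota (x * f_pair_val u)) =
          vhalf ^ (- root_form D (lat_map (tau D) (wt (f_pair_val u))
                             + wt (f_pair_val u)) (wt x)) *:
          K_diamond Delta phi
            (- lat_map (tau D \o tau_loc D i) (wt (f_pair_val u)))
            (f_pair_val (s u) * T_r_inv_f T i x)
    & forall (x : f_alg D vhalf) (u : f_pair D vhalf i),
        f_bracket T i x ->
        homogeneous x -> homogeneous (f_pair_val u) ->
        transport Xi bT (f_iota (f_pair_val u * x)) =
          vhalf ^ (- root_form D (lat_map (tau D) (wt (f_pair_val u))
                             + wt (f_pair_val u)) (wt x)) *:
          K_diamond Delta phi
            (- lat_map (tau_loc D i) (wt (f_pair_val u)))
            (T_r_f T i x * f_pair_val (s u))].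
Proof.
have a2 j : a_root D emb sqrt j ^+ 2 =
    emb (vhalf ^ (- root_form D (alpha j) (alpha (tau D j)))).
  by rewrite /a_root sqrtP fmorphXz.
have atau j : a_root D emb sqrt (tau D j) = a_root D emb sqrt j.
  by rewrite /a_root -!lat_map_alpha rf_tau.
have v0 := vhalf_neq0; have vn := vhalf_aperiodic.
have bT_bij := relative_braid_bij bT_spec.
have bT_P := relative_braidP bT_spec.
split=> [x|x u|x u].
- exact: (transport_sigma v0 vn a2 atau T_spec TL_spec Delta_spec phi_spec Xi_spec ci Ups_spec bT_bij bT_P).
- exact: (transport_sigma_pair v0 vn a2 atau T_spec TL_spec Delta_spec phi_spec Xi_spec ci Ups_spec bT_bij bT_P s_spec).
- exact: (transport_pair_bracket v0 vn a2 atau T_spec TL_spec Delta_spec phi_spec Xi_spec ci Ups_spec bT_bij bT_P s_spec).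
Qed.
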